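(* Let $d\ge2$, $\alpha\in(0,1)$ and let $f_0\in L^1_3(\mathbb R^d)$ be nonnegative with $$n_{f_0}=\int_{\mathbb R^d}f_0\,dv>0,\qquad T_{f_0}=\frac1{d\,n_{f_0}}\int_{\mathbb R^d}f_0(v)|v-\boldsymbol u_{f_0}|^2dv>0,\qquad \boldsymbol u_{f_0}=\frac1{n_{f_0}}\int_{\mathbb R^d}f_0(v)v\,dv .$$ Let $f(t,v)$ be the unique solution of $\partial_tf=(1-\alpha)Q(f,f)-\alpha Q_-(f,f)$, $f(0,\cdot)=f_0$. Then $\min(n_f(t),T_f(t))>0$ for all $t\ge0$. In addition, setting $\tau(t)=\sqrt2\int_0^tn_f(s)\sqrt{T_f(s)}\,ds$ and defining $\psi(\tau,\xi)$ by $$f(t,v)=n_f(t)(2T_f(t))^{-d/2}\psi\Big(\tau(t),\frac{v-\boldsymbol u_f(t)}{\sqrt{2T_f(t)}}\Big),$$ $\psi$ is the unique solution to $$\partial_\tau\psi+(\mathbf A_\psi(\tau)-d\,\mathbf B_\psi(\tau))\psi+\mathbf B_\psi(\tau)\,\mathrm{div}_\xi\big((\xi-\boldsymbol v_\psi(\tau))\psi\big)=(1-\alpha)Q(\psi,\psi)-\alpha Q_-(\psi,\psi)$$ with initial datum $\psi(0,\xi)=(2T_{f_0})^{d/2}n_{f_0}^{-1}f_0(\sqrt{2T_{f_0}}\,\xi+\boldsymbol u_{f_0})$, where, for all $\tau\ge0$, $$\mathbf A_\psi(\tau)=-\frac\alpha2\int_{\mathbb R^d}(d+2-2|\xi|^2)Q_-(\psi,\psi)(\tau,\xi)d\xi,\qquad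 \mathbf B_\psi(\tau)=-\frac\alpha2\int_{\mathbb R^d}\Big(1-\frac2d|\xi|^2\Big)Q_-(\psi,\psi)(\tau,\xi)d\xi,$$ $$\mathbf B_\psi(\tau)\boldsymbol v_\psi(\tau)=-\alpha\int_{\mathbb R^d}\xi\,Q_-(\psi,\psi)(\tau,\xi)d\xi\in\mathbb R^d .$$
   Context: $d\sigma$ is the normalized measure on $\mathbb S^{d-1}$ (total mass 1). With $v'=\frac{v+v_*}2+\frac{|v-v_*|}2\sigma$, $v'_*=\frac{v+v_*}2-\frac{|v-v_*|}2\sigma$, set $Q_+(g,f)(v)=\int_{\mathbb R^d\times\mathbb S^{d-1}}|v-v_*|g(v')f(v'_* )dv_*d\sigma$, $Q_-(g,f)(v)=g(v)\int_{\mathbb R^d}|v-v_*|f(v_* )dv_*$, $Q=Q_+-Q_-$. $L^1_q$ has norm $\int|f|\langle v\rangle^qdv$, $\langle v\rangle=(1+|v|^2)^{1/2}$. The well-posedness of both Cauchy problems is known from earlier work: for nonnegative $f_0\in L^1_3$ there is a unique nonnegative solution $f$ with $f(t,\cdot)\in L^1_3$; uniqueness for the rescaled equation is understood among nonnegative solutions in $\mathcal C([0,\infty),L^1_2(\mathbb R^d))\cap L^1_{\rm loc}((0,\infty),L^1_3(\mathbb R^d))$. $n_f(t)=\int f\,dv$, $n_f\boldsymbol u_f=\int fv\,dv$, $d\,n_fT_f=\int f|v-\boldsymbol u_f|^2dv$. In the rescaled equation $\boldsymbol v_\psi$ enters only through the product $\mathbf B_\psi\boldsymbol v_\psi$. 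*)

(* Defs.v *)
From HB Require Import structures.
From mathcomp Require Import all_boot all_order all_algebra.
From mathcomp Require Import all_classical all_reals all_analysis.
From mathcomp Require Import measurable_realfun.

Set Implicit Arguments.
Unset Strict Implicit.
Unset Printing Implicit Defensive.
Import Order.TTheory GRing.Theory Num.Theory.
Import numFieldNormedType.Exports.

Local Open Scope classical_set_scope.
Local Open Scope ring_scope.

Definition rV_display : measure_display.
Proof. exact: default_measure_display. Qed.

(* 'rV[R]_n carries the sigma-algebra generated by its n coordinates. *)
Section rV_measurable.
Context {R : realType} (n : nat).

Let coord (i : 'I_n) (v : 'rV[R]_n) : R := v 0 i.

Let rV_measurable0 : g_sigma_preimage coord set0.
Proof. exact: sigma_algebra0. Qed.

Let rV_measurableC A : g_sigma_preimage coord A -> g_sigma_preimage coord (~` A).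
Proof. exact: sigma_algebraC. Qed.

Let rV_measurable_bigcup (F : (set 'rV[R]_n)^nat) :
  (forall i, g_sigma_preimage coord (F i)) ->
  g_sigma_preimage coord (\bigcup_i (F i)).
Proof. exact: sigma_algebra_bigcup. Qed.

HB.instance Definition _ := @isMeasurable.Build rV_display
  'rV[R]_n (g_sigma_preimage coord)
  rV_measurable0 rV_measurableC rV_measurable_bigcup.

End rV_measurable.

Section rV_measurable_fun.
Context {R : realType}.

Lemma measurable_coord n (i : 'I_n) :
  measurable_fun [set: 'rV[R]_n] (fun v => v 0 i).
Proof.
move=> _ Y mY; rewrite setTI; apply: sub_sigma_algebra => /=.
rewrite -bigcup_seq/=; exists i => /=; first by rewrite mem_index_enum.
by exists Y => //; rewrite setTI.
Qed.

Lemma measurable_fun_rV d (T : measurableType d) n (f : T -> 'rV[R]_n) :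
  (forall i, measurable_fun [set: T] (fun x => f x 0 i)) ->
  measurable_fun [set: T] f.
Proof.
move=> mf _ A mA; rewrite setTI.
pose S : set (set 'rV[R]_n) := [set B | measurable (f @^-1` B)].
suff : S A by [].
move: A mA; apply: smallest_sub.
  split => /=; rewrite /S/=.
  - by rewrite preimage_set0.
  - by move=> B mB; rewrite setTD -preimage_setC; exact: measurableC.
  - by move=> F mF; rewrite preimage_bigcup; exact: bigcup_measurable.
rewrite -bigcup_seq/= => B [i /= _ [C mC <-]].
rewrite /S/= setTI -comp_preimage -[X in measurable X]setTI.
exact: mf.
Qed.

End rV_measurable_fun.

(* d-dimensional Lebesgue measure on the Borel sets of 'rV[R]_d, obtained by
   iterating lambda_(n+1) = (cons)_# (lambda_1 \x lambda_n). *)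
Section lebesgue_rV.
Context {R : realType}.

Definition rV_cons n (p : measurableTypeR R * 'rV[R]_n) : 'rV[R]_n.+1 :=
  \row_i if unlift ord0 i is Some j then p.2 0 j else p.1.

Definition rV_uncons n (v : 'rV[R]_n.+1) : measurableTypeR R * 'rV[R]_n :=
  (v 0 ord0, \row_j v 0 (lift ord0 j)).

Lemma rV_consK n : cancel (@rV_cons n) (@rV_uncons n).
Proof.
move=> [x v]; rewrite /rV_uncons /rV_cons mxE unlift_none; congr pair.
by apply/rowP => j; rewrite !mxE liftK.
Qed.

Lemma rV_unconsK n : cancel (@rV_uncons n) (@rV_cons n).
Proof.
move=> v; apply/rowP => i; rewrite mxE.
by case: unliftP => [j ->|->] //=; rewrite mxE.
Qed.

Lemma measurable_rV_cons n : measurable_fun [set: _] (@rV_cons n).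
Proof.
apply: measurable_fun_rV => i; rewrite /rV_cons.
case: (unliftP ord0 i) => [j ->|->].
- under eq_fun do rewrite mxE liftK.
  exact: (measurableT_comp (measurable_coord j)).
- under eq_fun do rewrite mxE unlift_none.
  exact: measurable_fst.
Qed.

Lemma measurable_rV_uncons n : measurable_fun [set: _] (@rV_uncons n).
Proof.
apply/measurable_fun_pairP; split => /=; first exact: measurable_coord.
apply: measurable_fun_rV => j /=.
under eq_fun do rewrite mxE.
exact: measurable_coord.
Qed.

Section step.
Variables (n : nat) (mu : {sigma_finite_measure set 'rV[R]_n -> \bar R}).

Definition lebesgue_rV_step : set 'rV[R]_n.+1 -> \bar R :=
  pushforward (lebesgue_measure \x mu)%E (@rV_cons n).

Let step0 : lebesgue_rV_step set0 = 0%E.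
Proof. by rewrite /lebesgue_rV_step /pushforward preimage_set0 measure0. Qed.

Let step_ge0 A : (0 <= lebesgue_rV_step A)%E.
Proof. exact: (measure_ge0 (lebesgue_measure \x mu)%E). Qed.

Let step_sigma_additive : semi_sigma_additive lebesgue_rV_step.
Proof.
move=> F mF tF mUF; rewrite /lebesgue_rV_step /pushforward preimage_bigcup.
have mP A : measurable A -> measurable (@rV_cons n @^-1` A).
  by move=> mA; rewrite -[X in measurable X]setTI; exact: measurable_rV_cons.
apply: (@measure_semi_sigma_additive _ _ _ (lebesgue_measure \x mu)%E).
- by move=> i; exact: mP.
- apply/trivIsetP => /= i j _ _ ij; rewrite -preimage_setI.
  by move/trivIsetP : tF => /(_ _ _ _ _ ij) ->//; rewrite preimage_set0.
- by rewrite -preimage_bigcup; exact: mP.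
Qed.

HB.instance Definition _ := isMeasure.Build _ _ _ lebesgue_rV_step
  step0 step_ge0 step_sigma_additive.

Let step_sigma_finite : sigma_finite setT lebesgue_rV_step.
Proof.
have /sigma_finiteP[F [TF ndF Foo]] := sigma_finiteT (@lebesgue_measure R).
have /sigma_finiteP[G [TG ndG Goo]] := sigma_finiteT mu.
exists (fun k => @rV_uncons n @^-1` (F k `*` G k)).
  rewrite -preimage_bigcup (_ : \bigcup_k _ = setT) ?preimage_setT//.
  apply/seteqP; split => // -[x y] _.
  have [k _ Fkx] : (\bigcup_k F k) x by rewrite -TF.
  have [l _ Gly] : (\bigcup_k G k) y by rewrite -TG.
  exists (maxn k l) => //; split => /=.
  - by move: x Fkx; exact/subsetPset/ndF/leq_maxl.
  - by move: y Gly; exact/subsetPset/ndG/leq_maxr.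
move=> k; have [mF Fk] := Foo k; have [mG Gk] := Goo k; split.
  rewrite -[X in measurable X]setTI.
  by apply: measurable_rV_uncons => //; exact: measurableX.
rewrite /lebesgue_rV_step /pushforward -comp_preimage.
rewrite (_ : _ \o _ = id) ?preimage_id; last first.
  by apply/funext; exact: rV_consK.
by rewrite product_measure1E// lte_mul_pinfty// ge0_fin_numE.
Qed.

HB.instance Definition _ := @Measure_isSigmaFinite.Build _ _ _
  lebesgue_rV_step step_sigma_finite.

End step.

Fixpoint lebesgue_rV n : {sigma_finite_measure set 'rV[R]_n -> \bar R} :=
  if n is m.+1 then lebesgue_rV_step (lebesgue_rV m) else \d_(0 : 'rV[R]_0).

End lebesgue_rV.

(* The norm `|v| of the library on 'rV[R]_d is the sup norm. *)
Definition enorm {R : realType} {d : nat} (v : 'rV[R]_d) : R :=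
  Num.sqrt (\sum_i v 0 i ^+ 2).

Section sphere.
Context {R : realType} {d : nat}.
Local Notation leb := (@lebesgue_rV R d).
Implicit Type A : set 'rV[R]_d.

Definition unit_ball : set 'rV[R]_d := [set v | enorm v <= 1].

Definition radial_proj (v : 'rV[R]_d) : 'rV[R]_d := (enorm v)^-1 *: v.

(* Normalized surface measure of the unit sphere, as a measure on 'rV[R]_d
   concentrated on the sphere: sigma(A) is the fraction of the volume of the
   unit ball occupied by the cone over A. *)
Definition sphere_measure A : \bar R :=
  ((fine (leb unit_ball))^-1%:E * leb (radial_proj @^-1` A `&` unit_ball))%E.

Lemma enorm_ge0 (v : 'rV[R]_d) : 0 <= enorm v.
Proof. exact: sqrtr_ge0. Qed.

Lemma measurable_enorm : measurable_fun [set: 'rV[R]_d] (@enorm R d).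
Proof.
apply: (@measurableT_comp _ _ _ _ _ _ (@Num.sqrt R)).
  by apply: continuous_measurable_fun; exact: sqrt_continuous.
apply: measurable_sum => i; apply: measurable_funX.
exact: measurable_coord.
Qed.

Lemma measurable_unit_ball : measurable unit_ball.
Proof.
rewrite (_ : unit_ball = setT `&` @enorm R d @^-1` `]-oo, 1]).
  by apply: measurable_enorm => //; exact: measurable_itv.
by rewrite setTI; apply/seteqP; split => v /=; rewrite in_itv.
Qed.

Lemma measurable_radial_proj : measurable_fun [set: 'rV[R]_d] radial_proj.
Proof.
apply: measurable_fun_rV => i.
rewrite (_ : (fun _ => _) = fun v => enorm v `^ (-1) * v 0 i).
  apply: measurable_funM; last exact: measurable_coord.
  exact: (measurableT_comp (measurable_powR (-1)) measurable_enorm).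
by apply/funext => v; rewrite mxE powR_inv1// enorm_ge0.
Qed.

Let preim A : measurable A -> measurable (radial_proj @^-1` A `&` unit_ball).
Proof.
move=> mA; apply: measurableI; last exact: measurable_unit_ball.
by rewrite -[X in measurable X]setTI; exact: measurable_radial_proj.
Qed.

Let sphere_measure0 : sphere_measure set0 = 0%E.
Proof. by rewrite /sphere_measure preimage_set0 set0I measure0 mule0. Qed.

Let sphere_measure_ge0 A : (0 <= sphere_measure A)%E.
Proof. by rewrite mule_ge0// lee_fin invr_ge0 fine_ge0. Qed.

Let sphere_measure_sigma_additive : semi_sigma_additive sphere_measure.
Proof.
move=> F mF tF mUF; rewrite /sphere_measure.
under eq_fun do rewrite -ge0_sume_distrr//.
apply: cvgeZl => //; rewrite preimage_bigcup setI_bigcupl.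
apply: measure_semi_sigma_additive.
- by move=> i; exact: preim.
- apply: trivIset_setIr => i j _ _ [v [Fi Fj]].
  by apply: (tF i j) => //; exists (radial_proj v).
- by rewrite -setI_bigcupl -preimage_bigcup; exact: preim.
Qed.

HB.instance Definition _ := isMeasure.Build _ _ _ sphere_measure
  sphere_measure0 sphere_measure_ge0 sphere_measure_sigma_additive.

End sphere.
Arguments sphere_measure {R} d A.

Section kinetic.
Context {R : realType} {d : nat}.
Local Notation V := ('rV[R]_d).
Local Notation leb := (@lebesgue_rV R d).
Implicit Types (h : V -> R) (f g psi : R -> V -> R).

Definition japanese (v : V) : R := Num.sqrt (1 + enorm v ^+ 2).

Definition L1norm (q : nat) h : \bar R :=
  (\int[leb]_v (`|h v| * japanese v ^+ q)%:E)%E.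

Definition in_L1 (q : nat) h : Prop :=
  measurable_fun [set: V] h /\ (L1norm q h < +oo)%E.

Definition vpost (v w s : V) : V := 2^-1 *: (v + w) + (enorm (v - w) / 2) *: s.

Definition vpost_star (v w s : V) : V :=
  2^-1 *: (v + w) - (enorm (v - w) / 2) *: s.

(* For nonnegative f and g in L^1_1 the integral below is finite for almost
   every v only; the other values of v get the value 0. *)
Definition Qplus (g f : V -> R) (v : V) : R :=
  fine (\int[leb]_w \int[sphere_measure d]_s
    (enorm (v - w) * g (vpost v w s) * f (vpost_star v w s))%:E)%E.

Definition Qminus (g f : V -> R) (v : V) : R :=
  g v * \int[leb]_w (enorm (v - w) * f w).

Definition Q (g f : V -> R) (v : V) : R := Qplus g f v - Qminus g f v.

Definition density h : R := \int[leb]_v h v.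

Definition bulk_velocity h : V :=
  (density h)^-1 *: \row_i \int[leb]_v (h v * v 0 i).

Definition temperature h : R :=
  (d%:R * density h)^-1 * \int[leb]_v (h v * enorm (v - bulk_velocity h) ^+ 2).

(* C([0,oo), L^1_2) /\ L^1_loc((0,oo), L^1_3), nonnegative; elements of L^1 are
   represented by nonnegative measurable functions, and only times t >= 0 are
   relevant. *)
Record solution_class f : Prop := SolutionClass {
  sc_ge0 : forall t : R, 0 <= t -> forall v, 0 <= f t v;
  sc_L12 : forall t : R, 0 <= t -> in_L1 2 (f t);
  sc_continuous : forall t : R, 0 <= t ->
    (fun s => L1norm 2 (f s \- f t)) @ within [set s | 0 <= s] (nbhs t) --> 0%E;
  sc_L1loc : forall a b : R, 0 < a -> a <= b ->
    lebesgue_measure.-integrable `[a, b] (fun s => L1norm 3 (f s)) }.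

Definition test_function (phi : V -> R) : Prop :=
  [/\ forall v, differentiable phi v,
      forall i, continuous (fun v => 'D_(delta_mx 0 i) phi v) &
      exists r, forall v, r < enorm v -> phi v = 0].

(* Weak form, integrated in time from the initial datum f0, of an evolution
   equation f_t = G(f), where rhs f t phi stands for < G(f)(t, .), phi >. The
   case t = 0 is the initial condition. *)
Definition weak_solution (rhs : (R -> V -> R) -> R -> (V -> R) -> R)
    (f0 : V -> R) f : Prop :=
  forall phi, test_function phi -> forall t : R, 0 <= t ->
    lebesgue_measure.-integrable `[0, t] (fun s => (rhs f s phi)%:E) /\
    \int[leb]_v (f t v * phi v) =
      \int[leb]_v (f0 v * phi v) +
      \int[lebesgue_measure]_(s in `[0, t]) rhs f s phi.

Definition collision_rhs (alpha : R) f (t : R) (phi : V -> R) : R :=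
  \int[leb]_v (((1 - alpha) * Q (f t) (f t) v
                - alpha * Qminus (f t) (f t) v) * phi v).

Definition annihilation_solution (alpha : R) (f0 : V -> R) f : Prop :=
  [/\ solution_class f,
      forall t : R, 0 <= t -> in_L1 3 (f t) &
      weak_solution (collision_rhs alpha) f0 f].

Definition A_coef (alpha : R) psi (tau : R) : R :=
  - (alpha / 2) * \int[leb]_xi
     ((d%:R + 2 - 2 * enorm xi ^+ 2) * Qminus (psi tau) (psi tau) xi).

Definition B_coef (alpha : R) psi (tau : R) : R :=
  - (alpha / 2) * \int[leb]_xi
     ((1 - 2 / d%:R * enorm xi ^+ 2) * Qminus (psi tau) (psi tau) xi).

(* The product B_psi v_psi; v_psi itself does not occur elsewhere. *)
Definition Bv_coef (alpha : R) psi (tau : R) : V :=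
  \row_i (- alpha * \int[leb]_xi (xi 0 i * Qminus (psi tau) (psi tau) xi)).

(* The term B div((xi - v) psi) is integrated by parts; 'D_w phi xi is
   w . grad phi(xi), here with w = B (xi - v) = B xi - B v. *)
Definition rescaled_rhs (alpha : R) psi (tau : R) (phi : V -> R) : R :=
  - (A_coef alpha psi tau - d%:R * B_coef alpha psi tau)
      * \int[leb]_xi (psi tau xi * phi xi)
  + \int[leb]_xi (psi tau xi *
      'D_(B_coef alpha psi tau *: xi - Bv_coef alpha psi tau) phi xi)
  + collision_rhs alpha psi tau phi.

Definition rescaled_solution (alpha : R) (psi0 : V -> R) psi : Prop :=
  solution_class psi /\ weak_solution (rescaled_rhs alpha) psi0 psi.

Definition unique_solution (P : (R -> V -> R) -> Prop) f : Prop :=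
  P f /\ forall g, P g -> forall t : R, 0 <= t -> {ae leb, forall v, g t v = f t v}.

Definition rescaled_time f (t : R) : R :=
  Num.sqrt 2 * \int[lebesgue_measure]_(s in `[0, t])
    (density (f s) * Num.sqrt (temperature (f s))).

Definition rescaling_of f psi : Prop := forall t : R, 0 <= t -> forall v,
  f t v = density (f t) * (2 * temperature (f t)) `^ (- (d%:R / 2)) *
    psi (rescaled_time f t)
        ((Num.sqrt (2 * temperature (f t)))^-1 *: (v - bulk_velocity (f t))).

Definition rescaled_datum (f0 : V -> R) (xi : V) : R :=
  (2 * temperature f0) `^ (d%:R / 2) * (density f0)^-1 *
    f0 (Num.sqrt (2 * temperature f0) *: xi + bulk_velocity f0).

End kinetic.

(* Main.v *)
(** Write [h_t = a h - div ((b v - c) h) + (1 - alpha) Q(h, h) - alpha Q_-(h, h)] for an equation with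
    time-dependent drift coefficients [a], [b], [c]; both equations of the theorem have this form. In
    weak form it is a family of scalar integral equations, and the affine map [v -> s(t) v + p(t)]
    together with a factor [m(t)] and the change of time [d tau = dt / (m s)] turns a solution into a
    solution of an equation of the same form, with explicit new coefficients. For the solution [f] of
    the annihilation equation, with [m = 1 / n_f], [s = (2 T_f)^(-1/2)] and [p = - s u_f], these
    coefficients are the ones of the rescaled equation, because the moments of order 0, 1, 2 of [f]
    decrease by [alpha] times the moments of [Q_-(f, f)]. The density stays positive since it satisfies
    a linear differential inequality, the temperature since [f(t)] has a density with respect to
    Lebesgue measure, and the rescaled time is unbounded, for otherwise the temperature would be
    bounded from below.

    Conversely let [g] be a solution of the rescaled equation in the large class of the uniqueness
    statement. The deviations of its moments from [(1, 0, d / 2)] satisfy linear homogeneous equations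
    with integrable coefficients, so the moments are conserved, and Povzner's inequality propagates
    the third moment. Hence the transformation can be inverted, with factors [m] and [s] that are
    exponentials of integrals of the coefficients of [g]; the result solves the annihilation equation,
    so it is [f], and [g] is the rescaling of [f]. *)

Require Import Defs.
From HB Require Import structures.
From mathcomp Require Import all_boot all_order all_algebra.
From mathcomp Require Import all_classical all_reals all_analysis.
From mathcomp Require Import measurable_realfun ring lra.
Import Order.TTheory GRing.Theory Num.Theory.
Import numFieldNormedType.Exports.
Local Open Scope classical_set_scope.
Local Open Scope ring_scope.

Set Implicit Arguments.
Unset Strict Implicit.

(** * Lebesgue measure on row vectors *)

(** Solutions are weak: tests are continuously differentiable with compact support, the coefficients
    are merely integrable in time, and in the uniqueness class the third moment is finite at almost
    every time and integrable only away from time 0. So nothing is differentiated in time: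
    [prim F f] (on the half-line, F is an integral of f) replaces derivatives, and its product and
    chain rules, like the motion of a test function along an affine map, come from one principle
    passing from approximate integrands on short intervals to the exact one. Terms that need a third
    moment carry the indicator [fin3] of the times at which it is finite.

    Two facts are not supplied by the hypotheses. The coefficient B_psi of an arbitrary rescaled
    solution might fail to be integrable near time 0; this is recovered from the equation itself,
    tested against a cut-off. And a bounded rescaled time would leave psi undetermined beyond some
    tau; positivity of the temperature at each time does not exclude it, so concentration at a point
    is ruled out by counting the collisions that are left. *)

Section change_of_variables.
Context d1 d2 (X : measurableType d1) (Y : measurableType d2) (R : realType).
Variables (phi : X -> Y) (mphi : measurable_fun setT phi).
Variables (mu : {measure set X -> \bar R}) (nu : {measure set Y -> \bar R}).
Variables (c : R) (c0 : 0 <= c).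
Hypothesis mu_nu : forall A, measurable A -> mu (phi @^-1` A) = (c%:E * nu A)%E.

(** Reduces a change of variables to the measure of preimages; it serves affine maps of the line,
    the radial projection and the antipodal map. *)
Lemma ge0_integral_scaled_pushforward (F : Y -> \bar R) :
  measurable_fun setT F -> (forall y, (0 <= F y)%E) ->
  (\int[mu]_x F (phi x) = c%:E * \int[nu]_y F y)%E.
Proof.
move=> mF F0.
have -> : (\int[mu]_x F (phi x) = \int[pushforward mu phi]_y F y)%E.
  by rewrite ge0_integral_pushforward// => y _.
rewrite -[c%:E]/((NngNum c0)%:num%:E) -ge0_integral_mscale//.
pose m1 : {measure set Y -> \bar R} :=
  measure_function_pushforward__canonical__measure_function_Measure mu mphi.
rewrite -[LHS]/(integral m1 setT F).
apply: eq_measure_integral => A mA _ /=.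
exact: mu_nu.
Qed.

End change_of_variables.

Section lebesgue1_affine.
Context {R : realType}.
Local Notation mu := (@lebesgue_measure R).

Lemma measurable_affine1 (a u : R) :
  measurable_fun [set: measurableTypeR R] ((fun x => a * x + u) : _ -> measurableTypeR R).
Proof. by apply: measurable_funD => //; apply: measurable_funM. Qed.

(** By uniqueness of Lebesgue measure, it suffices to compare lengths of half-open intervals. For a
    < 0 the preimage is closed on the other side, which does not change its length. *)
Lemma lebesgue_measure_affine (a u : R) (A : set (measurableTypeR R)) : a != 0 ->
  measurable A -> mu ((fun x => a * x + u) @^-1` A) = (`|a|^-1%:E * mu A)%E.
Proof.
move=> a0 mA.
have na0 : `|a| != 0 by rewrite normr_eq0.
pose m1 := measure_function_pushforward__canonical__measure_function_Measure
  (mu : {measure set (measurableTypeR R) -> \bar R}) (measurable_affine1 a u).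
pose m2 : {measure set _ -> \bar R} := mscale (NngNum (normr_ge0 a)) m1.
have -> : mu A = m2 A.
  apply: lebesgue_measure_unique => //= _ [[b c]] _ <-.
  rewrite /mscale /= /pushforward /=.
  have [alt0|agt0] := ltP a 0.
    rewrite (_ : _ @^-1` _ = `[a^-1 * (c - u), a^-1 * (b - u)[%classic); last first.
      apply/seteqP; split => x /=; rewrite !in_itv/= => /andP[h1 h2].
        rewrite -(ler_nM2l alt0) mulrA divff// mul1r -(ltr_nM2l alt0) mulrA divff// mul1r.
        by apply/andP; split; lra.
      move: h1 h2; rewrite -(ler_nM2l alt0) mulrA divff// mul1r.
      rewrite -(ltr_nM2l alt0) mulrA divff// mul1r => h1 h2.
      by apply/andP; split; lra.
    rewrite !lebesgue_measure_itv/= !lte_fin ltr_nM2l ?invr_lt0// ltrD2r.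
    case: ifPn => //; rewrite ?mule0//.
    rewrite -!EFinB -EFinM (ltr0_norm alt0) => _; congr EFin.
    by rewrite -mulrBr mulrA mulNr divff//; ring.
  have {}agt0 : 0 < a by rewrite lt_neqAle eq_sym a0.
  rewrite (_ : _ @^-1` _ = `]a^-1 * (b - u), a^-1 * (c - u)]%classic); last first.
    apply/seteqP; split => x /=; rewrite !in_itv/= => /andP[h1 h2].
      rewrite -(ler_pM2l agt0) mulrA divff// mul1r -(ltr_pM2l agt0) mulrA divff// mul1r.
      by apply/andP; split; lra.
    move: h1 h2; rewrite -(ler_pM2l agt0) mulrA divff// mul1r.
    rewrite -(ltr_pM2l agt0) mulrA divff// mul1r => h1 h2.
    by apply/andP; split; lra.
  rewrite !lebesgue_measure_itv/= !lte_fin ltr_pM2l ?invr_gt0// ltrD2r.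
  case: ifPn => //; rewrite ?mule0//.
  rewrite -!EFinB -EFinM (gtr0_norm agt0) => _; congr EFin.
  by rewrite -mulrBr mulrA divff//; ring.
rewrite /m2 /mscale/= muleA -EFinM mulVf// mul1e.
by [].
Qed.

End lebesgue1_affine.

Section lebesgue_rV_affine.
Context {R : realType}.
Local Notation leb := (@lebesgue_rV R _).

Lemma measurable_affine d (a : R) (u : 'rV[R]_d) :
  measurable_fun setT (fun v : 'rV[R]_d => a *: v + u).
Proof.
apply: measurable_fun_rV => i.
rewrite (_ : (fun _ => _) = fun v : 'rV[R]_d => a * v 0 i + u 0 i); last first.
  by apply/funext => v; rewrite !mxE.
by apply: measurable_funD => //; apply: measurable_funM => //; exact: measurable_coord.
Qed.

Lemma ge0_integral_lebesgue_rVS d (F : 'rV[R]_d.+1 -> \bar R) :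
  measurable_fun setT F -> (forall v, (0 <= F v)%E) ->
  (\int[@lebesgue_rV R d.+1]_v F v =
   \int[lebesgue_measure]_x \int[@lebesgue_rV R d]_y F (rV_cons (x, y)))%E.
Proof.
move=> mF F0.
transitivity (\int[lebesgue_measure \x @lebesgue_rV R d]_p F (rV_cons p))%E.
  rewrite -[RHS]/(integral _ (@rV_cons R d @^-1` setT) (F \o @rV_cons R d)).
  rewrite -ge0_integral_pushforward//; last exact: measurable_rV_cons.
rewrite (@fubini_tonelli1 _ _ _ _ _ _ _ (F \o @rV_cons R d))//.
  by apply: measurableT_comp => //; exact: measurable_rV_cons.
by move=> p; exact: F0.
Qed.

(** Induction on the dimension: Tonelli peels off the first coordinate, and each coordinate
    contributes one factor 1/|a|. In dimension 0 there is only one vector. *)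
Lemma ge0_integral_affine d (a : R) (u : 'rV[R]_d) (F : 'rV[R]_d -> \bar R) :
  a != 0 -> measurable_fun setT F -> (forall v, (0 <= F v)%E) ->
  (\int[leb]_v F (a *: v + u)%R = (`|a| ^- d)%:E * \int[leb]_v F v)%E.
Proof.
move=> a0; elim: d u F => [|d IH] u F mF F0.
  rewrite expr0 invr1 mul1e; congr integral; apply/funext => v.
  by congr F; apply/rowP => -[].
have mFa : measurable_fun setT (fun v : 'rV[R]_d.+1 => F (a *: v + u)).
  by apply: measurableT_comp => //; exact: measurable_affine.
rewrite ge0_integral_lebesgue_rVS// ge0_integral_lebesgue_rVS//.
pose G (x : measurableTypeR R) := (\int[@lebesgue_rV R d]_y F (rV_cons (x, y)))%E.
have mFc : measurable_fun setT (F \o @rV_cons R d).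
  by apply: measurableT_comp => //; exact: measurable_rV_cons.
have mG : measurable_fun setT G.
  by apply: (measurable_fun_fubini_tonelli_F (F \o @rV_cons R d)) => // p; exact: F0.
have G0 x : (0 <= G x)%E by exact: integral_ge0.
rewrite exprS invfM EFinM -muleA.
transitivity (\int[lebesgue_measure]_x ((`|a| ^- d)%:E * G (a * x + u ord0 ord0)%R))%E.
  apply: eq_integral => x _.
  have mFcx z : measurable_fun setT (fun y => F (rV_cons (z, y))).
    apply: (measurableT_comp mFc); exact: measurable_pair1.
  rewrite /G -(IH (\row_j u 0 (lift ord0 j)) (fun y => F (rV_cons (a * x + u ord0 ord0, y))))//.
  apply: eq_integral => y _; congr F.
  apply/rowP => i; rewrite !mxE.
  by case: unliftP => [j ->|->] /=; rewrite ?mxE.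
have mGa : measurable_fun setT (fun x : measurableTypeR R => G (a * x + u ord0 ord0)).
  by apply: (measurableT_comp mG); exact: measurable_affine1.
rewrite ge0_integralZl_EFin//.
rewrite (@ge0_integral_scaled_pushforward _ _ _ _ _ _ (measurable_affine1 a (u ord0 ord0))
  lebesgue_measure lebesgue_measure `|a|^-1 _ _ G)//.
- by rewrite muleCA.
- by move=> A mA; exact: lebesgue_measure_affine.
Qed.

End lebesgue_rV_affine.

Section euclidean.
Context {R : realType} {d : nat}.
Implicit Types v w : 'rV[R]_d.

Definition dotr v w : R := \sum_i v 0 i * w 0 i.

Lemma enorm_sqr v : enorm v ^+ 2 = \sum_i v 0 i ^+ 2.
Proof. by rewrite sqr_sqrtr// sumr_ge0// => i _; rewrite sqr_ge0. Qed.

Lemma enorm_sqrD v w : enorm (v + w) ^+ 2 = enorm v ^+ 2 + 2 * dotr v w + enorm w ^+ 2.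
Proof.
rewrite !enorm_sqr /dotr mulr_sumr -!big_split/=; apply: eq_bigr => i _.
by rewrite !mxE; ring.
Qed.

Lemma enormZ a v : enorm (a *: v) = `|a| * enorm v.
Proof.
rewrite /enorm -sqrtr_sqr -sqrtrM ?sqr_ge0//; congr Num.sqrt.
by rewrite mulr_sumr; apply: eq_bigr => i _; rewrite !mxE exprMn.
Qed.

Lemma enormN v : enorm (- v) = enorm v.
Proof. by rewrite -scaleN1r enormZ normrN1 mul1r. Qed.

Lemma enorm0 : enorm (0 : 'rV[R]_d) = 0.
Proof. by rewrite -(scale0r (0 : 'rV[R]_d)) enormZ normr0 mul0r. Qed.

Lemma enorm_eq0 v : enorm v = 0 -> v = 0.
Proof.
move=> v0; have := enorm_sqr v; rewrite v0 expr0n/= => /esym/eqP.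
rewrite psumr_eq0; last by move=> i _; rewrite sqr_ge0.
move=> /allP h; apply/rowP => i; rewrite mxE; apply/eqP.
by have := h i (mem_index_enum _); rewrite sqrf_eq0.
Qed.

Lemma dotrZr a v w : dotr v (a *: w) = a * dotr v w.
Proof. by rewrite mulr_sumr; apply: eq_bigr => i _; rewrite mxE; ring. Qed.

Lemma dotrZl a v w : dotr (a *: v) w = a * dotr v w.
Proof. by rewrite mulr_sumr; apply: eq_bigr => i _; rewrite mxE; ring. Qed.

Lemma dotr_le v w : dotr v w <= enorm v * enorm w.
Proof.
have [w0|w0] := eqVneq (enorm w) 0.
  rewrite (enorm_eq0 w0) enorm0 mulr0 /dotr big1// => i _.
  by rewrite mxE mulr0.
have wp : 0 < enorm w by rewrite lt_neqAle eq_sym w0 enorm_ge0.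
(* Cauchy-Schwarz: this is |w|^2 times the component of [v] orthogonal to [w], scaled so as to avoid
   a division. *)
have := sqr_ge0 (enorm (enorm w ^+ 2 *: v + (- dotr v w) *: w)).
rewrite enorm_sqrD !enormZ dotrZl dotrZr !exprMn !real_normK ?num_real// => h.
have {}h : 0 <= enorm w ^+ 2 * ((enorm v * enorm w) ^+ 2 - dotr v w ^+ 2).
  by apply: le_trans h _; rewrite le_eqVlt; apply/orP; left; apply/eqP; ring.
rewrite pmulr_rge0 ?exprn_gt0// subr_ge0 in h.
apply: le_trans (ler_norm _) _.
by rewrite -(@ler_pXn2r _ 2)// ?nnegrE ?mulr_ge0 ?enorm_ge0// real_normK ?num_real.
Qed.

Lemma enormD v w : enorm (v + w) <= enorm v + enorm w.
Proof.
rewrite -(@ler_pXn2r _ 2)// ?nnegrE ?addr_ge0 ?enorm_ge0// enorm_sqrD.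
by have := dotr_le v w; rewrite sqrrD; lra.
Qed.

Lemma enormB v w : enorm (v - w) <= enorm v + enorm w.
Proof. by rewrite (le_trans (enormD _ _))// enormN. Qed.

Lemma ler_coord_enorm v i : `|v 0 i| <= enorm v.
Proof.
rewrite -(@ler_pXn2r _ 2)// ?nnegrE ?enorm_ge0// real_normK ?num_real// enorm_sqr.
rewrite (bigD1 i)//= lerDl sumr_ge0// => j _; exact: sqr_ge0.
Qed.

End euclidean.

Section lebesgue_rV_measure.
Context {R : realType}.
Local Notation leb := (@lebesgue_rV R _).

Lemma lebesgue_rV_affine d (a : R) (u : 'rV[R]_d) (A : set 'rV[R]_d) :
  a != 0 -> measurable A ->
  leb ((fun v => a *: v + u) @^-1` A) = ((`|a| ^- d)%:E * leb A)%E.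
Proof.
move=> a0 mA.
have mA' : measurable ((fun v => a *: v + u) @^-1` A).
  by rewrite -[X in measurable X]setTI; exact: measurable_affine.
rewrite -[in RHS](setIT A) -integral_indic//.
rewrite -(ge0_integral_affine u a0 (F := fun v => (\1_A v)%:E))//.
- by rewrite -[in LHS](setIT (_ @^-1` _)) -integral_indic.
- by apply/measurable_EFinP; exact: measurable_indic.
Qed.

Lemma measurable_rV_box d (I : 'I_d -> interval R) :
  measurable [set v : 'rV[R]_d | forall i, v 0 i \in I i].
Proof.
rewrite (_ : mkset _ = \bigcap_(i in [set: 'I_d]) [set v : 'rV[R]_d | v 0 i \in I i]).
  apply: fin_bigcap_measurable => // i _.
  have := @measurable_coord R d i measurableT _ (measurable_itv (I i)).
  by rewrite setTI.
by apply/seteqP; split => v /= h i; [move=> _|]; exact: h.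
Qed.

Lemma lebesgue_rV_cube d :
  leb [set v : 'rV[R]_d | forall i, v 0 i \in `[-1, 1]] = (2 ^+ d)%:E.
Proof.
elim: d => [|d IH] /=.
  rewrite diracE mem_set// => -[]//.
rewrite /lebesgue_rV_step /pushforward.
rewrite (_ : _ @^-1` _ = `[-1, 1]%classic `*` [set v : 'rV[R]_d | forall i, v 0 i \in `[-1, 1]]).
  rewrite product_measure1E//=.
  - rewrite IH lebesgue_measure_itv/= lte_fin ifT ?gtrN//.
    by rewrite -EFinB -EFinM exprS; congr (_ * _)%:E; ring.
  - exact: measurable_rV_box.
apply/seteqP; split => [[x v]|[x v] [/= h1 h2]] /=.
  move=> h; split => /=.
    by have := h ord0; rewrite /rV_cons mxE unlift_none.
  by move=> i; have := h (lift ord0 i); rewrite /rV_cons mxE liftK.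
by move=> i; rewrite /rV_cons mxE; case: (unliftP ord0 i) => [j _|_] /=; [exact: h2|].
Qed.

(** The map v -> 2 v - u fixes [u] and is injective, so the measure m of the point satisfies m =
    2^-d m. It is finite because the point can be translated into the unit cube; hence it
    vanishes. *)
Lemma lebesgue_rV_set1 d (u : 'rV[R]_d) : (0 < d)%N -> leb [set u] = 0%E.
Proof.
move=> d0.
have m1 : measurable [set u].
  rewrite (_ : [set u] = [set v : 'rV[R]_d | forall i, v 0 i \in `[u 0 i, u 0 i]]).
    exact: measurable_rV_box.
  apply/seteqP; split => [v -> i /=|v /= h]; first by rewrite in_itv/= lexx.
  apply/rowP => i; apply/eqP; rewrite eq_le.
  by have := h i; rewrite in_itv/= andbC.
have fin1 : (leb [set u] < +oo)%E.
  pose A := (fun v => 1 *: v + u) @^-1` [set u].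
  have E : leb A = leb [set u].
    by rewrite lebesgue_rV_affine ?oner_neq0// normr1 expr1n invr1 mul1e.
  rewrite -E (@le_lt_trans _ _ (leb [set v : 'rV[R]_d | forall i, v 0 i \in `[-1, 1]]))//.
    apply: le_measure; rewrite ?inE.
    - by rewrite -[X in measurable X]setTI; exact: measurable_affine.
    - exact: measurable_rV_box.
    - move=> v; rewrite /A/= scale1r => vu.
      have -> : v = 0 by apply: (addIr u); rewrite add0r.
      by move=> i; rewrite mxE in_itv/= lerN10 ler01.
  by rewrite lebesgue_rV_cube ltry.
have := @lebesgue_rV_affine d 2 (- u) [set u]; rewrite pnatr_eq0 => /(_ isT m1).
rewrite (_ : _ @^-1` _ = [set u]); last first.
  apply/seteqP; split => v /= => [h|->].
    apply: (@scalerI _ _ (2 : R)); first by rewrite pnatr_eq0.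
    by apply: (addIr (- u)); rewrite h scaler_nat mulr2n addrK.
  by rewrite scaler_nat mulr2n addrK.
have : leb [set u] \is a fin_num by rewrite ge0_fin_numE.
move/fineK => <-; rewrite -EFinM => -[] h.
congr EFin; apply/eqP; rewrite -(mulrI_eq0 _ (@mulfI _ (1 - `|2 : R| ^- d) _)).
  by rewrite mulrBl mul1r {1}h subrr.
rewrite subr_eq0 eq_sym lt_eqF// invf_lt1 ?exprn_gt0 ?normr_gt0 ?pnatr_eq0//.
by rewrite exprn_egt1 ?gtr0_norm// ?ltr1n// -lt0n.
Qed.

Lemma lebesgue_rV_unit_ball_fin d : (leb (@unit_ball R d) < +oo)%E.
Proof.
rewrite (@le_lt_trans _ _ (leb [set v : 'rV[R]_d | forall i, v 0 i \in `[-1, 1]]))//; last first.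
  by rewrite lebesgue_rV_cube ltry.
apply: le_measure; rewrite ?inE; first exact: measurable_unit_ball.
  exact: measurable_rV_box.
move=> v /= v1 i; rewrite in_itv/= -ler_norml.
exact: le_trans (ler_coord_enorm _ _) v1.
Qed.

(** The ball contains the cube of half-side 1/(d+1); d+1 rather than d keeps the scale nonzero in
    dimension 0. *)
Lemma lebesgue_rV_unit_ball_gt0 d : (0 < leb (@unit_ball R d))%E.
Proof.
pose C := [set v : 'rV[R]_d | forall i, v 0 i \in `[-1, 1]].
have mC : measurable C by exact: measurable_rV_box.
have c0 : (d.+1%:R : R) != 0 by rewrite pnatr_eq0.
rewrite (@lt_le_trans _ _ (leb ((fun v => d.+1%:R *: v + 0) @^-1` C)))//.
  rewrite lebesgue_rV_affine// lebesgue_rV_cube -EFinM lte_fin mulr_gt0//.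
    by rewrite invr_gt0 exprn_gt0// normr_gt0.
apply: le_measure; rewrite ?inE.
- by rewrite -[X in measurable X]setTI; exact: measurable_affine.
- exact: measurable_unit_ball.
move=> v /= h; rewrite /unit_ball/= -(@ler_pXn2r _ 2)// ?nnegrE ?enorm_ge0// expr1n enorm_sqr.
apply: (@le_trans _ _ (\sum_(i < d) (d.+1%:R^-1))).
  apply: ler_sum => i _.
  have := h i; rewrite !mxE addr0 in_itv/= -ler_norml normrM.
  rewrite (@ger0_norm _ d.+1%:R)// -ler_pdivlMl ?ltr0n// mulr1 => hi.
  rewrite -real_normK ?num_real//; apply: (@le_trans _ _ (`|v 0 i| * 1)); last by rewrite mulr1.
  rewrite expr2 ler_wpM2l//; apply: le_trans hi _.
  by rewrite invf_le1 ?ltr0n// ler1n.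
by rewrite sumr_const card_ord -[_ *+ d]mulr_natl ler_pdivrMr ?ltr0n// mul1r ler_nat.
Qed.

End lebesgue_rV_measure.

(** * The normalized measure of the sphere *)

Section sphere_integral.
Context {R : realType} {d : nat}.
Local Notation leb := (@lebesgue_rV R d).
Local Notation V := 'rV[R]_d.

Let kappa : R := fine (leb unit_ball).

Let kappaE : kappa%:E = leb unit_ball.
Proof.
by rewrite fineK// ge0_fin_numE//; exact: lebesgue_rV_unit_ball_fin.
Qed.

Let kappa_gt0 : 0 < kappa.
Proof. by rewrite -lte_fin kappaE; exact: lebesgue_rV_unit_ball_gt0. Qed.

Lemma sphere_measureT : sphere_measure d setT = 1%E :> \bar R.
Proof.
rewrite /sphere_measure preimage_setT setTI -/kappa -kappaE -EFinM mulVf//.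
by rewrite gt_eqF.
Qed.

HB.instance Definition _ := Measure_isProbability.Build _ _ _
  (@sphere_measure R d) sphere_measureT.

Lemma radial_projN (v : V) : radial_proj (- v) = - radial_proj v.
Proof. by rewrite /radial_proj enormN scalerN. Qed.

(** Only an inequality, because 0^-1 = 0 makes [radial_proj 0] equal to 0. Since it holds for every
    vector, upper bounds need no exceptional set. *)
Lemma enorm_radial_proj_le1 (v : V) : enorm (radial_proj v) <= 1.
Proof.
rewrite /radial_proj enormZ ger0_norm ?invr_ge0 ?enorm_ge0//.
have [->|v0] := eqVneq (enorm v) 0; first by rewrite mulr0.
by rewrite mulVf.
Qed.

Lemma enorm_radial_proj (v : V) : v != 0 -> enorm (radial_proj v) = 1.
Proof.
move=> v0; rewrite /radial_proj enormZ ger0_norm ?invr_ge0 ?enorm_ge0//.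
by rewrite mulVf//; apply: contra_neq v0 => /enorm_eq0.
Qed.

Lemma radial_projZ a (v : V) : 0 < a -> radial_proj (a *: v) = radial_proj v.
Proof.
move=> a0; rewrite /radial_proj enormZ gtr0_norm// scalerA invfM mulrAC mulVf ?mul1r//.
by rewrite gt_eqF.
Qed.

Lemma radial_projK (v : V) : radial_proj (radial_proj v) = radial_proj v.
Proof.
have [->|v0] := eqVneq v 0; first by rewrite /radial_proj !scaler0.
rewrite {2}/radial_proj radial_projZ// invr_gt0 lt_neqAle enorm_ge0 andbT eq_sym.
by apply: contra_neq v0 => /enorm_eq0.
Qed.

Lemma enorm_radial_projK (v : V) : enorm v *: radial_proj v = v.
Proof.
rewrite /radial_proj scalerA; have [v0|v0] := eqVneq (enorm v) 0.
  by rewrite (enorm_eq0 v0) scaler0.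
by rewrite divff// scale1r.
Qed.

Let measurable_oppv : measurable_fun setT (fun v : V => - v).
Proof.
rewrite (_ : (fun _ => _) = (fun v : V => -1 *: v + 0)); last first.
  by apply/funext => v; rewrite scaleN1r addr0.
exact: measurable_affine.
Qed.

(** [sphere_measure] lives on the whole space; this lets [s] be replaced by a normalized vector, for
    which estimates hold pointwise. The projection is idempotent, so it preserves cones. *)
Lemma ge0_sphere_integral_radial (F : V -> \bar R) :
  measurable_fun setT F -> (forall v, (0 <= F v)%E) ->
  (\int[sphere_measure d]_s F (radial_proj s) = \int[sphere_measure d]_s F s)%E.
Proof.
move=> mF F0.
rewrite (@ge0_integral_scaled_pushforward _ _ _ _ _ _ (@measurable_radial_proj R d)
  (sphere_measure d) (sphere_measure d) 1) ?mul1e// => A mA.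
rewrite mul1e /sphere_measure/=; congr (_ * leb (_ `&` _))%E.
by apply/seteqP; split => v /=; rewrite radial_projK.
Qed.

(** The map v -> -v preserves Lebesgue measure and the unit ball, and sends the cone over a set to
    the cone over its opposite. *)
Lemma ge0_sphere_integralN (F : V -> \bar R) :
  measurable_fun setT F -> (forall v, (0 <= F v)%E) ->
  (\int[sphere_measure d]_s F (- s)%R = \int[sphere_measure d]_s F s)%E.
Proof.
move=> mF F0.
rewrite (@ge0_integral_scaled_pushforward _ _ _ _ _ _ measurable_oppv
  (sphere_measure d) (sphere_measure d) 1) ?mul1e// => A mA.
rewrite mul1e /sphere_measure; congr (_ * _)%E.
have mB : measurable (radial_proj @^-1` A `&` unit_ball).
  apply: measurableI; last exact: measurable_unit_ball.
  by rewrite -[X in measurable X]setTI; exact: measurable_radial_proj.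
have /(lebesgue_rV_affine 0)/(_ mB) : (-1 : R) != 0 by rewrite oppr_eq0 oner_neq0.
rewrite normrN1 expr1n invr1 mul1e => <-; congr (leb _).
apply/seteqP; split => v /=; rewrite scaleN1r addr0 radial_projN.
  by move=> [? ?]; split => //; rewrite /unit_ball/= enormN.
by rewrite /unit_ball/= enormN.
Qed.

Lemma sphere_measure_set0 : (0 < d)%N -> sphere_measure d [set (0 : V)] = 0%E.
Proof.
move=> d0; rewrite /sphere_measure.
suff -> : radial_proj @^-1` [set 0] `&` unit_ball = [set (0 : V)].
  by rewrite lebesgue_rV_set1// mule0.
apply/seteqP; split => [v [/= h _]|v ->].
  by rewrite -[v]enorm_radial_projK h scaler0.
by split => /=; rewrite /radial_proj ?scaler0// /unit_ball/= enorm0.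
Qed.

End sphere_integral.

(** * Polar coordinates *)

Section polar.
Context {R : realType} {d : nat}.
Hypothesis d_gt0 : (0 < d)%N.
Local Notation leb := (@lebesgue_rV R d).
Local Notation V := 'rV[R]_d.
Local Notation sph := (@sphere_measure R d).
Local Notation Rm := (measurableTypeR R).

Let nrm : V -> Rm := @enorm R d.

Let measurable_nrm : measurable_fun setT nrm.
Proof. exact: measurable_enorm. Qed.

Let cb (r : R) : set V := [set z : V | enorm z <= r].

Let cb0E : cb 0 = [set 0].
Proof.
apply/seteqP; split => z /=; rewrite /cb/=; last by move->; rewrite enorm0.
by move=> z0; apply: enorm_eq0; apply/eqP; rewrite eq_le z0 enorm_ge0.
Qed.

Let mball (r : R) (B : set V) : measurable B ->
  measurable (cb r `&` radial_proj @^-1` B).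
Proof.
move=> mB; apply: measurableI; last by rewrite -[X in measurable X]setTI; exact: measurable_radial_proj.
have := measurable_nrm measurableT (measurable_itv `]-oo, r]).
by rewrite setTI; congr measurable; apply/seteqP; split => z /=; rewrite in_itv.
Qed.

(** For r > 0, dilation by 1/r maps the truncated cone over [B] to the one in the unit ball, and the
    same holds for the full ball, so the scaling factors cancel. For r = 0 only the origin is left,
    which is null. *)
Let ball_sphere (r : R) (B : set V) : measurable B ->
  leb (cb r `&` radial_proj @^-1` B) =
  (leb (cb r) * sph B)%E.
Proof.
move=> mB.
have [r0|r0|->] := ltgtP r 0.
- rewrite (_ : cb r = set0) ?set0I ?measure0 ?mul0e//.
  by apply/seteqP; split => z //=; rewrite /cb/= leNgt (lt_le_trans r0 (enorm_ge0 z)).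
- have E (C : set V) : measurable C ->
      leb (cb r `&` radial_proj @^-1` C) =
      ((`|r^-1| ^- d)%:E * leb (radial_proj @^-1` C `&` unit_ball))%E.
    move=> mC.
    rewrite -(@lebesgue_rV_affine R d r^-1 0) ?invr_eq0 ?gt_eqF//.
      congr (leb _); apply/seteqP; split => z /=; rewrite addr0 radial_projZ ?invr_gt0//.
        by move=> [zr ?]; split => //; rewrite /unit_ball/= enormZ gtr0_norm ?invr_gt0// mulrC ler_pdivrMr// mul1r.
      by rewrite /unit_ball/= enormZ gtr0_norm ?invr_gt0// mulrC ler_pdivrMr// mul1r => -[].
    apply: measurableI; last exact: measurable_unit_ball.
    by rewrite -[X in measurable X]setTI; exact: measurable_radial_proj.
  rewrite E//.
  have -> : cb r = cb r `&` radial_proj @^-1` setT.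
    by rewrite preimage_setT setIT.
  rewrite E// preimage_setT setTI /sphere_measure -muleA; congr (_ * _)%E.
  have /fineK <- : leb (@unit_ball R d) \is a fin_num.
    by rewrite ge0_fin_numE//; exact: lebesgue_rV_unit_ball_fin.
  rewrite muleA -EFinM divff ?mul1e// gt_eqF// fine_gt0//.
  by rewrite lebesgue_rV_unit_ball_gt0 lebesgue_rV_unit_ball_fin.
- rewrite cb0E lebesgue_rV_set1// mul0e; apply/eqP; rewrite eq_le measure_ge0 andbT.
  rewrite -(@lebesgue_rV_set1 R d 0)// -cb0E; apply: le_measure; rewrite ?inE.
  + exact: mball.
  + by have := @mball 0 setT measurableT; rewrite preimage_setT setIT.
  + by move=> z [].
Qed.

Let ball_fin (r : R) : (leb (cb r) < +oo)%E.
Proof.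
have [r0|r0] := leP r 0.
  apply: (@le_lt_trans _ _ (leb [set (0:V)])); last by rewrite lebesgue_rV_set1.
  apply: le_measure; rewrite ?inE.
  - by have := @mball r setT measurableT; rewrite preimage_setT setIT.
  - rewrite -cb0E; by have := @mball 0 setT measurableT; rewrite preimage_setT setIT.
  move=> z /= zr; apply: enorm_eq0; apply/eqP; rewrite eq_le enorm_ge0 andbT.
  exact: le_trans zr r0.
have -> : cb r = (fun v => r^-1 *: v + 0) @^-1` unit_ball.
  apply/seteqP; split => z /=; rewrite addr0 /unit_ball/= enormZ gtr0_norm ?invr_gt0// mulrC ler_pdivrMr// mul1r//.
rewrite lebesgue_rV_affine ?invr_eq0 ?gt_eqF//; last exact: measurable_unit_ball.
by rewrite lte_mul_pinfty//; exact: lebesgue_rV_unit_ball_fin.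
Qed.

Let rho0 : {measure set Rm -> \bar R} :=
  measure_function_pushforward__canonical__measure_function_Measure leb measurable_nrm.

(** The distribution of |v| under Lebesgue measure. It gets its own name so that it can carry a
    sigma-finite structure, required for product measures. *)
Definition radial_law : set Rm -> \bar R := rho0.

HB.instance Definition _ := isMeasure.Build _ _ _ radial_law
  (measure0 rho0) (measure_ge0 rho0) (@measure_semi_sigma_additive _ _ _ rho0).

Let rho0_itv (r : R) : rho0 `]-oo, r]%classic = leb (cb r).
Proof.
by rewrite /rho0/= /pushforward; congr (leb _); apply/seteqP; split => z /=; rewrite in_itv.
Qed.

Let rho0_sigma_finite : sigma_finite setT rho0.
Proof.
exists (fun k => `]-oo, k%:R]%classic).
  apply/esym/seteqP; split => // x _; exists (Num.truncn x).+1 => //=.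
  by rewrite in_itv/= ltW// truncnS_gt.
by move=> k; split; [exact: measurable_itv|rewrite rho0_itv; exact: ball_fin].
Qed.

HB.instance Definition _ := @Measure_isSigmaFinite.Build _ _ _ radial_law rho0_sigma_finite.

Let rho : {sigma_finite_measure set Rm -> \bar R} := radial_law.

Let polmap : V -> Rm * V := fun z => (nrm z, radial_proj z).

Let measurable_polmap : measurable_fun setT polmap.
Proof.
by apply/measurable_fun_pairP; split => //=; exact: measurable_radial_proj.
Qed.

Let pol : {measure set (Rm * V) -> \bar R} :=
  measure_function_pushforward__canonical__measure_function_Measure leb measurable_polmap.

(** Modulus and direction are independent. For fixed [B] both sides are measures in [A]; they agree
    on the half-lines ]-oo, r] by [ball_sphere], hence on half-open intervals, hence everywhere. *)
Let polE (A : set Rm) (B : set V) : measurable A -> measurable B ->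
  pol (A `*` B) = (rho A * sph B)%E.
Proof.
move=> mA mB.
have mrB : measurable (radial_proj @^-1` B : set V).
  by rewrite -[X in measurable X]setTI; exact: measurable_radial_proj.
pose m1 : {measure set Rm -> \bar R} :=
  measure_function_pushforward__canonical__measure_function_Measure (mrestr leb mrB) measurable_nrm.
have [c [c0 cE]] : exists c : R, 0 <= c /\ c%:E = sph B.
  by exists (fine (sph B)); split; [exact: fine_ge0|rewrite fineK//; exact: fin_num_measure].
pose m2 : {measure set Rm -> \bar R} := mscale (NngNum c0) rho.
have m2E C : m2 C = (rho C * sph B)%E by rewrite muleC -cE.
suff : m1 A = m2 A.
  by rewrite m2E => <-.
have E (r : R) : m1 `]-oo, r]%classic = m2 `]-oo, r]%classic.
  rewrite m2E -[rho _]/(rho0 _) rho0_itv -ball_sphere//.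
have fin2 (r : R) : (m2 `]-oo, r]%classic < +oo)%E.
  rewrite m2E -[rho _]/(rho0 _) rho0_itv muleC.
  by rewrite lte_mul_pinfty ?ball_fin// -cE.
clearbody m1 m2.
have Eab (a b : R) : a <= b -> m1 `]a, b]%classic = m2 `]a, b]%classic.
  move=> ab.
  have -> : `]a, b]%classic = `]-oo, b]%classic `\` `]-oo, a]%classic :> set Rm.
    apply/seteqP; split => x /=; rewrite !in_itv/=.
      by move=> /andP[ax ->]; split => //; apply/negP; rewrite -ltNge.
    by move=> [-> /negP]; rewrite -ltNge andbT.
  have I : `]-oo, b] `&` `]-oo, a] = `]-oo, a]%classic :> set Rm.
    apply/seteqP; split => x /=; rewrite !in_itv/=; first by move=> [].
    by move=> xa; split => //; exact: le_trans xa ab.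
  have f2 := fin2 b.
  have f1 : (m1 `]-oo, b]%classic < +oo)%E by rewrite E.
  have mb : measurable (`]-oo, b]%classic : set Rm) by exact: measurable_itv.
  have ma : measurable (`]-oo, a]%classic : set Rm) by exact: measurable_itv.
  rewrite (measureD mb ma f1) (measureD mb ma f2) I.
  by congr (_ - _)%E; exact: E.
pose g (k : nat) : set Rm := `]- k%:R, k%:R]%classic.
have gT : \bigcup_k g k = setT.
  apply/seteqP; split => // x _; exists (Num.truncn `|x|).+1 => //=.
  by rewrite /g/= in_itv/=; have := truncnS_gt `|x|; rewrite ltr_norml => /andP[-> /ltW ->].
apply: (@measure_unique _ R Rm (@ocitv R) g erefl (@ocitvI R) _ gT m1 m2 _ _ A mA).
- by move=> i; exists (- i%:R, i%:R).
- move=> _ [[a b]] /= _ <-; have [ab|ab] := leP a b; first exact: Eab.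
  by rewrite set_itv_ge ?measure0// bnd_simp -leNgt ltW.
- move=> k; rewrite Eab; last first.
    by rewrite (@le_trans _ _ 0)// lerNl oppr0.
  apply: le_lt_trans (fin2 k%:R); apply: le_measure; rewrite ?inE; try exact: measurable_itv.
  by move=> x /=; rewrite !in_itv/= => /andP[].
Qed.

(** No Jacobian r^(d-1) appears: the outer integral stays over the whole space and sees only the
    modulus, the direction being replaced by an independent one. *)
Lemma ge0_integral_polar (K : R -> V -> \bar R) :
  measurable_fun setT (fun p : Rm * V => K p.1 p.2) ->
  (forall r w, (0 <= K r w)%E) ->
  (\int[leb]_z K (enorm z) (radial_proj z) =
   \int[leb]_z \int[sph]_s K (enorm z) s)%E.
Proof.
move=> mK K0; pose KK p := K p.1 p.2.
transitivity (\int[pol]_p KK p)%E.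
  rewrite -[RHS]/(integral (pushforward leb polmap) setT KK).
  by rewrite ge0_integral_pushforward// => p _; exact: K0.
rewrite (@eq_measure_integral _ _ _ setT (rho \x sph)%E); last first.
  by move=> A mA _; apply/esym; exact: (@product_measure_unique _ _ _ _ R rho sph pol polE).
have KK0 p : (0 <= KK p)%E by exact: K0.
rewrite fubini_tonelli1//.
transitivity (\int[pushforward leb nrm]_r fubini_F sph KK r)%E; first by [].
rewrite ge0_integral_pushforward//.
- exact: measurable_fun_fubini_tonelli_F.
- by move=> r _; exact: integral_ge0.
Qed.

(** Turning z into |z| s is reversible and preserves dz ds. By polar coordinates both sides become
    the same integral with two independent directions, whose order does not matter. This is the core
    of the exchange of pre- and post-collisional velocities. *)
Lemma ge0_integral_polar_swap (H : V -> V -> \bar R) :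
  measurable_fun setT (fun p : V * V => H p.1 p.2) ->
  (forall v w, (0 <= H v w)%E) ->
  (\int[leb]_z \int[sph]_s H z (enorm z *: s)%R =
   \int[leb]_z \int[sph]_s H (enorm z *: s)%R z)%E.
Proof.
move=> mH H0.
have mscal : measurable_fun setT (fun p : Rm * V => p.1 *: p.2).
  apply: measurable_fun_rV => i.
  rewrite (_ : (fun _ => _) = fun p : Rm * V => p.1 * p.2 0 i); last first.
    by apply/funext => p; rewrite mxE.
  apply: measurable_funM => //.
  exact: (measurableT_comp (measurable_coord i)).
have aux (G : V -> V -> \bar R) : measurable_fun setT (fun p : V * V => G p.1 p.2) ->
    (forall v w, (0 <= G v w)%E) ->
    (\int[leb]_z \int[sph]_s G z (enorm z *: s)%R =
     \int[leb]_z \int[sph]_w \int[sph]_s G (enorm z *: w)%R (enorm z *: s)%R)%E.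
  move=> mG G0.
  pose K (r : R) (w : V) : \bar R := (\int[sph]_s G (r *: w)%R (r *: s)%R)%E.
  rewrite -(ge0_integral_polar (K := K)).
  - by apply: eq_integral => z _; rewrite /K enorm_radial_projK.
  - pose GG (p : (Rm * V) * V) := G (p.1.1 *: p.1.2) (p.1.1 *: p.2).
    have mGG : measurable_fun setT GG.
      rewrite (_ : GG = (fun p : V * V => G p.1 p.2) \o
        (fun p : (Rm * V) * V => (p.1.1 *: p.1.2, p.1.1 *: p.2)))//.
      apply: measurableT_comp => //; apply/measurable_fun_pairP; split => /=.
        by apply: (measurableT_comp mscal).
      apply: (measurableT_comp mscal (g := fun p : (Rm * V) * V => (p.1.1, p.2))).
      apply/measurable_fun_pairP; split => //=.
        exact: (measurableT_comp measurable_fst measurable_fst).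
      exact: measurable_snd.
    by apply: (measurable_fun_fubini_tonelli_F GG) => // p; exact: G0.
  - by move=> r w; exact: integral_ge0.
have mH' : measurable_fun setT (fun p : V * V => H p.2 p.1).
  rewrite (_ : (fun p => _) = (fun p : V * V => H p.1 p.2) \o (fun p => (p.2, p.1)))//.
  by apply: measurableT_comp => //; exact: measurable_swap.
rewrite (aux _ mH H0).
rewrite -[RHS]/(\int[leb]_z \int[sph]_s (fun v w => H w v) z (enorm z *: s)%R)%E.
rewrite (aux _ mH' (fun v w => H0 w v)).
apply: eq_integral => z _.
pose F (p : V * V) := H (enorm z *: p.1) (enorm z *: p.2).
apply: (fubini_tonelli F) => //.
have mz : measurable_fun setT (fun v : V => enorm z *: v).
  rewrite (_ : (fun _ => _) = fun v : V => enorm z *: v + 0); last first.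
    by apply/funext => v; rewrite addr0.
  exact: measurable_affine.
rewrite (_ : F = (fun p : V * V => H p.1 p.2) \o
        (fun p => (enorm z *: p.1, enorm z *: p.2)))//.
apply: measurableT_comp => //; apply/measurable_fun_pairP; split => /=.
- exact: (measurableT_comp mz).
- exact: (measurableT_comp mz).
- by move=> p; exact: H0.
Qed.

End polar.

(** * Real-valued integrals and weighted L1 spaces *)

Section real_integral.
Context d (T : measurableType d) (R : realType) (mu : {measure set T -> \bar R}).
Implicit Types f g : T -> R.

Definition itg f : Prop := mu.-integrable setT (EFin \o f).

Lemma itg_meas f : itg f -> measurable_fun setT f.
Proof. by move=> /measurable_int /measurable_EFinP. Qed.

Lemma itg_dom f g : measurable_fun setT f -> (forall x, `|f x| <= g x) ->
  itg g -> itg f.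
Proof.
move=> mf fg ig; apply: (le_integrable _ _ _ ig) => //.
  exact/measurable_EFinP.
by move=> x _ /=; rewrite lee_fin (le_trans (fg x))// ler_norm.
Qed.

Lemma itgD f g : itg f -> itg g -> itg (fun x => f x + g x).
Proof. by move=> hf hg; exact: (integrableD measurableT hf hg). Qed.

Lemma itgB f g : itg f -> itg g -> itg (fun x => f x - g x).
Proof. by move=> hf hg; exact: (integrableB measurableT hf hg). Qed.

Lemma itgZ k f : itg f -> itg (fun x => k * f x).
Proof. by move=> hf; exact: (integrableZl measurableT k hf). Qed.

Lemma itg0 : itg (fun=> 0).
Proof. exact: integrable0. Qed.

Lemma itg_norm f : itg f -> itg (fun x => `|f x|).
Proof. by move=> hf; exact: (integrable_norm hf). Qed.

Lemma itg_ge0_fin f : measurable_fun setT f -> (forall x, 0 <= f x) ->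
  (\int[mu]_x (f x)%:E < +oo)%E -> itg f.
Proof.
move=> mf f0 fo; apply/integrableP; split; first exact/measurable_EFinP.
by under eq_integral do rewrite /= ger0_norm//.
Qed.

Lemma EFin_Rintegral f : itg f -> (\int[mu]_x f x)%:E = (\int[mu]_x (f x)%:E)%E.
Proof. by move=> hf; rewrite /Rintegral fineK//; exact: integrable_fin_num. Qed.

Lemma RintD f g : itg f -> itg g ->
  \int[mu]_x (f x + g x) = \int[mu]_x f x + \int[mu]_x g x.
Proof. exact: RintegralD. Qed.

Lemma RintB f g : itg f -> itg g ->
  \int[mu]_x (f x - g x) = \int[mu]_x f x - \int[mu]_x g x.
Proof. exact: RintegralB. Qed.

Lemma RintZ k f : itg f -> \int[mu]_x (k * f x) = k * \int[mu]_x f x.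
Proof. exact: RintegralZl. Qed.

Lemma le_Rint f g : itg f -> itg g -> (forall x, f x <= g x) ->
  \int[mu]_x f x <= \int[mu]_x g x.
Proof. by move=> hf hg fg; apply: le_Rintegral. Qed.

Lemma eq_Rint f g : (forall x, f x = g x) -> \int[mu]_x f x = \int[mu]_x g x.
Proof. by move=> fg; apply: eq_Rintegral => x _; exact: fg. Qed.

Lemma Rint_ge0 f : (forall x, 0 <= f x) -> 0 <= \int[mu]_x f x.
Proof. by move=> f0; apply: Rintegral_ge0. Qed.

Lemma norm_Rint f : itg f -> `|\int[mu]_x f x| <= \int[mu]_x `|f x|.
Proof. exact: le_normr_Rintegral. Qed.

Lemma norm_Rint_le f g : itg f -> itg g -> (forall x, `|f x| <= g x) ->
  `|\int[mu]_x f x| <= \int[mu]_x g x.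
Proof.
move=> hf hg fg; apply: (le_trans (norm_Rint hf)).
by apply: le_Rint => //; exact: itg_norm.
Qed.

Lemma itg_sum_seq (I : Type) (s : seq I) (F : I -> T -> R) : (forall i, itg (F i)) ->
  itg (fun x => \sum_(i <- s) F i x).
Proof.
move=> h; elim: s => [|i s IH].
  by under eq_fun do rewrite big_nil; exact: itg0.
by under eq_fun do rewrite big_cons; exact: itgD.
Qed.

Lemma Rint_sum_seq (I : Type) (s : seq I) (F : I -> T -> R) : (forall i, itg (F i)) ->
  \int[mu]_x (\sum_(i <- s) F i x) = \sum_(i <- s) \int[mu]_x F i x.
Proof.
move=> h; elim: s => [|i s IH].
  rewrite big_nil; under eq_Rint do rewrite big_nil.
  by rewrite Rintegral_cst// mul0r.
rewrite big_cons -IH -RintD//; last exact: itg_sum_seq.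
by apply: eq_Rint => x; rewrite big_cons.
Qed.

Lemma Rint_dct (f_ : nat -> T -> R) f g : (forall n, measurable_fun setT (f_ n)) ->
  (forall x, f_ n x @[n --> \oo] --> f x) -> itg g ->
  (forall n x, `|f_ n x| <= g x) ->
  (\int[mu]_x f_ n x) @[n --> \oo] --> \int[mu]_x f x.
Proof.
move=> mf_ cf ig fg.
have mf : measurable_fun setT f by apply: (measurable_fun_cvg mf_) => x _; exact: cf.
have fgx x : `|f x| <= g x.
  by apply: (cvgr_to_le (cvg_norm (cf x))); exact: nearW.
have [] := @dominated_convergence _ T R mu setT measurableT (fun n => EFin \o f_ n)
  (EFin \o f) (EFin \o g).
- by move=> n; apply/measurable_EFinP.
- exact/measurable_EFinP.
- by apply: aeW => x _; apply: cvg_EFin; [exact: nearW|exact: cf].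
- by [].
- by apply: aeW => x n _ /=; rewrite lee_fin.
move=> intf _; rewrite -(EFin_Rintegral intf) => h.
exact: (fine_cvg h).
Qed.

Lemma ge0_Rint_eq0 f : itg f -> (forall x, 0 <= f x) -> \int[mu]_x f x = 0 ->
  {ae mu, forall x, f x = 0}.
Proof.
move=> hf f0 h.
have : (\int[mu]_(x in setT) `|(EFin \o f) x| = 0)%E.
  rewrite -[RHS]/(0%:E) -h EFin_Rintegral//.
  by apply: eq_integral => x _ /=; rewrite ger0_norm.
move=> /ae_eq_integral_abs -/(_ measurableT); move=> /(_ _) H.
have := H (measurable_int mu hf).
by apply: filterS => x /= /(_ Logic.I) [].
Qed.

Lemma ae_eq_Rint f g : measurable_fun setT f -> measurable_fun setT g ->
  {ae mu, forall x, f x = g x} -> \int[mu]_x f x = \int[mu]_x g x.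
Proof.
move=> mf mg fg; congr fine; apply: ae_eq_integral => //.
- exact/measurable_EFinP.
- exact/measurable_EFinP.
- by apply: filterS fg => x /= -> .
Qed.

Lemma ae_itg f g : measurable_fun setT g -> {ae mu, forall x, f x = g x} ->
  itg f -> itg g.
Proof.
move=> mg fg /integrableP[mf fo]; apply/integrableP; split; first exact/measurable_EFinP.
rewrite (@ae_eq_integral _ _ _ mu setT (fun x => `|(f x)%:E|%E))//.
- by apply: measurableT_comp => //; exact/measurable_EFinP.
- by apply: measurableT_comp => //.
- by apply: filterS fg => x /= ->.
Qed.

End real_integral.
Arguments itg {d T R} mu f.

Section real_fubini.
Context d1 d2 (T1 : measurableType d1) (T2 : measurableType d2) (R : realType).
Variables (m1 : {sigma_finite_measure set T1 -> \bar R})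
  (m2 : {sigma_finite_measure set T2 -> \bar R}).

(** Holds without integrability: the real integral is [fine] of a difference of two nonnegative
    integrals, each measurable in the parameter. *)
Lemma measurable_Rintegral_param (F : T1 * T2 -> R) : measurable_fun setT F ->
  measurable_fun setT (fun x => \int[m2]_y F (x, y)).
Proof.
move=> mF; rewrite (_ : (fun x => _) = fine \o (fun x =>
    \int[m2]_y ((EFin \o F)^\+ (x, y)) - \int[m2]_y ((EFin \o F)^\- (x, y)))%E); last first.
  by apply/funext => x /=; rewrite /Rintegral integralE funepos.unlock funeneg.unlock.
have mE : measurable_fun setT (EFin \o F) by exact/measurable_EFinP.
have p0 z : (0 <= (EFin \o F)^\+ z)%E by exact: funepos_ge0.
have n0 z : (0 <= (EFin \o F)^\- z)%E by exact: funeneg_ge0.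
apply: measurableT_comp => //; apply: emeasurable_funB.
- exact: (@measurable_fun_fubini_tonelli_F _ _ T1 T2 R m2 _ (measurable_funepos mE) p0).
- exact: (@measurable_fun_fubini_tonelli_F _ _ T1 T2 R m2 _ (measurable_funeneg mE) n0).
Qed.

(** The inner integral may diverge on a null set of parameters, where [fine] gives it some real
    value; the previous lemma keeps the function so obtained measurable. *)
Lemma Rint_fubini (F : T1 * T2 -> R) : itg (m1 \x m2)%E F ->
  itg m1 (fun x => \int[m2]_y F (x, y)) /\
  \int[(m1 \x m2)%E]_p F p = \int[m1]_x \int[m2]_y F (x, y).
Proof.
move=> iF; have mF := itg_meas iF.
have fin : {ae m1, forall x, fubini_F m2 (EFin \o F) x = (\int[m2]_y F (x, y))%:E}.
  apply: filterS (ae_integrable1 iF) => x ix.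
  by rewrite [RHS](EFin_Rintegral ix).
have iFF := integrable_fubini_F iF.
have mI := measurable_Rintegral_param mF.
have E : ae_eq m1 setT (fubini_F m2 (EFin \o F)) (fun x => (\int[m2]_y F (x, y))%:E).
  by apply: filterS fin => x ->.
split.
  apply/integrableP; split; first exact/measurable_EFinP.
  case/integrableP : iFF => mf; congr (_ < _)%E.
  apply: ae_eq_integral => //.
  - exact: measurableT_comp.
  - by apply: measurableT_comp => //; exact/measurable_EFinP.
  - by apply: filterS fin => x /= -> .
rewrite /Rintegral -(integral12_prod_meas1 iF); congr fine.
by apply: ae_eq_integral => //; [exact: measurable_int iFF|exact/measurable_EFinP].
Qed.

End real_fubini.

Section measurable_vec.
Context d0 (T : measurableType d0) (R : realType) (d : nat).
Implicit Types f g : T -> 'rV[R]_d.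

Lemma meas_coord f i : measurable_fun setT f -> measurable_fun setT (fun x => f x 0 i).
Proof. by move=> mf; exact: (measurableT_comp (measurable_coord i)). Qed.

Lemma meas_vadd f g : measurable_fun setT f -> measurable_fun setT g ->
  measurable_fun setT (fun x => f x + g x).
Proof.
move=> mf mg; apply: measurable_fun_rV => i.
by under eq_fun do rewrite mxE; apply: measurable_funD; exact: meas_coord.
Qed.

Lemma meas_vscale (r : T -> R) f : measurable_fun setT r -> measurable_fun setT f ->
  measurable_fun setT (fun x => r x *: f x).
Proof.
move=> mr mf; apply: measurable_fun_rV => i.
by under eq_fun do rewrite mxE; apply: measurable_funM => //; exact: meas_coord.
Qed.

Lemma meas_vsub f g : measurable_fun setT f -> measurable_fun setT g ->
  measurable_fun setT (fun x => f x - g x).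
Proof.
move=> mf mg; apply: measurable_fun_rV => i.
by under eq_fun do rewrite !mxE; apply: measurable_funB; exact: meas_coord.
Qed.

Lemma meas_enorm f : measurable_fun setT f -> measurable_fun setT (fun x => enorm (f x)).
Proof. by move=> mf; exact: (measurableT_comp (@measurable_enorm R d)). Qed.

End measurable_vec.

Section japanese_bracket.
Context {R : realType} {d : nat}.
Implicit Types v w : 'rV[R]_d.

Lemma japanese_sqr v : japanese v ^+ 2 = 1 + enorm v ^+ 2.
Proof. by rewrite sqr_sqrtr// addr_ge0// sqr_ge0. Qed.

Lemma japanese_ge1 v : 1 <= japanese v.
Proof.
rewrite -(@ler_pXn2r _ 2)// ?nnegrE ?sqrtr_ge0// japanese_sqr expr1n.
by rewrite lerDl sqr_ge0.
Qed.

Lemma japanese_gt0 v : 0 < japanese v.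
Proof. exact: lt_le_trans ltr01 (japanese_ge1 v). Qed.

Lemma japanese_ge0 v : 0 <= japanese v.
Proof. exact: ltW (japanese_gt0 v). Qed.

Lemma enorm_le_japanese v : enorm v <= japanese v.
Proof.
rewrite -(@ler_pXn2r _ 2)// ?nnegrE ?sqrtr_ge0// japanese_sqr.
by rewrite lerDr.
Qed.

Lemma japanese_exp_le (p q : nat) v : (p <= q)%N -> japanese v ^+ p <= japanese v ^+ q.
Proof. by move=> pq; apply: ler_weXn2l => //; exact: japanese_ge1. Qed.

Lemma japanese_exp_ge1 (p : nat) v : 1 <= japanese v ^+ p.
Proof. by rewrite exprn_ege1// japanese_ge1. Qed.

Lemma measurable_japanese : measurable_fun setT (@japanese R d).
Proof.
apply: (@measurableT_comp _ _ _ _ _ _ (@Num.sqrt R)).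
  by apply: continuous_measurable_fun; exact: sqrt_continuous.
by apply: measurable_funD => //; apply: measurable_funX; exact: measurable_enorm.
Qed.

Lemma enormB_japanese v w : enorm (v - w) <= 2 * (japanese v * japanese w).
Proof.
apply: le_trans (enormB _ _) _.
have := enorm_le_japanese v; have := enorm_le_japanese w.
have := japanese_ge1 v; have := japanese_ge1 w; nra.
Qed.

End japanese_bracket.

Section weighted_L1.
Context {R : realType} {d : nat}.
Local Notation V := 'rV[R]_d.
Local Notation leb := (@lebesgue_rV R d).
Implicit Types (h k : V -> R) (q : nat).

Definition Nrm q h : R := \int[leb]_v (`|h v| * japanese v ^+ q).

Lemma in_L1_meas q h : in_L1 q h -> measurable_fun setT h.
Proof. by case. Qed.

Lemma measurable_japaneseX q : measurable_fun setT (fun v : V => japanese v ^+ q).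
Proof. by apply: measurable_funX; exact: measurable_japanese. Qed.

Lemma in_L1P q h : in_L1 q h <->
  measurable_fun setT h /\ itg leb (fun v => `|h v| * japanese v ^+ q).
Proof.
have h0 v : 0 <= `|h v| * japanese v ^+ q.
  by rewrite mulr_ge0// exprn_ge0// japanese_ge0.
split => [[mh fin]|[mh ih]]; split => //.
  apply: itg_ge0_fin => //; apply: measurable_funM.
    exact: measurableT_comp.
  exact: measurable_japaneseX.
by rewrite /L1norm; exact: integrable_lty.
Qed.

Lemma in_L1_itg q h : in_L1 q h -> itg leb (fun v => `|h v| * japanese v ^+ q).
Proof. by move=> /in_L1P []. Qed.

Lemma L1normE q h : in_L1 q h -> L1norm q h = (Nrm q h)%:E.
Proof. by move=> /in_L1P[_ ih]; rewrite /Nrm EFin_Rintegral. Qed.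

Lemma Nrm_ge0 q h : 0 <= Nrm q h.
Proof. by apply: Rint_ge0 => v; rewrite mulr_ge0// exprn_ge0// japanese_ge0. Qed.

Lemma in_L1_pair q h k C : in_L1 q h -> measurable_fun setT k ->
  (forall v, `|k v| <= C * japanese v ^+ q) ->
  itg leb (fun v => h v * k v) /\ `|\int[leb]_v (h v * k v)| <= C * Nrm q h.
Proof.
move=> /in_L1P[mh ih] mk kC.
have b v : `|h v * k v| <= C * (`|h v| * japanese v ^+ q).
  by rewrite normrM mulrCA ler_wpM2l.
have i : itg leb (fun v => h v * k v).
  by apply: (itg_dom _ b); [exact: measurable_funM|exact: itgZ].
split => //; rewrite /Nrm -RintZ//; apply: norm_Rint_le => //.
exact: itgZ.
Qed.

Lemma in_L1_le p q h : (p <= q)%N -> in_L1 q h -> in_L1 p h.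
Proof.
move=> pq /in_L1P[mh ih]; apply/in_L1P; split => //; apply: itg_dom ih.
  by apply: measurable_funM; [exact: measurableT_comp|exact: measurable_japaneseX].
move=> v; rewrite ger0_norm ?ler_wpM2l ?japanese_exp_le//.
by rewrite mulr_ge0// exprn_ge0// japanese_ge0.
Qed.

Lemma Nrm_le p q h : (p <= q)%N -> in_L1 q h -> Nrm p h <= Nrm q h.
Proof.
move=> pq hq; have hp := in_L1_le pq hq.
apply: le_Rint; [exact: in_L1_itg|exact: in_L1_itg|move=> v].
by rewrite ler_wpM2l ?japanese_exp_le.
Qed.

Lemma in_L1_dom q h k : measurable_fun setT k -> (forall v, `|k v| <= `|h v|) ->
  in_L1 q h -> in_L1 q k.
Proof.
move=> mk kh /in_L1P[mh ih]; apply/in_L1P; split => //; apply: itg_dom ih.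
  by apply: measurable_funM; [exact: measurableT_comp|exact: measurable_japaneseX].
move=> v; rewrite ger0_norm ?ler_wpM2r// ?exprn_ge0 ?japanese_ge0//.
by rewrite mulr_ge0// exprn_ge0// japanese_ge0.
Qed.

Lemma in_L1B q h k : in_L1 q h -> in_L1 q k -> in_L1 q (h \- k).
Proof.
move=> /in_L1P[mh ih] /in_L1P[mk ik]; apply/in_L1P; split; first exact: measurable_funB.
apply: itg_dom (itgD ih ik).
  apply: measurable_funM; last exact: measurable_japaneseX.
  by apply: measurableT_comp => //; exact: measurable_funB.
move=> v; rewrite ger0_norm ?mulr_ge0 ?exprn_ge0 ?japanese_ge0//.
by rewrite -mulrDl ler_wpM2r ?exprn_ge0 ?japanese_ge0// ler_normB.
Qed.

Lemma in_L1Z q c h : in_L1 q h -> in_L1 q (fun v => c * h v).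
Proof.
move=> /in_L1P[mh ih]; apply/in_L1P; split; first exact: measurable_funM.
apply: itg_dom (itgZ `|c| ih).
  apply: measurable_funM; last exact: measurable_japaneseX.
  by apply: measurableT_comp => //; exact: measurable_funM.
move=> v; rewrite ger0_norm ?mulr_ge0 ?exprn_ge0 ?japanese_ge0//.
by rewrite normrM mulrA.
Qed.

Lemma Nrm_triangle q h k : in_L1 q h -> in_L1 q k ->
  Nrm q h <= Nrm q k + Nrm q (h \- k).
Proof.
move=> hq kq; have hk := in_L1B hq kq.
rewrite -RintD ?in_L1_itg//; [|exact: in_L1_itg|exact: in_L1_itg].
apply: le_Rint; [exact: in_L1_itg| |move=> v].
  by apply: itgD; exact: in_L1_itg.
rewrite -mulrDl ler_wpM2r ?exprn_ge0 ?japanese_ge0//=.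
by rewrite -[in leLHS](subrKC (k v) (h v)) ler_normD.
Qed.

Lemma NrmZ q c h : in_L1 q h -> Nrm q (fun v => c * h v) = `|c| * Nrm q h.
Proof.
move=> hq; rewrite -RintZ ?in_L1_itg//; last exact: in_L1_itg.
by apply: eq_Rint => v; rewrite normrM mulrA.
Qed.

End weighted_L1.

Section bilinear.
Context {R : realType} {d : nat}.
Local Notation V := 'rV[R]_d.
Local Notation leb := (@lebesgue_rV R d).
Local Notation leb2 := (leb \x leb)%E.
Implicit Types (h k : V -> R) (q : nat) (K : V * V -> R).

(** The collision terms, the moments of the loss term and the pair correlations are all of this
    form, so that one set of bounds, limits and changes of variables serves them all. *)
Definition bil K h k : R := \int[leb2]_p (K p * (h p.1 * k p.2)).

Lemma meas_tensor h k : measurable_fun setT h -> measurable_fun setT k ->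
  measurable_fun setT (fun p : V * V => h p.1 * k p.2).
Proof. by move=> mh mk; apply: measurable_funM; exact: measurableT_comp. Qed.

Lemma itg_tensor h k : itg leb h -> itg leb k ->
  itg leb2 (fun p => h p.1 * k p.2).
Proof.
move=> ih ik; have mh := itg_meas ih; have mk := itg_meas ik.
apply/(integrable12ltyP leb leb); first by apply/measurable_EFinP; exact: meas_tensor.
under eq_integral => x _.
  under eq_integral => y _ do rewrite /= normrM EFinM.
  rewrite ge0_integralZl//; last by apply/measurable_EFinP; exact: measurableT_comp.
  rewrite -(EFin_Rintegral (itg_norm ik)).
  over.
rewrite ge0_integralZr//.
- rewrite -(EFin_Rintegral (itg_norm ih)) -EFinM; exact: ltry.
- by apply/measurable_EFinP; exact: measurableT_comp.
- by rewrite lee_fin Rint_ge0.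
Qed.

Lemma Rint_tensor h k : itg leb h -> itg leb k ->
  \int[leb2]_p (h p.1 * k p.2) = (\int[leb]_v h v) * (\int[leb]_v k v).
Proof.
move=> ih ik; rewrite (Rint_fubini (itg_tensor ih ik)).2.
under eq_Rint => v do rewrite (RintZ (h v) ik) mulrC.
by rewrite (RintZ _ ih) mulrC.
Qed.

Section bound.
Variables (q : nat) (K : V * V -> R) (C : R) (h k : V -> R).
Hypotheses (mK : measurable_fun setT K)
  (KC : forall p, `|K p| <= C * (japanese p.1 ^+ q * japanese p.2 ^+ q))
  (hq : in_L1 q h) (kq : in_L1 q k).

Let dom p : `|K p * (h p.1 * k p.2)| <=
  C * ((`|h p.1| * japanese p.1 ^+ q) * (`|k p.2| * japanese p.2 ^+ q)).
Proof.
rewrite !normrM (le_trans (ler_wpM2r _ (KC p)))// ?mulr_ge0//.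
by rewrite le_eqVlt; apply/orP; left; apply/eqP; ring.
Qed.

Let itgdom : itg leb2 (fun p =>
  C * ((`|h p.1| * japanese p.1 ^+ q) * (`|k p.2| * japanese p.2 ^+ q))).
Proof.
by apply: itgZ; apply: (itg_tensor (in_L1_itg hq) (in_L1_itg kq)).
Qed.

Lemma itg_bil : itg leb2 (fun p => K p * (h p.1 * k p.2)).
Proof.
apply: itg_dom dom itgdom; apply: measurable_funM => //.
by apply: meas_tensor; apply: in_L1_meas; eassumption.
Qed.

Lemma norm_bil_le : `|bil K h k| <= C * (Nrm q h * Nrm q k).
Proof.
apply: (le_trans (norm_Rint_le itg_bil itgdom dom)).
rewrite RintZ; last by apply: (itg_tensor (in_L1_itg hq) (in_L1_itg kq)).
by rewrite (Rint_tensor (in_L1_itg hq) (in_L1_itg kq)).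
Qed.

Lemma bil_fubini : bil K h k = \int[leb]_v \int[leb]_w (K (v, w) * (h v * k w)).
Proof. exact: (Rint_fubini itg_bil).2. Qed.

End bound.

End bilinear.

(** * Weak form of the collision operator *)

Section sphere_average.
Context {R : realType} {d : nat}.
Hypothesis d_gt0 : (0 < d)%N.
Local Notation V := 'rV[R]_d.
Local Notation leb := (@lebesgue_rV R d).
Local Notation sph := (@sphere_measure R d).
Implicit Types (phi psi : V -> R) (v w s : V).

Lemma vpostE v w s : vpost v w s = 2^-1 *: (v + w) + 2^-1 *: (enorm (v - w) *: s).
Proof. by rewrite /vpost scalerA [2^-1 * _]mulrC. Qed.

Lemma vpost_starE v w s : vpost_star v w s = 2^-1 *: (v + w) - 2^-1 *: (enorm (v - w) *: s).
Proof. by rewrite /vpost_star scalerA [2^-1 * _]mulrC. Qed.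

Lemma vpost_starN v w s : vpost_star v w s = vpost v w (- s).
Proof. by rewrite /vpost_star /vpost scalerN. Qed.

Lemma vpostC v w s : vpost v w s = vpost w v s.
Proof. by rewrite /vpost (addrC v) -(enormN (v - w)) opprB. Qed.

Lemma dotrNr v w : dotr v (- w) = - dotr v w.
Proof. by rewrite -scaleN1r dotrZr mulN1r. Qed.

Lemma parallelogram v w :
  enorm (v + w) ^+ 2 + enorm (v - w) ^+ 2 = 2 * enorm v ^+ 2 + 2 * enorm w ^+ 2.
Proof. by rewrite !enorm_sqrD enormN dotrNr; ring. Qed.

Lemma enormZ_sqr a v : enorm (a *: v) ^+ 2 = a ^+ 2 * enorm v ^+ 2.
Proof. by rewrite enormZ exprMn real_normK ?num_real. Qed.

Lemma enorm_vpost_sqr v w s : enorm s = 1 ->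
  enorm (vpost v w s) ^+ 2 =
  2^-1 * (enorm v ^+ 2 + enorm w ^+ 2) + 2^-1 * enorm (v - w) * dotr (v + w) s.
Proof.
move=> s1; rewrite vpostE enorm_sqrD dotrZl !dotrZr !enormZ_sqr s1.
by have := parallelogram v w; nra.
Qed.

(** Conservation of energy; an inequality because the normalized direction has norm at most 1, so
    that it holds for every [s], the origin included. *)
Lemma enorm_vpostD v w s :
  enorm (vpost v w (radial_proj s)) ^+ 2 + enorm (vpost_star v w (radial_proj s)) ^+ 2
  <= enorm v ^+ 2 + enorm w ^+ 2.
Proof.
have r1 : enorm (radial_proj s) ^+ 2 <= 1.
  by rewrite exprn_ile1// ?enorm_ge0// enorm_radial_proj_le1.
move: (radial_proj s) r1 => r r1; rewrite vpostE vpost_starE parallelogram !enormZ_sqr.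
have := ler_wpM2l (sqr_ge0 (enorm (v - w))) r1.
by have := parallelogram v w; lra.
Qed.

Lemma measurable_oppv : measurable_fun setT (fun v : V => - v).
Proof.
rewrite (_ : (fun _ => _) = (fun v : V => -1 *: v + 0)); last first.
  by apply/funext => v; rewrite scaleN1r addr0.
exact: measurable_affine.
Qed.

Lemma japanese_vpostD v w s :
  japanese (vpost v w (radial_proj s)) ^+ 2 + japanese (vpost_star v w (radial_proj s)) ^+ 2
  <= japanese v ^+ 2 + japanese w ^+ 2.
Proof. by rewrite !japanese_sqr; have := enorm_vpostD v w s; lra. Qed.

(** The bracket of the other post-collisional velocity is at least 1, and a + b - 1 <= a b when a, b
    >= 1. *)
Lemma japanese_vpost_le v w s :
  japanese (vpost v w (radial_proj s)) <= japanese v * japanese w.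
Proof.
rewrite -(@ler_pXn2r _ 2)// ?nnegrE ?mulr_ge0 ?japanese_ge0// exprMn.
have := japanese_vpostD v w s.
have := japanese_ge1 v; have := japanese_ge1 w.
have := japanese_ge1 (vpost_star v w (radial_proj s)).
rewrite !japanese_sqr => h1 h2 h3 h4.
have := sqr_ge0 (enorm v); have := sqr_ge0 (enorm w).
have := sqr_ge0 (enorm (vpost_star v w (radial_proj s))).
by nra.
Qed.

Lemma measurable_vpost : measurable_fun setT (fun p : (V * V) * V => vpost p.1.1 p.1.2 p.2).
Proof.
have m1 : measurable_fun setT (fun p : (V * V) * V => p.1.1).
  exact: (measurableT_comp measurable_fst measurable_fst).
have m2 : measurable_fun setT (fun p : (V * V) * V => p.1.2).
  exact: (measurableT_comp measurable_snd measurable_fst).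
apply: meas_vadd.
  by apply: meas_vscale => //; exact: meas_vadd.
apply: meas_vscale => //; apply: measurable_funM => //.
by apply: meas_enorm; exact: meas_vsub.
Qed.

Lemma measurable_vpost_radial :
  measurable_fun setT (fun p : (V * V) * V => vpost p.1.1 p.1.2 (radial_proj p.2)).
Proof.
pose g (p : (V * V) * V) := (p.1, radial_proj p.2).
apply: (measurableT_comp measurable_vpost (g := g)).
apply/measurable_fun_pairP; split => /=; first exact: measurable_fst.
exact: (measurableT_comp (@measurable_radial_proj R d) measurable_snd).
Qed.

(** Mean of [phi] over the outcomes of a collision. Normalizing [s] changes nothing almost
    everywhere and makes the energy bounds valid for every [s]. *)
Definition avg phi (p : V * V) : R := \int[sph]_s phi (vpost p.1 p.2 (radial_proj s)).

Lemma measurable_avg phi : measurable_fun setT phi -> measurable_fun setT (avg phi).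
Proof.
move=> mphi; apply: (@measurable_Rintegral_param _ _ _ _ R sph
  (fun p : (V * V) * V => phi (vpost p.1.1 p.1.2 (radial_proj p.2)))).
exact: (measurableT_comp mphi measurable_vpost_radial).
Qed.

Lemma Rint_sphere_cst (c : R) : \int[sph]_s c = c.
Proof.
rewrite Rintegral_cst// -[RHS]mulr1; congr (_ * _).
by rewrite -[RHS]/(fine 1%E); congr fine; exact: sphere_measureT.
Qed.

Lemma itg_sphere_cst (c : R) : itg sph (fun=> c).
Proof. exact: finite_measure_integrable_cst. Qed.

Lemma itg_avg phi (q : nat) C (p : V * V) : measurable_fun setT phi ->
  (forall v, `|phi v| <= C * japanese v ^+ q) ->
  itg sph (fun s => phi (vpost p.1 p.2 (radial_proj s))) /\
  `|avg phi p| <= C * (japanese p.1 ^+ q * japanese p.2 ^+ q).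
Proof.
move=> mphi phiC.
have C0 : 0 <= C.
  have := le_trans (normr_ge0 _) (phiC 0).
  by rewrite pmulr_lge0// exprn_gt0// japanese_gt0.
have b s : `|phi (vpost p.1 p.2 (radial_proj s))| <= C * (japanese p.1 ^+ q * japanese p.2 ^+ q).
  apply: (le_trans (phiC _)); rewrite ler_wpM2l// -exprMn.
  by rewrite lerXn2r ?nnegrE ?mulr_ge0 ?japanese_ge0// japanese_vpost_le.
have ic := itg_sphere_cst.
have i1 : itg sph (fun s => phi (vpost p.1 p.2 (radial_proj s))).
  apply: (itg_dom _ b (ic _)).
  apply: (measurableT_comp mphi).
  have := measurableT_comp measurable_vpost_radial (measurable_pair1 p).
  by [].
split => //; apply: (le_trans (norm_Rint_le i1 (ic _) b)).
by rewrite Rint_sphere_cst.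
Qed.

Lemma ae_sphere_norm1 : {ae sph, forall s : V, enorm (radial_proj s) = 1}.
Proof.
exists [set 0]; split.
- have := @measurable_rV_box R d (fun i => `[0, 0]); congr measurable.
  apply/seteqP; split => v /=; last by move=> -> i; rewrite mxE in_itv/= lexx.
  move=> h; apply/rowP => i; apply/eqP; rewrite eq_le mxE andbC.
  by have := h i; rewrite in_itv.
- exact: sphere_measure_set0.
- move=> s /=; apply: contra_notP => /eqP s0; exact: enorm_radial_proj.
Qed.

Lemma Rint_sphereN (F : V -> R) : itg sph F -> \int[sph]_s F (- s) = \int[sph]_s F s.
Proof.
move=> iF; have mF := itg_meas iF.
rewrite /Rintegral integralE [in RHS]integralE; congr (fine (_ - _)).
  rewrite -[RHS]ge0_sphere_integralN//; first by apply: eq_integral => s _; rewrite funepos.unlock.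
  by apply: measurable_funepos; exact/measurable_EFinP.
rewrite -[RHS]ge0_sphere_integralN//; first by apply: eq_integral => s _; rewrite funeneg.unlock.
by apply: measurable_funeneg; exact/measurable_EFinP.
Qed.

Lemma avgC phi v w : avg phi (v, w) = avg phi (w, v).
Proof. by apply: eq_Rint => s /=; rewrite vpostC. Qed.

Lemma avg_cst c p : avg (fun=> c) p = c.
Proof. by rewrite /avg Rint_sphere_cst. Qed.

Lemma avg_star phi (q : nat) C (p : V * V) : measurable_fun setT phi ->
  (forall v, `|phi v| <= C * japanese v ^+ q) ->
  avg phi p = \int[sph]_s phi (vpost_star p.1 p.2 (radial_proj s)).
Proof.
move=> mphi phiC; have [i1 _] := itg_avg p mphi phiC.
rewrite /avg -Rint_sphereN//; apply: eq_Rint => s.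
by rewrite vpost_starN radial_projN.
Qed.

(** Both post-collisional velocities have the same distribution, by the antipodal symmetry; so [avg]
    may be estimated through their sum, which is what conservation laws control. *)
Lemma avg_le2 phi (q : nat) C (p : V * V) M : measurable_fun setT phi ->
  (forall v, `|phi v| <= C * japanese v ^+ q) ->
  (forall s, phi (vpost p.1 p.2 (radial_proj s)) +
    phi (vpost_star p.1 p.2 (radial_proj s)) <= M) ->
  avg phi p <= M / 2.
Proof.
move=> mphi phiC h; rewrite ler_pdivlMr// mulr_natr mulr2n.
have [i1 _] := itg_avg p mphi phiC.
rewrite {2}(avg_star p mphi phiC).
have i2 : itg sph (fun s => phi (vpost_star p.1 p.2 (radial_proj s))).
  apply: itg_dom (itg_sphere_cst (C * (japanese p.1 ^+ q * japanese p.2 ^+ q))).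
  - under eq_fun do rewrite vpost_starN -radial_projN.
    exact: (measurableT_comp (itg_meas i1) measurable_oppv).
  - have C0 : 0 <= C.
      have := le_trans (normr_ge0 _) (phiC 0).
      by rewrite pmulr_lge0// exprn_gt0// japanese_gt0.
    move=> s; apply: (le_trans (phiC _)); rewrite ler_wpM2l// -exprMn.
    rewrite lerXn2r ?nnegrE ?mulr_ge0 ?japanese_ge0// vpost_starN -radial_projN.
    exact: japanese_vpost_le.
rewrite -RintD// -(Rint_sphere_cst M); apply: le_Rint => //.
- exact: itgD.
- exact: itg_sphere_cst.
Qed.

Lemma itg_sphere_bounded (F : V -> R) M : measurable_fun setT F ->
  (forall s, `|F s| <= M) -> itg sph F.
Proof.
move=> mF FM; apply: (itg_dom mF FM); exact: itg_sphere_cst.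
Qed.

Lemma Rint_sphere_coord i : \int[sph]_s (radial_proj s) 0 i = 0.
Proof.
have m1 : measurable_fun setT (fun s : V => radial_proj s 0 i).
  by apply: meas_coord; exact: measurable_radial_proj.
have i1 : itg sph (fun s => radial_proj s 0 i).
  apply: (itg_sphere_bounded (M := 1)) => // s.
  exact: le_trans (ler_coord_enorm _ _) (enorm_radial_proj_le1 s).
have := Rint_sphereN i1; under eq_Rint do rewrite radial_projN mxE -mulN1r.
rewrite RintZ//; set x := Rintegral _ _ _; lra.
Qed.

Lemma avg_coord i (p : V * V) : avg (fun v => v 0 i) p = 2^-1 * (p.1 0 i + p.2 0 i).
Proof.
have m1 : measurable_fun setT (fun s : V => radial_proj s 0 i).
  by apply: meas_coord; exact: measurable_radial_proj.
have i1 : itg sph (fun s => radial_proj s 0 i).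
  apply: (itg_sphere_bounded (M := 1)) => // s.
  exact: le_trans (ler_coord_enorm _ _) (enorm_radial_proj_le1 s).
rewrite /avg.
have E s : vpost p.1 p.2 (radial_proj s) 0 i =
    2^-1 * (p.1 0 i + p.2 0 i) + enorm (p.1 - p.2) / 2 * radial_proj s 0 i.
  by move: (radial_proj s) => r; rewrite !mxE.
rewrite (eq_Rint _ E) RintD; [|exact: itg_sphere_cst|exact: itgZ].
by rewrite Rint_sphere_cst RintZ// Rint_sphere_coord mulr0 addr0.
Qed.

(** The cross term of |v'|^2 is linear in the direction, hence has mean zero. The expansion holds
    almost everywhere only, where the direction has norm exactly 1. *)
Lemma avg_enorm_sqr (p : V * V) :
  avg (fun v => enorm v ^+ 2) p = 2^-1 * (enorm p.1 ^+ 2 + enorm p.2 ^+ 2).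
Proof.
have mr := @measurable_radial_proj R d.
have m1 i : measurable_fun setT (fun s : V => radial_proj s 0 i) by exact: meas_coord.
have i1 i : itg sph (fun s => radial_proj s 0 i).
  apply: (itg_sphere_bounded (M := 1)) => // s.
  exact: le_trans (ler_coord_enorm _ _) (enorm_radial_proj_le1 s).
have id : itg sph (fun s => dotr (p.1 + p.2) (radial_proj s)).
  by apply: itg_sum_seq => i; exact: itgZ.
have ed : \int[sph]_s dotr (p.1 + p.2) (radial_proj s) = 0.
  rewrite Rint_sum_seq; last by move=> i; exact: itgZ.
  by apply: big1 => i _; rewrite RintZ// Rint_sphere_coord mulr0.
rewrite /avg (@ae_eq_Rint _ _ _ sph _ (fun s => 2^-1 * (enorm p.1 ^+ 2 + enorm p.2 ^+ 2) +
   2^-1 * enorm (p.1 - p.2) * dotr (p.1 + p.2) (radial_proj s))).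
- rewrite RintD; [|exact: itg_sphere_cst|exact: itgZ].
  by rewrite Rint_sphere_cst RintZ// ed mulr0 addr0.
- apply: measurable_funX; apply: meas_enorm.
  exact: (measurableT_comp measurable_vpost_radial (measurable_pair1 p)).
- by apply: measurable_funD => //; apply: measurable_funM => //; exact: itg_meas id.
- by apply: filterS ae_sphere_norm1 => s s1; exact: enorm_vpost_sqr.
Qed.

End sphere_average.

Section collision_weak_form.
Context {R : realType} {d : nat}.
Hypothesis d_gt0 : (0 < d)%N.
Local Notation V := 'rV[R]_d.
Local Notation leb := (@lebesgue_rV R d).
Local Notation leb2 := (leb \x leb)%E.
Local Notation sph := (@sphere_measure R d).
Implicit Types (phi psi h : V -> R) (v w s : V).

(** Passage to centre of mass and relative velocity in two steps of unit Jacobian: the reflection w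
    -> v - w for fixed v, then a translation of v for fixed relative velocity. *)
Lemma ge0_com_change (g : V * V -> \bar R) : measurable_fun setT g ->
  (forall p, (0 <= g p)%E) ->
  (\int[leb]_v \int[leb]_w g (2^-1 *: (v + w), v - w)%R =
   \int[leb]_G \int[leb]_z g (G, z))%E.
Proof.
move=> mg g0.
have mh : measurable_fun setT (fun p : V * V => (p.1 - 2^-1 *: p.2, p.2)).
  apply/measurable_fun_pairP; split => /=; last exact: measurable_snd.
  apply: meas_vsub; first exact: measurable_fst.
  by apply: meas_vscale => //; exact: measurable_snd.
pose gh p := g (p.1 - 2^-1 *: p.2, p.2).
have mgh : measurable_fun setT gh by exact: (measurableT_comp mg mh).
have gh0 p : (0 <= gh p)%E by exact: g0.
transitivity (\int[leb]_v \int[leb]_z gh (v, z))%E.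
  apply: eq_integral => v _.
  pose F w := g (2^-1 *: (v + w), v - w)%R.
  have mF : measurable_fun setT F.
    apply: (measurableT_comp mg); apply/measurable_fun_pairP; split => /=.
      apply: meas_vscale => //; apply: meas_vadd => //; exact: measurable_id.
    by apply: meas_vsub => //; exact: measurable_id.
  have N1 : (-1 : R) != 0 by rewrite oppr_eq0 oner_neq0.
  have := ge0_integral_affine v N1 mF (fun w => g0 _).
  rewrite normrN1 expr1n invr1 mul1e => <-.
  apply: eq_integral => z _; rewrite /F /gh/=; congr (g (_, _)).
    by apply/rowP => i; rewrite !mxE; field.
  by apply/rowP => i; rewrite !mxE; ring.
rewrite (fubini_tonelli gh)// (fubini_tonelli g)//.
apply: eq_integral => z _.
have N1 : (1 : R) != 0 by exact: oner_neq0.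
have mF : measurable_fun setT (fun G => g (G, z)) by exact: (measurableT_comp mg (measurable_pair2 z)).
have := ge0_integral_affine (- (2^-1 *: z)) N1 mF (fun w => g0 _).
rewrite normr1 expr1n invr1 mul1e => <-.
by apply: eq_integral => v _; rewrite /gh/= scale1r.
Qed.

Section kernel_K.
Variables (h psi : V -> R).
Hypotheses (mh : measurable_fun setT h) (mpsi : measurable_fun setT psi)
  (h0 : forall v, 0 <= h v) (psi0 : forall v, 0 <= psi v).

(** Here [G] is the centre of mass, [z] the relative velocity and [y] the relative velocity after
    the collision. Exchanging [z] and [y] turns [K] into [K'], except for the factor |z|, which
    equals |y| because collisions preserve the relative speed. *)
Let K (G z y : V) : R :=
  enorm z * h (G + 2^-1 *: y) * h (G - 2^-1 *: y) * psi (G + 2^-1 *: z).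
Let K' (G z y : V) : R :=
  enorm z * h (G + 2^-1 *: z) * h (G - 2^-1 *: z) * psi (G + 2^-1 *: y).

Let mcomp d0 (T : measurableType d0) (k : V -> R) (a b : T -> V) :
  measurable_fun setT k -> measurable_fun setT a -> measurable_fun setT b ->
  measurable_fun setT (fun x => k (a x + 2^-1 *: b x)).
Proof.
move=> mk ma mb; apply: (measurableT_comp mk (g := fun x => a x + 2^-1 *: b x)).
by apply: meas_vadd => //; exact: meas_vscale.
Qed.

Let mcompB d0 (T : measurableType d0) (k : V -> R) (a b : T -> V) :
  measurable_fun setT k -> measurable_fun setT a -> measurable_fun setT b ->
  measurable_fun setT (fun x => k (a x - 2^-1 *: b x)).
Proof.
move=> mk ma mb; apply: (measurableT_comp mk (g := fun x => a x - 2^-1 *: b x)).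
by apply: meas_vsub => //; exact: meas_vscale.
Qed.

Let mK d0 (T : measurableType d0) (G z y : T -> V) :
  measurable_fun setT G -> measurable_fun setT z -> measurable_fun setT y ->
  measurable_fun setT (fun x => (K (G x) (z x) (y x))%:E).
Proof.
move=> mG mz my; apply/measurable_EFinP; rewrite /K.
do ![apply: measurable_funM].
- exact: meas_enorm.
- exact: mcomp.
- exact: mcompB.
- exact: mcomp.
Qed.

Let mK' d0 (T : measurableType d0) (G z y : T -> V) :
  measurable_fun setT G -> measurable_fun setT z -> measurable_fun setT y ->
  measurable_fun setT (fun x => (K' (G x) (z x) (y x))%:E).
Proof.
move=> mG mz my; apply/measurable_EFinP; rewrite /K'.
do ![apply: measurable_funM].
- exact: meas_enorm.
- exact: mcomp.
- exact: mcompB.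
- exact: mcomp.
Qed.

Let K0 G z y : (0 <= (K G z y)%:E)%E.
Proof. by rewrite lee_fin /K !mulr_ge0// enorm_ge0. Qed.

Let K'0 G z y : (0 <= (K' G z y)%:E)%E.
Proof. by rewrite lee_fin /K' !mulr_ge0// enorm_ge0. Qed.

Let m11 : measurable_fun setT (fun p : (V * V) * V => p.1.1).
Proof. exact: (measurableT_comp measurable_fst measurable_fst). Qed.
Let m12 : measurable_fun setT (fun p : (V * V) * V => p.1.2).
Proof. exact: (measurableT_comp measurable_snd measurable_fst). Qed.
Let reduce (k : V -> V -> V -> R) :
  (forall d0 (T : measurableType d0) (G z y : T -> V),
   measurable_fun setT G -> measurable_fun setT z -> measurable_fun setT y ->
   measurable_fun setT (fun x => (k (G x) (z x) (y x))%:E)) ->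
  (forall G z y, (0 <= (k G z y)%:E)%E) ->
  (\int[leb]_v \int[leb]_w \int[sph]_s
     (k (2^-1 *: (v + w)) (v - w) (enorm (v - w) *: s))%R%:E =
   \int[leb]_G \int[leb]_z \int[sph]_s (k G z (enorm z *: s)%R)%:E)%E.
Proof.
move=> mk k0.
pose g (p : V * V) : \bar R := (\int[sph]_s (k p.1 p.2 (enorm p.2 *: s)%R)%:E)%E.
have mg : measurable_fun setT g.
  pose F (p : (V * V) * V) := (k p.1.1 p.1.2 (enorm p.1.2 *: p.2))%:E.
  apply: (@measurable_fun_fubini_tonelli_F _ _ _ _ _ sph F) => [|p]; last exact: k0.
  by apply: mk => //; apply: meas_vscale => //; exact: meas_enorm.
have g0 p : (0 <= g p)%E by apply: integral_ge0.
exact: (ge0_com_change mg g0).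
Qed.

(** The collision is an involution preserving |v - w| dv dw ds. In centre-of-mass variables it only
    rotates the relative velocity, so [ge0_integral_polar_swap] applies for each fixed centre. *)
Lemma ge0_prepostcollisional :
  (\int[leb]_v \int[leb]_w \int[sph]_s
    (enorm (v - w) * h (vpost v w s) * h (vpost_star v w s) * psi v)%R%:E =
   \int[leb]_v \int[leb]_w \int[sph]_s
    (enorm (v - w) * h v * h w * psi (vpost v w s))%R%:E)%E.
Proof.
have half1 v w : 2^-1 *: (v + w) + 2^-1 *: (v - w) = v.
  by apply/rowP => i; rewrite !mxE; field.
have half2 v w : 2^-1 *: (v + w) - 2^-1 *: (v - w) = w.
  by apply/rowP => i; rewrite !mxE; field.
transitivity (\int[leb]_v \int[leb]_w \int[sph]_s
     (K (2^-1 *: (v + w)) (v - w) (enorm (v - w) *: s))%R%:E)%E.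
  apply: eq_integral => v _; apply: eq_integral => w _; apply: eq_integral => s _.
  by rewrite /K vpostE vpost_starE half1.
transitivity (\int[leb]_v \int[leb]_w \int[sph]_s
     (K' (2^-1 *: (v + w)) (v - w) (enorm (v - w) *: s))%R%:E)%E; last first.
  apply: eq_integral => v _; apply: eq_integral => w _; apply: eq_integral => s _.
  by rewrite /K' vpostE half1 half2.
transitivity (\int[leb]_G \int[leb]_z \int[sph]_s (K G z (enorm z *: s)%R)%:E)%E.
  exact: (reduce mK K0).
transitivity (\int[leb]_G \int[leb]_z \int[sph]_s (K' G z (enorm z *: s)%R)%:E)%E; last first.
  exact/esym/(reduce mK' K'0).
apply: eq_integral => G _.
have mKG : measurable_fun setT (fun p : V * V => (K G p.1 p.2)%:E).
  by apply: mK; [exact: measurable_cst|exact: measurable_fst|exact: measurable_snd].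
transitivity (\int[leb]_z \int[sph]_s (K G (enorm z *: s)%R z)%:E)%E.
  exact: (@ge0_integral_polar_swap _ _ d_gt0 (fun z y => (K G z y)%:E) mKG (K0 G)).
apply: eq_integral => z _.
have mes : measurable_fun setT (fun s : V => enorm z *: s).
  by apply: meas_vscale => //; exact: measurable_id.
have mz1 : measurable_fun setT (fun s : V => (K G (enorm z *: s) z)%:E) by apply: mK.
have mz2 : measurable_fun setT (fun s : V => (K' G z (enorm z *: s))%:E) by apply: mK'.
rewrite -(ge0_sphere_integral_radial mz1)// -(ge0_sphere_integral_radial mz2)//.
have mr := @measurable_radial_proj R d.
apply: ge0_ae_eq_integral => //.
- exact: (measurableT_comp mz1).
- exact: (measurableT_comp mz2).
- apply: filterS (ae_sphere_norm1 d_gt0) => s s1 _.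
  by rewrite /K /K' enormZ s1 mulr1 ger0_norm ?enorm_ge0.
Qed.

End kernel_K.

Section Qplus_weak.
Variables (h : V -> R).
Hypotheses (h0 : forall v, 0 <= h v) (h3 : in_L1 3 h).

Let mh : measurable_fun setT h := in_L1_meas h3.

Let EQ v : \bar R := (\int[leb]_w \int[sph]_s
    (enorm (v - w) * h (vpost v w s) * h (vpost_star v w s))%R%:E)%E.

Let F0 (p : (V * V) * V) : \bar R :=
  (enorm (p.1.1 - p.1.2) * h (vpost p.1.1 p.1.2 p.2) * h (vpost_star p.1.1 p.1.2 p.2))%:E.

Let mF0 : measurable_fun setT F0.
Proof.
have m11 : measurable_fun setT (fun p : (V * V) * V => p.1.1).
  exact: (measurableT_comp measurable_fst measurable_fst).
have m12 : measurable_fun setT (fun p : (V * V) * V => p.1.2).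
  exact: (measurableT_comp measurable_snd measurable_fst).
apply/measurable_EFinP; apply: measurable_funM; first apply: measurable_funM.
- by apply: meas_enorm; exact: meas_vsub.
- exact: (measurableT_comp mh (@measurable_vpost R d)).
- have mv : measurable_fun setT (fun p : (V * V) * V => vpost_star p.1.1 p.1.2 p.2).
    rewrite /vpost_star; apply: meas_vsub.
      by apply: meas_vscale => //; exact: meas_vadd.
    apply: meas_vscale; last exact: measurable_snd.
    by apply: measurable_funM => //; apply: meas_enorm; exact: meas_vsub.
  exact: (measurableT_comp mh mv).
Qed.

Let F00 p : (0 <= F0 p)%E.
Proof. by rewrite lee_fin !mulr_ge0// enorm_ge0. Qed.

Let G0 (p : V * V) : \bar R := (\int[sph]_s F0 (p, s))%E.

Let mG0 : measurable_fun setT G0.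
Proof. exact: (@measurable_fun_fubini_tonelli_F _ _ _ _ _ sph F0 mF0 F00). Qed.

Let G00 p : (0 <= G0 p)%E. Proof. exact: integral_ge0. Qed.

Let mEQ : measurable_fun setT EQ.
Proof. exact: (@measurable_fun_fubini_tonelli_F _ _ _ _ _ leb G0 mG0 G00). Qed.

Let EQ0 v : (0 <= EQ v)%E.
Proof. by rewrite /EQ; apply: integral_ge0 => w _; exact: (G00 (v, w)). Qed.

Let EQ_mul psi C : measurable_fun setT psi -> (forall v, 0 <= psi v) ->
  (forall v, psi v <= C * japanese v ^+ 2) ->
  (\int[leb]_v (EQ v * (psi v)%:E) =
   (\int[leb2]_p (enorm (p.1 - p.2) * avg psi p * (h p.1 * h p.2))%R%:E))%E /\
  itg leb2 (fun p => enorm (p.1 - p.2) * avg psi p * (h p.1 * h p.2)).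
Proof.
move=> mpsi psi0 psiC.
have psiC' v : `|psi v| <= C * japanese v ^+ 2 by rewrite ger0_norm.
have mdist : measurable_fun setT (fun p : V * V => enorm (p.1 - p.2)).
  by apply: meas_enorm; apply: meas_vsub; [exact: measurable_fst|exact: measurable_snd].
have mK : measurable_fun setT (fun p : V * V => enorm (p.1 - p.2) * avg psi p).
  by apply: measurable_funM => //; exact: measurable_avg.
have KC (p : V * V) : `|enorm (p.1 - p.2) * avg psi p| <=
    (2 * C) * (japanese p.1 ^+ 3 * japanese p.2 ^+ 3).
  rewrite normrM ger0_norm ?enorm_ge0//.
  apply: (le_trans (ler_pM (enorm_ge0 _) (normr_ge0 _) (enormB_japanese _ _) (itg_avg p mpsi psiC').2)).
  by rewrite le_eqVlt; apply/orP; left; apply/eqP; ring.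
have iB := itg_bil mK KC h3 h3.
split; last exact: iB.
transitivity (\int[leb]_v \int[leb]_w \int[sph]_s
    (enorm (v - w) * h (vpost v w s) * h (vpost_star v w s) * psi v)%R%:E)%E.
  apply: eq_integral => v _.
  have pv : (0 <= (psi v)%:E)%E by rewrite lee_fin.
  have mGv : measurable_fun setT (fun w => G0 (v, w)).
    exact: (measurableT_comp mG0 (measurable_pair1 v)).
  have e1 := ge0_integralZr leb measurableT mGv (fun w _ => G00 (v, w)) pv.
  transitivity (\int[leb]_w (G0 (v, w) * (psi v)%:E))%E; first exact: (esym e1).
  apply: eq_integral => w _.
  have mFv : measurable_fun setT (fun s => F0 ((v, w), s)).
    exact: (measurableT_comp mF0 (measurable_pair1 (v, w))).
  have e2 := ge0_integralZr sph measurableT mFv (fun s _ => F00 ((v, w), s)) pv.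
  by rewrite /G0 -e2.
rewrite (ge0_prepostcollisional mh mpsi h0 psi0).
have avg0 p : 0 <= avg psi p by exact: Rint_ge0.
rewrite fubini_tonelli1//; last 2 first.
- by apply/measurable_EFinP; exact: (itg_meas iB).
- by move=> p; rewrite lee_fin !mulr_ge0// enorm_ge0.
apply: eq_integral => v _; apply: eq_integral => w _ /=.
have [ia _] := itg_avg (v, w) mpsi psiC'.
have e3 : (enorm (v - w) * avg psi (v, w) * (h v * h w))%:E =
    ((enorm (v - w) * h v * h w)%:E * (avg psi (v, w))%:E)%E.
  by rewrite -EFinM; congr EFin; ring.
have mv : measurable_fun setT (fun s => (enorm (v - w) * h v * h w * psi (vpost v w s))%:E).
  apply/measurable_EFinP; apply: measurable_funM => //.
  exact: (measurableT_comp mpsi (measurableT_comp (@measurable_vpost R d) (measurable_pair1 (v, w)))).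
rewrite e3 -(ge0_sphere_integral_radial mv); last first.
  by move=> s; rewrite lee_fin !mulr_ge0// enorm_ge0.
rewrite (EFin_Rintegral ia) -(integralZl measurableT ia).
by apply: eq_integral => s _; rewrite EFinM.
Qed.

(** With the test function 1, the weak form shows that the total gain is finite, so the gain is
    finite almost everywhere and the [fine] in [Qplus] loses nothing. *)
Let EQ_fin : {ae leb, forall v, EQ v = (Qplus h h v)%:E}.
Proof.
have b1 v : (fun=> 1 : R) v <= 1 * japanese v ^+ 2 by rewrite mul1r japanese_exp_ge1.
have [e1 i1] := EQ_mul (@measurable_cst _ _ V R setT 1) (fun=> ler01) b1.
have iE : leb.-integrable setT EQ.
  apply/integrableP; split; first exact: mEQ.
  rewrite (_ : (\int[leb]_v `|EQ v| = \int[leb]_v (EQ v * 1%:E))%E); last first.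
    by apply: eq_integral => v _; rewrite mule1 gee0_abs.
  by rewrite e1; exact: integrable_lty.
apply: filterS (integrable_ae measurableT iE) => v /(_ Logic.I) fv.
by rewrite /Qplus fineK.
Qed.

Lemma measurable_Qplus : measurable_fun setT (Qplus h h).
Proof. by apply: (measurableT_comp _ mEQ). Qed.

Lemma Qplus_weak_ge0 psi C : measurable_fun setT psi -> (forall v, 0 <= psi v) ->
  (forall v, psi v <= C * japanese v ^+ 2) ->
  itg leb (fun v => Qplus h h v * psi v) /\
  \int[leb]_v (Qplus h h v * psi v) = bil (fun p => enorm (p.1 - p.2) * avg psi p) h h.
Proof.
move=> mpsi psi0 psiC; have [e i] := EQ_mul mpsi psi0 psiC.
have mQ : measurable_fun setT (fun v => (Qplus h h v * psi v)%:E).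
  by apply/measurable_EFinP; apply: measurable_funM => //; exact: measurable_Qplus.
have E : (\int[leb]_v (Qplus h h v * psi v)%:E =
   (\int[leb2]_p (enorm (p.1 - p.2) * avg psi p * (h p.1 * h p.2))%R%:E))%E.
  rewrite -e; apply: ae_eq_integral => //.
  - by apply: emeasurable_funM => //; exact/measurable_EFinP.
  - by apply: filterS EQ_fin => v -> _; rewrite EFinM.
split; last by rewrite /Rintegral E.
apply: itg_ge0_fin; first exact/measurable_EFinP.
- by move=> v; exact: (mulr_ge0 (fine_ge0 (EQ0 v)) (psi0 v)).
- by rewrite E; exact: integrable_lty.
Qed.

End Qplus_weak.

End collision_weak_form.

Section bilinear_theory.
Context {R : realType} {d : nat}.
Local Notation V := 'rV[R]_d.
Local Notation leb := (@lebesgue_rV R d).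
Local Notation leb2 := (leb \x leb)%E.
Implicit Types (h k phi : V -> R) (q : nat) (K : V * V -> R).

Lemma bil_swap q C K h k : measurable_fun setT K ->
  (forall p, `|K p| <= C * (japanese p.1 ^+ q * japanese p.2 ^+ q)) ->
  in_L1 q h -> in_L1 q k -> bil K h k = bil (fun p => K (p.2, p.1)) k h.
Proof.
move=> mK KC hq kq.
pose Ks (p : V * V) := K (p.2, p.1).
have mKs : measurable_fun setT Ks by exact: (measurableT_comp mK (@measurable_swap _ _ _ _)).
have KsC p : `|Ks p| <= C * (japanese p.1 ^+ q * japanese p.2 ^+ q).
  by rewrite /Ks (le_trans (KC _))//= [japanese p.2 ^+ q * _]mulrC.
rewrite -[RHS]/(bil Ks k h) (bil_fubini mKs KsC kq hq).
have iF := itg_bil mK KC hq kq.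
have iG := itg_bil mKs KsC kq hq.
rewrite /bil /Rintegral -(integral21_prod_meas1 iF).
transitivity (fine (\int[leb]_x (fubini_F leb (EFin \o (fun p => Ks p * (k p.1 * h p.2))%R) x))%E).
  congr fine; apply: eq_integral => w _; apply: eq_integral => v _.
  by rewrite /Ks/= (mulrC (h v)).
rewrite (integral12_prod_meas1 iG) -[LHS]/(\int[leb2]_p (Ks p * (k p.1 * h p.2))).
exact: (Rint_fubini iG).2.
Qed.

Lemma bilD_K q C1 C2 K1 K2 h k : measurable_fun setT K1 -> measurable_fun setT K2 ->
  (forall p, `|K1 p| <= C1 * (japanese p.1 ^+ q * japanese p.2 ^+ q)) ->
  (forall p, `|K2 p| <= C2 * (japanese p.1 ^+ q * japanese p.2 ^+ q)) ->
  in_L1 q h -> in_L1 q k ->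
  bil (fun p => K1 p + K2 p) h k = bil K1 h k + bil K2 h k.
Proof.
move=> m1 m2 b1 b2 hq kq; rewrite -RintD; [|exact: (itg_bil m1 b1 hq kq)|exact: (itg_bil m2 b2 hq kq)].
by apply: eq_Rint => p; rewrite mulrDl.
Qed.

Lemma bilZ_K q c C K h k : measurable_fun setT K ->
  (forall p, `|K p| <= C * (japanese p.1 ^+ q * japanese p.2 ^+ q)) ->
  in_L1 q h -> in_L1 q k ->
  bil (fun p => c * K p) h k = c * bil K h k.
Proof.
move=> mK b hq kq; rewrite -[in RHS]RintZ; last exact: (itg_bil mK b hq kq).
by apply: eq_Rint => p /=; ring.
Qed.

Lemma eq_bil K1 K2 h k : (forall p, K1 p = K2 p) -> bil K1 h k = bil K2 h k.
Proof. by move=> E; apply: eq_Rint => p; rewrite E. Qed.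

(** The bound involves only [k] and the difference, so that it visibly tends to 0 when [h] tends to
    [k]. *)
Lemma bil_diff_le q C K h k : measurable_fun setT K ->
  (forall p, `|K p| <= C * (japanese p.1 ^+ q * japanese p.2 ^+ q)) ->
  in_L1 q h -> in_L1 q k ->
  `|bil K h h - bil K k k| <= C * (Nrm q (h \- k) * (2 * Nrm q k + Nrm q (h \- k))).
Proof.
move=> mK b hq kq; have hk := in_L1B hq kq.
have -> : bil K h h - bil K k k = bil K (h \- k) h + bil K k (h \- k).
  rewrite /bil -RintB; [|exact: (itg_bil mK b hq hq)|exact: (itg_bil mK b kq kq)].
  rewrite -RintD; [|exact: (itg_bil mK b hk hq)|exact: (itg_bil mK b kq hk)].
  by apply: eq_Rint => p /=; ring.
have C0 : 0 <= C.
  have := le_trans (normr_ge0 _) (b (0, 0)).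
  by rewrite pmulr_lge0// mulr_gt0// exprn_gt0// japanese_gt0.
apply: (le_trans (ler_normD _ _)).
apply: (le_trans (lerD (norm_bil_le mK b hk hq) (norm_bil_le mK b kq hk))).
rewrite -mulrDr ler_wpM2l//.
have := Nrm_triangle hq kq; have := Nrm_ge0 q (h \- k); have := Nrm_ge0 q k.
nra.
Qed.

Lemma le_bil q C1 C2 K1 K2 h : measurable_fun setT K1 -> measurable_fun setT K2 ->
  (forall p, `|K1 p| <= C1 * (japanese p.1 ^+ q * japanese p.2 ^+ q)) ->
  (forall p, `|K2 p| <= C2 * (japanese p.1 ^+ q * japanese p.2 ^+ q)) ->
  in_L1 q h -> (forall v, 0 <= h v) -> (forall p, K1 p <= K2 p) ->
  bil K1 h h <= bil K2 h h.
Proof.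
move=> m1 m2 b1 b2 hq h0 K12.
apply: le_Rint; [exact: (itg_bil m1 b1 hq hq)|exact: (itg_bil m2 b2 hq hq)|move=> p].
by rewrite ler_wpM2r// mulr_ge0.
Qed.

Lemma bil_weight q C h : in_L1 q h -> (forall v, 0 <= h v) ->
  bil (fun p => C * (japanese p.1 ^+ q * japanese p.2 ^+ q)) h h = C * (Nrm q h * Nrm q h).
Proof.
move=> hq h0; rewrite /bil /Nrm -(Rint_tensor (in_L1_itg hq) (in_L1_itg hq)).
rewrite -RintZ; last exact: (itg_tensor (in_L1_itg hq) (in_L1_itg hq)).
by apply: eq_Rint => p; rewrite !ger0_norm//; ring.
Qed.

Lemma measurable_dist : measurable_fun setT (fun p : V * V => enorm (p.1 - p.2)).
Proof.
by apply: meas_enorm; apply: meas_vsub; [exact: measurable_fst|exact: measurable_snd].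
Qed.

Lemma measurable_dist_fst phi : measurable_fun setT phi ->
  measurable_fun setT (fun p : V * V => enorm (p.1 - p.2) * phi p.1).
Proof.
move=> mphi; apply: measurable_funM; first exact: measurable_dist.
exact: (measurableT_comp mphi measurable_fst).
Qed.

(** The relative speed costs one power of each bracket: a test of growth q needs moments of order q
    + 1. *)
Lemma dist_fst_bound q C phi : (forall v, `|phi v| <= C * japanese v ^+ q) ->
  forall p : V * V, `|enorm (p.1 - p.2) * phi p.1| <=
    (2 * C) * (japanese p.1 ^+ q.+1 * japanese p.2 ^+ q.+1).
Proof.
move=> phiC p; rewrite normrM ger0_norm ?enorm_ge0//.
have C0 : 0 <= C.
  have := le_trans (normr_ge0 _) (phiC 0).
  by rewrite pmulr_lge0// exprn_gt0// japanese_gt0.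
apply: (le_trans (ler_pM (enorm_ge0 _) (normr_ge0 _) (enormB_japanese _ _) (phiC _))).
rewrite !exprS.
have -> : 2 * (japanese p.1 * japanese p.2) * (C * japanese p.1 ^+ q) =
  2 * C * (japanese p.1 * japanese p.1 ^+ q * (japanese p.2 * 1)) by ring.
rewrite ler_wpM2l ?mulr_ge0//.
rewrite ler_wpM2l ?mulr_ge0 ?exprn_ge0 ?japanese_ge0//.
by rewrite ler_wpM2l ?japanese_ge0// japanese_exp_ge1.
Qed.

Lemma itg_dist h v : in_L1 1 h -> itg leb (fun w => enorm (v - w) * h w).
Proof.
move=> h1; have m : measurable_fun setT (fun w : V => enorm (v - w)).
  by apply: meas_enorm; apply: meas_vsub => //; exact: measurable_id.
have b w : `|enorm (v - w)| <= (2 * japanese v) * japanese w ^+ 1.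
  by rewrite ger0_norm ?enorm_ge0// expr1 -mulrA enormB_japanese.
by have [+ _] := in_L1_pair h1 m b; under eq_fun do rewrite mulrC.
Qed.

Lemma Qminus_weak q C phi h : in_L1 q.+1 h -> measurable_fun setT phi ->
  (forall v, `|phi v| <= C * japanese v ^+ q) ->
  itg leb (fun v => Qminus h h v * phi v) /\
  \int[leb]_v (Qminus h h v * phi v) = bil (fun p => enorm (p.1 - p.2) * phi p.1) h h.
Proof.
move=> hq mphi phiC.
have h1 : in_L1 1 h by exact: in_L1_le hq.
have iB := itg_bil (measurable_dist_fst mphi) (dist_fst_bound phiC) hq hq.
have [iI E] := Rint_fubini iB.
have E1 v : \int[leb]_w (enorm (v - w) * phi v * (h v * h w)) = Qminus h h v * phi v.
  rewrite /Qminus -mulrA [_ * phi v]mulrC mulrA -RintZ; last exact: itg_dist.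
  by apply: eq_Rint => w; ring.
split.
  by move: iI; congr itg; apply/funext => v; exact: E1.
by rewrite /bil E; apply: eq_Rint => v; rewrite -E1.
Qed.

End bilinear_theory.

Section collision.
Context {R : realType} {d : nat}.
Hypothesis d_gt0 : (0 < d)%N.
Local Notation V := 'rV[R]_d.
Local Notation leb := (@lebesgue_rV R d).
Variable alpha : R.
Hypotheses (alpha_gt0 : 0 < alpha) (alpha_lt1 : alpha < 1).
Implicit Types (h k phi psi : V -> R) (q : nat).

Lemma avgB phi psi q C1 C2 p : measurable_fun setT phi -> measurable_fun setT psi ->
  (forall v, `|phi v| <= C1 * japanese v ^+ q) ->
  (forall v, `|psi v| <= C2 * japanese v ^+ q) ->
  avg (fun v => phi v - psi v) p = avg phi p - avg psi p.
Proof.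
move=> m1 m2 b1 b2; rewrite /avg RintB//; [exact: (itg_avg p m1 b1).1|exact: (itg_avg p m2 b2).1].
Qed.

Lemma measurable_dist_avg phi : measurable_fun setT phi ->
  measurable_fun setT (fun p : V * V => enorm (p.1 - p.2) * avg phi p).
Proof.
by move=> mphi; apply: measurable_funM; [exact: measurable_dist|exact: measurable_avg].
Qed.

Lemma dist_avg_bound q C phi : measurable_fun setT phi ->
  (forall v, `|phi v| <= C * japanese v ^+ q) ->
  forall p : V * V, `|enorm (p.1 - p.2) * avg phi p| <=
    (2 * C) * (japanese p.1 ^+ q.+1 * japanese p.2 ^+ q.+1).
Proof.
move=> mphi phiC p; rewrite normrM ger0_norm ?enorm_ge0//.
apply: (le_trans (ler_pM (enorm_ge0 _) (normr_ge0 _) (enormB_japanese _ _) (itg_avg p mphi phiC).2)).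
by rewrite !exprS le_eqVlt; apply/orP; left; apply/eqP; ring.
Qed.

Lemma Qplus_weak C phi h : in_L1 3 h -> (forall v, 0 <= h v) ->
  measurable_fun setT phi -> (forall v, `|phi v| <= C * japanese v ^+ 2) ->
  itg leb (fun v => Qplus h h v * phi v) /\
  \int[leb]_v (Qplus h h v * phi v) = bil (fun p => enorm (p.1 - p.2) * avg phi p) h h.
Proof.
move=> h3 h0 mphi phiC.
(* Positive and negative parts of [phi], written linearly in |phi| and [phi] so that bounds and
   measurability are immediate. *)
pose fp v := 2^-1 * (`|phi v| + phi v); pose fm v := 2^-1 * (`|phi v| - phi v).
have mn : measurable_fun setT (fun v => `|phi v|) by exact: measurableT_comp.
have mp : measurable_fun setT fp by apply: measurable_funM => //; exact: measurable_funD.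
have mm : measurable_fun setT fm by apply: measurable_funM => //; exact: measurable_funB.
have fp0 v : 0 <= fp v.
  by rewrite mulr_ge0 ?invr_ge0// -lerBlDr sub0r -normrN ler_norm.
have fm0 v : 0 <= fm v by rewrite mulr_ge0 ?invr_ge0// subr_ge0 ler_norm.
have fpC v : fp v <= C * japanese v ^+ 2.
  by rewrite /fp; have := phiC v; have := ler_norm (phi v); lra.
have fmC v : fm v <= C * japanese v ^+ 2.
  by rewrite /fm; have := phiC v; have := ler_norm (- phi v); rewrite normrN; lra.
have E v : phi v = fp v - fm v by rewrite /fp /fm; lra.
have fpC' v : `|fp v| <= C * japanese v ^+ 2 by rewrite ger0_norm.
have fmC' v : `|fm v| <= C * japanese v ^+ 2 by rewrite ger0_norm.
have [ip ep] := Qplus_weak_ge0 d_gt0 h0 h3 mp fp0 fpC.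
have [im em] := Qplus_weak_ge0 d_gt0 h0 h3 mm fm0 fmC.
have EQ v : Qplus h h v * phi v = Qplus h h v * fp v - Qplus h h v * fm v.
  by rewrite E mulrBr.
split.
  by have := itgB ip im; congr itg; apply/funext => v; rewrite EQ.
rewrite (eq_Rint _ EQ) RintB// ep em /bil -RintB.
- apply: eq_Rint => p; rewrite (_ : avg phi p = avg fp p - avg fm p); first by ring.
  by rewrite -(avgB p mp mm fpC' fmC'); apply: eq_Rint => s; rewrite E.
- exact: (itg_bil (measurable_dist_avg mp) (dist_avg_bound mp fpC') h3 h3).
- exact: (itg_bil (measurable_dist_avg mm) (dist_avg_bound mm fmC') h3 h3).
Qed.

(** The loss terms merge, (1 - alpha) Q - alpha Q_- = (1 - alpha) Q_+ - Q_-, and the exchange of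
    velocities moves Q_+ onto the average of the test function. *)
Definition Kcoll phi (p : V * V) : R :=
  enorm (p.1 - p.2) * ((1 - alpha) * avg phi p - phi p.1).

Definition coll h phi : R := bil (Kcoll phi) h h.

Lemma measurable_Kcoll phi : measurable_fun setT phi -> measurable_fun setT (Kcoll phi).
Proof.
move=> mphi; apply: measurable_funM; first exact: measurable_dist.
apply: measurable_funB.
  by apply: measurable_funM => //; exact: measurable_avg.
exact: (measurableT_comp mphi measurable_fst).
Qed.

Lemma KcollE phi p : Kcoll phi p =
  (1 - alpha) * (enorm (p.1 - p.2) * avg phi p) - enorm (p.1 - p.2) * phi p.1.
Proof. by rewrite /Kcoll; ring. Qed.

Lemma Kcoll_bound q C phi : measurable_fun setT phi ->
  (forall v, `|phi v| <= C * japanese v ^+ q) ->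
  forall p, `|Kcoll phi p| <= (4 * C) * (japanese p.1 ^+ q.+1 * japanese p.2 ^+ q.+1).
Proof.
move=> mphi phiC p; rewrite KcollE.
have b1 := dist_avg_bound mphi phiC p; have b2 := dist_fst_bound phiC p.
apply: (le_trans (ler_normB _ _)).
have -> : 4 * C = 2 * C + 2 * C by ring.
rewrite [leRHS]mulrDl; apply: (lerD _ b2); apply: le_trans b1.
have n0 : 0 <= 1 - alpha by rewrite subr_ge0 ltW.
have n1 : `|1 - alpha| <= 1 by rewrite ger0_norm// gerBl ltW.
by rewrite normrM ler_piMl.
Qed.

Lemma collision_rhsE C (f : R -> V -> R) t phi : in_L1 3 (f t) -> (forall v, 0 <= f t v) ->
  measurable_fun setT phi -> (forall v, `|phi v| <= C * japanese v ^+ 2) ->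
  collision_rhs alpha f t phi = coll (f t) phi.
Proof.
move=> h3 h0 mphi phiC; rewrite /collision_rhs /coll.
have [ip ep] := Qplus_weak h3 h0 mphi phiC.
have [im em] := Qminus_weak h3 mphi phiC.
rewrite (@eq_Rint _ _ _ leb _ (fun v => (1 - alpha) * (Qplus (f t) (f t) v * phi v)
   - Qminus (f t) (f t) v * phi v)); last by move=> v; rewrite /Q; ring.
rewrite RintB//; last exact: itgZ.
rewrite RintZ// ep em /bil -RintZ; last first.
  exact: (itg_bil (measurable_dist_avg mphi) (dist_avg_bound mphi phiC) h3 h3).
rewrite -RintB.
- by apply: eq_Rint => p; rewrite KcollE; ring.
- by apply: itgZ; exact: (itg_bil (measurable_dist_avg mphi) (dist_avg_bound mphi phiC) h3 h3).
- exact: (itg_bil (measurable_dist_fst mphi) (dist_fst_bound phiC) h3 h3).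
Qed.

(** Moments of order 0, 1 and 2 of Q_-(h, h). The constant is kept as a function applied to [p.1] so
    that the three are instances of the same kernel. *)
Definition q0 h : R := bil (fun p => enorm (p.1 - p.2) * (fun=> 1) p.1) h h.
Definition q1 i h : R := bil (fun p => enorm (p.1 - p.2) * (fun v : V => v 0 i) p.1) h h.
Definition q2 h : R := bil (fun p => enorm (p.1 - p.2) * (fun v : V => enorm v ^+ 2) p.1) h h.

Lemma cst1_bound q (v : V) : `|1 : R| <= 1 * japanese v ^+ q.
Proof. by rewrite normr1 mul1r japanese_exp_ge1. Qed.

Lemma coord_bound q i (v : V) : `|v 0 i| <= 1 * japanese v ^+ q.+1.
Proof.
rewrite mul1r (le_trans (ler_coord_enorm _ _))// (le_trans (enorm_le_japanese _))//.
by rewrite -[leLHS]expr1 japanese_exp_le.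
Qed.

Lemma enorm_sqr_bound q (v : V) : `|enorm v ^+ 2| <= 1 * japanese v ^+ q.+2.
Proof.
rewrite mul1r ger0_norm ?sqr_ge0// (@le_trans _ _ (japanese v ^+ 2))//.
  by rewrite japanese_sqr lerDr.
exact: japanese_exp_le.
Qed.

Lemma measurable_enorm_sqr : measurable_fun setT (fun v : V => enorm v ^+ 2).
Proof. by apply: measurable_funX; exact: measurable_enorm. Qed.

Lemma coll1 h : in_L1 1 h -> coll h (fun=> 1) = - alpha * q0 h.
Proof.
move=> h1.
have mc : measurable_fun [set: V] (fun=> 1 : R) by exact: measurable_cst.
rewrite /q0 -(bilZ_K (- alpha) (measurable_dist_fst mc) (dist_fst_bound (cst1_bound 0)) h1 h1).
by apply: eq_bil => p; rewrite /Kcoll avg_cst//=; ring.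
Qed.

(** Momentum and energy are conserved by the pair, not by each particle: only the symmetrized kernel
    shows the cancellation that leaves the annihilation term alone. *)
Lemma bil_symm q C (K : V * V -> R) h : measurable_fun setT K ->
  (forall p, `|K p| <= C * (japanese p.1 ^+ q * japanese p.2 ^+ q)) ->
  in_L1 q h -> bil K h h = bil (fun p => 2^-1 * (K p + K (p.2, p.1))) h h.
Proof.
move=> mK b hq.
pose Ks (p : V * V) := K (p.2, p.1).
have mKs : measurable_fun setT Ks by exact: (measurableT_comp mK (@measurable_swap _ _ _ _)).
have bs p : `|Ks p| <= C * (japanese p.1 ^+ q * japanese p.2 ^+ q).
  by rewrite /Ks (le_trans (b _))//= [japanese p.2 ^+ q * _]mulrC.
have e := bil_swap mK b hq hq.
have bD (p : V * V) : `|K p + Ks p| <= (C + C) * (japanese p.1 ^+ q * japanese p.2 ^+ q).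
  by rewrite mulrDl (le_trans (ler_normD _ _))// lerD.
rewrite (bilZ_K 2^-1 (K := fun p => K p + Ks p) (measurable_funD mK mKs) bD hq hq).
by rewrite (bilD_K mK mKs b bs hq hq) -/Ks -e; field.
Qed.

Lemma coll_coord i h : in_L1 2 h -> coll h (fun v => v 0 i) = - alpha * q1 i h.
Proof.
move=> h2; have mc := @measurable_coord R d i.
rewrite /q1 -(bilZ_K (- alpha) (measurable_dist_fst mc) (dist_fst_bound (coord_bound 0 i)) h2 h2).
rewrite /coll (bil_symm (measurable_Kcoll mc) (Kcoll_bound mc (coord_bound 0 i)) h2).
have mK : measurable_fun setT (fun p : V * V => - alpha * (enorm (p.1 - p.2) * p.1 0 i)).
  by apply: measurable_funM => //; exact: (measurable_dist_fst mc).
have bK (p : V * V) : `|- alpha * (enorm (p.1 - p.2) * p.1 0 i)| <=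
    (alpha * (2 * 1)) * (japanese p.1 ^+ 2 * japanese p.2 ^+ 2).
  rewrite normrM normrN (gtr0_norm alpha_gt0) -[leRHS]mulrA ler_wpM2l ?(ltW alpha_gt0)//.
  exact: (dist_fst_bound (coord_bound 0 i)).
rewrite [RHS](bil_symm mK bK h2).
apply: eq_bil => p; rewrite /Kcoll avg_coord//= avg_coord//= -(enormN (p.2 - p.1)) opprB.
by field.
Qed.

Lemma coll_enorm_sqr h : in_L1 3 h -> coll h (fun v => enorm v ^+ 2) = - alpha * q2 h.
Proof.
move=> h3; have mc := measurable_enorm_sqr.
rewrite /q2 -(bilZ_K (- alpha) (measurable_dist_fst mc) (dist_fst_bound (enorm_sqr_bound 0)) h3 h3).
rewrite /coll (bil_symm (measurable_Kcoll mc) (Kcoll_bound mc (enorm_sqr_bound 0)) h3).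
have mK : measurable_fun setT (fun p : V * V => - alpha * (enorm (p.1 - p.2) * enorm p.1 ^+ 2)).
  by apply: measurable_funM => //; exact: (measurable_dist_fst mc).
have bK (p : V * V) : `|- alpha * (enorm (p.1 - p.2) * enorm p.1 ^+ 2)| <=
    (alpha * (2 * 1)) * (japanese p.1 ^+ 3 * japanese p.2 ^+ 3).
  rewrite normrM normrN (gtr0_norm alpha_gt0) -[leRHS]mulrA ler_wpM2l ?(ltW alpha_gt0)//.
  exact: (dist_fst_bound (enorm_sqr_bound 0)).
rewrite [RHS](bil_symm mK bK h3).
apply: eq_bil => p; rewrite /Kcoll avg_enorm_sqr//= avg_enorm_sqr//= -(enormN (p.2 - p.1)) opprB.
by field.
Qed.

End collision.

(** * Differentiable test functions *)

Section continuous_measurable_rV.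
Context {R : realType} {d : nat}.
Local Notation V := 'rV[R]_d.

Lemma rV_norm_le (v : V) e : 0 <= e -> (forall i, `|v 0 i| <= e) -> `|v| <= e.
Proof.
move=> e0 h; rewrite [`|v|]mx_normrE; elim/big_ind : _ => //.
- by move=> x y xe ye; rewrite ge_max xe.
- by move=> [i j] _ /=; rewrite (ord1 i).
Qed.

Let grid n (v : V) : V := \row_i ((Num.floor (v 0 i * n.+1%:R))%:~R / n.+1%:R).

Let grid_close n v : `|grid n v - v| <= n.+1%:R^-1.
Proof.
apply: rV_norm_le => [|i]; first by rewrite invr_ge0.
rewrite !mxE distrC ger0_norm.
  rewrite lerBlDr -[X in _ <= X + _]div1r -mulrDl ler_pdivlMr ?ltr0n// addrC ltW//.
  by have := floorD1_gt (v 0 i * n.+1%:R); rewrite intrD.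
by rewrite subr_ge0 ler_pdivrMr ?ltr0n// floor_le.
Qed.

(** The sigma-algebra is generated by the coordinates, not by the open sets. Rounding the
    coordinates to multiples of 1/(n+1) gives functions constant on countably many boxes, which
    converge pointwise to [f]. *)
Lemma continuous_rV_measurable (f : V -> R) : continuous f -> measurable_fun setT f.
Proof.
move=> cf; apply: (@measurable_fun_cvg _ _ _ _ (fun n => f \o grid n)); last first.
  move=> v _; apply: (@cvg_comp _ _ _ (fun n => grid n v) f _ (nbhs v)); last exact: cf.
  apply/cvgrPdist_le => e e0; near=> n; rewrite distrC (le_trans (grid_close n v))//.
  by near: n; have := near_infty_natSinv_lt (PosNum e0); apply: filterS => n /ltW.
move=> n _ Y mY; rewrite setTI.
pose c (z : 'rV[int]_d) : V := \row_i ((z 0 i)%:~R / n.+1%:R).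
pose A (z : 'rV[int]_d) : set V := [set v | forall i, Num.floor (v 0 i * n.+1%:R) = z 0 i].
have mA z : measurable (A z).
  rewrite (_ : A z = \bigcap_(i in [set: 'I_d])
      [set v : V | v 0 i \in `[(z 0 i)%:~R / n.+1%:R, (z 0 i + 1)%:~R / n.+1%:R[]).
    apply: fin_bigcap_measurable => // i _.
    have := @measurable_coord R d i measurableT _
      (measurable_itv `[(z 0 i)%:~R / n.+1%:R, (z 0 i + 1)%:~R / n.+1%:R[).
    by rewrite setTI.
  apply/seteqP; split => v /= h i => [_|]; last first.
    have := h i Logic.I; rewrite /= in_itv/= ler_pdivrMr ?ltr0n// ltr_pdivlMr ?ltr0n//.
    by rewrite -floor_eq => /eqP.
  rewrite /= in_itv/= ler_pdivrMr ?ltr0n// ltr_pdivlMr ?ltr0n//.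
  by rewrite -floor_eq h.
rewrite (_ : _ @^-1` Y = \bigcup_k (if (unpickle k : option 'rV[int]_d) is Some z then
    (if `[< Y (f (c z)) >] then A z else set0) else set0)).
  apply: bigcupT_measurable => k; case: unpickle => // z; by case: ifP.
apply/seteqP; split => [v /= Yv|v [k _]].
  pose z : 'rV[int]_d := \row_i Num.floor (v 0 i * n.+1%:R).
  exists (pickle z) => //; rewrite pickleK.
  have -> : c z = grid n v by apply/rowP => i; rewrite !mxE.
  by rewrite asboolT// => i; rewrite mxE.
case: unpickle => // z; case: ifPn => // /asboolP Yz Az /=.
suff -> : grid n v = c z by [].
by apply/rowP => i; rewrite !mxE Az.
Unshelve. all: by end_near. Qed.

End continuous_measurable_rV.

Section one_variable.
Context {R : realType}.

Lemma is_derive_quadratic (f : R -> R) (x l M : R) :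
  (forall z, `|f z - f x - l * (z - x)| <= M * (z - x) ^+ 2) -> is_derive x 1 f l.
Proof.
move=> h; apply/is_derive1_caratheodory.
exists (fun z => if z == x then l else (f z - f x) / (z - x)); split; rewrite ?eqxx//.
  move=> z; case: eqVneq => [->|zx]; first by rewrite !subrr mulr0.
  by rewrite divfK// subr_eq0.
rewrite /prop_for /continuous_at eqxx; apply/cvgrPdist_le => e e0.
have M0 : 0 <= M.
  by have := le_trans (normr_ge0 _) (h (x + 1)); rewrite addrAC subrr add0r expr1n mulr1.
near=> z; case: eqVneq => [_|zx]; first by rewrite subrr normr0 ltW.
have zx0 : z - x != 0 by rewrite subr_eq0.
have -> : l - (f z - f x) / (z - x) = - ((f z - f x - l * (z - x)) / (z - x)) by field.
rewrite normrN normrM normfV ler_pdivrMr ?normr_gt0//.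
apply: (le_trans (h z)); rewrite -[_ ^+ 2]real_normK ?num_real// expr2 mulrA.
rewrite ler_wpM2r//; near: z.
have [->|M1] := eqVneq M 0; first by apply: nearW => z; rewrite mul0r ltW.
have {}M0 : 0 < M by rewrite lt_neqAle eq_sym M1.
exists (e / M) => /=; first by rewrite divr_gt0.
by move=> z /=; rewrite distrC ltr_pdivlMr// mulrC => /ltW.
Unshelve. all: by end_near. Qed.

(** Squaring makes the positive part continuously differentiable, which is the regularity asked of
    test functions. *)
Definition pospart2 (x : R) : R := Num.max x 0 ^+ 2.

Lemma is_derive_pospart2 (x : R) : is_derive x 1 pospart2 (2 * Num.max x 0).
Proof.
apply: (@is_derive_quadratic _ _ _ 1) => z; rewrite /pospart2 mul1r.
have [x0|x0] := leP x 0; have [z0|z0] := leP z 0.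
- by rewrite expr0n/= subrr mulr0 mul0r subrr normr0 sqr_ge0.
- have -> : z ^+ 2 - 0 ^+ 2 - 2 * 0 * (z - x) = z ^+ 2 by ring.
  by rewrite ger0_norm ?sqr_ge0// lerXn2r ?nnegrE; lra.
- have xz : x * z <= 0 by rewrite mulr_ge0_le0// ltW.
  have -> : 0 ^+ 2 - x ^+ 2 - 2 * x * (z - x) = x ^+ 2 - 2 * (x * z) by ring.
  have -> : (z - x) ^+ 2 = z ^+ 2 - 2 * (x * z) + x ^+ 2 by ring.
  by have := sqr_ge0 z; have := sqr_ge0 x => ? ?; rewrite ger0_norm; lra.
- have -> : z ^+ 2 - x ^+ 2 - 2 * x * (z - x) = (z - x) ^+ 2 by ring.
  by rewrite ger0_norm ?sqr_ge0.
Qed.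

Lemma pospart2_ge0 x : 0 <= pospart2 x. Proof. exact: sqr_ge0. Qed.

Lemma continuous_max0 : continuous (fun x : R => Num.max x 0).
Proof.
move=> x; apply/cvgrPdist_le => e e0; near=> z.
apply: (@le_trans _ _ `|x - z|); last by near: z; exists e => //= z /ltW.
have [x0|x0] := leP x 0; have [z0|z0] := leP z 0; rewrite ?subrr ?normr0//.
- by rewrite sub0r normrN (gtr0_norm z0) distrC gtr0_norm; lra.
- by rewrite subr0 (gtr0_norm x0) gtr0_norm; lra.
Unshelve. all: by end_near. Qed.

End one_variable.

Section gradient.
Context {R : realType} {d : nat}.
Local Notation V := 'rV[R]_d.
Implicit Types (phi psi : V -> R) (dphi dpsi : 'I_d -> V -> R).

(** The gradient is named explicitly, so that it can be computed by rules and estimated instead of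
    being handled through directional derivatives. *)
Definition has_grad phi dphi : Prop :=
  [/\ forall v, differentiable phi v,
      forall v w, 'D_w phi v = \sum_i w 0 i * dphi i v &
      forall i, continuous (dphi i)].

Lemma has_grad_derive phi : (forall v, differentiable phi v) ->
  (forall i, continuous (fun v => 'D_(delta_mx 0 i) phi v)) ->
  has_grad phi (fun i v => 'D_(delta_mx 0 i) phi v).
Proof.
move=> dphi cphi; split => // v w.
rewrite deriveE// [in LHS](row_sum_delta w) linear_sum; apply: eq_bigr => i _.
by rewrite linearZ deriveE.
Qed.

Lemma has_grad_partial phi dphi i v : has_grad phi dphi ->
  'D_(delta_mx 0 i) phi v = dphi i v.
Proof.
move=> [_ -> _]; rewrite (bigD1 i)//= mxE !eqxx mul1r big1 ?addr0// => j ji.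
by rewrite mxE (negbTE ji) andbF mul0r.
Qed.

Lemma has_grad_continuous phi dphi : has_grad phi dphi -> continuous phi.
Proof. by move=> [dphi_ _ _] v; exact: differentiable_continuous. Qed.

Lemma has_grad_measurable phi dphi : has_grad phi dphi -> measurable_fun setT phi.
Proof. by move=> /has_grad_continuous; exact: continuous_rV_measurable. Qed.

Lemma has_grad_measurable_d phi dphi i : has_grad phi dphi -> measurable_fun setT (dphi i).
Proof. by move=> [_ _ c]; exact: continuous_rV_measurable. Qed.

Lemma has_grad_cst (c : R) : has_grad (fun=> c) (fun _ _ => 0).
Proof.
split => [v|v w|i].
- exact: differentiable_cst.
- by rewrite derive_cst big1// => i _; rewrite mulr0.
- exact: cst_continuous.
Qed.

Lemma has_grad_coord j : has_grad (fun v => v 0 j) (fun i _ => (i == j)%:R).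
Proof.
split => [v|v w|i].
- exact: differentiable_coord.
- have -> : 'D_w (fun v : V => v 0 j) v = w 0 j.
    rewrite /derive; apply: cvg_lim => //.
    apply: (@cvg_trans _ ((fun=> w 0 j) @ (0 : R)^')); last exact: cvg_cst.
    apply: near_eq_cvg; near=> h.
    have h0 : h != 0 by near: h; exact: nbhs_dnbhs_neq.
    rewrite /= !mxE addrK -[_ *: _]/(h^-1 * (h * w 0 j)) mulrA mulVf// mul1r//.
  rewrite (bigD1 j)//= eqxx mulr1 big1 ?addr0// => i ij.
  by rewrite (negbTE ij) mulr0.
- exact: cst_continuous.
Unshelve. all: by end_near. Qed.

Lemma has_gradD phi dphi psi dpsi : has_grad phi dphi -> has_grad psi dpsi ->
  has_grad (fun v => phi v + psi v) (fun i v => dphi i v + dpsi i v).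
Proof.
move=> [d1 e1 c1] [d2 e2 c2]; split => [v|v w|i v].
- exact: differentiableD.
- rewrite (@deriveD _ _ _ phi psi); [|exact: diff_derivable|exact: diff_derivable].
  by rewrite e1 e2 -big_split; apply: eq_bigr => i _; rewrite mulrDr.
- exact: (cvgD (c1 i v) (c2 i v)).
Qed.

Lemma has_gradM phi dphi psi dpsi : has_grad phi dphi -> has_grad psi dpsi ->
  has_grad (fun v => phi v * psi v) (fun i v => phi v * dpsi i v + psi v * dphi i v).
Proof.
move=> h1 h2; have k1 := has_grad_continuous h1; have k2 := has_grad_continuous h2.
move: h1 h2 => [d1 e1 c1] [d2 e2 c2]; split => [v|v w|i v].
- exact: differentiableM.
- rewrite (@deriveM _ _ phi psi); [|exact: diff_derivable|exact: diff_derivable].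
  rewrite e1 e2 -[_ *: _]/(phi v * _) -[psi v *: _]/(psi v * _) !mulr_sumr -big_split.
  by apply: eq_bigr => i _ /=; ring.
- exact: (cvgD (cvgM (k1 v) (c2 i v)) (cvgM (k2 v) (c1 i v))).
Qed.

Lemma has_grad_sum (I : Type) (s : seq I) (F : I -> V -> R) (dF : I -> 'I_d -> V -> R) :
  (forall j, has_grad (F j) (dF j)) ->
  has_grad (fun v => \sum_(j <- s) F j v) (fun i v => \sum_(j <- s) dF j i v).
Proof.
move=> h; elim: s => [|j s IH].
  under eq_fun do rewrite big_nil; under [X in has_grad _ X]eq_fun do under eq_fun do rewrite big_nil.
  exact: has_grad_cst.
under eq_fun do rewrite big_cons; under [X in has_grad _ X]eq_fun do under eq_fun do rewrite big_cons.
exact: has_gradD.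
Qed.

Lemma has_grad_comp (g g' : R -> R) phi dphi : has_grad phi dphi ->
  (forall v, is_derive (phi v) 1 g (g' (phi v))) -> continuous (g' \o phi) ->
  has_grad (fun v => g (phi v)) (fun i v => g' (phi v) * dphi i v).
Proof.
move=> [d1 e1 c1] dg cg.
have dgv v : differentiable g (phi v).
  by apply/derivable1_diffP; exact: (@ex_derive _ _ _ _ _ _ _ (dg v)).
split => [v|v w|i v].
- exact: differentiable_comp.
- rewrite deriveE; last exact: differentiable_comp.
  rewrite (diff_comp (d1 v) (dgv v))/= diff1E// -[_ *: _]/(_ * _) -deriveE// e1.
  rewrite derive1E (@derive_val _ _ _ _ _ _ _ (dg v)) mulr_suml.
  by apply: eq_bigr => i _; ring.
- exact: (cvgM (cg v) (c1 i v)).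
Qed.

Lemma has_grad_affine phi dphi (a : R) (u : V) : has_grad phi dphi ->
  has_grad (fun v => phi (a *: v + u)) (fun i v => a * dphi i (a *: v + u)).
Proof.
move=> [d1 e1 c1].
have ca : continuous (fun v : V => a *: v + u).
  by move=> v; exact: (cvgD (@scaler_continuous _ _ a v) (cvg_cst _)).
have isd v : is_diff v (fun v : V => a *: v + u) (fun w => a *: w).
  apply: (is_diff_eq (is_diffD (is_diff_scaler a v) (is_diff_cst u v))).
  by apply/funext => w /=; rewrite addr0.
split => [v|v w|i v].
- by apply: differentiable_comp => //; exact: (@ex_diff _ _ _ _ _ _ (isd v)).
- rewrite deriveE; last by apply: differentiable_comp => //; exact: (@ex_diff _ _ _ _ _ _ (isd v)).
  rewrite (@diff_comp _ _ _ _ (fun v : V => a *: v + u) phi v)//.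
  have isdv := isd v; rewrite /= diff_val -deriveE// e1.
  by apply: eq_bigr => i _; rewrite mxE; ring.
- have cc : {for v, continuous (dphi i \o (fun v0 => a *: v0 + u))}.
    by apply: continuous_comp; [exact: ca|exact: c1].
  exact: (cvgM (cvg_cst a) cc).
Qed.

Lemma has_grad_enorm_sqr : has_grad (fun v : V => enorm v ^+ 2) (fun i v => 2 * v 0 i).
Proof.
have h j := has_gradM (has_grad_coord j) (has_grad_coord j).
have := has_grad_sum (index_enum 'I_d) h.
rewrite (_ : (fun v => _) = (fun v : V => enorm v ^+ 2)); last first.
  by apply/funext => v; rewrite enorm_sqr; apply: eq_bigr => i _; rewrite expr2.
congr has_grad; apply/funext => i; apply/funext => v.
rewrite (bigD1 i)//= eqxx mulr1 big1 ?addr0; first by ring.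
by move=> j ji; rewrite eq_sym (negbTE ji) !mulr0 addr0.
Qed.

End gradient.

(** * Primitives of locally integrable functions *)

Section half_line.
Context {R : realType}.
Local Notation mu := (@lebesgue_measure R).
Implicit Types (F G D f g p : R -> R) (x y t T C : R).

(** Intervals are open on the left so that adjacent ones concatenate without overlap. *)
Definition ind x y t : R := (x < t <= y)%R%:R.

(** Continuity on the closed half-line, by sequences: the values at negative times are never
    consulted. *)
Definition scont F : Prop := forall t, 0 <= t -> forall u : nat -> R,
  (forall n, 0 <= u n) -> u n @[n --> \oo] --> t -> F (u n) @[n --> \oo] --> F t.

Definition li f : Prop := forall x y, 0 <= x -> x <= y -> itg mu (fun t => ind x y t * f t).

Definition Int x y f : R := \int[mu]_t (ind x y t * f t).

(** Local absolute continuity on the half-line with derivative [f]. No pointwise derivative is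
    claimed. *)
Definition prim F f : Prop := li f /\ forall x y, 0 <= x -> x <= y -> F y - F x = Int x y f.

Lemma ind_ge0 x y t : 0 <= ind x y t. Proof. exact: ler0n. Qed.

Lemma ind_le1 x y t : ind x y t <= 1. Proof. by rewrite /ind; case: (_ < _ <= _). Qed.

Lemma ind1 x y t : x < t -> t <= y -> ind x y t = 1.
Proof. by rewrite /ind => -> ->. Qed.

Lemma indE x y t : ind x y t = \1_(`]x, y]) t.
Proof. by rewrite /ind indicE mem_setE in_itv. Qed.

Lemma measurable_ind x y : measurable_fun setT (ind x y).
Proof.
by rewrite (_ : ind x y = \1_(`]x, y]))//; apply/funext => t; rewrite indE.
Qed.

Lemma itg_ind x y : itg mu (ind x y).
Proof.
rewrite (_ : ind x y = \1_(`]x, y])); last by apply/funext => t; rewrite indE.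
exact: integrable_indic_itv.
Qed.

Lemma Int_mkcond x y f : Int x y f = \int[mu]_(t in `]x, y]) f t.
Proof.
rewrite [RHS]Rintegral_mkcond; apply: eq_Rint => t.
by rewrite patchE indE indicE; case: ifPn => _; rewrite ?mul1r ?mul0r.
Qed.

Lemma itg_ind_mkcond x y f :
  itg mu (fun t => ind x y t * f t) <-> mu.-integrable `]x, y] (EFin \o f).
Proof.
rewrite /itg (_ : EFin \o _ = (EFin \o f) \_ `]x, y]).
  exact: iff_sym (integrable_mkcond _ _).
apply/funext => t; rewrite patchE /= indE indicE; case: ifPn => _.
  by rewrite mul1r.
by rewrite mul0r.
Qed.

Lemma Int_cst x y c : x <= y -> Int x y (fun=> c) = c * (y - x).
Proof.
move=> xy; rewrite Int_mkcond Rintegral_cst//= lebesgue_measure_itv/= lte_fin.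
by case: ltP => // yx; rewrite (@le_anti _ _ x y) ?xy// subrr.
Qed.

Lemma ind_bounded (k : R -> R) x y C : measurable_fun setT k -> (forall t, x < t <= y -> `|k t| <= C) ->
  itg mu (fun t => ind x y t * k t).
Proof.
move=> mk kC; apply: (itg_dom _ _ (itgZ `|C| (itg_ind x y))).
  by apply: measurable_funM => //; exact: measurable_ind.
move=> t; rewrite normrM (ger0_norm (ind_ge0 _ _ _)) mulrC /ind.
by case: (boolP (x < t <= y)) => [h|_]; rewrite ?mulr0// !mulr1 (le_trans (kC _ h))// ler_norm.
Qed.

Lemma seq_within F (t l : R) :
  (forall u : nat -> R, (forall n, 0 <= u n) -> u n @[n --> \oo] --> t ->
    F (u n) @[n --> \oo] --> l) ->
  F @ within [set s | 0 <= s] (nbhs t) --> l.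
Proof.
move=> h; apply/cvgrPdist_le => e e0; rewrite near_withinE.
have [[n hn]|/forallNP N] := pselect (exists n : nat, forall s, 0 <= s ->
    `|t - s| < n.+1%:R^-1 -> `|l - F s| <= e).
  by exists n.+1%:R^-1 => [|s /= sn s0]; [rewrite /= invr_gt0|exact: hn].
have /choice[u hu] : forall n : nat, exists s,
    [/\ 0 <= s, `|t - s| < n.+1%:R^-1 & e < `|l - F s|].
  move=> n; apply: contrapT => /forallNP M; apply: (N n) => s s0 sn.
  by rewrite leNgt; apply/negP => es; exact: (M s).
exfalso; have : F (u n) @[n --> \oo] --> l.
  apply: h => [n|]; first by have [] := hu n.
  apply/cvgrPdist_lt => r r0; near=> n.
  have [_ un _] := hu n; apply: (lt_trans un); near: n.
  exact: (near_infty_natSinv_lt (PosNum r0)).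
move=> /cvgrPdist_lt /(_ e e0) [n _ /(_ n)] /= /(_ (leqnn n)).
by have [_ _ /ltW] := hu n; rewrite leNgt => /negbTE ->.
Unshelve. all: by end_near. Qed.

Lemma within_seq (U : topologicalType) (F : R -> U) (t : R) (l : U) (u : nat -> R) :
  F @ within [set s | 0 <= s] (nbhs t) --> l ->
  (forall n, 0 <= u n) -> u n @[n --> \oo] --> t -> F (u n) @[n --> \oo] --> l.
Proof.
move=> h u0 ut; apply: (cvg_comp u F _ h) => A /= [e e0 hA].
have /cvgrPdist_lt /(_ e e0) := ut; apply: filterS => n /= un.
by apply: hA => //=; exact: u0.
Qed.

(** Freezing the function at its value in 0 for negative times makes it continuous on the whole
    line; boundedness and measurability in time are obtained through this extension. *)
Lemma scont_max F : scont F -> continuous (fun t => F (Num.max t 0)).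
Proof.
move=> cF t.
have := @seq_within F (Num.max t 0) (F (Num.max t 0)) (cF _ _).
have m0 : 0 <= Num.max t 0 by rewrite le_max lexx orbT.
move=> /(_ m0) h A /h[e e0 hA].
have /cvgrPdist_lt /(_ e e0) := @continuous_max0 R t.
by apply: filterS => s /= /hA; apply; rewrite /= le_max lexx orbT.
Qed.

Lemma scont_bounded F T : scont F -> exists C, 0 <= C /\
  forall t, 0 <= t -> t <= T -> `|F t| <= C.
Proof.
move=> /scont_max cF; have [T0|T0] := leP 0 T; last first.
  by exists 0; split => // t t0 tT; have := lt_le_trans T0 t0; rewrite ltNge tT.
have [|c _ hc] := @EVT_max R (fun t => `|F (Num.max t 0)|) 0 T T0; last first.
  exists `|F (Num.max c 0)|; split => // t t0 tT.
  by have := hc t; rewrite in_itv/= t0 tT => /(_ isT); rewrite [Num.max t 0]max_l.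
apply: continuous_subspaceT => t.
by apply: (@continuous_comp _ _ _ (fun t => F (Num.max t 0)) (fun x => `|x|)); [exact: cF|exact: norm_continuous].
Qed.

Lemma scont_measurable F : scont F -> measurable_fun setT (fun t => F (Num.max t 0)).
Proof. by move=> cF; apply: continuous_measurable_fun; exact: scont_max. Qed.

Lemma ind_max F x y t : 0 <= x -> ind x y t * F t = ind x y t * F (Num.max t 0).
Proof.
move=> x0; rewrite /ind; case: (boolP (x < t <= y)) => [/andP[xt _]|_]; rewrite ?mul0r//.
by rewrite max_l// (le_trans x0)// ltW.
Qed.

Lemma liM f (k : R -> R) : li f -> scont k -> li (fun t => f t * k t).
Proof.
move=> hf ck x y x0 xy; have [C [C0 hC]] := scont_bounded y ck.
rewrite (_ : (fun t => _) = (fun t => (ind x y t * f t) * k (Num.max t 0))); last first.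
  by apply/funext => t; rewrite mulrCA -mulrA ind_max// mulrC mulrA mulrAC.
apply: (itg_dom _ _ (itgZ C (itg_norm (hf x y x0 xy)))).
  apply: measurable_funM; last exact: scont_measurable.
  exact: itg_meas (hf x y x0 xy).
move=> t; rewrite normrM mulrC; rewrite /ind; case: (boolP (x < t <= y)) => [/andP[xt ty]|_].
  have t0 : 0 <= t by rewrite (le_trans x0)// ltW.
  by rewrite max_l// mul1r ler_wpM2r// hC.
by rewrite mul0r normr0 !mulr0.
Qed.

Lemma li_cst c : li (fun=> c).
Proof. by move=> x y _ _; apply: (@ind_bounded _ _ _ `|c|). Qed.

Lemma li_scont (k : R -> R) : scont k -> li k.
Proof. by move=> /(liM (li_cst 1)); under eq_fun do rewrite mul1r. Qed.

Lemma liD f g : li f -> li g -> li (fun t => f t + g t).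
Proof.
move=> hf hg x y x0 xy; under eq_fun do rewrite mulrDr.
by apply: itgD; [exact: hf|exact: hg].
Qed.

Lemma liZ c f : li f -> li (fun t => c * f t).
Proof.
move=> hf x y x0 xy; under eq_fun do rewrite mulrCA.
by apply: itgZ; exact: hf.
Qed.

Lemma li_norm f : li f -> li (fun t => `|f t|).
Proof.
move=> hf x y x0 xy; rewrite (_ : (fun t => _) = (fun t => `|ind x y t * f t|)).
  by apply: itg_norm; exact: hf.
by apply/funext => t; rewrite normrM (ger0_norm (ind_ge0 _ _ _)).
Qed.

Lemma li_sum (I : Type) (s : seq I) (f_ : I -> R -> R) : (forall i, li (f_ i)) ->
  li (fun t => \sum_(i <- s) f_ i t).
Proof.
move=> h; elim: s => [|i s IH].
  by under eq_fun do rewrite big_nil; exact: li_cst.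
by under eq_fun do rewrite big_cons; exact: liD.
Qed.

Lemma IntD x y f g : 0 <= x -> x <= y -> li f -> li g ->
  Int x y (fun t => f t + g t) = Int x y f + Int x y g.
Proof.
move=> x0 xy hf hg; rewrite /Int -RintD; [|exact: hf|exact: hg].
by apply: eq_Rint => t; rewrite mulrDr.
Qed.

Lemma IntZ x y c f : 0 <= x -> x <= y -> li f -> Int x y (fun t => c * f t) = c * Int x y f.
Proof.
move=> x0 xy hf; rewrite /Int -RintZ; last exact: hf.
by apply: eq_Rint => t; rewrite mulrCA.
Qed.

Lemma le_Int x y f g : 0 <= x -> x <= y -> li f -> li g ->
  (forall t, x < t -> t <= y -> f t <= g t) -> Int x y f <= Int x y g.
Proof.
move=> x0 xy hf hg h; apply: le_Rint; [exact: hf|exact: hg|move=> t].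
rewrite /ind; case: (boolP (x < t <= y)) => [/andP[xt ty]|_]; rewrite ?mul0r// !mul1r.
exact: h.
Qed.

Lemma eq_Int x y f g : (forall t, x < t -> t <= y -> f t = g t) -> Int x y f = Int x y g.
Proof.
move=> h; apply: eq_Rint => t.
by rewrite /ind; case: (boolP (x < t <= y)) => [/andP[xt ty]|_]; rewrite ?mul0r// h.
Qed.

Lemma ind_cat x y z t : x <= y -> y <= z -> ind x z t = ind x y t + ind y z t.
Proof.
move=> xy yz; rewrite /ind; have [ty|ty] := leP t y.
  by rewrite (le_trans ty yz) addr0.
by rewrite (le_lt_trans xy ty) andbF add0r.
Qed.

Lemma Int_cat x y z f : 0 <= x -> x <= y -> y <= z -> li f ->
  Int x z f = Int x y f + Int y z f.
Proof.
move=> x0 xy yz hf; rewrite -[RHS]RintD; [|exact: hf|by apply: hf => //; exact: (le_trans x0 xy)].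
by apply: eq_Rint => t; rewrite (ind_cat _ xy yz) mulrDl.
Qed.

Lemma prim_Int f : li f -> prim (fun t => Int 0 t f) f.
Proof. by move=> hf; split => // x y x0 xy; rewrite (Int_cat _ x0 xy hf)// addrAC subrr add0r. Qed.

Lemma prim_scont F f : prim F f -> scont F.
Proof.
move=> [hf hF] t t0 u u0 ut.
have FE s : 0 <= s -> F s = F 0 + Int 0 s f by move=> s0; rewrite -hF// subrKC.
have [T [T0 uT tT]] : exists T, [/\ 0 <= T, forall n, u n <= T & t <= T].
  have [M [_ hM]] := cvg_seq_bounded (cvgP _ ut).
  exists (Num.max t (M + 1)); rewrite le_max t0 le_max lexx; split => // n.
  have h1 : M < M + 1 by rewrite ltrDl.
  by rewrite le_max (le_trans (ler_norm _) (hM _ h1 n Logic.I)) orbT.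
(* The indicators of ]0, u n] need not converge at the limit point [t] itself, so that null point is
   removed before dominated convergence. *)
pose f' s := (s != t)%:R * f s.
have mE s : 0 <= s -> measurable_fun setT (fun r => ind 0 s r * f' r).
  move=> s0; under eq_fun do rewrite mulrCA.
  apply: measurable_funM; last exact: itg_meas (hf 0 s (lexx _) s0).
  rewrite (_ : (fun r => _) = \1_(~` [set t])); first by apply/measurable_indicP/measurableC; exact: measurable_set1.
  apply/funext => r; rewrite indicE; congr (nat_of_bool _)%:R.
  by apply/idP/idP => [/eqP rt|]; [rewrite inE|rewrite inE => /eqP].
have E s : 0 <= s -> s <= T -> Int 0 s f = \int[mu]_r (ind 0 s r * f' r).
  move=> s0 sT; have mf := itg_meas (hf 0 s (lexx _) s0).
  have mf' := mE s s0.
  apply: ae_eq_Rint => //; exists [set t]; split => //; first exact: lebesgue_measure_set1.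
  move=> r /= hr; apply: contrapT => /eqP rt; apply: hr.
  by rewrite /f' rt mul1r.
rewrite FE//; under eq_cvg do rewrite FE//.
apply: cvgD; first exact: cvg_cst.
rewrite E// (_ : (fun n => _) = (fun n => \int[mu]_r (ind 0 (u n) r * f' r))); last first.
  by apply/funext => n; rewrite E.
apply: (@Rint_dct _ _ R mu (fun n r => ind 0 (u n) r * f' r) (fun r => ind 0 t r * f' r)
  (fun r => `|ind 0 T r * f r|)).
- by move=> n; exact: mE.
- move=> r; rewrite /f'; have [->|rt] := eqVneq r t.
    by rewrite mul0r !mulr0; under eq_cvg do rewrite mulr0; exact: cvg_cst.
  apply: cvgMl; apply: (cvg_near_cst).
  have e0 : 0 < `|t - r| by rewrite normr_gt0 subr_eq0 eq_sym.
  have /cvgrPdist_lt /(_ _ e0) := ut; apply: filterS => n un.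
  rewrite /ind; congr ((_ && _)%:R); apply/idP/idP => rtu.
    rewrite leNgt; apply/negP => tr; move: un.
    by rewrite (ltr0_norm (_ : t - r < 0)) ?subr_lt0// ltr_norml => /andP[]; lra.
  move: un; have rt' : r < t by rewrite lt_neqAle rt.
  by rewrite (gtr0_norm (_ : 0 < t - r)) ?subr_gt0// => /(le_lt_trans (ler_norm _)); lra.
- by apply: itg_norm; exact: hf.
- move=> n r; rewrite !normrM (ger0_norm (ind_ge0 _ _ _)) (ger0_norm (ind_ge0 _ _ _)).
  rewrite mulrA ler_wpM2r// normr_nat (@le_trans _ _ (ind 0 (u n) r))//.
    by rewrite ler_piMr ?ind_ge0//; case: (r != t).
  rewrite /ind; case: (boolP (0 < r <= u n)) => [/andP[-> ru]|_]; last exact: ler0n.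
  by rewrite (le_trans ru (uT n)).
Unshelve. all: by end_near. Qed.

(** * Primitives from approximate integrands on short intervals *)

Section partition_limit.
Variables (D G : R -> R) (H : R -> R -> R -> R).
Hypothesis Hincr : forall x y, 0 <= x -> x <= y ->
  itg mu (fun t => ind x y t * H x y t) /\ D y - D x = Int x y (H x y).
Hypothesis Hbound : forall T, 0 <= T -> exists p, itg mu p /\
  forall x y t, 0 <= x -> x < t -> t <= y -> y <= T -> `|H x y t| <= p t.
Hypothesis Hcvg : forall t (u v : nat -> R), 0 < t ->
  (forall n, 0 <= u n < t) -> (forall n, t <= v n) ->
  u n @[n --> \oo] --> t -> v n @[n --> \oo] --> t ->
  H (u n) (v n) t @[n --> \oo] --> G t.

Section interval.
Variables (x y : R).
Hypotheses (x0 : 0 <= x) (xy : x <= y).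

Let node (n k : nat) : R := x + (y - x) * (k%:R / n.+1%:R).

Let node0 n : node n 0 = x.
Proof. by rewrite /node mul0r mulr0 addr0. Qed.

Let noden n : node n n.+1 = y.
Proof. by rewrite /node divff ?pnatr_eq0// mulr1 subrKC. Qed.

Let nodeS n k : node n k.+1 = node n k + (y - x) / n.+1%:R.
Proof. by rewrite /node -(natr1 k); field. Qed.

Let node_le n k l : (k <= l)%N -> node n k <= node n l.
Proof.
by move=> kl; rewrite lerD2l ler_wpM2l ?subr_ge0// ler_wpM2r ?invr_ge0// ler_nat.
Qed.

Let node_ge n k : 0 <= node n k.
Proof. by rewrite (le_trans x0)// -(node0 n) node_le. Qed.

Let step (n : nat) (t : R) : R := \sum_(0 <= k < n.+1)
  ind (node n k) (node n k.+1) t * H (node n k) (node n k.+1) t.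

Let ind_nodes n m t : ind x (node n m) t = \sum_(0 <= k < m) ind (node n k) (node n k.+1) t.
Proof.
elim: m => [|m IH]; first by rewrite big_geq// node0 /ind; case: ltP => //= /lt_geF ->.
by rewrite big_nat_recr//= -IH -ind_cat ?node_le// -[in leLHS](node0 n) node_le.
Qed.

Let stepE n t : x < t <= y -> exists k, [/\ node n k < t, t <= node n k.+1,
  (k < n.+1)%N & step n t = H (node n k) (node n k.+1) t].
Proof.
move=> xty; have := ind_nodes n n.+1 t; rewrite noden /ind xty => E.
have : exists k : 'I_n.+1, ind (node n k) (node n k.+1) t == 1.
  apply: contrapT => /forallNP N; move: E; rewrite big_mkord big1 => [|k _].
    by move/eqP; rewrite oner_eq0.
  by have := N k; rewrite /ind; case: (_ < t <= _) => //; rewrite eqxx.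
move=> [k /eqP ik]; exists k; move: (ik); rewrite {1}/ind.
case: (boolP (_ < t <= _)) => [/andP[k1 k2] _|_ /eqP]; last by rewrite eq_sym oner_eq0.
split => //; rewrite /step big_mkord (bigD1 k)//= ik mul1r big1 ?addr0// => j jk.
move: E; rewrite big_mkord (bigD1 k)//= -/(ind _ _ _) ik -[in LHS](addr0 1) => /addrI/esym/eqP.
rewrite psumr_eq0 => [/allP/(_ j)|? _]; last exact: ind_ge0.
by rewrite mem_index_enum jk => /(_ isT) /= /eqP; rewrite -/(ind _ _ _) => ->; rewrite mul0r.
Qed.

Let step_out n t : ~~ (x < t <= y) -> step n t = 0.
Proof.
move=> xty; have := ind_nodes n n.+1 t; rewrite noden /ind (negbTE xty) => /esym/eqP.
rewrite psumr_eq0 => [/allP E|? _]; last exact: ind_ge0.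
rewrite /step big_seq big1// => k kn; have /eqP := E k kn.
by rewrite -/(ind _ _ _) => ->; rewrite mul0r.
Qed.

Let itg_step n : itg mu (step n).
Proof. by apply: itg_sum_seq => k; exact: (Hincr (node_ge n k) (node_le _ (leqnSn k))).1. Qed.

Let Int_step n : \int[mu]_t step n t = D y - D x.
Proof.
rewrite Rint_sum_seq => [|k]; last exact: (Hincr (node_ge n k) (node_le _ (leqnSn k))).1.
rewrite -[in RHS](noden n) -[in RHS](node0 n).
rewrite -(telescope_sumr (fun k => D (node n k)) (leq0n n.+1)).
by apply: eq_bigr => k _; rewrite (Hincr (node_ge n k) (node_le _ (leqnSn k))).2.
Qed.

(** Sum [H] over a uniform partition of [x, y]. The integrals telescope to D y - D x for every mesh,
    while the integrands converge pointwise to [G] under a common bound: each [t] lies in exactly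
    one cell, which shrinks to [t]. *)
Lemma partition_limit : itg mu (fun t => ind x y t * G t) /\ D y - D x = Int x y G.
Proof.
have y0 := le_trans x0 xy.
have [p [ip hp]] := Hbound y0.
have cvg_step t : step n t @[n --> \oo] --> ind x y t * G t.
  rewrite /ind; case: (boolP (x < t <= y)) => xty; last first.
    by under eq_cvg do rewrite step_out//; rewrite mul0r; exact: cvg_cst.
  rewrite mul1r; have /choice[k hk] : forall n, exists k, [/\ node n k < t, t <= node n k.+1,
    (k < n.+1)%N & step n t = H (node n k) (node n k.+1) t] by move=> n; exact: stepE.
  rewrite (_ : (fun n => _) = (fun n => H (node n (k n)) (node n (k n).+1) t)); last first.
    by apply/funext => n; have [] := hk n.
  have t0 : 0 < t by have /andP[xt _] := xty; exact: le_lt_trans xt.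
  have bnd n z : node n (k n) <= z -> z <= node n (k n).+1 -> `|t - z| <= (y - x) / n.+1%:R.
    move=> z1 z2; have [k1 k2 _ _] := hk n; move: z2 k2; rewrite nodeS => z2 k2.
    by move: (node n (k n)) ((y - x) / _) z1 k1 z2 k2 => a w *; rewrite ler_norml; apply/andP; split; lra.
  have small (z : nat -> R) : (forall n, node n (k n) <= z n) ->
      (forall n, z n <= node n (k n).+1) -> z n @[n --> \oo] --> t.
    move=> z1 z2; apply/cvgrPdist_le => e e0.
    have yx : 0 < y - x by have /andP[a1 a2] := xty; rewrite subr_gt0 (lt_le_trans a1).
    have er : 0 < e / (y - x) by rewrite divr_gt0.
    near=> n; apply: (le_trans (bnd n _ (z1 n) (z2 n))).
    rewrite mulrC -ler_pdivlMr// ltW//; near: n.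
    exact: (near_infty_natSinv_lt (PosNum er)).
  apply: Hcvg => //.
  - by move=> n; have [k1 _ _ _] := hk n; rewrite node_ge.
  - by move=> n; have [] := hk n.
  - by apply: small => // n; rewrite node_le.
  - by apply: small => // n; rewrite node_le.
have sb n t : `|step n t| <= `|p t|.
  case: (boolP (x < t <= y)) => xty; last by rewrite step_out// normr0.
  have [k [k1 k2 kn ->]] := stepE n xty; rewrite (le_trans _ (ler_norm _))//.
  by apply: hp => //; rewrite -(noden n) node_le.
have ip' := itg_norm ip.
have := Rint_dct (fun n => itg_meas (itg_step n)) cvg_step ip' sb.
rewrite (_ : (fun n => _) = (fun=> D y - D x)); last by apply/funext => n; rewrite Int_step.
move=> h; split; last first.
  by rewrite /Int -(cvg_lim (@Rhausdorff R) h) lim_cst.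
apply: (itg_dom _ _ ip'); first exact: (measurable_fun_cvg (fun n => itg_meas (itg_step n)) (fun t _ => cvg_step t)).
by move=> t; apply: (cvgr_to_le (cvg_norm (cvg_step t))); exact: nearW.
Unshelve. all: by end_near. Qed.
End interval.

Lemma prim_of_increments : prim D G.
Proof. by split => [x y x0 xy|x y x0 xy]; have [] := partition_limit x0 xy. Qed.

End partition_limit.

End half_line.

Section half_line_calculus.
Context {R : realType}.
Implicit Types (F G D f g p : R -> R) (x y t T C : R).

Lemma Intxx x f : Int x x f = 0.
Proof. by rewrite Int_mkcond set_itv_ge ?Rintegral_set0// bnd_simp ltxx. Qed.

Lemma scont_cst (c : R) : scont (fun _ : R => c).
Proof. by move=> t _ u _ _; exact: cvg_cst. Qed.

Lemma scontD F G : scont F -> scont G -> scont (fun t => F t + G t).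
Proof. by move=> cF cG t t0 u u0 ut; exact: (cvgD (cF t t0 u u0 ut) (cG t t0 u u0 ut)). Qed.

Lemma scontM F G : scont F -> scont G -> scont (fun t => F t * G t).
Proof. by move=> cF cG t t0 u u0 ut; exact: (cvgM (cF t t0 u u0 ut) (cG t t0 u u0 ut)). Qed.

Lemma scontN F : scont F -> scont (fun t => - F t).
Proof. by move=> cF t t0 u u0 ut; exact: (cvgN (cF t t0 u u0 ut)). Qed.

Lemma scontB F G : scont F -> scont G -> scont (fun t => F t - G t).
Proof. by move=> cF cG; exact: (scontD cF (scontN cG)). Qed.

Lemma scontV F : (forall t, 0 <= t -> F t != 0) -> scont F -> scont (fun t => (F t)^-1).
Proof. by move=> F0 cF t t0 u u0 ut; apply: cvgV; [exact: F0|exact: cF]. Qed.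

Lemma scont_comp (g : R -> R) F : continuous g -> scont F -> scont (fun t => g (F t)).
Proof. by move=> cg cF t t0 u u0 ut; apply: (cvg_comp (F \o u) g (cF t t0 u u0 ut)); exact: cg. Qed.

Lemma scont_sum (I : Type) (s : seq I) (F_ : I -> R -> R) : (forall i, scont (F_ i)) ->
  scont (fun t => \sum_(i <- s) F_ i t).
Proof.
move=> h; elim: s => [|i s IH].
  by under eq_fun do rewrite big_nil; exact: scont_cst.
by under eq_fun do rewrite big_cons; exact: scontD.
Qed.

(** Chain rule in the form of difference quotients: [k] is the exact quotient of the outer function
    and [kap] its limit. It gives the rules for the inverse, the square root and the exponential. *)
Lemma prim_factor D F f (k : R -> R -> R) (kap : R -> R) : prim F f ->
  (forall x y, 0 <= x -> x <= y -> D y - D x = k x y * (F y - F x)) ->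
  (forall T, 0 <= T -> exists C, forall x y, 0 <= x -> x <= y -> y <= T -> `|k x y| <= C) ->
  (forall t (u v : nat -> R), 0 < t -> (forall n, 0 <= u n < t) -> (forall n, t <= v n) ->
    u n @[n --> \oo] --> t -> v n @[n --> \oo] --> t ->
    k (u n) (v n) @[n --> \oo] --> kap t) ->
  prim D (fun t => kap t * f t).
Proof.
move=> [hf hF] hD hC hk; apply: (@prim_of_increments R _ _ (fun x y t => k x y * f t)).
- move=> x y x0 xy; split; last by rewrite IntZ// hD// hF.
  by under eq_fun do rewrite mulrCA; apply: itgZ; exact: hf.
- move=> T T0; have [C CP] := hC T T0; exists (fun t => C * `|ind 0 T t * f t|); split.
    by apply: itgZ; apply: itg_norm; exact: hf.
  move=> x y t x0 xt ty yT; rewrite !normrM (@ind1 R 0 T t) ?normr1 ?mul1r; [|exact: le_lt_trans xt|exact: le_trans yT].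
  by rewrite ler_wpM2r// CP// ltW// (lt_le_trans xt).
- by move=> t u v *; apply: cvgMl; exact: hk.
Qed.

Lemma prim_ext D F f g : (forall t, 0 <= t -> D t = F t) -> (forall t, 0 < t -> f t = g t) ->
  prim F f -> prim D g.
Proof.
move=> DF fg [hf hF]; split => x y x0 xy.
  rewrite (_ : (fun t => _) = (fun t => ind x y t * f t)); first exact: hf.
  apply/funext => t; rewrite /ind; case: (boolP (x < t <= y)) => [/andP[xt _]|_]; rewrite ?mul0r//.
  by rewrite fg// (le_lt_trans x0).
rewrite !DF// ?hF//; last exact: (le_trans x0).
by apply: eq_Int => t xt _; rewrite fg// (le_lt_trans x0).
Qed.

Lemma prim_cst (c : R) : prim (fun _ : R => c) (fun=> 0).
Proof.
split => [|x y x0 xy]; first exact: li_cst.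
by rewrite Int_cst// mul0r subrr.
Qed.

Lemma primD F f G g : prim F f -> prim G g -> prim (fun t => F t + G t) (fun t => f t + g t).
Proof.
move=> [hf hF] [hg hG]; split => [|x y x0 xy]; first exact: liD.
by rewrite IntD// -hF// -hG//; ring.
Qed.

Lemma primZ c F f : prim F f -> prim (fun t => c * F t) (fun t => c * f t).
Proof.
move=> [hf hF]; split => [|x y x0 xy]; first exact: liZ.
by rewrite IntZ// -hF//; ring.
Qed.

Lemma primN F f : prim F f -> prim (fun t => - F t) (fun t => - f t).
Proof. by move=> /(primZ (-1)); apply: prim_ext => t _; rewrite mulN1r. Qed.

Lemma prim_sum (I : Type) (s : seq I) (F_ f_ : I -> R -> R) : (forall i, prim (F_ i) (f_ i)) ->
  prim (fun t => \sum_(i <- s) F_ i t) (fun t => \sum_(i <- s) f_ i t).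
Proof.
move=> h; elim: s => [|i s IH].
  by under eq_fun do rewrite big_nil; under [X in prim _ X]eq_fun do rewrite big_nil; exact: prim_cst.
under eq_fun do rewrite big_cons; under [X in prim _ X]eq_fun do rewrite big_cons.
exact: primD.
Qed.

Lemma seq_ge0 t (u v : nat -> R) : 0 < t -> (forall n, 0 <= u n < t) -> (forall n, t <= v n) ->
  [/\ 0 <= t, forall n, 0 <= u n & forall n, 0 <= v n].
Proof.
move=> t0 u0 v0; split => [|n|n]; first exact: ltW.
  by have /andP[] := u0 n.
exact: le_trans (ltW t0) (v0 n).
Qed.

Lemma primM F f G g : prim F f -> prim G g ->
  prim (fun t => F t * G t) (fun t => f t * G t + F t * g t).
Proof.
move=> pF pG; have cF := prim_scont pF; have cG := prim_scont pG.
case: pF pG => [hf hF] [hg hG].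
(* Discrete product rule: the increment of F G is (increment of F) G(y) + F(x) (increment of G). *)
apply: (@prim_of_increments R _ _ (fun x y t => f t * G y + F x * g t)).
- move=> x y x0 xy; split.
    rewrite (_ : (fun t => _) = (fun t => G y * (ind x y t * f t) + F x * (ind x y t * g t))).
      by apply: itgD; apply: itgZ; [exact: hf|exact: hg].
    by apply/funext => t; ring.
  transitivity (Int x y (fun t => G y * f t + F x * g t)); last first.
    by apply: eq_Int => t _ _; ring.
  by rewrite (IntD x0 xy (liZ (G y) hf) (liZ (F x) hg)) !IntZ// -hF// -hG//; ring.
- move=> T T0; have [A [A0 hA]] := scont_bounded T cG; have [B [B0 hB]] := scont_bounded T cF.
  exists (fun t => A * `|ind 0 T t * f t| + B * `|ind 0 T t * g t|); split.
    by apply: itgD; apply: itgZ; apply: itg_norm; [exact: hf|exact: hg].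
  move=> x y t x0 xt ty yT; rewrite !normrM (@ind1 R 0 T t) ?normr1 ?mul1r; [|exact: le_lt_trans xt|exact: le_trans yT].
  have xy := ltW (lt_le_trans xt ty).
  rewrite (le_trans (ler_normD _ _))// lerD// normrM ?[`|f t| * _]mulrC ler_wpM2r//.
    by apply: hA => //; exact: (le_trans x0).
  by apply: hB => //; exact: (le_trans xy).
- move=> t u v t0 u0 v0 ut vt; have [t0' u0' v0'] := seq_ge0 t0 u0 v0.
  apply: (cvgD (cvgM (cvg_cst _) (cG t t0' v v0' vt)) (cvgM (cF t t0' u u0' ut) (cvg_cst _))).
Qed.

Lemma scont_lower F T : scont F -> (forall t, 0 <= t -> 0 < F t) -> exists c, 0 < c /\
  forall t, 0 <= t -> t <= T -> c <= F t.
Proof.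
move=> cF F0; have [C [C0 hC]] := scont_bounded T (scontV (fun t h => lt0r_neq0 (F0 t h)) cF).
exists (C + 1)^-1; split => [|t t0 tT]; first by rewrite invr_gt0; lra.
have := hC t t0 tT; have Ft := F0 t t0; rewrite gtr0_norm ?invr_gt0// => h.
rewrite -[F t]invrK lef_pV2 ?posrE ?invr_gt0//; lra.
Qed.

Lemma primV F f : (forall t, 0 <= t -> 0 < F t) -> prim F f ->
  prim (fun t => (F t)^-1) (fun t => - (F t) ^- 2 * f t).
Proof.
move=> F0 pF; have cF := prim_scont pF.
have cV := scontV (fun t h => lt0r_neq0 (F0 t h)) cF.
apply: (@prim_factor _ _ _ (fun x y => - ((F x)^-1 * (F y)^-1)) _ pF).
- move=> x y x0 xy; have y0 := le_trans x0 xy.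
  by field; rewrite !lt0r_neq0 ?F0.
- move=> T T0; have [C [C0 hC]] := scont_bounded T cV; exists (C * C) => x y x0 xy yT.
  rewrite normrN normrM ler_pM//; first by apply: hC => //; exact: (le_trans xy).
  by apply: hC => //; exact: (le_trans x0).
- move=> t u v t0 u0 v0 ut vt; have [t0' u0' v0'] := seq_ge0 t0 u0 v0.
  have -> : - F t ^- 2 = - ((F t)^-1 * (F t)^-1) by rewrite expr2 invfM.
  exact: (cvgN (cvgM (cV t t0' u u0' ut) (cV t t0' v v0' vt))).
Qed.

Lemma scont_sqrt F : scont F -> scont (fun t => Num.sqrt (F t)).
Proof. by apply: scont_comp; exact: sqrt_continuous. Qed.

Lemma prim_sqrt F f : (forall t, 0 <= t -> 0 < F t) -> prim F f ->
  prim (fun t => Num.sqrt (F t)) (fun t => (2 * Num.sqrt (F t))^-1 * f t).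
Proof.
move=> F0 pF; have cF := prim_scont pF; have cS := scont_sqrt cF.
have S0 t : 0 <= t -> 0 < Num.sqrt (F t) by move=> t0; rewrite sqrtr_gt0 F0.
apply: (@prim_factor _ _ _ (fun x y => (Num.sqrt (F x) + Num.sqrt (F y))^-1) _ pF).
- move=> x y x0 xy; have y0 := le_trans x0 xy.
  have ex := sqr_sqrtr (ltW (F0 x x0)); have ey := sqr_sqrtr (ltW (F0 y y0)).
  have -> : F y - F x =
      (Num.sqrt (F y) - Num.sqrt (F x)) * (Num.sqrt (F x) + Num.sqrt (F y)).
    by rewrite -{1}ey -{1}ex; ring.
  by rewrite mulrCA mulVf ?mulr1// lt0r_neq0// addr_gt0// S0.
- move=> T T0; have [c [c0 hc]] := scont_lower T cS S0; exists c^-1 => x y x0 xy yT.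
  have y0 := le_trans x0 xy; have p := addr_gt0 (S0 x x0) (S0 y y0).
  rewrite gtr0_norm ?invr_gt0// lef_pV2 ?posrE//.
  have := hc x x0 (le_trans xy yT); have := S0 y y0; lra.
- move=> t u v t0 u0 v0 ut vt; have [t0' u0' v0'] := seq_ge0 t0 u0 v0.
  rewrite mulr_natl mulr2n; apply: cvgV; first by rewrite lt0r_neq0// addr_gt0// S0.
  exact: (cvgD (cS t t0' u u0' ut) (cS t t0' v v0' vt)).
Qed.

Lemma expR_increment (a b : R) : exists z, [/\ Num.min a b <= z, z <= Num.max a b &
  expR b - expR a = expR z * (b - a)].
Proof.
wlog ab : a b / a <= b => [h|].
  have [ab|ab] := leP a b; first by have := h a b ab; rewrite min_l// max_r.
  have [z [z1 z2 z3]] := h b a (ltW ab); move: z1 z2.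
  rewrite (min_l (ltW ab)) (max_r (ltW ab)) => z1 z2.
  by exists z; rewrite z1 z2 -opprB z3 -mulrN opprB.
have [z + ->] := @MVT_segment R expR expR a b ab (fun x _ => is_derive_expR x)
  (continuous_subspaceT (@continuous_expR R)).
by rewrite in_itv/= => /andP[z1 z2]; exists z; rewrite min_l// max_r.
Qed.

Lemma cvg_min_max (u v w : nat -> R) (l : R) : u n @[n --> \oo] --> l -> v n @[n --> \oo] --> l ->
  (forall n, Num.min (u n) (v n) <= w n) -> (forall n, w n <= Num.max (u n) (v n)) ->
  w n @[n --> \oo] --> l.
Proof.
move=> ul vl w1 w2; apply/cvgrPdist_le => e e0.
move/cvgrPdist_le : ul => /(_ e e0) ul; move/cvgrPdist_le : vl => /(_ e e0) vl.
near=> n; have : `|l - u n| <= e by near: n.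
have : `|l - v n| <= e by near: n.
have := w1 n; have := w2 n; rewrite !ler_norml.
by case: (leP (u n) (v n)) => _ ? ? /andP[? ?] /andP[? ?]; apply/andP; split; lra.
Unshelve. all: by end_near. Qed.

Lemma prim_exp F f : prim F f -> prim (fun t => expR (F t)) (fun t => expR (F t) * f t).
Proof.
move=> pF; have cF := prim_scont pF.
have /choice[z hz] : forall xy : R * R, exists z, [/\ Num.min (F xy.1) (F xy.2) <= z,
   z <= Num.max (F xy.1) (F xy.2) &
   expR (F xy.2) - expR (F xy.1) = expR z * (F xy.2 - F xy.1)].
  by move=> [x y]; exact: expR_increment.
apply: (@prim_factor _ _ _ (fun x y => expR (z (x, y))) _ pF).
- by move=> x y x0 xy; have [_ _] := hz (x, y).
- move=> T T0; have [C [C0 hC]] := scont_bounded T cF; exists (expR C) => x y x0 xy yT.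
  rewrite ger0_norm ?expR_ge0// ler_expR; have [_ + _] := hz (x, y) => /= /le_trans; apply.
  rewrite ge_max; apply/andP; split; apply: (le_trans (ler_norm _)); apply: hC => //.
    exact: (le_trans xy).
  exact: (le_trans x0).
- move=> t u v t0 u0 v0 ut vt; have [t0' u0' v0'] := seq_ge0 t0 u0 v0.
  apply: (cvg_comp (fun n => z (u n, v n)) expR _ (@continuous_expR R _)).
  apply: (cvg_min_max (cF t t0' u u0' ut) (cF t t0' v v0' vt)) => n.
    by have [] := hz (u n, v n).
  by have [] := hz (u n, v n).
Qed.

Lemma prim_uniq_cst F f : prim F f -> (forall t, 0 < t -> f t = 0) -> forall t, 0 <= t -> F t = F 0.
Proof.
move=> [_ hF] f0 t t0; apply/eqP; rewrite -subr_eq0 hF//; apply/eqP.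
rewrite -[RHS](mul0r (t - 0)) -Int_cst//; apply: eq_Int => s s0 _; exact: f0.
Qed.

Lemma prim_le F f g x y : prim F f -> li g -> 0 <= x -> x <= y ->
  (forall t, x < t -> t <= y -> f t <= g t) -> F y <= F x + Int x y g.
Proof. by move=> [hf hF] hg x0 xy fg; rewrite -lerBlDl hF//; exact: le_Int. Qed.

(** The integrating factor exp(- int k) is at most 1 since k >= 0, so the source term is bounded by
    C along the way. *)
Lemma gronwall F f (k : R -> R) C t : prim F f -> li k -> 0 <= C -> 0 <= t ->
  (forall s, 0 <= k s) ->
  (forall s, 0 < s -> f s <= k s * F s + C) -> F t <= expR (Int 0 t k) * (F 0 + C * t).
Proof.
move=> pF hk C0 t0 k0 hf.
have pE := prim_exp (primN (prim_Int hk)).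
have p := primM pE pF.
have cF := prim_scont pF.
have := prim_le p (li_cst C) (lexx 0) t0 _.
rewrite /= Int_cst// subr0 Intxx.
rewrite oppr0 expR0 mul1r => /(_ _)h.
rewrite -ler_pdivrMl ?expR_gt0// -expRN; apply: h => s s0 st.
have e0 : 0 <= expR (- Int 0 s k) by exact: expR_ge0.
have e1 : expR (- Int 0 s k) <= 1.
  rewrite -expR0 ler_expR oppr_le0; apply: Rint_ge0 => r.
  by rewrite mulr_ge0 ?ind_ge0.
rewrite -mulrA -mulrDr.
have h1 : - k s * F s + f s <= C by have := hf s s0; lra.
apply: (@le_trans _ _ (expR (- Int 0 s k) * C)); first by rewrite ler_wpM2l.
by rewrite -[leRHS]mul1r ler_wpM2r.
Qed.

Lemma linear_ode F (k : R -> R) f : prim F f -> li k -> (forall s, 0 < s -> f s = k s * F s) ->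
  forall t, 0 <= t -> F t = F 0 * expR (Int 0 t k).
Proof.
move=> pF hk hf t t0.
have p := primM (prim_exp (primN (prim_Int hk))) pF.
have := prim_uniq_cst p _ t0; rewrite /=.
rewrite Intxx oppr0 expR0 mul1r => <- => [|s s0]; last by rewrite hf//; ring.
by rewrite mulrAC -expRD addNr expR0 mul1r.
Qed.

End half_line_calculus.

(** * Affine maps and cut-off functions *)

Section transfer.
Context d1 d2 (T1 : measurableType d1) (T2 : measurableType d2) (R : realType).
Variables (m1 : {measure set T1 -> \bar R}) (m2 : {measure set T2 -> \bar R}).

(** From nonnegative to signed functions, through |F| + F and |F| - F. *)
Lemma itg_transfer (A : T1 -> T2) (c : R) (F : T2 -> R) : measurable_fun setT A -> 0 <= c ->
  (forall G : T2 -> \bar R, measurable_fun setT G -> (forall y, (0 <= G y)%E) ->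
    (\int[m1]_x G (A x) = c%:E * \int[m2]_y G y)%E) ->
  itg m2 F -> itg m1 (F \o A) /\ \int[m1]_x F (A x) = c * \int[m2]_y F y.
Proof.
move=> mA c0 H iF; have mF := itg_meas iF.
have nonneg (G : T2 -> R) : itg m2 G -> (forall y, 0 <= G y) ->
    itg m1 (G \o A) /\ \int[m1]_x G (A x) = c * \int[m2]_y G y.
  move=> iG G0; have mG := itg_meas iG.
  have E : (\int[m1]_x (G (A x))%:E = (c * \int[m2]_y G y)%R%:E)%E.
    have mG' : measurable_fun setT (EFin \o G) by exact/measurable_EFinP.
    by rewrite (H (EFin \o G) mG') ?EFinM ?EFin_Rintegral// => y; rewrite lee_fin.
  split; last by rewrite /Rintegral E.
  apply: itg_ge0_fin => [|x|]; [exact: measurableT_comp|exact: G0|by rewrite E ltry].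
have iN := itg_norm iF.
have ip : itg m2 (fun y => `|F y| + F y) by exact: itgD.
have in_ : itg m2 (fun y => `|F y| - F y) by exact: itgB.
have [ip1 ep] := nonneg _ ip (fun y => ltac:(by rewrite -lerBlDr sub0r -normrN ler_norm)).
have [in1 en] := nonneg _ in_ (fun y => ltac:(by rewrite subr_ge0 ler_norm)).
have E y : F y = 2^-1 * ((`|F y| + F y) - (`|F y| - F y)) by field.
have i1 := itgB ip1 in1.
split.
  rewrite (_ : F \o A = fun x => 2^-1 * ((`|F (A x)| + F (A x)) - (`|F (A x)| - F (A x)))).
    exact: (itgZ _ i1).
  by apply/funext => x; exact: E.
rewrite (eq_Rint _ (fun x => E (A x))) (RintZ _ i1) (RintB ip1 in1) ep en.
rewrite [in RHS](eq_Rint _ E) (RintZ _ (itgB ip in_)) (RintB ip in_); ring.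
Qed.

End transfer.

Section affine_L1.
Context {R : realType} {d : nat}.
Local Notation V := 'rV[R]_d.
Local Notation leb := (@lebesgue_rV R d).
Local Notation leb2 := (leb \x leb)%E.
Implicit Types (h k phi : V -> R) (q : nat) (a : R) (u v w : V) (K : V * V -> R).

Definition aff a u (y : V) : V := a *: y + u.
Definition affV a u (w : V) : V := a^-1 *: (w - u).

Lemma affK a u : a != 0 -> cancel (aff a u) (affV a u).
Proof. by move=> a0 y; rewrite /affV /aff addrK scalerA mulVf// scale1r. Qed.

Lemma affVK a u : a != 0 -> cancel (affV a u) (aff a u).
Proof. by move=> a0 y; rewrite /affV /aff scalerA mulfV// scale1r subrK. Qed.

Lemma measurable_aff a u : measurable_fun setT (aff a u).
Proof. exact: measurable_affine. Qed.

Lemma measurable_affV a u : measurable_fun setT (affV a u).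
Proof. by apply: meas_vscale => //; apply: meas_vsub => //; exact: measurable_id. Qed.

Lemma Rint_aff a u (F : V -> R) : 0 < a -> itg leb F ->
  itg leb (F \o aff a u) /\ \int[leb]_v F (aff a u v) = a ^- d * \int[leb]_v F v.
Proof.
move=> a0 iF; apply: itg_transfer iF => [||G mG G0].
- exact: measurable_aff.
- by rewrite invr_ge0 exprn_ge0// ltW.
- by rewrite -{2}(gtr0_norm a0); apply: ge0_integral_affine => //; rewrite gt_eqF.
Qed.

Lemma Rint_aff2 a u (F : V * V -> R) : 0 < a -> itg leb2 F ->
  itg leb2 (fun p => F (aff a u p.1, aff a u p.2)) /\
  \int[leb2]_p F (aff a u p.1, aff a u p.2) = a ^- (d + d) * \int[leb2]_p F p.
Proof.
move=> a0 iF.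
have mA2 : measurable_fun setT (fun p : V * V => (aff a u p.1, aff a u p.2)).
  apply/measurable_fun_pairP; split => /=.
    exact: (measurableT_comp (measurable_aff a u) measurable_fst).
  exact: (measurableT_comp (measurable_aff a u) measurable_snd).
apply: (@itg_transfer _ _ _ _ _ leb2 leb2 (fun p => (aff a u p.1, aff a u p.2)) _ _ _ _ _ iF) => //.
  by rewrite invr_ge0 exprn_ge0// ltW.
move=> G mG G0.
have mG2 : measurable_fun setT (fun p : V * V => G (aff a u p.1, aff a u p.2)).
  exact: (measurableT_comp mG mA2).
have c0 : (0 <= (`|a| ^- d)%:E)%E by rewrite lee_fin invr_ge0 exprn_ge0.
rewrite (@fubini_tonelli1 _ _ _ _ _ leb leb (fun p : V * V => G (aff a u p.1, aff a u p.2)))// fubini_tonelli1//.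
transitivity (\int[leb]_v ((`|a| ^- d)%:E * \int[leb]_w G (aff a u v, w)))%E.
  apply: eq_integral => v _.
  apply: (@ge0_integral_affine R d a u (fun w => G (aff a u v, w))) => //.
    by rewrite gt_eqF.
  exact: (measurableT_comp mG (@measurable_pair1 _ _ V V (aff a u v))).
have mGF : measurable_fun setT (fun v => \int[leb]_w G (v, w))%E.
  exact: measurable_fun_fubini_tonelli_F.
rewrite ge0_integralZl//; last 2 first.
- exact: (measurableT_comp mGF (measurable_aff a u)).
- by move=> v _; exact: integral_ge0.
rewrite (@ge0_integral_affine R d a u (fun v => \int[leb]_w G (v, w))%E)//; last 2 first.
- by rewrite gt_eqF.
- by move=> v; exact: integral_ge0.
by rewrite muleA -EFinM (gtr0_norm a0) exprD invfM.
Qed.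

(** Distortion of the bracket by the inverse affine map: <(w - u)/a> <= 1 + (|w| + |u|)/a, which is
    at most this constant times <w>. *)
Definition affC a u : R := 1 + (1 + enorm u) / a.

Lemma affC_ge1 a u : 0 < a -> 1 <= affC a u.
Proof. by move=> a0; rewrite lerDl divr_ge0 ?addr_ge0 ?enorm_ge0// ltW. Qed.

Lemma japanese_le1 v : japanese v <= 1 + enorm v.
Proof.
have e0 := enorm_ge0 v; rewrite -(@ler_pXn2r _ 2)// ?nnegrE ?japanese_ge0 ?addr_ge0//.
by rewrite japanese_sqr; nra.
Qed.

Lemma japanese_affV a u w : 0 < a -> japanese (affV a u w) <= affC a u * japanese w.
Proof.
move=> a0; apply: (le_trans (japanese_le1 _)); rewrite /affV enormZ.
rewrite gtr0_norm ?invr_gt0// /affC.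
have h := enormB w u; have j := enorm_le_japanese w; have j1 := japanese_ge1 w.
have eu := enorm_ge0 u; have ia : 0 < a^-1 by rewrite invr_gt0.
have : a^-1 * enorm (w - u) <= a^-1 * ((1 + enorm u) * japanese w).
  by rewrite ler_wpM2l ?(ltW ia)//; apply: (le_trans h); nra.
by move=> ?; rewrite mulrDl mul1r -mulrA mulrCA lerD.
Qed.

Lemma aff_in_L1 q a u h : 0 < a -> in_L1 q h ->
  in_L1 q (h \o aff a u) /\ Nrm q (h \o aff a u) <= a ^- d * affC a u ^+ q * Nrm q h.
Proof.
move=> a0 /in_L1P[mh ih]; have a0' := lt0r_neq0 a0.
pose F w := `|h w| * japanese (affV a u w) ^+ q.
have mj : measurable_fun setT (fun w => japanese (affV a u w) ^+ q).
  exact: (measurableT_comp (measurable_japaneseX q) (measurable_affV a u)).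
have b w : `|F w| <= affC a u ^+ q * (`|h w| * japanese w ^+ q).
  rewrite ger0_norm ?mulr_ge0 ?exprn_ge0 ?japanese_ge0// mulrCA ler_wpM2l//.
  rewrite -exprMn lerXn2r ?nnegrE ?mulr_ge0 ?japanese_ge0 ?(le_trans ler01 (affC_ge1 _ _))//.
  exact: japanese_affV.
have iF : itg leb F.
  apply: (itg_dom _ b (itgZ _ ih)); apply: measurable_funM => //; exact: measurableT_comp.
have [i1 e1] := Rint_aff u a0 iF.
have E v : (F \o aff a u) v = `|h (aff a u v)| * japanese v ^+ q by rewrite /F /= affK.
split.
  apply/in_L1P; split; first exact: (measurableT_comp mh (measurable_aff a u)).
  by under eq_fun do rewrite -E.
rewrite /Nrm -(eq_Rint _ E) e1 -mulrA ler_wpM2l ?invr_ge0 ?exprn_ge0 ?(ltW a0)//.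
rewrite -RintZ//; apply: le_Rint => //; first exact: itgZ.
by move=> w; exact: (le_trans (ler_norm _) (b w)).
Qed.

Lemma Rint_aff_mul a u h k : 0 < a -> itg leb (fun w => h w * k (affV a u w)) ->
  itg leb (fun y => h (aff a u y) * k y) /\
  \int[leb]_y (h (aff a u y) * k y) = a ^- d * \int[leb]_w (h w * k (affV a u w)).
Proof.
move=> a0 iF; have [] := Rint_aff u a0 iF; have a0' := lt0r_neq0 a0.
have E v : ((fun w => h w * k (affV a u w)) \o aff a u) v = h (aff a u v) * k v by rewrite /= affK.
by rewrite (_ : _ \o _ = fun v => h (aff a u v) * k v) ?(eq_Rint _ E)//; apply/funext.
Qed.

Lemma bil_aff q C K a u h : 0 < a -> measurable_fun setT K ->
  (forall p, `|K p| <= C * (japanese p.1 ^+ q * japanese p.2 ^+ q)) -> in_L1 q h ->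
  bil K (h \o aff a u) (h \o aff a u) =
  a ^- (d + d) * bil (fun p => K (affV a u p.1, affV a u p.2)) h h.
Proof.
move=> a0 mK KC hq; have a0' := lt0r_neq0 a0.
have mV2 : measurable_fun setT (fun p : V * V => (affV a u p.1, affV a u p.2)).
  apply/measurable_fun_pairP; split => /=.
    exact: (measurableT_comp (measurable_affV a u) measurable_fst).
  exact: (measurableT_comp (measurable_affV a u) measurable_snd).
have mK2 := measurableT_comp mK mV2.
have C0 : 0 <= C.
  have := le_trans (normr_ge0 _) (KC (0, 0)) => /=.
  by rewrite pmulr_lge0// mulr_gt0// exprn_gt0// japanese_gt0.
have b p : `|K (affV a u p.1, affV a u p.2)| <=
    (C * (affC a u ^+ q * affC a u ^+ q)) * (japanese p.1 ^+ q * japanese p.2 ^+ q).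
  apply: (le_trans (KC _)) => /=; rewrite -mulrA ler_wpM2l// mulrACA.
  have jj w : japanese (affV a u w) ^+ q <= affC a u ^+ q * japanese w ^+ q.
    rewrite -exprMn lerXn2r ?nnegrE ?mulr_ge0 ?japanese_ge0 ?(le_trans ler01 (affC_ge1 _ _))//.
    exact: japanese_affV.
  by apply: ler_pM; rewrite ?exprn_ge0 ?japanese_ge0.
have [_ <-] := Rint_aff2 u a0 (itg_bil mK2 b hq hq).
by apply: eq_Rint => -[v w] /=; rewrite !affK.
Qed.

End affine_L1.

Section cutoff.
Context {R : realType} {d : nat}.
Local Notation V := 'rV[R]_d.
Local Notation leb := (@lebesgue_rV R d).

(** The cut-off (1 - |v|^2/r^2)_+^2: supported in the ball of radius r and explicit enough for the
    bounds on its gradient to be computed. *)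
Definition chi (r : R) (v : V) : R := pospart2 (1 - enorm v ^+ 2 / r ^+ 2).

Lemma chi_ge0 r v : 0 <= chi r v. Proof. exact: pospart2_ge0. Qed.

Lemma chi_le1 r v : chi r v <= 1.
Proof.
rewrite /chi /pospart2 expr_le1// ?le_max ?lexx ?orbT// ge_max ler01 andbT.
by rewrite gerBl divr_ge0// sqr_ge0.
Qed.

Lemma chi_out r v : 0 < r -> r < enorm v -> chi r v = 0.
Proof.
move=> r0 rv; rewrite /chi /pospart2 max_r ?expr0n//.
rewrite subr_le0 ler_pdivlMr ?exprn_gt0// mul1r lerXn2r ?nnegrE ?enorm_ge0// ltW//.
Qed.

(** From (1 - z)_+^2 >= 1 - 2 z. It gives the convergence of the cut-offs to 1 and, later, the
    control of distant pairs of velocities by the temperature. *)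
Lemma chi_ge r v : 1 - 2 * (enorm v ^+ 2 / r ^+ 2) <= chi r v.
Proof.
rewrite /chi /pospart2; have h : 0 <= enorm v ^+ 2 / r ^+ 2 by rewrite divr_ge0// sqr_ge0.
by move: h; set z := _ / _ => h; case: (leP (1 - z) 0) => [h1|_]; [rewrite expr0n/=; lra|nra].
Qed.

Lemma chi_cvg v : chi n.+1%:R v @[n --> \oo] --> (1 : R).
Proof.
apply/cvgrPdist_le => e e0; near=> n.
rewrite ger0_norm ?subr_ge0 ?chi_le1// lerBlDr -lerBlDl (le_trans _ (chi_ge _ _))//.
rewrite lerD2l lerN2 mulrA ler_pdivrMr ?exprn_gt0//.
have h1 : (2 * enorm v ^+ 2) / e <= n.+1%:R.
  near: n; have := nbhs_infty_ger ((2 * enorm v ^+ 2) / e); apply: filterS => n /le_trans; apply.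
  by rewrite ler_nat.
rewrite -ler_pdivrMl// mulrC (le_trans h1)// ler_eXnr// ler1n//.
Unshelve. all: by end_near. Qed.

Lemma has_grad_chi r : has_grad (chi r)
  (fun i v => - (4 / r ^+ 2) * Num.max (1 - enorm v ^+ 2 / r ^+ 2) 0 * v 0 i).
Proof.
have h1 := has_gradD (has_grad_cst 1)
  (has_gradM (has_grad_cst (- (r ^+ 2)^-1)) (@has_grad_enorm_sqr R d)).
have := @has_grad_comp _ _ pospart2 (fun x => 2 * Num.max x 0) _ _ h1
  (fun v => is_derive_pospart2 _).
have -> : (fun v : V => pospart2 (1 + - (r ^+ 2)^-1 * enorm v ^+ 2)) = chi r.
  by apply/funext => v; rewrite /chi mulNr [_^-1 * _]mulrC.
move=> /(_ _)h; rewrite (_ : (fun i v => _) = (fun i v =>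
   2 * Num.max (1 + - (r ^+ 2)^-1 * enorm v ^+ 2) 0 *
   (0 + (- (r ^+ 2)^-1 * (2 * v 0 i) + enorm v ^+ 2 * 0)))).
  apply: h => v; apply: (@continuous_comp _ _ _ (fun v : V => 1 + - (r ^+ 2)^-1 * enorm v ^+ 2)
    (fun x => 2 * Num.max x 0)); first exact: (has_grad_continuous h1).
  exact: (cvgM (cvg_cst _) (@continuous_max0 R _)).
apply/funext => i; apply/funext => v.
have -> : enorm v ^+ 2 / r ^+ 2 = (r ^+ 2)^-1 * enorm v ^+ 2 by rewrite mulrC.
by rewrite !mulNr; move: (enorm v ^+ 2) ((r ^+ 2)^-1) => e b; move: (Num.max (1 - b * e) 0) => m; ring.
Qed.

Lemma chi_continuous r : continuous (chi r).
Proof. exact: has_grad_continuous (has_grad_chi r). Qed.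

Lemma chi_in_L1 q (h : V -> R) (r C : R) : 0 < r -> measurable_fun setT h ->
  (forall v, `|h v| <= C) -> (forall v, r < enorm v -> h v = 0) -> in_L1 q h.
Proof.
move=> r0 mh hC hr; apply/in_L1P; split => //.
pose A := [set v : V | enorm v <= r].
have mA : measurable A.
  rewrite (_ : A = setT `&` @enorm R d @^-1` `]-oo, r]).
    by apply: measurable_enorm => //; exact: measurable_itv.
  by rewrite setTI; apply/seteqP; split => v /=; rewrite in_itv.
have finA : (leb A < +oo)%E.
  have AE : (fun v : V => r *: v + 0) @^-1` A = @unit_ball R d.
    apply/seteqP; split => v; rewrite /A /unit_ball /= addr0 enormZ (gtr0_norm r0);
      by rewrite -{2}(mulr1 r) ler_pM2l.
  have := @lebesgue_rV_affine R d r 0 A (lt0r_neq0 r0) mA; rewrite AE => E.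
  have := lebesgue_rV_unit_ball_fin; move=> /(_ R d); rewrite E.
  rewrite !ltey; apply: contra => /eqP ->.
  by rewrite gt0_muley// lte_fin invr_gt0 exprn_gt0// normr_gt0 gt_eqF.
have iA : itg leb (\1_A).
  apply: itg_ge0_fin => [|v|]; first exact/measurable_indicP.
    by rewrite indicE.
  by rewrite integral_indic// setIT.
apply: (itg_dom _ _ (itgZ (`|C| * (1 + r) ^+ q) iA)).
  by apply: measurable_funM; [exact: measurableT_comp|exact: measurable_japaneseX].
move=> v; rewrite ger0_norm ?mulr_ge0 ?exprn_ge0 ?japanese_ge0//.
have [vr|vr] := leP (enorm v) r; last first.
  rewrite hr// normr0 mul0r mulr_ge0 ?indicE ?ler0n//.
  by rewrite mulr_ge0// exprn_ge0// addr_ge0// ltW.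
rewrite indicE mem_set// mulr1 ler_pM ?exprn_ge0 ?japanese_ge0//.
  exact: (le_trans (hC v) (ler_norm _)).
rewrite lerXn2r ?nnegrE ?japanese_ge0 ?addr_ge0 ?(ltW r0)//.
by apply: (le_trans (japanese_le1 v)); rewrite lerD2l.
Qed.

End cutoff.

Lemma cvg_ext (T : topologicalType) (f g : nat -> T) (l : T) : (forall n, f n = g n) ->
  g n @[n --> \oo] --> l -> f n @[n --> \oo] --> l.
Proof. by move=> /funext ->. Qed.

Lemma in_L1D {R : realType} {d : nat} q (h k : 'rV[R]_d -> R) : in_L1 q h -> in_L1 q k ->
  in_L1 q (fun v => h v + k v).
Proof.
move=> hq kq; have := in_L1B hq (in_L1Z (-1) kq).
by congr in_L1; apply/funext => v /=; rewrite mulN1r opprK.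
Qed.

(** * A monotone class theorem and continuity of affine maps in weighted L1 *)

Section continuous_generators.
Context {R : realType} {d : nat}.
Local Notation V := 'rV[R]_d.

(** Stable under intersection, by taking products, and with indicators that are limits of the
    continuous functions p / (p + 1/k). *)
Definition positivity_sets : set (set V) :=
  [set A | exists p : V -> R, [/\ continuous p, forall v, 0 <= p v & A = [set v | 0 < p v]]].

Lemma positivity_setsI : setI_closed positivity_sets.
Proof.
move=> _ _ [p [cp p0 ->]] [q [cq q0 ->]]; exists (fun v => p v * q v); split.
- by move=> v; exact: (cvgM (cp v) (cq v)).
- by move=> v; rewrite mulr_ge0.
- apply/seteqP; split => v /= => [[pv qv]|]; first exact: mulr_gt0.
  rewrite lt0r mulf_eq0 negb_or => /andP[/andP[pv qv] _].
  by rewrite !lt0r pv qv p0 q0.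
Qed.

Lemma continuous_coord i : continuous (fun v : V => v 0 i).
Proof. exact: has_grad_continuous (has_grad_coord i). Qed.

Lemma measurable_positivity_sets : @measurable _ V = <<s positivity_sets >>.
Proof.
apply/seteqP; split; last first.
  apply: smallest_sub; first exact: sigma_algebra_measurable.
  move=> _ [p [cp p0 ->]].
  rewrite (_ : [set v | 0 < p v] = setT `&` p @^-1` `]0, +oo[).
    by apply: (continuous_rV_measurable cp) => //; exact: measurable_itv.
  by rewrite setTI; apply/seteqP; split => v /=; rewrite in_itv/= andbT.
apply: smallest_sub; first exact: smallest_sigma_algebra.
rewrite -bigcup_seq/= => B [i _ [C mC <-]]; rewrite setTI.
have {}mC : (measurable : set (set (measurableTypeR R))) C by exact: mC.
move: C mC; rewrite RGenOInfty.measurableE; apply: smallest_sub.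
  split => /=.
  - by rewrite preimage_set0; exact: sigma_algebra0.
  - by move=> D hD; rewrite setTD -preimage_setC; exact: sigma_algebraC.
  - by move=> F hF; rewrite preimage_bigcup; exact: sigma_algebra_bigcup.
move=> _ [x ->] /=; apply: sub_sigma_algebra.
exists (fun v => Num.max (v 0 i - x) 0); split.
- move=> v; apply: (@continuous_comp _ _ _ (fun v : V => v 0 i - x) (fun z => Num.max z 0)).
    exact: (cvgB (@continuous_coord i v) (cvg_cst x)).
  exact: continuous_max0.
- by move=> v; rewrite le_max lexx orbT.
- by apply/seteqP; split => v /=; rewrite in_itv/= andbT lt_max ltxx orbF subr_gt0.
Qed.

End continuous_generators.

Import HBSimple HBNNSimple.

Section L1_monotone_class.
Context {R : realType} {d : nat}.
Local Notation V := 'rV[R]_d.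
Variables (q : nat) (P : (V -> R) -> Prop).
Hypothesis PD : forall h k, P h -> P k -> P (fun v => h v + k v).
Hypothesis PZ : forall c h, P h -> P (fun v => c * h v).
Hypothesis Plim : forall (h_ : nat -> V -> R) h k, (forall n, P (h_ n)) ->
  (forall n, measurable_fun setT (h_ n)) ->
  (forall v, h_ n v @[n --> \oo] --> h v) -> (forall n v, `|h_ n v| <= k v) -> in_L1 q k -> P h.
Hypothesis Pcont : forall phi r, continuous phi -> (forall v, r < enorm v -> phi v = 0) -> P phi.

Let rad (n : nat) : R := n.+1%:R.

Let rad0 n : 0 < rad n. Proof. by rewrite ltr0n. Qed.

Let mchi n : measurable_fun setT (chi (rad n) : V -> R).
Proof. exact: continuous_rV_measurable (@chi_continuous R d _). Qed.

Let Lchi n : in_L1 q (chi (rad n) : V -> R).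
Proof.
apply: (@chi_in_L1 _ _ q _ _ 1 (rad0 n) (mchi n)) => v; first by rewrite ger0_norm ?chi_ge0 ?chi_le1.
exact: chi_out.
Qed.

Let Pchi n : P (chi (rad n)).
Proof. by apply: (Pcont (r := rad n)); [exact: chi_continuous|move=> v; exact: chi_out]. Qed.

Let P0 : P (fun=> 0).
Proof. by have := PZ 0 (Pchi 0); under eq_fun do rewrite mul0r. Qed.

Let Psum (I : Type) (s : seq I) (F : I -> V -> R) : (forall i, P (F i)) ->
  P (fun v => \sum_(i <- s) F i v).
Proof.
move=> h; elim: s => [|i s IH]; first by under eq_fun do rewrite big_nil.
by under eq_fun do rewrite big_cons; exact: PD.
Qed.

Let PA (A : set V) : Prop := forall n, P (fun v => chi (rad n) v * \1_A v).

Let PApos A : positivity_sets A -> PA A.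
Proof.
move=> [p [cp p0 ->]] n.
pose h_ (k : nat) v := chi (rad n) v * (p v / (p v + k.+1%:R^-1)).
have den k v : 0 < p v + k.+1%:R^-1 by rewrite ltr_wpDl// invr_gt0.
have ch k : continuous (h_ k).
  move=> v; apply: (cvgM (@chi_continuous R d _ _)); apply: (cvgM (cp v)).
  by apply: cvgV; [rewrite lt0r_neq0//|exact: (cvgD (cp v) (cvg_cst _))].
apply: (Plim (h_ := h_) (k := chi (rad n))) => //.
- move=> k; apply: (Pcont (r := rad n)) => // v vr.
  by rewrite /h_ chi_out// mul0r.
- by move=> k; exact: continuous_rV_measurable.
- move=> v; rewrite /h_; apply: cvgMr; rewrite indicE.
  have [pv0|pv0] := ltP 0 (p v).
    rewrite mem_set// -[X in _ --> X](mulfV (lt0r_neq0 pv0)) -[X in _ / X]addr0.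
    apply: cvgMr; apply: cvgV; first by rewrite addr0 lt0r_neq0.
    apply: cvgD; first exact: cvg_cst.
    exact: cvg_harmonic.
  have -> : p v = 0 by apply/le_anti; rewrite pv0 p0.
  rewrite memNset /=; last by rewrite ltNge pv0.
  by under eq_cvg do rewrite mul0r; exact: cvg_cst.
- move=> k v; rewrite /h_ ger0_norm; last by rewrite mulr_ge0 ?chi_ge0// divr_ge0 ?p0// ltW.
  rewrite ler_piMr ?chi_ge0// ler_pdivrMr// mul1r lerDl invr_ge0//.
Qed.

Let PAmeas A : measurable A -> PA A.
Proof.
rewrite measurable_positivity_sets; move: A.
apply: (dynkin_induction measurable_positivity_sets positivity_setsI).
- move=> n; under eq_fun do rewrite indicT mulr1; exact: Pchi.
- exact: PApos.
- move=> A _ h n.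
  rewrite (_ : (fun v => _) = (fun v => chi (rad n) v + -1 * (chi (rad n) v * \1_A v))).
    by apply: PD => //; exact: PZ.
  apply/funext => v; rewrite !indicE in_setC; case: (v \in A) => /=; ring.
- move=> F mF tF hF n.
  pose h_ (k : nat) v := \sum_(0 <= j < k) chi (rad n) v * \1_(F j) v.
  have hE k v : h_ k v = chi (rad n) v * \1_(\bigcup_(j < k) F j) v.
    rewrite /h_ -mulr_sumr; congr (_ * _).
    elim: k => [|k IH]; first by rewrite big_geq// bigcup_mkord big_ord0 indicE memNset.
    have -> : \bigcup_(j < k.+1) F j = (\bigcup_(j < k) F j) `|` F k.
      apply/seteqP; split => [w [j /= jk Fj]|w [[j /= jk Fj]|Fk]].
      - by move: jk; rewrite ltnS leq_eqVlt => /predU1P[<-|jk]; [right|left; exists j].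
      - by exists j => //=; exact: ltnW.
      - by exists k => /=.
    rewrite big_nat_recr//= IH !indicE.
    have [h1|h1] := boolP (v \in F k); have [h2|h2] := boolP (v \in \bigcup_(j < k) F j) => /=.
    + exfalso; move: h1 h2; rewrite !inE => h1 [j /= jk h2].
      by have := tF j k Logic.I Logic.I; move=> /(_ (ex_intro _ v (conj h2 h1))) jk'; move: jk; rewrite jk' ltnn.
    + by rewrite add0r mem_set//; right; move: h1; rewrite inE.
    + by rewrite addr0 mem_set//; left; move: h2; rewrite inE.
    + rewrite addr0 memNset// => -[]; [move: h2|move: h1]; rewrite notin_setE; exact.
  apply: (Plim (h_ := h_) (k := chi (rad n))) => //.
  + by move=> k; apply: Psum => j; exact: hF.
  + move=> k; rewrite (_ : h_ k = fun v => chi (rad n) v * \1_(\bigcup_(j < k) F j) v).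
      by apply: measurable_funM => //; apply/measurable_indicP/bigcup_measurable.
    by apply/funext => v; exact: hE.
  + move=> v; under eq_cvg do rewrite hE; apply: cvgMr.
    have [/[!inE]-[j _ Fj]|h] := boolP (v \in \bigcup_k F k).
      rewrite indicE mem_set; last by exists j.
      apply: cvg_near_cst; near=> k; rewrite indicE mem_set//; exists j => //=.
      by near: k; exact: nbhs_infty_gt.
    rewrite indicE (negbTE h); apply: cvg_near_cst; apply: nearW => k.
    rewrite indicE memNset// => -[j _ Fj]; move: h; rewrite notin_setE; apply.
    by exists j.
  + move=> k v; rewrite hE ger0_norm; last by rewrite mulr_ge0 ?chi_ge0// indicE ler0n.
    by rewrite ler_piMr ?chi_ge0// indicE; case: (_ \in _).
Unshelve. all: by end_near. Qed.

(** [P] reaches the positivity sets by the quotients p / (p + 1/k), all measurable sets by Dynkin's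
    theorem, simple functions by linearity, and [h] by two dominated limits. The cut-off multiplies
    every indicator so that all these functions stay in weighted L1. *)
Lemma L1_monotone_class h : (forall v, 0 <= h v) -> in_L1 q h -> P h.
Proof.
move=> h0 hq; have mh := in_L1_meas hq.
have mEh : measurable_fun setT (EFin \o h) by exact/measurable_EFinP.
have trunc n : P (fun v => chi (rad n) v * h v).
  pose s k : {nnsfun V >-> R} := nnsfun_approx measurableT mEh k.
  have cs v : s k v @[k --> \oo] --> h v.
    have c := @cvg_nnsfun_approx _ V R setT measurableT _ mEh (fun v _ => h0 v) v Logic.I.
    exact: (fine_cvg c).
  have sh k v : s k v <= h v.
    rewrite -(cvg_lim (@Rhausdorff R) (cs v)); apply: nondecreasing_cvgn_le.
      by move=> i j ij; have /lefP := nd_nnsfun_approx measurableT mEh ij; exact.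
    by apply/cvg_ex; exists (h v); exact: cs.
  apply: (Plim (h_ := fun k v => chi (rad n) v * s k v) (k := h)) => //.
  - move=> k.
    have E : (fun v => chi (rad n) v * s k v) = (fun v =>
        \sum_(y <- finmap.enum_fset (fset_set (range (s k)))) y * (chi (rad n) v * \1_(s k @^-1` [set y]) v)).
      apply/funext => v; rewrite {1}fimfunE fsbig_finite//= mulr_sumr.
      by apply: eq_bigr => y _; ring.
    rewrite E; apply: Psum => y; apply: PZ; apply: PAmeas.
    exact: measurable_sfunP.
  - by move=> k; apply: measurable_funM.
  - by move=> v; apply: cvgMr; exact: cs.
  - move=> k v; have sk0 : 0 <= s k v by exact: fun_ge0.
    rewrite ger0_norm; last by rewrite mulr_ge0 ?chi_ge0.
    apply: le_trans (sh k v).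
    by rewrite ler_piMl ?chi_le1.
apply: (Plim (h_ := fun n v => chi (rad n) v * h v) (k := h)) => //.
- by move=> n; exact: measurable_funM.
- move=> v; rewrite -[X in _ --> X]mul1r; apply: cvgMl; exact: chi_cvg.
- move=> n v; rewrite ger0_norm; last by rewrite mulr_ge0 ?chi_ge0.
  by rewrite ler_piMl ?chi_le1.
Qed.

End L1_monotone_class.

Section affine_continuity.
Context {R : realType} {d : nat}.
Local Notation V := 'rV[R]_d.
Local Notation leb := (@lebesgue_rV R d).

Lemma cvg_rV (v_ : nat -> V) (v : V) : (forall i, v_ n 0 i @[n --> \oo] --> v 0 i) ->
  v_ n @[n --> \oo] --> v.
Proof.
move=> h; apply/cvgrPdist_le => e e0.
have : \forall n \near \oo, forall i, `|v 0 i - v_ n 0 i| <= e.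
  apply: filter_forall => i; move/cvgrPdist_le : (h i) => /(_ e e0); exact.
apply: filterS => n hn; apply: rV_norm_le; first exact: ltW.
by move=> i; rewrite !mxE.
Qed.

Lemma cvg_enorm (v_ : nat -> V) (v : V) : (forall i, v_ n 0 i @[n --> \oo] --> v 0 i) ->
  enorm (v_ n) @[n --> \oo] --> enorm v.
Proof.
move=> h; apply: (cvg_comp (fun n => \sum_i v_ n 0 i ^+ 2) (@Num.sqrt R)); last exact: sqrt_continuous.
elim: (index_enum _) => [|i s IH].
  by apply: (@cvg_ext _ _ (fun=> 0)) => [n|]; rewrite big_nil//; exact: cvg_cst.
rewrite big_cons; apply: (cvg_ext (fun n => _ : _ = v_ n 0 i * v_ n 0 i + \sum_(j <- s) v_ n 0 j ^+ 2)).
  by move=> n; rewrite big_cons.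
exact: (cvgD (cvgM (h i) (h i)) IH).
Qed.

Lemma cc_bounded (phi : V -> R) r : continuous phi ->
  (forall v, r < enorm v -> phi v = 0) -> exists B, 0 <= B /\ forall v, `|phi v| <= B.
Proof.
move=> cphi hr; pose A := [set v : V | forall i, v ord0 i \in `[- `|r|, `|r|]].
have cA : compact A.
  exact: (@rV_compact _ d (fun=> `[- `|r|, `|r|]%classic) (fun _ => @segment_compact R _ _)).
have A0 : A !=set0.
  by exists 0 => i; rewrite mxE in_itv/= oppr_le0 normr_ge0.
have cn : {within A, continuous (fun v => `|phi v|)}.
  apply: continuous_subspaceT => v.
  by apply: (@continuous_comp _ _ _ phi (fun x => `|x|)); [exact: cphi|exact: norm_continuous].
have [c _ hc] := EVT_max_rV A0 cA cn.
exists `|phi c|; split => // v; have [vr|vr] := leP (enorm v) r; last first.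
  by rewrite hr// normr0.
apply: hc; rewrite inE => i; rewrite in_itv/= -ler_norml (le_trans (ler_coord_enorm _ _))//.
exact: (le_trans vr (ler_norm _)).
Qed.

Variables (q : nat) (a_ : nat -> R) (u_ : nat -> V) (a : R) (u : V).
Hypotheses (a0_ : forall n, 0 < a_ n) (a0 : 0 < a) (ca : a_ n @[n --> \oo] --> a)
  (cu : forall i, u_ n 0 i @[n --> \oo] --> u 0 i).

Let ia : (a_ n)^-1 @[n --> \oo] --> a^-1.
Proof. by apply: cvgV => //; exact: lt0r_neq0. Qed.

Lemma aff_cvg y : aff (a_ n) (u_ n) y @[n --> \oo] --> aff a u y.
Proof.
apply: cvg_rV => i; rewrite /aff !mxE; apply: (cvg_ext (fun n => _ : _ = a_ n * y 0 i + u_ n 0 i)).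
  by move=> n; rewrite !mxE.
by apply: cvgD; [apply: cvgM => //; exact: cvg_cst|exact: cu].
Qed.

Lemma affC_bounded : exists M, 0 <= M /\ forall n, affC (a_ n) (u_ n) <= M.
Proof.
have c : affC (a_ n) (u_ n) @[n --> \oo] --> affC a u.
  exact: (cvgD (cvg_cst _) (cvgM (cvgD (cvg_cst _) (cvg_enorm cu)) ia)).
have [M [_ hM]] := cvg_seq_bounded (cvgP _ c).
have h1 : M < `|M| + 1 by rewrite (le_lt_trans (ler_norm _))// ltrDl.
exists (`|M| + 1); split => [|n]; first exact: addr_ge0.
exact: (le_trans (ler_norm _) (hM _ h1 n Logic.I)).
Qed.

Lemma aff_Nrm_bounded : exists M, 0 <= M /\
  forall n, (a_ n) ^- d * affC (a_ n) (u_ n) ^+ q <= M.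
Proof.
have [M [M0 hM]] := affC_bounded.
have c : (a_ n)^-1 ^+ d @[n --> \oo] --> a^-1 ^+ d by exact: (cvg_comp (fun n => (a_ n)^-1) (fun x : R => x ^+ d) ia (@exprn_continuous _ d _)).
have [N [_ hN]] := cvg_seq_bounded (cvgP _ c).
have h1 : N < `|N| + 1 by rewrite (le_lt_trans (ler_norm _))// ltrDl.
exists ((`|N| + 1) * M ^+ q); split => [|n]; first by rewrite mulr_ge0 ?exprn_ge0// addr_ge0.
have C0 : 0 <= affC (a_ n) (u_ n) := le_trans ler01 (affC_ge1 (u_ n) (a0_ n)).
apply: ler_pM; rewrite ?invr_ge0 ?exprn_ge0 ?(ltW (a0_ n))//; last by rewrite lerXn2r ?nnegrE.
by rewrite -exprVn (le_trans (ler_norm _) (hN _ h1 n Logic.I)).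
Qed.

(** For a continuous function of compact support this is dominated convergence; the maps are
    uniformly bounded on weighted L1, so the property passes to dominated limits, and the monotone
    class theorem concludes. Membership in L1 is part of the induction because those bounds require
    it. *)
Lemma aff_L1_cvg h : (forall v, 0 <= h v) -> in_L1 q h ->
  Nrm q ((h \o aff (a_ n) (u_ n)) \- (h \o aff a u)) @[n --> \oo] --> (0 : R).
Proof.
move=> h0 hq; suff : in_L1 q h /\
  Nrm q ((h \o aff (a_ n) (u_ n)) \- (h \o aff a u)) @[n --> \oo] --> (0 : R) by case.
move: h h0 hq; have [M [M0 hM]] := aff_Nrm_bounded.
have aL1 h n : in_L1 q h -> in_L1 q (h \o aff (a_ n) (u_ n)) /\
    Nrm q (h \o aff (a_ n) (u_ n)) <= M * Nrm q h.
  move=> hq; have [h1 h2] := aff_in_L1 (u_ n) (a0_ n) hq; split => //.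
  by rewrite (le_trans h2)// ler_wpM2r ?Nrm_ge0.
have squeeze (x y : nat -> R) : (forall n, 0 <= x n) -> (forall n, x n <= y n) ->
    y n @[n --> \oo] --> (0 : R) -> x n @[n --> \oo] --> (0 : R).
  move=> x0 xy y0; apply: (squeeze_cvgr _ (cvg_cst 0) y0); apply: nearW => n.
  by rewrite x0 xy.
apply: L1_monotone_class.
- move=> h k [hq hc] [kq kc]; split; first exact: in_L1D.
  apply: (squeeze _ (fun n => Nrm q ((h \o aff (a_ n) (u_ n)) \- (h \o aff a u)) +
     Nrm q ((k \o aff (a_ n) (u_ n)) \- (k \o aff a u)))) => [n|n|]; first exact: Nrm_ge0.
    have i1 := in_L1_itg (in_L1B (aL1 h n hq).1 (aff_in_L1 u a0 hq).1).
    have i2 := in_L1_itg (in_L1B (aL1 k n kq).1 (aff_in_L1 u a0 kq).1).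
    have i3 := in_L1_itg (in_L1B (aL1 _ n (in_L1D hq kq)).1 (aff_in_L1 u a0 (in_L1D hq kq)).1).
    rewrite -(RintD i1 i2); apply: le_Rint => //; first exact: itgD.
    move=> v; rewrite -mulrDl ler_wpM2r ?exprn_ge0 ?japanese_ge0//=.
    by rewrite opprD addrACA ler_normD.
  by rewrite -[X in _ --> X]addr0; exact: cvgD.
- move=> c h [hq hc]; split; first exact: in_L1Z.
  rewrite (_ : (fun n => _) = (fun n => `|c| * Nrm q ((h \o aff (a_ n) (u_ n)) \- (h \o aff a u)))).
    by rewrite -[X in _ --> X](mulr0 `|c|); exact: cvgMr.
  apply/funext => n; rewrite -NrmZ; last exact: in_L1B (aL1 h n hq).1 (aff_in_L1 u a0 hq).1.
  by apply: eq_Rint => v /=; rewrite mulrBr.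
- move=> h_ h k hh mh hc hk kq.
  have mh' : measurable_fun setT h by apply: (measurable_fun_cvg mh) => v _; exact: hc.
  have hkv v : `|h v| <= k v.
    by apply: (cvgr_to_le (cvg_norm (hc v))); exact: nearW.
  have k0 v : 0 <= k v := le_trans (normr_ge0 _) (hkv v).
  have hq : in_L1 q h.
    by apply: (in_L1_dom mh' _ kq) => v; rewrite (ger0_norm (k0 v)).
  split => //.
  have cN : Nrm q (h_ m \- h) @[m --> \oo] --> (0 : R).
    have -> : (0 : R) = \int[leb]_v (0 : R) by rewrite Rintegral_cst// mul0r.
    apply: (@Rint_dct _ _ _ leb (fun m v => `|(h_ m \- h) v| * japanese v ^+ q) (fun=> 0)
      (fun v => 2 * (`|k v| * japanese v ^+ q))).
    + move=> m; apply: measurable_funM; last exact: measurable_japaneseX.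
      by apply: measurableT_comp => //; exact: measurable_funB.
    + move=> v; rewrite -(mul0r (japanese v ^+ q)); apply: cvgMl.
      rewrite -(normr0 R); apply: cvg_norm; rewrite -(subrr (h v)).
      by apply: cvgB; [exact: hc|exact: cvg_cst].
    + by apply: itgZ; exact: in_L1_itg.
    + move=> m v; rewrite ger0_norm ?mulr_ge0 ?exprn_ge0 ?japanese_ge0//.
      rewrite mulrA ler_wpM2r ?exprn_ge0 ?japanese_ge0//= (ger0_norm (k0 v)).
      by rewrite (le_trans (ler_normB _ _))// mulr_natl mulr2n lerD.
  (* The approximation error e/(2C) is multiplied by at most [M] along the sequence and by the norm
     of the limit map, which together cost at most e/2; the 1 makes C positive. *)
  pose C := 1 + M + a ^- d * affC a u ^+ q.
  have C0 : 0 < C.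
    rewrite /C -addrA ltr_wpDr// addr_ge0// mulr_ge0 ?invr_ge0 ?exprn_ge0 ?(ltW a0)//.
    exact: (le_trans ler01 (affC_ge1 u a0)).
  apply/cvgrPdist_le => e e0; have eC : 0 < e / (C + C) by rewrite divr_gt0// addr_gt0.
  have [m _ /(_ m (leqnn m))/=] : \forall m \near \oo, Nrm q (h_ m \- h) <= e / (C + C).
    move/cvgrPdist_le : cN => /(_ _ eC); apply: filterS => m.
    by rewrite sub0r normrN ger0_norm ?Nrm_ge0.
  move=> hm; have [hmq hmc] := hh m.
  have e2 : 0 < e / 2 by rewrite divr_gt0.
  move/cvgrPdist_le : hmc => /(_ _ e2); apply: filterS => n.
  rewrite !sub0r !normrN !(ger0_norm (Nrm_ge0 _ _)) => hn.
  pose A n := aff (a_ n) (u_ n).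
  have i1 := in_L1_itg (in_L1B (aL1 _ n hmq).1 (aff_in_L1 u a0 hmq).1).
  have j2 := aL1 _ n (in_L1B hmq hq); have i2 := in_L1_itg j2.1.
  have j3 := aff_in_L1 u a0 (in_L1B hmq hq); have i3 := in_L1_itg j3.1.
  have i4 := in_L1_itg (in_L1B (aL1 _ n hq).1 (aff_in_L1 u a0 hq).1).
  have : Nrm q ((h \o A n) \- (h \o aff a u)) <= Nrm q ((h_ m \o A n) \- (h_ m \o aff a u))
      + Nrm q ((h_ m \- h) \o A n) + Nrm q ((h_ m \- h) \o aff a u).
    rewrite -(RintD i1 i2) -(RintD (itgD i1 i2) i3); apply: le_Rint => //.
      exact: (itgD (itgD i1 i2) i3).
    move=> v; rewrite -!mulrDl ler_wpM2r ?exprn_ge0 ?japanese_ge0//=.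
    set x1 := h _; set x2 := h (aff a u v); set y1 := h_ m _; set y2 := h_ m (aff a u v).
    have -> : x1 - x2 = (y1 - y2) - (y1 - x1) + (y2 - x2) by ring.
    by rewrite (le_trans (ler_normD _ _))// lerD2r (le_trans (ler_normB _ _)).
  move=> /le_trans; apply.
  have b2 := le_trans j2.2 (ler_wpM2l M0 hm).
  have b3 : Nrm q ((h_ m \- h) \o aff a u) <= a ^- d * affC a u ^+ q * (e / (C + C)).
    apply: (le_trans j3.2); rewrite ler_wpM2l// mulr_ge0 ?invr_ge0 ?exprn_ge0 ?(ltW a0)//.
    exact: (le_trans ler01 (affC_ge1 u a0)).
  have E : C * (e / (C + C)) = e / 2 by field; rewrite lt0r_neq0// addr_gt0.
  have : (M + a ^- d * affC a u ^+ q) * (e / (C + C)) <= C * (e / (C + C)).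
    by rewrite ler_wpM2r ?(ltW eC)// /C -addrA lerDr.
  rewrite E mulrDl => h5.
  have := lerD hn (le_trans (lerD b2 b3) h5); rewrite -splitr addrA; exact.
- move=> phi r cphi hr.
  have mphi := continuous_rV_measurable cphi.
  pose r1 := `|r| + 1; have r1_gt0 : 0 < r1 by rewrite ltr_wpDl.
  have r_r1 : r < r1 by rewrite (le_lt_trans (ler_norm _))// ltrDl.
  have [B [B0 hB]] := cc_bounded cphi hr.
  have phiq : in_L1 q phi.
    by apply: (chi_in_L1 q r1_gt0 mphi hB) => v vr; apply: hr; exact: lt_trans vr.
  split => //.
  have [N [N0 hN]] := affC_bounded.
  pose M1 := N + affC a u.
  have Ca : 0 <= affC a u := le_trans ler01 (affC_ge1 u a0).
  have M1_ge0 : 0 <= M1 by rewrite addr_ge0.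
  (* If [phi] does not vanish at the image of y, then <y> <= M1 (1 + r1): all transported functions
     are supported in the ball of radius [rho]. *)
  pose rho := M1 * (1 + r1) + 1.
  have rho0 : 0 < rho by rewrite ltr_wpDl// mulr_ge0// addr_ge0// ltW.
  have out b w y : 0 < b -> affC b w <= M1 -> rho < enorm y -> phi (aff b w y) = 0.
    move=> b0 bM ry; apply: hr; rewrite ltNge; apply/negP => h.
    move: ry; rewrite ltNge => /negP; apply.
    apply: (le_trans (enorm_le_japanese y)); rewrite -(affK w (lt0r_neq0 b0) y).
    apply: (le_trans (japanese_affV _ _ b0)); rewrite /rho -[leLHS]addr0 lerD//.
    apply: ler_pM => //; [exact: (le_trans ler01 (affC_ge1 w b0))|exact: japanese_ge0|].
    apply: (le_trans (japanese_le1 _)); rewrite lerD2l (le_trans h)// ltW//.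
  have outn n y : rho < enorm y -> phi (aff (a_ n) (u_ n) y) = 0.
    by apply: out => //; rewrite (le_trans (hN n))// lerDl.
  have outa y : rho < enorm y -> phi (aff a u y) = 0.
    by apply: out => //; rewrite lerDr.
  pose k y := \1_[set y : V | enorm y <= rho] y * (B + B).
  have mk : measurable_fun setT k.
    apply: measurable_funM => //; apply/measurable_indicP.
    rewrite (_ : mkset _ = setT `&` @enorm R d @^-1` `]-oo, rho]).
      by apply: measurable_enorm => //; exact: measurable_itv.
    by rewrite setTI; apply/seteqP; split => v /=; rewrite in_itv.
  have kq : in_L1 q k.
    apply: (@chi_in_L1 _ _ q k rho (B + B) rho0 mk) => v.
      by rewrite /k indicE; case: (_ \in _); rewrite ?mul1r ?mul0r ?normr0 ?ger0_norm ?addr_ge0.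
    by move=> vr; rewrite /k indicE memNset ?mul0r//= leNgt vr.
  have -> : (0 : R) = \int[leb]_v (0 : R) by rewrite Rintegral_cst// mul0r.
  apply: (@Rint_dct _ _ _ leb (fun m v =>
     `|((phi \o aff (a_ m) (u_ m)) \- (phi \o aff a u)) v| * japanese v ^+ q) (fun=> 0)
      (fun v => `|k v| * japanese v ^+ q)).
  + move=> m; apply: measurable_funM; last exact: measurable_japaneseX.
    apply: measurableT_comp => //; apply: measurable_funB.
      exact: (measurableT_comp mphi (measurable_aff _ _)).
    exact: (measurableT_comp mphi (measurable_aff _ _)).
  + move=> v; rewrite -(mul0r (japanese v ^+ q)); apply: cvgMl.
    rewrite -(normr0 R); apply: cvg_norm; rewrite -(subrr (phi (aff a u v))).
    apply: cvgB; last exact: cvg_cst.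
    have cv := @aff_cvg v; rewrite /comp; apply: (@cvg_comp _ _ _ (fun n => aff (a_ n) (u_ n) v) phi); first exact: cv.
    exact: cphi.
  + exact: in_L1_itg.
  + move=> m v; rewrite ger0_norm; last by rewrite mulr_ge0 ?exprn_ge0 ?japanese_ge0.
    rewrite ler_wpM2r ?exprn_ge0 ?japanese_ge0//=.
    have [vr|vr] := leP (enorm v) rho.
      rewrite /k indicE mem_set// mul1r (ger0_norm (addr_ge0 B0 B0)).
      by rewrite (le_trans (ler_normB _ _))// lerD.
    by rewrite outn// outa// subrr normr0.
Qed.

End affine_continuity.

(** * Curves in L1 and evolution equations *)

(** Truncating the weight [k] at level n and letting n grow gives measurability in time of moments
    too high to depend continuously on time. *)
Lemma measurable_fine_lim d (T : measurableType d) (R : realType)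
  (mu : {measure set T -> \bar R}) (k : T -> R) (H : R -> T -> R) :
  measurable_fun setT k -> (forall x, 0 <= k x) -> (forall t x, 0 <= H t x) ->
  (forall n t, itg mu (fun x => Num.min (k x) n%:R * H t x)) ->
  (forall t, measurable_fun setT (H t)) ->
  (forall n : nat, measurable_fun setT (fun t => \int[mu]_x (Num.min (k x) n%:R * H t x))) ->
  measurable_fun setT (fun t => (\int[mu]_x (k x * H t x)%:E)%E).
Proof.
move=> mk k0 H0 iH mH mI.
have c0 n t x : 0 <= Num.min (k x) n%:R * H t x.
  by rewrite mulr_ge0// le_min k0 ler0n.
apply: (@emeasurable_fun_cvg _ _ _ _
  (fun n t => (\int[mu]_x (Num.min (k x) n%:R * H t x)%:E)%E)).
  move=> n; rewrite (_ : (fun t => _) =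
    (fun t => (\int[mu]_x (Num.min (k x) n%:R * H t x))%:E)); last first.
    by apply/funext => t; rewrite EFin_Rintegral.
  exact/measurable_EFinP.
move=> t _.
have -> : (\int[mu]_x (k x * H t x)%:E = \int[mu]_x
    (limn (fun n => (Num.min (k x) n%:R * H t x)%:E)))%E.
  apply: eq_integral => x _; apply/esym/cvg_lim => //.
  apply: cvg_near_cst; have := nbhs_infty_ger (k x); apply: filterS => n kn.
  by rewrite min_l.
apply: cvg_monotone_convergence => //.
- by move=> n; apply/measurable_EFinP; exact: itg_meas (iH n t).
- by move=> n x _; rewrite lee_fin.
- move=> x _ m n mn; rewrite lee_fin ler_wpM2r// le_min ge_min lexx/=.
  by rewrite ge_min ler_nat mn orbT.
Qed.

Section curve.
Context {R : realType} {d : nat}.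
Local Notation V := 'rV[R]_d.
Local Notation leb := (@lebesgue_rV R d).
Local Notation leb2 := (leb \x leb)%E.
Local Notation mu := (@lebesgue_measure R).
Implicit Types (h : R -> V -> R) (k phi : V -> R) (K : V * V -> R) (t C : R).

(** The part of the solution class concerned with L^1_2 alone, with continuity along sequences. The
    third moment is handled apart because it need not be finite at every time. *)
Record curve h : Prop := Curve {
  curve_ge0 : forall t, 0 <= t -> forall v, 0 <= h t v;
  curve_L12 : forall t, 0 <= t -> in_L1 2 (h t);
  curve_cvg : forall t, 0 <= t -> forall u : nat -> R, (forall n, 0 <= u n) ->
    u n @[n --> \oo] --> t -> Nrm 2 (h (u n) \- h t) @[n --> \oo] --> (0 : R) }.

Lemma solution_class_curve h : solution_class h -> curve h.
Proof.
move=> [h0 h2 hc _]; split => // t t0 u u0 ut.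
have := within_seq (hc t t0) u0 ut.
rewrite (_ : (fun n => _) = EFin \o (fun n => Nrm 2 (h (u n) \- h t))).
  by move=> /fine_cvg.
by apply/funext => n; rewrite /= L1normE//; apply: in_L1B; exact: h2.
Qed.

Lemma curve_solution_class h : curve h ->
  (forall a b : R, 0 < a -> a <= b -> mu.-integrable `[a, b] (fun s => L1norm 3 (h s))) ->
  solution_class h.
Proof.
move=> [h0 h2 hc] hl; split => // t t0.
have : (fun s => Nrm 2 (h s \- h t)) @ within [set s | 0 <= s] (nbhs t) --> (0 : R).
  by apply: seq_within => u u0 ut; exact: hc.
move=> H.
have : EFin \o (fun s => Nrm 2 (h s \- h t)) @ within [set s | 0 <= s] (nbhs t) --> 0%E.
  by apply: cvg_EFin => //; exact: nearW.
apply: cvg_trans; apply: near_eq_cvg; rewrite near_withinE; apply: nearW => s /= s0.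
by rewrite L1normE//; apply: in_L1B; exact: h2.
Qed.

Section fixed_curve.
Variables (h : R -> V -> R).
Hypothesis hcurve : curve h.

Lemma in_L1_pairC q (f : V -> R) k C : in_L1 q f -> measurable_fun setT k ->
  (forall v, `|k v| <= C * japanese v ^+ q) -> itg leb (fun v => f v * k v).
Proof. by move=> fq mk kC; have [] := in_L1_pair fq mk kC. Qed.

(** Time and test function vary together, as is needed for tests that move with time; quadratic
    growth is the most that continuity in L^1_2 allows. *)
Lemma curve_pair_seq t (u : nat -> R) (k_ : nat -> V -> R) k C : 0 <= t ->
  (forall n, 0 <= u n) -> u n @[n --> \oo] --> t ->
  (forall n, measurable_fun setT (k_ n)) ->
  (forall n v, `|k_ n v| <= C * japanese v ^+ 2) ->
  (forall v, k_ n v @[n --> \oo] --> k v) ->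
  \int[leb]_v (h (u n) v * k_ n v) @[n --> \oo] --> \int[leb]_v (h t v * k v).
Proof.
move=> t0 u0 ut mk kC kk; have ht2 := curve_L12 hcurve t0.
have hu2 n := curve_L12 hcurve (u0 n).
have c1 : \int[leb]_v (h t v * k_ n v) @[n --> \oo] --> \int[leb]_v (h t v * k v).
  apply: (@Rint_dct _ _ _ leb (fun n v => h t v * k_ n v) (fun v => h t v * k v)
    (fun v => C * (`|h t v| * japanese v ^+ 2))).
  - by move=> n; apply: measurable_funM => //; exact: in_L1_meas ht2.
  - by move=> v; apply: cvgMr; exact: kk.
  - by apply: itgZ; exact: in_L1_itg.
  - by move=> n v; rewrite normrM mulrCA ler_wpM2l.
have c2 : \int[leb]_v ((h (u n) \- h t) v * k_ n v) @[n --> \oo] --> (0 : R).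
  apply/norm_cvg0P; apply: (squeeze_cvgr _ (cvg_cst 0) (_ : C * Nrm 2 (h (u n) \- h t) @[n --> \oo] --> 0)).
    by apply: nearW => n; rewrite normr_ge0 /=; have [_] := in_L1_pair (in_L1B (hu2 n) ht2) (mk n) (kC n).
  by rewrite -(mulr0 C); apply: cvgMr; exact: (curve_cvg hcurve t0 u0 ut).
have c3 := cvgD c2 c1; rewrite add0r in c3.
rewrite (_ : (fun n => _) = (fun n => \int[leb]_v ((h (u n) \- h t) v * k_ n v) +
  \int[leb]_v (h t v * k_ n v))); first exact: c3.
apply/funext => n; rewrite -RintD; last exact: in_L1_pairC ht2 (mk n) (kC n).
  by apply: eq_Rint => v /=; ring.
exact: in_L1_pairC (in_L1B (hu2 n) ht2) (mk n) (kC n).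
Qed.

Lemma curve_bil_seq t (u : nat -> R) (K_ : nat -> V * V -> R) K C : 0 <= t ->
  (forall n, 0 <= u n) -> u n @[n --> \oo] --> t ->
  (forall n, measurable_fun setT (K_ n)) ->
  (forall n p, `|K_ n p| <= C * (japanese p.1 ^+ 2 * japanese p.2 ^+ 2)) ->
  (forall p, K_ n p @[n --> \oo] --> K p) ->
  bil (K_ n) (h (u n)) (h (u n)) @[n --> \oo] --> bil K (h t) (h t).
Proof.
move=> t0 u0 ut mK KC KK; have ht2 := curve_L12 hcurve t0.
have hu2 n := curve_L12 hcurve (u0 n); have mht := in_L1_meas ht2.
have c1 : bil (K_ n) (h t) (h t) @[n --> \oo] --> bil K (h t) (h t).
  apply: (@Rint_dct _ _ _ leb2 (fun n p => K_ n p * (h t p.1 * h t p.2))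
     (fun p => K p * (h t p.1 * h t p.2))
    (fun p => C * ((`|h t p.1| * japanese p.1 ^+ 2) * (`|h t p.2| * japanese p.2 ^+ 2)))).
  - by move=> n; apply: measurable_funM => //; exact: meas_tensor.
  - by move=> p; apply: cvgMl; exact: KK.
  - by apply: itgZ; exact: (itg_tensor (in_L1_itg ht2) (in_L1_itg ht2)).
  - move=> n p; rewrite !normrM [leLHS]mulrC [leRHS](_ : _ = (`|h t p.1| * `|h t p.2|) *
      (C * (japanese p.1 ^+ 2 * japanese p.2 ^+ 2))); last by ring.
    by rewrite ler_wpM2l.
have c2 : (bil (K_ n) (h (u n)) (h (u n)) - bil (K_ n) (h t) (h t)) @[n --> \oo] --> (0 : R).
  apply/norm_cvg0P; apply: (squeeze_cvgr _ (cvg_cst 0) (_ : C * (Nrm 2 (h (u n) \- h t) *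
      (2 * Nrm 2 (h t) + Nrm 2 (h (u n) \- h t))) @[n --> \oo] --> 0)).
    by apply: nearW => n; rewrite normr_ge0 /=; exact: bil_diff_le (mK n) (KC n) (hu2 n) ht2.
  have cn := curve_cvg hcurve t0 u0 ut.
  have := cvgM (cvg_cst C) (cvgM cn (cvgD (cvg_cst (2 * Nrm 2 (h t))) cn)).
  by rewrite mul0r mulr0; exact.
have c3 := cvgD c2 c1; rewrite add0r in c3.
rewrite (_ : (fun n => _) = (fun n => (bil (K_ n) (h (u n)) (h (u n)) - bil (K_ n) (h t) (h t)) +
  bil (K_ n) (h t) (h t))); first exact: c3.
by apply/funext => n; rewrite subrK.
Qed.

Lemma curve_pair k C : measurable_fun setT k -> (forall v, `|k v| <= C * japanese v ^+ 2) ->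
  scont (fun t => \int[leb]_v (h t v * k v)).
Proof.
by move=> mk kC t t0 u u0 ut; apply: (curve_pair_seq t0 u0 ut (fun=> mk) (fun=> kC)) => v; exact: cvg_cst.
Qed.

Lemma curve_bil K C : measurable_fun setT K ->
  (forall p, `|K p| <= C * (japanese p.1 ^+ 2 * japanese p.2 ^+ 2)) ->
  scont (fun t => bil K (h t) (h t)).
Proof.
by move=> mK KC t t0 u u0 ut; apply: (curve_bil_seq t0 u0 ut (fun=> mK) (fun=> KC)) => v; exact: cvg_cst.
Qed.

Lemma curve_Nrm2 : scont (fun t => Nrm 2 (h t)).
Proof.
move=> t t0 u u0 ut.
have b (v : V) : `|japanese v ^+ 2| <= 1 * japanese v ^+ 2.
  by rewrite mul1r ger0_norm ?exprn_ge0 ?japanese_ge0.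
have E s : 0 <= s -> Nrm 2 (h s) = \int[leb]_v (h s v * japanese v ^+ 2).
  by move=> s0; apply: eq_Rint => v; rewrite ger0_norm// (curve_ge0 hcurve).
rewrite E//; apply: (cvg_ext (fun n => E _ (u0 n))).
exact: (curve_pair (measurable_japaneseX 2) b t0 u0 ut).
Qed.

Lemma curve_Nrm2_bounded T : exists C, 0 <= C /\
  forall t, 0 <= t -> t <= T -> Nrm 2 (h t) <= C.
Proof.
have [C [C0 hC]] := scont_bounded T curve_Nrm2; exists C; split => // t t0 tT.
by have := hC t t0 tT; rewrite ger0_norm ?Nrm_ge0.
Qed.

Let max0_ge0 t : 0 <= Num.max t 0.
Proof. by rewrite le_max lexx orbT. Qed.

Lemma curve_pair_measurable k : measurable_fun setT k -> (forall v, 0 <= k v) ->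
  measurable_fun setT (fun t => (\int[leb]_v (k v * h (Num.max t 0) v)%:E)%E).
Proof.
move=> mk k0.
have b n (v : V) : `|Num.min (k v) n%:R| <= n%:R * japanese v ^+ 2.
  rewrite ger0_norm ?le_min ?k0 ?ler0n// (@le_trans _ _ n%:R) ?ge_min ?lexx ?orbT//.
  by rewrite ler_peMr ?ler0n// japanese_exp_ge1.
have mm n : measurable_fun setT (fun v => Num.min (k v) n%:R) by exact: measurable_minr.
apply: measurable_fine_lim => //.
- by move=> t v; exact: (curve_ge0 hcurve).
- move=> n t; have := in_L1_pairC (curve_L12 hcurve (max0_ge0 t)) (mm n) (b n).
  by under eq_fun do rewrite mulrC.
- by move=> t; exact: in_L1_meas (curve_L12 hcurve (max0_ge0 t)).
- move=> n; have := scont_measurable (curve_pair (mm n) (b n)).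
  by congr measurable_fun; apply/funext => t; apply: eq_Rint => v; rewrite mulrC.
Qed.

Lemma curve_bil_measurable K : measurable_fun setT K -> (forall p, 0 <= K p) ->
  measurable_fun setT (fun t => bil K (h (Num.max t 0)) (h (Num.max t 0))).
Proof.
move=> mK K0.
have b n (p : V * V) : `|Num.min (K p) n%:R| <= n%:R * (japanese p.1 ^+ 2 * japanese p.2 ^+ 2).
  rewrite ger0_norm ?le_min ?K0 ?ler0n// (@le_trans _ _ n%:R) ?ge_min ?lexx ?orbT//.
  rewrite ler_peMr ?ler0n// -[leLHS]mulr1 ler_pM// japanese_exp_ge1//.
have mm n : measurable_fun setT (fun p => Num.min (K p) n%:R) by exact: measurable_minr.
have L2 t := curve_L12 hcurve (max0_ge0 t).
apply: (@measurableT_comp _ _ _ _ _ _ fine) => //.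
apply: measurable_fine_lim => //.
- by move=> t p; rewrite mulr_ge0// (curve_ge0 hcurve).
- by move=> n t; exact: itg_bil (mm n) (b n) (L2 t) (L2 t).
- by move=> t; apply: meas_tensor; exact: in_L1_meas (L2 t).
- by move=> n; exact: scont_measurable (curve_bil (mm n) (b n)).
Qed.

End fixed_curve.
End curve.

Section collision_limits.
Context {R : realType} {d : nat}.
Local Notation V := 'rV[R]_d.
Local Notation leb := (@lebesgue_rV R d).
Local Notation leb2 := (leb \x leb)%E.
Local Notation sph := (@sphere_measure R d).
Variable alpha : R.
Hypotheses (alpha_gt0 : 0 < alpha) (alpha_lt1 : alpha < 1).
Implicit Types (h k phi psi : V -> R) (q : nat) (C : R) (p : V * V).

Lemma avg_bound2 C phi p : measurable_fun setT phi ->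
  (forall v, `|phi v| <= C * japanese v ^+ 2) ->
  `|avg phi p| <= C * (japanese p.1 ^+ 2 + japanese p.2 ^+ 2).
Proof.
move=> mphi phiC; have [i1 _] := itg_avg p mphi phiC.
have C0 : 0 <= C.
  have := le_trans (normr_ge0 _) (phiC 0).
  by rewrite pmulr_lge0// exprn_gt0// japanese_gt0.
have b s : `|phi (vpost p.1 p.2 (radial_proj s))| <= C * (japanese p.1 ^+ 2 + japanese p.2 ^+ 2).
  apply: (le_trans (phiC _)); rewrite ler_wpM2l//.
  have := japanese_vpostD p.1 p.2 s.
  by have := sqr_ge0 (japanese (vpost_star p.1 p.2 (radial_proj s))); lra.
apply: (le_trans (norm_Rint_le i1 (itg_sphere_cst _) b)).
by rewrite Rint_sphere_cst.
Qed.

(** Uses <v'>^2 <= <v>^2 + <w>^2 instead of the product bound, so the powers split as 3 + 1 or 1 + 3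
    rather than 3 + 3. *)
Lemma Kcoll_bound3 C phi p : measurable_fun setT phi ->
  (forall v, `|phi v| <= C * japanese v ^+ 2) ->
  `|Kcoll alpha phi p| <= 4 * C * (japanese p.1 ^+ 3 * japanese p.2 ^+ 1
                                 + japanese p.1 ^+ 1 * japanese p.2 ^+ 3).
Proof.
move=> mphi phiC; rewrite /Kcoll normrM (ger0_norm (enorm_ge0 _)).
have b1 := avg_bound2 p mphi phiC; have b2 := phiC p.1.
have b3 := enormB_japanese p.1 p.2.
have C0 : 0 <= C.
  by have := le_trans (normr_ge0 _) b2; rewrite pmulr_lge0// exprn_gt0// japanese_gt0.
have n0 : 0 <= 1 - alpha by rewrite subr_ge0 ltW.
have b4 : `|(1 - alpha) * avg phi p - phi p.1| <=
    2 * C * (japanese p.1 ^+ 2 + japanese p.2 ^+ 2).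
  apply: (le_trans (ler_normB _ _)); rewrite normrM (ger0_norm n0).
  have := ler_wpM2r (normr_ge0 (avg phi p)) (_ : 1 - alpha <= 1).
  rewrite gerBl ltW// => /(_ isT).
  have := sqr_ge0 (japanese p.2) => j2 h1.
  have : C * japanese p.2 ^+ 2 >= 0 by rewrite mulr_ge0.
  rewrite mul1r in h1; lra.
apply: (le_trans (ler_pM _ _ b3 b4)); rewrite ?enorm_ge0// le_eqVlt; apply/orP; left; apply/eqP; ring.
Qed.

(** Linear in the third moment. This is essential, since that moment is only locally integrable in
    time and its square need not be. *)
Lemma coll_bound3 C phi h : in_L1 3 h -> measurable_fun setT phi ->
  (forall v, `|phi v| <= C * japanese v ^+ 2) ->
  `|coll alpha h phi| <= 8 * C * (Nrm 3 h * Nrm 1 h).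
Proof.
move=> h3 mphi phiC; have h1 := in_L1_le (isT : (1 <= 3)%N) h3.
have i3 := in_L1_itg h3; have i1 := in_L1_itg h1.
have iK := itg_bil (measurable_Kcoll alpha mphi) (Kcoll_bound alpha_gt0 alpha_lt1 mphi phiC) h3 h3.
have t31 := itg_tensor i3 i1; have t13 := itg_tensor i1 i3.
have b p : `|Kcoll alpha phi p * (h p.1 * h p.2)| <=
   4 * C * ((`|h p.1| * japanese p.1 ^+ 3) * (`|h p.2| * japanese p.2 ^+ 1) +
   (`|h p.1| * japanese p.1 ^+ 1) * (`|h p.2| * japanese p.2 ^+ 3)).
  have := Kcoll_bound3 p mphi phiC; move: (Kcoll alpha phi p) => K KC.
  rewrite !normrM [leLHS]mulrC [leRHS](_ : _ = (`|h p.1| * `|h p.2|) * (4 * C *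
    (japanese p.1 ^+ 3 * japanese p.2 ^+ 1 + japanese p.1 ^+ 1 * japanese p.2 ^+ 3))); last by ring.
  by rewrite ler_wpM2l.
apply: (le_trans (norm_Rint_le iK (itgZ _ (itgD t31 t13)) b)).
rewrite (RintZ _ (itgD t31 t13)) (RintD t31 t13) (Rint_tensor i3 i1) (Rint_tensor i1 i3).
by rewrite le_eqVlt; apply/orP; left; apply/eqP; rewrite /Nrm; ring.
Qed.

Lemma Kcoll_cvg q C (phi_ : nat -> V -> R) phi p : (forall n, measurable_fun setT (phi_ n)) ->
  (forall n v, `|phi_ n v| <= C * japanese v ^+ q) ->
  (forall v, phi_ n v @[n --> \oo] --> phi v) ->
  Kcoll alpha (phi_ n) p @[n --> \oo] --> Kcoll alpha phi p.
Proof.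
move=> mphi phiC phic; have C0 : 0 <= C.
  have := le_trans (normr_ge0 _) (phiC 0 0).
  by rewrite pmulr_lge0// exprn_gt0// japanese_gt0.
have ca : avg (phi_ n) p @[n --> \oo] --> avg phi p.
  apply: (@Rint_dct _ _ _ sph (fun n s => phi_ n (vpost p.1 p.2 (radial_proj s)))
    (fun s => phi (vpost p.1 p.2 (radial_proj s)))
    (fun=> C * (japanese p.1 ^+ q * japanese p.2 ^+ q))).
  - by move=> n; have [/itg_meas] := itg_avg p (mphi n) (phiC n).
  - by move=> s; exact: phic.
  - exact: itg_sphere_cst.
  - move=> n s; apply: (le_trans (phiC _ _)); rewrite ler_wpM2l// -exprMn.
    by rewrite lerXn2r ?nnegrE ?mulr_ge0 ?japanese_ge0// japanese_vpost_le.
exact: (cvgM (cvg_cst _) (cvgB (cvgM (cvg_cst _) ca) (phic p.1))).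
Qed.

Lemma coll_cvg q C (phi_ : nat -> V -> R) phi h : in_L1 q.+1 h ->
  (forall n, measurable_fun setT (phi_ n)) ->
  (forall n v, `|phi_ n v| <= C * japanese v ^+ q) ->
  (forall v, phi_ n v @[n --> \oo] --> phi v) ->
  coll alpha h (phi_ n) @[n --> \oo] --> coll alpha h phi.
Proof.
move=> hq mphi phiC phic; have mh := in_L1_meas hq.
apply: (@Rint_dct _ _ _ leb2 (fun n p => Kcoll alpha (phi_ n) p * (h p.1 * h p.2))
     (fun p => Kcoll alpha phi p * (h p.1 * h p.2))
    (fun p => 4 * C * ((`|h p.1| * japanese p.1 ^+ q.+1) * (`|h p.2| * japanese p.2 ^+ q.+1)))).
- by move=> n; apply: measurable_funM; [exact: measurable_Kcoll|exact: meas_tensor].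
- by move=> p; apply: cvgMl; exact: Kcoll_cvg mphi phiC phic.
- by apply: itgZ; exact: (itg_tensor (in_L1_itg hq) (in_L1_itg hq)).
- move=> n p; have := Kcoll_bound alpha_gt0 alpha_lt1 (mphi n) (phiC n) p.
  move: (Kcoll alpha (phi_ n) p) => K KC.
  rewrite !normrM [leLHS]mulrC [leRHS](_ : _ = (`|h p.1| * `|h p.2|) *
      (4 * C * (japanese p.1 ^+ q.+1 * japanese p.2 ^+ q.+1))); last by ring.
  by rewrite ler_wpM2l.
Qed.

(** For tests of at most linear growth the collision term is controlled by L^1_2, hence it is
    defined at every time and continuous. *)
Lemma Kcoll_bound2 q C phi : (q <= 1)%N -> measurable_fun setT phi ->
  (forall v, `|phi v| <= C * japanese v ^+ q) ->
  forall p, `|Kcoll alpha phi p| <= (4 * C) * (japanese p.1 ^+ 2 * japanese p.2 ^+ 2).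
Proof.
move=> q1 mphi phiC p; apply: Kcoll_bound => // v; apply: (le_trans (phiC v)).
rewrite ler_wpM2l ?japanese_exp_le//.
have := le_trans (normr_ge0 _) (phiC 0).
by rewrite pmulr_lge0// exprn_gt0// japanese_gt0.
Qed.

Lemma curve_coll_seq (h : R -> V -> R) q C (phi_ : nat -> V -> R) phi (t : R) (u : nat -> R) :
  curve h -> (q <= 1)%N -> 0 <= t -> (forall n, 0 <= u n) -> u n @[n --> \oo] --> t ->
  (forall n, measurable_fun setT (phi_ n)) ->
  (forall n v, `|phi_ n v| <= C * japanese v ^+ q) ->
  (forall v, phi_ n v @[n --> \oo] --> phi v) ->
  coll alpha (h (u n)) (phi_ n) @[n --> \oo] --> coll alpha (h t) phi.
Proof.
move=> ch q1 t0 u0 ut mphi phiC phic.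
apply: (curve_bil_seq ch t0 u0 ut (fun n => measurable_Kcoll alpha (mphi n))
  (fun n => Kcoll_bound2 q1 (mphi n) (phiC n))) => p.
exact: Kcoll_cvg mphi phiC phic.
Qed.

Lemma curve_coll (h : R -> V -> R) q C phi : curve h -> (q <= 1)%N -> measurable_fun setT phi ->
  (forall v, `|phi v| <= C * japanese v ^+ q) -> scont (fun t => coll alpha (h t) phi).
Proof.
move=> ch q1 mphi phiC; exact: (curve_bil ch (measurable_Kcoll alpha mphi) (Kcoll_bound2 q1 mphi phiC)).
Qed.

End collision_limits.

Section compact_tests.
Context {R : realType} {d : nat}.
Local Notation V := 'rV[R]_d.
Implicit Types (phi : V -> R) (dphi : 'I_d -> V -> R) (r : R).

Definition euler dphi (v : V) : R := \sum_i v 0 i * dphi i v.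

Lemma enorm_continuous : continuous (@enorm R d).
Proof.
move=> v; apply: (@continuous_comp _ _ _ (fun v : V => \sum_i v 0 i ^+ 2) (@Num.sqrt R)).
  have -> : (fun v : V => \sum_i v 0 i ^+ 2) = (fun v : V => enorm v ^+ 2).
    by apply/funext => w; rewrite enorm_sqr.
  exact: (has_grad_continuous has_grad_enorm_sqr).
exact: sqrt_continuous.
Qed.

Lemma test_grad_out phi dphi r : has_grad phi dphi -> (forall v, r < enorm v -> phi v = 0) ->
  forall i v, r < enorm v -> dphi i v = 0.
Proof.
move=> hg hr i v rv; rewrite -(has_grad_partial i v hg).
rewrite (@near_eq_derive _ _ _ phi (fun=> 0) v) ?derive_cst//.
have := @enorm_continuous v => /cvgrPdist_lt /(_ (enorm v - r)).
rewrite subr_gt0 => /(_ rv); apply: filterS => w.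
by rewrite ltr_norml => /andP[_ h]; apply: hr; move: h; lra.
Qed.

Lemma test_bounded phi dphi r : has_grad phi dphi -> (forall v, r < enorm v -> phi v = 0) ->
  exists C, [/\ 0 <= C, forall v, `|phi v| <= C, forall i v, `|dphi i v| <= C,
    forall v, `|euler dphi v| <= C & measurable_fun setT (euler dphi)].
Proof.
move=> hg hr; have out := test_grad_out hg hr.
have [B [B0 hB]] := cc_bounded (has_grad_continuous hg) hr.
have /choice[D hD] : forall i, exists D, 0 <= D /\ forall v, `|dphi i v| <= D.
  by move=> i; case: hg => _ _ cd; exact: (cc_bounded (cd i) (out i)).
have mE : measurable_fun setT (euler dphi).
  apply: measurable_sum => i; apply: measurable_funM; first exact: measurable_coord.
  exact: has_grad_measurable_d hg.
have S0 : 0 <= \sum_i D i by apply: sumr_ge0 => i _; have [] := hD i.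
have DS i : D i <= \sum_j D j.
  by rewrite (bigD1 i)//= lerDl; apply: sumr_ge0 => j _; have [] := hD j.
exists (B + (\sum_i D i) + `|r| * (\sum_i D i)); split => //.
- by rewrite !addr_ge0// mulr_ge0.
- by move=> v; rewrite (le_trans (hB v))// -addrA lerDl addr_ge0// mulr_ge0.
- move=> i v; apply: (le_trans ((hD i).2 v)); apply: (le_trans (DS i)).
  by rewrite -addrA addrCA lerDl addr_ge0// mulr_ge0.
- move=> v; have [vr|vr] := leP (enorm v) r; last first.
    rewrite /euler big1 ?normr0 ?addr_ge0 ?mulr_ge0// => i _.
    by rewrite out// mulr0.
  apply: (@le_trans _ _ (`|r| * \sum_i D i)); last by rewrite lerDr addr_ge0.
  rewrite mulr_sumr; apply: (le_trans (ler_norm_sum _ _ _)); apply: ler_sum => i _.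
  rewrite normrM ler_pM//; last by have [] := hD i.
  by rewrite (le_trans (ler_coord_enorm _ _))// (le_trans vr)// ler_norm.
Qed.

Lemma test_functionP phi : test_function phi <->
  exists dphi r, has_grad phi dphi /\ forall v, r < enorm v -> phi v = 0.
Proof.
split => [[d1 c1 [r hr]]|[dphi [r [hg hr]]]].
  by exists (fun i v => 'D_(delta_mx 0 i) phi v), r; split => //; exact: has_grad_derive.
split; [by case: hg| |by exists r].
move=> i; rewrite (_ : (fun v => _) = dphi i); first by case: hg.
by apply/funext => v; exact: has_grad_partial.
Qed.

End compact_tests.

Section cutoff_bounds.
Context {R : realType} {d : nat}.
Local Notation V := 'rV[R]_d.

Definition dchi (r : R) (i : 'I_d) (v : V) : R :=
  - (4 / r ^+ 2) * Num.max (1 - enorm v ^+ 2 / r ^+ 2) 0 * v 0 i.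

Lemma euler_dchi r v : euler (dchi r) v =
  - 4 * (Num.max (1 - enorm v ^+ 2 / r ^+ 2) 0 * (enorm v ^+ 2 / r ^+ 2)).
Proof.
rewrite /euler /dchi [in X in _ = _ * (_ * X)]enorm_sqr.
rewrite mulr_suml !mulr_sumr; apply: eq_bigr => i _; ring.
Qed.

Let max01 (x : R) : 0 <= x -> 0 <= Num.max (1 - x) 0 <= 1.
Proof. by move=> x0; rewrite le_max lexx orbT /= ge_max ler01 andbT gerBl. Qed.

(** The bound does not depend on r, and the same holds for the radial derivative: cutting off a
    function of quadratic growth keeps its gradient bounds up to a fixed factor. *)
Lemma dchi_le r i v : 1 <= r -> `|dchi r i v| <= 4.
Proof.
move=> r1; have r0 : 0 < r := lt_le_trans ltr01 r1.
have e0 := enorm_ge0 v; have vi := ler_coord_enorm v i.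
have q0 : 0 <= enorm v ^+ 2 / r ^+ 2 by rewrite divr_ge0// sqr_ge0.
have /andP[m0 m1] := max01 q0.
rewrite /dchi !normrM normrN (ger0_norm m0) (ger0_norm (_ : 0 <= 4 / r ^+ 2)); last first.
  by rewrite divr_ge0// sqr_ge0.
have [vr|vr] := leP (enorm v) r; last first.
  rewrite max_r ?mulr0 ?mul0r// subr_le0 ler_pdivlMr ?exprn_gt0// mul1r.
  by rewrite lerXn2r ?nnegrE ?(ltW r0)// ltW.
have h : `|v 0 i| / r ^+ 2 <= 1.
  rewrite ler_pdivrMr ?exprn_gt0// mul1r (le_trans vi)// (le_trans vr)//.
  by rewrite ler_eXnr.
have -> : 4 / r ^+ 2 * Num.max (1 - enorm v ^+ 2 / r ^+ 2) 0 * `|v 0 i| =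
  4 * (Num.max (1 - enorm v ^+ 2 / r ^+ 2) 0 * (`|v 0 i| / r ^+ 2)) by ring.
rewrite -[leRHS]mulr1 ler_wpM2l//; apply: mulr_ile1 => //; rewrite divr_ge0 ?sqr_ge0//.
Qed.

Lemma euler_dchi_le r v : `|euler (dchi r) v| <= 4.
Proof.
rewrite euler_dchi; have q0 : 0 <= enorm v ^+ 2 / r ^+ 2 by rewrite divr_ge0// sqr_ge0.
rewrite normrM normrN normr_nat -[leRHS]mulr1 ler_wpM2l ?ler0n//.
move: q0; move: (_ / _) => x x0; have /andP[m0 m1] := max01 x0.
rewrite ger0_norm ?mulr_ge0//; case: (leP (1 - x) 0) => h; first by rewrite mul0r.
by nra.
Qed.

Let small (c : R) : c / n.+1%:R @[n --> \oo] --> (0 : R).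
Proof. by rewrite -(mulr0 c); apply: cvgMr; exact: cvg_harmonic. Qed.

Let squeeze0 (x y : nat -> R) : (forall n, `|x n| <= y n) -> y n @[n --> \oo] --> (0 : R) ->
  x n @[n --> \oo] --> (0 : R).
Proof.
move=> xy y0; apply/norm_cvg0P; apply: (squeeze_cvgr _ (cvg_cst 0) y0).
by apply: nearW => n; rewrite normr_ge0 xy.
Qed.

Let inv_sqr n : (n.+1%:R ^+ 2 : R)^-1 <= n.+1%:R^-1.
Proof. by rewrite lef_pV2 ?posrE ?exprn_gt0 ?ltr0n// ler_eXnr// ler1n. Qed.

Lemma dchi_cvg i v : dchi n.+1%:R i v @[n --> \oo] --> (0 : R).
Proof.
apply: (squeeze0 _ (small (4 * `|v 0 i|))) => n.
have q0 : 0 <= enorm v ^+ 2 / (n.+1%:R : R) ^+ 2 by rewrite divr_ge0// sqr_ge0.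
have /andP[m0 m1] := max01 q0.
have p0 : 0 <= 4 / (n.+1%:R : R) ^+ 2 by rewrite divr_ge0 ?sqr_ge0.
rewrite /dchi !normrM normrN (ger0_norm m0) (ger0_norm p0).
apply: (@le_trans _ _ (4 / n.+1%:R ^+ 2 * `|v 0 i|)).
  by rewrite ler_wpM2r// ler_piMr.
by rewrite mulrAC ler_wpM2l ?mulr_ge0.
Qed.

Lemma euler_dchi_cvg v : euler (dchi n.+1%:R) v @[n --> \oo] --> (0 : R).
Proof.
apply: (squeeze0 _ (small (4 * enorm v ^+ 2))) => n; rewrite euler_dchi.
have q0 : 0 <= enorm v ^+ 2 / (n.+1%:R : R) ^+ 2 by rewrite divr_ge0// sqr_ge0.
have /andP[m0 m1] := max01 q0.
rewrite normrM normrN normr_nat -mulrA ler_wpM2l ?ler0n// (ger0_norm (mulr_ge0 m0 q0)).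
by apply: (le_trans (ler_piMl q0 m1)); rewrite ler_wpM2l ?sqr_ge0.
Qed.

End cutoff_bounds.

Section evolution.
Context {R : realType} {d : nat}.
Local Notation V := 'rV[R]_d.
Local Notation leb := (@lebesgue_rV R d).
Local Notation mu := (@lebesgue_measure R).
Variable alpha : R.
Hypotheses (alpha_gt0 : 0 < alpha) (alpha_lt1 : alpha < 1).
Implicit Types (phi : V -> R) (dphi : 'I_d -> V -> R).

(* The equation with transport coefficients: the weak form of
   h_t = a h - div ((b v - c) h) + (1 - alpha) Q(h, h) - alpha Q_-(h, h). *)
Definition lin_rhs (a b : R -> R) (c : 'I_d -> R -> R) (h : R -> V -> R) phi dphi (t : R) : R :=
  a t * (\int[leb]_v (h t v * phi v)) + b t * (\int[leb]_v (h t v * euler dphi v))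
  - \sum_i c i t * (\int[leb]_v (h t v * dphi i v)).

(** The gradient is passed along with the test function. The initial datum is left out, so that the
    statement is stable under changes of unknown and of time. *)
Definition evolves a b c h : Prop := forall phi dphi r, has_grad phi dphi ->
  (forall v, r < enorm v -> phi v = 0) ->
  prim (fun t => \int[leb]_v (h t v * phi v))
       (fun t => lin_rhs a b c h phi dphi t + coll alpha (h t) phi).

Variables (a b : R -> R) (c : 'I_d -> R -> R) (h : R -> V -> R).
Hypotheses (la : li a) (lb : li b) (lc : forall i, li (c i)) (hcurve : curve h).

(** The functions that can be used as tests once the cut-off is removed: besides [phi], everything
    that the transport terms pair with the solution has quadratic growth. *)
Definition growth2 phi dphi (C : R) : Prop :=
  [/\ has_grad phi dphi, forall v, `|phi v| <= C * japanese v ^+ 2,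
      forall v, `|euler dphi v| <= C * japanese v ^+ 2 &
      forall i v, `|dphi i v| <= C * japanese v ^+ 2].

Lemma measurable_euler phi dphi : has_grad phi dphi -> measurable_fun setT (euler dphi).
Proof.
move=> hg; apply: measurable_sum => i; apply: measurable_funM; first exact: measurable_coord.
exact: (has_grad_measurable_d _ hg).
Qed.

Lemma li_lin_rhs phi dphi C : growth2 phi dphi C -> li (lin_rhs a b c h phi dphi).
Proof.
move=> [hg b1 b2 b3]; apply: liD; first apply: liD.
- by apply: liM => //; exact: (curve_pair hcurve (has_grad_measurable hg) b1).
- by apply: liM => //; exact: (curve_pair hcurve (measurable_euler hg) b2).
- rewrite (_ : (fun t => _) = (fun t => -1 * \sum_i c i t * (\int[leb]_v (h t v * dphi i v)))).
    apply: liZ; apply: li_sum => i; apply: liM => //.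
    exact: (curve_pair hcurve (has_grad_measurable_d i hg) (b3 i)).
  by apply/funext => t; rewrite mulN1r.
Qed.

Lemma test_growth2 phi dphi r : has_grad phi dphi -> (forall v, r < enorm v -> phi v = 0) ->
  exists C, growth2 phi dphi C /\ forall v, `|phi v| <= C * japanese v ^+ 0.
Proof.
move=> hg hr; have [C [C0 c1 c2 c3 _]] := test_bounded hg hr.
have up x (v : V) : x <= C -> x <= C * japanese v ^+ 2.
  by move=> /le_trans; apply; rewrite ler_peMr// japanese_exp_ge1.
exists C; split => [|v]; last by rewrite expr0 mulr1.
by split => // [v|v|i v]; apply: up.
Qed.

Definition cutf phi n (v : V) : R := phi v * chi n.+1%:R v.
Definition dcut phi dphi n i (v : V) : R :=
  phi v * dchi n.+1%:R i v + chi n.+1%:R v * dphi i v.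

Lemma has_grad_cutf phi dphi n : has_grad phi dphi -> has_grad (cutf phi n) (dcut phi dphi n).
Proof. by move=> hg; exact: (has_gradM hg (@has_grad_chi R d _)). Qed.

Lemma cutf_out phi n v : (n.+1%:R : R) < enorm v -> cutf phi n v = 0.
Proof. by move=> nv; rewrite /cutf chi_out ?mulr0// ltr0n. Qed.

Lemma euler_dcut phi dphi n v :
  euler (dcut phi dphi n) v = phi v * euler (dchi n.+1%:R) v + chi n.+1%:R v * euler dphi v.
Proof.
rewrite /euler !mulr_sumr -big_split; apply: eq_bigr => i _; rewrite /dcut /=; ring.
Qed.

Lemma cutf_le phi n v : `|cutf phi n v| <= `|phi v|.
Proof. by rewrite normrM (ger0_norm (chi_ge0 _ _)) ler_piMr// chi_le1. Qed.

Lemma cutf_cvg phi v : cutf phi n v @[n --> \oo] --> phi v.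
Proof. by rewrite -[X in _ --> X]mulr1; apply: cvgMr; exact: chi_cvg. Qed.

Let mix_le (x y z w : R) (C M : R) : `|x| <= C * M -> `|z| <= 4 -> 0 <= y <= 1 -> `|w| <= C * M ->
  `|x * z + y * w| <= 5 * C * M.
Proof.
move=> xC z4 /andP[y0 y1] wC; apply: (le_trans (ler_normD _ _)); rewrite !normrM (ger0_norm y0).
have -> : 5 * C * M = C * M * 4 + 1 * (C * M) by ring.
by apply: lerD; apply: ler_pM.
Qed.

Lemma cutf_growth2 phi dphi C n : growth2 phi dphi C -> growth2 (cutf phi n) (dcut phi dphi n) (5 * C).
Proof.
move=> [hg b1 b2 b3]; have ch (v : V) : 0 <= chi n.+1%:R v <= 1 by rewrite chi_ge0 chi_le1.
split => [|v|v|i v].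
- exact: has_grad_cutf.
- apply: (le_trans (cutf_le _ _ _)); apply: (le_trans (b1 v)).
  have := le_trans (normr_ge0 _) (b1 v); lra.
- by rewrite euler_dcut mix_le// ?euler_dchi_le.
- by rewrite mix_le// dchi_le// ler1n.
Qed.

Section extension.
Variables (phi : V -> R) (dphi : 'I_d -> V -> R) (C : R) (J p : R -> R) (x y : R).
Hypotheses (g2 : growth2 phi dphi C) (x0 : 0 <= x) (xy : x <= y).
Hypotheses (mJ : measurable_fun setT J) (J01 : forall t, 0 <= J t <= 1)
  (aeJ : {ae mu, forall t, 0 < t -> J t = 1}).
Hypotheses (ip : itg mu (fun t => ind x y t * p t))
  (bp : forall n t, x < t -> t <= y -> `|J t * coll alpha (h t) (cutf phi n)| <= p t)
  (cp : forall t, x < t -> t <= y ->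
     J t * coll alpha (h t) (cutf phi n) @[n --> \oo] --> J t * coll alpha (h t) phi).
Hypothesis ev : evolves a b c h.

Let y0 : 0 <= y := le_trans x0 xy.

Let C0 : 0 <= C.
Proof.
case: g2 => _ b1 _ _; have := le_trans (normr_ge0 _) (b1 0).
by rewrite pmulr_lge0// exprn_gt0// japanese_gt0.
Qed.

Let L n t := lin_rhs a b c h (cutf phi n) (dcut phi dphi n) t.

Let itgJ n : itg mu (fun t => ind x y t * (L n t + J t * coll alpha (h t) (cutf phi n))).
Proof.
have lL := li_lin_rhs (cutf_growth2 n g2).
have hg := has_grad_cutf n (let: And4 hg _ _ _ := g2 in hg).
have [C' [_ b0]] := test_growth2 hg (@cutf_out phi n).
have cc := curve_coll alpha_gt0 alpha_lt1 hcurve (leqnSn _) (has_grad_measurable hg) b0.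
under eq_fun do rewrite mulrDr; apply: itgD; first exact: lL.
rewrite (_ : (fun t => _) = (fun t => J t * (ind x y t * coll alpha (h t) (cutf phi n)))); last first.
  by apply/funext => t; rewrite mulrCA.
have ic := li_scont cc x0 xy.
apply: (itg_dom _ _ (itg_norm ic)); first by apply: measurable_funM => //; exact: (itg_meas ic).
move=> t; have /andP[j0 j1] := J01 t.
by rewrite normrM (ger0_norm j0) ler_piMl.
Qed.

Let IntJ n : \int[leb]_v (h y v * cutf phi n v) - \int[leb]_v (h x v * cutf phi n v) =
  \int[mu]_t (ind x y t * (L n t + J t * coll alpha (h t) (cutf phi n))).
Proof.
have hg := has_grad_cutf n (let: And4 hg _ _ _ := g2 in hg).
have [lg ->//] := ev hg (@cutf_out phi n).
apply: ae_eq_Rint; [exact: (itg_meas (lg x y x0 xy))|exact: (itg_meas (itgJ n))|].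
apply: (@filterS _ _ (ae_filter_ringOfSetsType mu) _ _ _ aeJ) => t Jt; rewrite /ind; case: (boolP (x < t <= y)) => [/andP[xt _]|_].
  by rewrite Jt ?mul1r// (le_lt_trans x0).
by rewrite !mul0r.
Qed.

(** The cut-off is removed by dominated convergence in time. [J] is 1 for tests of linear growth and
    [fin3] for quadratic ones, where it suppresses the collision term on the null set of times at
    which the third moment is infinite. *)
Lemma evolves_extension :
  itg mu (fun t => ind x y t * (lin_rhs a b c h phi dphi t + J t * coll alpha (h t) phi)) /\
  \int[leb]_v (h y v * phi v) - \int[leb]_v (h x v * phi v) =
  Int x y (fun t => lin_rhs a b c h phi dphi t + J t * coll alpha (h t) phi).
Proof.
have [hg b1 b2 b3] := g2.
have [N [N0 hN]] := curve_Nrm2_bounded hcurve y.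
have mphi := has_grad_measurable hg.
have cutg n := cutf_growth2 n g2.
have mcutf n := has_grad_measurable (has_grad_cutf n hg).
have pc (t : R) (k_ : nat -> V -> R) (k : V -> R) : 0 <= t -> (forall n, measurable_fun setT (k_ n)) ->
    (forall n v, `|k_ n v| <= 5 * C * japanese v ^+ 2) ->
    (forall v, k_ n v @[n --> \oo] --> k v) ->
    \int[leb]_v (h t v * k_ n v) @[n --> \oo] --> \int[leb]_v (h t v * k v).
  by move=> t0 mk kC kk; apply: (curve_pair_seq hcurve t0 (fun=> t0) (cvg_cst t) mk kC kk).
have pb (t : R) (k : V -> R) : x < t -> t <= y -> measurable_fun setT k ->
    (forall v, `|k v| <= 5 * C * japanese v ^+ 2) -> `|\int[leb]_v (h t v * k v)| <= 5 * C * N.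
  move=> xt ty mk kC; have t0 : 0 <= t := le_trans x0 (ltW xt).
  have [_ /le_trans->//] := in_L1_pair (curve_L12 hcurve t0) mk kC.
  by rewrite ler_wpM2l ?mulr_ge0// hN.
have cL : forall t, 0 <= t -> \int[leb]_v (h t v * cutf phi n v) @[n --> \oo] -->
    \int[leb]_v (h t v * phi v).
  move=> t t0; apply: pc => // [n|]; first by case: (cutg n).
  by move=> v; exact: cutf_cvg.
have cE : forall t, 0 <= t -> \int[leb]_v (h t v * euler (dcut phi dphi n) v) @[n --> \oo] -->
    \int[leb]_v (h t v * euler dphi v).
  move=> t t0; apply: pc => // [n|n|v].
  - exact: (measurable_euler (has_grad_cutf n hg)).
  - by case: (cutg n).
  - apply: (@cvg_ext _ _ (fun n => phi v * euler (dchi n.+1%:R) v + chi n.+1%:R v * euler dphi v)).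
      by move=> n; exact: euler_dcut.
    have := cvgD (cvgM (cvg_cst (phi v)) (@euler_dchi_cvg R d v))
      (cvgM (@chi_cvg R d v) (cvg_cst (euler dphi v))).
    by rewrite mulr0 add0r mul1r; exact.
have cD : forall i t, 0 <= t -> \int[leb]_v (h t v * dcut phi dphi n i v) @[n --> \oo] -->
    \int[leb]_v (h t v * dphi i v).
  move=> i t t0; apply: pc => // [n|n|v].
  - exact: (has_grad_measurable_d _ (has_grad_cutf n hg)).
  - by case: (cutg n).
  - have := cvgD (cvgM (cvg_cst (phi v)) (@dchi_cvg R d i v))
      (cvgM (@chi_cvg R d v) (cvg_cst (dphi i v))).
    by rewrite mulr0 add0r mul1r; exact.
pose F n t := ind x y t * (L n t + J t * coll alpha (h t) (cutf phi n)).
pose G t := ind x y t * (lin_rhs a b c h phi dphi t + J t * coll alpha (h t) phi).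
have FG t : F n t @[n --> \oo] --> G t.
  rewrite /F /G /ind; case: (boolP (x < t <= y)) => [/andP[xt ty]|_]; last first.
    rewrite mul0r; apply: (@cvg_ext _ _ (fun=> 0)); last exact: cvg_cst.
    by move=> n; rewrite mul0r.
  have t0 : 0 <= t := le_trans x0 (ltW xt).
  rewrite !mul1r; apply: (@cvg_ext _ _ (fun n => L n t + J t * coll alpha (h t) (cutf phi n))).
    by move=> n; rewrite mul1r.
  apply: cvgD; last exact: cp.
  apply: cvgB; first by apply: cvgD; apply: cvgMr; [exact: cL|exact: cE].
  elim: (index_enum _) => [|i s IH].
    by apply: (@cvg_ext _ _ (fun=> 0)) => [n|]; rewrite big_nil//; exact: cvg_cst.
  rewrite big_cons; apply: (@cvg_ext _ _ (fun n => c i t * (\int[leb]_v (h t v * dcut phi dphi n i v))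
     + \sum_(j <- s) c j t * (\int[leb]_v (h t v * dcut phi dphi n j v)))).
    by move=> n; rewrite big_cons.
  by apply: cvgD => //; apply: cvgMr; exact: cD.
pose g t := (5 * C * N) * (`|ind x y t * a t| + `|ind x y t * b t|
   + \sum_i `|ind x y t * c i t|) + `|ind x y t * p t|.
have ig : itg mu g.
  apply: itgD; last exact: itg_norm.
  apply: itgZ; apply: itgD; last by apply: itg_sum_seq => i; apply: itg_norm; exact: lc.
  by apply: itgD; apply: itg_norm; [exact: la|exact: lb].
have Fg n t : `|F n t| <= g t.
  rewrite /F /g /ind; case: (boolP (x < t <= y)) => [/andP[xt ty]|_]; last first.
    rewrite !mul0r !normr0 big1 => [|i _]; last by rewrite mul0r normr0.
    by rewrite !addr0 mulr0.
  rewrite !mul1r; apply: (le_trans (ler_normD _ _)); apply: lerD; last first.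
    by apply: (le_trans (bp n xt ty)); rewrite ler_norm.
  have e1 : `|\int[leb]_v (h t v * cutf phi n v)| <= 5 * C * N by apply: pb => //; case: (cutg n).
  have e2 : `|\int[leb]_v (h t v * euler (dcut phi dphi n) v)| <= 5 * C * N.
    by apply: pb => //; [exact: (measurable_euler (has_grad_cutf n hg))|case: (cutg n)].
  have e3 i : `|\int[leb]_v (h t v * dcut phi dphi n i v)| <= 5 * C * N.
    by apply: pb => //; [exact: (has_grad_measurable_d _ (has_grad_cutf n hg))|case: (cutg n)].
  have K0 : 0 <= 5 * C * N by rewrite !mulr_ge0.
  apply: (le_trans (ler_normB _ _)); rewrite mulrDr; apply: lerD; last first.
    apply: (le_trans (ler_norm_sum _ _ _)); rewrite mulr_sumr; apply: ler_sum => i _.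
    by rewrite normrM mul1r mulrC ler_wpM2r.
  apply: (le_trans (ler_normD _ _)); rewrite mulrDr.
  by apply: lerD; rewrite normrM mulrC ler_wpM2r.
have dct := Rint_dct (fun n => itg_meas (itgJ n)) FG ig Fg.
split.
  apply: (itg_dom _ _ ig); first exact: (measurable_fun_cvg (fun n => itg_meas (itgJ n)) (fun t _ => FG t)).
  by move=> t; apply: (cvgr_to_le (cvg_norm (FG t))); exact: nearW.
have lhs := cvgB (cL y y0) (cL x x0).
have E : (fun n => \int[leb]_v (h y v * cutf phi n v) - \int[leb]_v (h x v * cutf phi n v)) =
  (fun n => \int[mu]_t F n t) by apply/funext => n; exact: IntJ.
have lhs' : \int[mu]_t F n t @[n --> \oo] -->
  \int[leb]_v (h y v * phi v) - \int[leb]_v (h x v * phi v) by rewrite -E; exact: lhs.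
exact: (etrans (esym (cvg_lim (@Rhausdorff R) lhs')) (cvg_lim (@Rhausdorff R) dct)).
Qed.

End extension.

End evolution.

(** * Evolution of the moments *)

Section moments.
Context {R : realType} {d : nat}.
Hypothesis d_gt0 : (0 < d)%N.
Local Notation V := 'rV[R]_d.
Local Notation leb := (@lebesgue_rV R d).
Local Notation leb2 := (leb \x leb)%E.
Variable alpha : R.
Hypotheses (alpha_gt0 : 0 < alpha) (alpha_lt1 : alpha < 1).

Definition mom1 (i : 'I_d) (h : V -> R) : R := \int[leb]_v (h v * v 0 i).
Definition mom2 (h : V -> R) : R := \int[leb]_v (h v * enorm v ^+ 2).

Lemma growth2_cst : growth2 (fun _ : V => 1 : R) (fun _ _ => 0) 1.
Proof.
split => [|v|v|i v]; first exact: has_grad_cst.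
- exact: cst1_bound.
- by rewrite /euler big1 => [|i _]; rewrite ?mulr0// normr0 mul1r exprn_ge0// japanese_ge0.
- by rewrite normr0 mul1r exprn_ge0// japanese_ge0.
Qed.

Lemma growth2_coord i : growth2 (fun v : V => v 0 i) (fun j _ => (j == i)%:R) 1.
Proof.
have E (v : V) : euler (fun j _ => (j == i)%:R) v = v 0 i.
  rewrite /euler (bigD1 i)//= eqxx mulr1 big1 ?addr0// => j /negbTE ->.
  by rewrite mulr0.
split => [|v|v|j v]; first exact: has_grad_coord.
- exact: coord_bound.
- by rewrite E; exact: coord_bound.
- by case: (j == i); rewrite ?normr1 ?normr0 mul1r ?japanese_exp_ge1// exprn_ge0// japanese_ge0.
Qed.

Lemma growth2_energy : growth2 (fun v : V => enorm v ^+ 2) (fun i v => 2 * v 0 i) 2.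
Proof.
have E (v : V) : euler (fun i v => 2 * v 0 i) v = 2 * enorm v ^+ 2.
  rewrite /euler enorm_sqr mulr_sumr; apply: eq_bigr => i _; ring.
have e2 (v : V) : enorm v ^+ 2 <= japanese v ^+ 2 by rewrite japanese_sqr lerDr.
split => [|v|v|j v]; first exact: has_grad_enorm_sqr.
- rewrite ger0_norm ?sqr_ge0//; have := e2 v; have := sqr_ge0 (enorm v); lra.
- by rewrite E normrM normr_nat (ger0_norm (sqr_ge0 _)) ler_wpM2l.
- rewrite normrM ger0_norm// ler_wpM2l//; have := @coord_bound R d 1 j v; rewrite mul1r; exact.
Qed.

(** The loss of energy controls the third moment: |v| <= |w| + |v - w| gives |v|^3 <= |v - w| |v|^2
    + |w| |v|^2. The constants come from (1 + x)^3 <= 4 + 4 x^3 and |w| <= 1 + |w|^2. *)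
Lemma Nrm3_le_q2 (h : V -> R) : in_L1 3 h -> (forall v, 0 <= h v) ->
  Nrm 3 h * density h <= 4 * q2 h + 8 * Nrm 2 h ^+ 2.
Proof.
move=> h3 h0; have h2 := in_L1_le (isT : (2 <= 3)%N) h3.
have h0L := in_L1_le (isT : (0 <= 3)%N) h3.
have ih : itg leb h.
  have := in_L1_itg h0L; congr itg; apply/funext => v.
  by rewrite expr0 mulr1 ger0_norm.
pose K1 (p : V * V) := japanese p.1 ^+ 3.
pose K2 (p : V * V) := 4 * (enorm (p.1 - p.2) * enorm p.1 ^+ 2) +
   8 * (japanese p.1 ^+ 2 * japanese p.2 ^+ 2).
have mj q : measurable_fun setT (fun p : V * V => japanese p.1 ^+ q).
  exact: (measurableT_comp (measurable_japaneseX q) measurable_fst).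
have mj2 q : measurable_fun setT (fun p : V * V => japanese p.2 ^+ q).
  exact: (measurableT_comp (measurable_japaneseX q) measurable_snd).
have mq2 := measurable_dist_fst (@measurable_enorm_sqr R d).
have bq2 := dist_fst_bound (@enorm_sqr_bound R d 0).
have mjj : measurable_fun setT (fun p : V * V => japanese p.1 ^+ 2 * japanese p.2 ^+ 2).
  exact: measurable_funM.
have jj0 q (p : V * V) : 0 <= japanese p.1 ^+ q * japanese p.2 ^+ q.
  by rewrite mulr_ge0// exprn_ge0// japanese_ge0.
have b1 p : `|K1 p| <= 1 * (japanese p.1 ^+ 3 * japanese p.2 ^+ 3).
  by rewrite mul1r ger0_norm ?exprn_ge0 ?japanese_ge0// ler_peMr ?exprn_ge0 ?japanese_ge0 ?japanese_exp_ge1.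
have b23 (p : V * V) : `|japanese p.1 ^+ 2 * japanese p.2 ^+ 2| <= 1 * (japanese p.1 ^+ 3 * japanese p.2 ^+ 3).
  by rewrite mul1r ger0_norm// ler_pM ?exprn_ge0 ?japanese_ge0 ?japanese_exp_le.
have m4 : measurable_fun setT (fun p : V * V => 4 * (enorm (p.1 - p.2) * enorm p.1 ^+ 2)).
  exact: measurable_funM.
have m8 : measurable_fun setT (fun p : V * V => 8 * (japanese p.1 ^+ 2 * japanese p.2 ^+ 2)).
  exact: measurable_funM.
have b4 (p : V * V) : `|4 * (enorm (p.1 - p.2) * enorm p.1 ^+ 2)| <=
    8 * (japanese p.1 ^+ 3 * japanese p.2 ^+ 3).
  rewrite normrM normr_nat; have := bq2 p; rewrite mulr1 => hb.
  by move: hb; lra.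
have b8 (p : V * V) : `|8 * (japanese p.1 ^+ 2 * japanese p.2 ^+ 2)| <=
    8 * (japanese p.1 ^+ 3 * japanese p.2 ^+ 3).
  by rewrite normrM normr_nat ler_wpM2l//; have := b23 p; rewrite mul1r.
have b2 p : `|K2 p| <= 16 * (japanese p.1 ^+ 3 * japanese p.2 ^+ 3).
  apply: (le_trans (ler_normD _ _)); have := b4 p; have := b8 p; lra.
have K12 p : K1 p <= K2 p.
  rewrite /K1 /K2; have t := enormB p.1 (p.1 - p.2).
  rewrite opprB addrC subrK in t.
  have jv := japanese_le1 p.1; have j0 := japanese_ge0 p.1.
  have e0 := enorm_ge0 p.1; have f0 := enorm_ge0 p.2; have x0 := enorm_ge0 (p.1 - p.2).
  have h3' : japanese p.1 ^+ 3 <= (1 + enorm p.1) ^+ 3.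
    by rewrite lerXn2r ?nnegrE// addr_ge0.
  have t2 : enorm p.1 <= enorm p.2 + enorm (p.1 - p.2).
    have := enormD p.2 (p.1 - p.2); rewrite addrC subrK; exact.
  apply: (le_trans h3'); rewrite !japanese_sqr.
  move: t2 e0 f0 x0; move: (enorm p.1) (enorm p.2) (enorm (p.1 - p.2)) => e f x t2 e0 f0 x0.
  have h1 : e ^+ 3 <= (f + x) * e ^+ 2 by rewrite exprS ler_wpM2r// sqr_ge0.
  have h2' : (1 + e) ^+ 3 <= 4 + 4 * e ^+ 3.
    have : 0 <= (e - 1) ^+ 2 * (e + 1) by rewrite mulr_ge0 ?sqr_ge0// addr_ge0.
    nra.
  have h4 : f <= 1 + f ^+ 2 by nra.
  have h5 : f * e ^+ 2 <= (1 + f ^+ 2) * e ^+ 2 by rewrite ler_wpM2r// sqr_ge0.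
  have := sqr_ge0 f; have := sqr_ge0 e; have : 0 <= e ^+ 2 * f ^+ 2 by rewrite mulr_ge0 ?sqr_ge0.
  nra.
have := le_bil (mj 3) (measurable_funD m4 m8) b1 b2 h3 h0 K12.
rewrite (bilD_K m4 m8 b4 b8 h3 h3) (bilZ_K 4 mq2 bq2 h3 h3) (bilZ_K 8 mjj b23 h3 h3).
have -> : bil K1 h h = Nrm 3 h * density h.
  rewrite -(Rint_tensor (in_L1_itg h3) ih); apply: eq_Rint => p.
  by rewrite /K1 mulrA (ger0_norm (h0 p.1)) (mulrC (japanese p.1 ^+ 3)).
have := bil_weight 1 h2 h0; rewrite mul1r => E.
have -> : bil (fun p => japanese p.1 ^+ 2 * japanese p.2 ^+ 2) h h = Nrm 2 h ^+ 2.
  by rewrite expr2 -E; apply: eq_bil => p; rewrite mul1r.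
exact.
Qed.

(** Linear in the density, with a factor bounded locally in time: this makes the density equation a
    linear differential inequality. *)
Lemma q0_le (h : V -> R) : in_L1 1 h -> (forall v, 0 <= h v) -> q0 h <= 2 * Nrm 1 h * density h.
Proof.
move=> h1 h0; have ih : itg leb h.
  have := in_L1_itg (in_L1_le (isT : (0 <= 1)%N) h1); congr itg; apply/funext => v.
  by rewrite expr0 mulr1 ger0_norm.
have i1 := in_L1_itg h1.
have t1 := itg_tensor i1 ih; have t2 := itg_tensor ih i1.
have mc : measurable_fun [set: V] (fun=> 1 : R) by exact: measurable_cst.
have iq := itg_bil (measurable_dist_fst mc) (dist_fst_bound (cst1_bound 0)) h1 h1.
have -> : 2 * Nrm 1 h * density h = \int[leb2]_p (`|h p.1| * japanese p.1 ^+ 1 * h p.2 +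
    h p.1 * (`|h p.2| * japanese p.2 ^+ 1)).
  by rewrite (RintD t1 t2) (Rint_tensor i1 ih) (Rint_tensor ih i1) /Nrm /density; ring.
apply: le_Rint => //; first exact: itgD.
move=> p; rewrite !(ger0_norm (h0 _)) !expr1 mulr1.
have -> : h p.1 * japanese p.1 * h p.2 + h p.1 * (h p.2 * japanese p.2) =
  (japanese p.1 + japanese p.2) * (h p.1 * h p.2) by ring.
rewrite ler_wpM2r ?mulr_ge0//; apply: (le_trans (enormB _ _)).
by apply: lerD; exact: enorm_le_japanese.
Qed.

Lemma q0_ge0 (h : V -> R) : (forall v, 0 <= h v) -> 0 <= q0 h.
Proof. by move=> h0; apply: Rint_ge0 => p; rewrite !mulr_ge0 ?enorm_ge0. Qed.

Lemma q2_ge0 (h : V -> R) : (forall v, 0 <= h v) -> 0 <= q2 h.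
Proof. by move=> h0; apply: Rint_ge0 => p; rewrite !mulr_ge0 ?enorm_ge0 ?sqr_ge0. Qed.

Lemma densityE (h : V -> R) : density h = \int[leb]_v (h v * 1).
Proof. by apply: eq_Rint => v; rewrite mulr1. Qed.

Section curve_moments.
Variables (h : R -> V -> R).
Hypothesis hcurve : curve h.

Lemma scont_density : scont (fun t => density (h t)).
Proof.
rewrite (_ : (fun t => _) = (fun t => \int[leb]_v (h t v * 1))).
  exact: (curve_pair hcurve (measurable_cst _) (cst1_bound 2)).
by apply/funext => t; exact: densityE.
Qed.

Lemma scont_mom1 i : scont (fun t => mom1 i (h t)).
Proof. exact: (curve_pair hcurve (measurable_coord i) (coord_bound 1 i)). Qed.

Lemma scont_mom2 : scont (fun t => mom2 (h t)).
Proof. exact: (curve_pair hcurve (@measurable_enorm_sqr R d) (@enorm_sqr_bound R d 0)). Qed.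

Lemma scont_q0 : scont (fun t => q0 (h t)).
Proof.
have b v : `|1 : R| <= 1 * japanese v ^+ 1 := cst1_bound 1 (v : V).
exact: (curve_bil hcurve (measurable_dist_fst (measurable_cst _)) (dist_fst_bound b)).
Qed.

Lemma scont_q1 i : scont (fun t => q1 i (h t)).
Proof. exact: (curve_bil hcurve (measurable_dist_fst (measurable_coord i)) (dist_fst_bound (coord_bound 0 i))). Qed.

Lemma measurable_q2 : measurable_fun setT (fun t : R => q2 (h (Num.max t 0))).
Proof.
apply: (curve_bil_measurable hcurve (measurable_dist_fst (@measurable_enorm_sqr R d))) => p.
by rewrite mulr_ge0 ?enorm_ge0 ?sqr_ge0.
Qed.

(** Indicator of the times at which the third moment is finite. Multiplying by it suppresses [q2]
    where its defining integral may diverge. *)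
Definition fin3 (t : R) : R := `[< in_L1 3 (h (Num.max t 0)) >]%:R.

Lemma fin3_01 t : 0 <= fin3 t <= 1.
Proof. by rewrite /fin3; case: asbool; rewrite /= ?lexx ?ler01. Qed.

Let max0_ge0 (t : R) : 0 <= Num.max t 0.
Proof. by rewrite le_max lexx orbT. Qed.

Lemma measurable_L1norm3 : measurable_fun setT (fun t : R => L1norm 3 (h (Num.max t 0))).
Proof.
have := curve_pair_measurable hcurve (measurable_japaneseX 3) (fun v => exprn_ge0 3 (japanese_ge0 v)).
congr measurable_fun; apply/funext => t; apply: eq_integral => v _.
by rewrite ger0_norm ?(curve_ge0 hcurve)// mulrC.
Qed.

Lemma measurable_fin3 : measurable_fun setT fin3.
Proof.
rewrite (_ : fin3 = \1_[set t : R | (L1norm 3 (h (Num.max t 0%R)) < +oo)%E]).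
  apply/measurable_indicP.
  by have := emeasurable_fun_infty_o measurableT measurable_L1norm3 +oo%E; rewrite setTI.
apply/funext => t; rewrite /fin3 indicE; congr (nat_of_bool _)%:R.
apply/asboolP/idP => [[_ h3]|]; first by rewrite inE.
rewrite inE /= => h3; split => //; exact: in_L1_meas (curve_L12 hcurve (max0_ge0 t)).
Qed.

Lemma measurable_Nrm3 : measurable_fun setT (fun t : R => Nrm 3 (h (Num.max t 0))).
Proof. exact: (measurableT_comp _ measurable_L1norm3). Qed.

End curve_moments.
End moments.

(** Monotone convergence as the lower end 1/(n+1) tends to 0: a uniform bound upgrades integrability
    away from time 0 to integrability up to time 0. *)
Lemma itg_ind_exhaust {R : realType} (F : R -> R) (y M : R) :
  measurable_fun setT F -> (forall t, 0 <= F t) ->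
  (forall n : nat, itg (@lebesgue_measure R) (fun t => ind n.+1%:R^-1 y t * F t)) ->
  (forall n : nat, Int n.+1%:R^-1 y F <= M) ->
  itg (@lebesgue_measure R) (fun t => ind 0 y t * F t).
Proof.
move=> mF F0 iF FM; apply: itg_ge0_fin.
- by apply: measurable_funM => //; exact: measurable_ind.
- by move=> t; rewrite mulr_ge0// ind_ge0.
have cv t : (ind n.+1%:R^-1 y t * F t)%:E @[n --> \oo] --> (ind 0 y t * F t)%:E.
  apply: cvg_EFin; first exact: nearW.
  apply: cvgMl; rewrite /ind; have [t0|t0] := ltP 0 t; last first.
    apply: cvg_near_cst; apply: nearW => n /=.
    by rewrite ltNge (le_trans t0)//= invr_ge0.
  apply: cvg_near_cst; have := near_infty_natSinv_lt (PosNum t0).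
  by apply: filterS => n /= ->.
have H : (\int[lebesgue_measure]_t (ind n.+1%:R^-1 y t * F t)%:E)%E @[n --> \oo] -->
    (\int[lebesgue_measure]_t (limn (fun n : nat => (ind n.+1%:R^-1 y t * F t)%:E)))%E.
  apply: cvg_monotone_convergence => //.
  - by move=> n; apply/measurable_EFinP; exact: (itg_meas (iF n)).
  - by move=> n t _; rewrite lee_fin mulr_ge0// ind_ge0.
  - move=> t _ m n mn; rewrite lee_fin ler_wpM2r//.
    rewrite /ind; have [h|h] := boolP (m.+1%:R^-1 < t <= y); last exact: ler0n.
    have /andP[h1 h2] := h.
    by rewrite (le_lt_trans _ h1)//= ?h2// lef_pV2 ?posrE ?ltr0n// ler_nat ltnS.
have E : (\int[lebesgue_measure]_t (limn (fun n => (ind n.+1%:R^-1 y t * F t)%:E)) =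
  \int[lebesgue_measure]_t (ind 0 y t * F t)%:E)%E.
  by apply: eq_integral => t _; apply/cvg_lim => //; exact: cv.
rewrite E in H; apply: (@le_lt_trans _ _ M%:E); last exact: ltry.
rewrite -(cvg_lim (@ereal_hausdorff R) H); apply: lime_le; first by apply/cvg_ex; eexists; exact: H.
by apply: nearW => n; rewrite -(EFin_Rintegral (iF n)) lee_fin; exact: FM.
Qed.

Lemma Rint_zero d (T : measurableType d) (R : realType) (mu : {measure set T -> \bar R}) :
  \int[mu]_x (0 : R) = 0.
Proof. by rewrite Rintegral_cst// mul0r. Qed.

Section evolution_moments.
Context {R : realType} {d : nat}.
Hypothesis d_gt0 : (0 < d)%N.
Local Notation V := 'rV[R]_d.
Local Notation leb := (@lebesgue_rV R d).
Local Notation mu := (@lebesgue_measure R).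
Variable alpha : R.
Hypotheses (alpha_gt0 : 0 < alpha) (alpha_lt1 : alpha < 1).

Lemma solution_class_fin3 (h : R -> V -> R) : solution_class h ->
  {ae mu, forall t, 0 < t -> fin3 h t = 1}.
Proof.
move=> [h0 h2 _ hl].
have H (n : nat) : {ae mu, forall t, t \in `[n.+1%:R^-1, n.+1%:R]%classic -> L1norm 3 (h t) \is a fin_num}.
  have le1 : (n.+1%:R^-1 : R) <= n.+1%:R.
    by rewrite (@le_trans _ _ 1)// ?ler1n// invf_le1 ?ltr0n// ler1n.
  have := integrable_ae _ (hl _ _ (ltac:(by rewrite invr_gt0 ltr0n) : 0 < (n.+1%:R : R)^-1) le1).
  move=> /(_ (measurable_itv _)); apply: (@filterS _ _ (ae_filter_ringOfSetsType mu)) => t ht.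
  by rewrite inE => /ht.
have : {ae mu, forall t, forall n : nat, t \in `[n.+1%:R^-1, n.+1%:R]%classic ->
    L1norm 3 (h t) \is a fin_num} by apply: ae_foralln.
apply: (@filterS _ _ (ae_filter_ringOfSetsType mu)) => t ht t0.
rewrite /fin3 max_l ?(ltW t0)// asboolT//; split; first exact: in_L1_meas (h2 t (ltW t0)).
have [n hn] : exists n : nat, t \in `[(n.+1%:R : R)^-1, n.+1%:R].
  pose n := (Num.truncn t + Num.truncn t^-1).+1.
  exists n; rewrite in_itv/=; apply/andP; split.
    rewrite -[leRHS]invrK lef_pV2 ?posrE ?invr_gt0 ?ltr0n//.
    rewrite ltW// (lt_le_trans (truncnS_gt _))// ler_nat /n ltnS.
    by rewrite (leq_trans (leq_addl (Num.truncn t) _)).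
  rewrite ltW// (lt_le_trans (truncnS_gt _))// ler_nat /n ltnS.
  by rewrite (leq_trans (leq_addr (Num.truncn t^-1) _)).
have := ht n; rewrite inE => /(_ hn) /fin_numP[_ h3].
by rewrite ltey.
Qed.

Lemma solution_class_itg3 (h : R -> V -> R) x y : solution_class h -> 0 < x -> x <= y ->
  itg mu (fun t => ind x y t * (fin3 h t * Nrm 3 (h t))).
Proof.
move=> sh x0 xy; have hc := solution_class_curve sh.
have [h0 h2 _ hl] := sh.
have E t : ind x y t * (fin3 h t * Nrm 3 (h t)) =
    ind x y t * (fin3 h t * Nrm 3 (h (Num.max t 0))).
  rewrite /ind; case: (boolP (x < t <= y)) => [/andP[xt _]|_]; rewrite ?mul0r//.
  by rewrite [Num.max t 0]max_l// ltW// (lt_trans x0).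
under eq_fun do rewrite E.
have nn t : 0 <= ind x y t * (fin3 h t * Nrm 3 (h (Num.max t 0))).
  by rewrite !mulr_ge0 ?ind_ge0 ?Nrm_ge0//; have /andP[] := fin3_01 h t.
have m : measurable_fun setT (fun t => ind x y t * (fin3 h t * Nrm 3 (h (Num.max t 0)))).
  apply: measurable_funM; first exact: measurable_ind.
  by apply: measurable_funM; [exact: (measurable_fin3 hc)|exact: (measurable_Nrm3 hc)].
apply: itg_ge0_fin => //.
have := hl _ _ x0 xy => /integrableP[mL].
apply: le_lt_trans.
rewrite [leRHS]integral_mkcond; apply: ge0_le_integral => //.
- by move=> t _; rewrite lee_fin.
- exact/measurable_EFinP.
- apply/(measurable_restrictT _ _).1 => //.
  exact: measurableT_comp.
move=> t _; rewrite patchE /ind; case: (boolP (x < t <= y)) => [/andP[xt ty]|_]; last first.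
  by rewrite mul0r; case: ifP => _; [exact: abse_ge0|exact: lexx].
have t0 : 0 <= t by rewrite ltW// (lt_trans x0).
rewrite mem_set; last by rewrite /= in_itv/= (ltW xt) ty.
rewrite mul1r /fin3 max_l//; case: asboolP => h3; last by rewrite mul0r abse_ge0.
by rewrite mul1r L1normE//= ger0_norm ?Nrm_ge0.
Qed.

Variables (a b : R -> R) (c : 'I_d -> R -> R) (h : R -> V -> R).
Hypotheses (la : li a) (lb : li b) (lc : forall i, li (c i)) (hcurve : curve h)
  (ev : evolves alpha a b c h).

(** Here the collision terms are dominated by the squared L^1_2 norm, which is bounded on compact
    time intervals, so no third moment enters. *)
Lemma evolves_linear phi dphi C : growth2 phi dphi C -> (forall v, `|phi v| <= C * japanese v ^+ 1) ->
  prim (fun t => \int[leb]_v (h t v * phi v))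
       (fun t => lin_rhs a b c h phi dphi t + coll alpha (h t) phi).
Proof.
move=> g2 b1; have [hg _ _ _] := g2; have mphi := has_grad_measurable hg.
have bc n v : `|cutf phi n v| <= C * japanese v ^+ 1 := le_trans (cutf_le _ _ _) (b1 v).
have mc n := has_grad_measurable (has_grad_cutf n hg).
have C0 : 0 <= C.
  have := le_trans (normr_ge0 _) (b1 0).
  by rewrite pmulr_lge0// exprn_gt0// japanese_gt0.
have H x y : 0 <= x -> x <= y ->
  itg mu (fun t => ind x y t * (lin_rhs a b c h phi dphi t + coll alpha (h t) phi)) /\
  \int[leb]_v (h y v * phi v) - \int[leb]_v (h x v * phi v) =
  Int x y (fun t => lin_rhs a b c h phi dphi t + coll alpha (h t) phi).
  move=> x0 xy; have [N [N0 hN]] := curve_Nrm2_bounded hcurve y.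
  have := @evolves_extension R d alpha alpha_gt0 alpha_lt1 a b c h la lb lc hcurve phi dphi C
    (fun=> 1) (fun=> 4 * C * (N * N)) x y g2 x0 xy.
  rewrite (_ : (fun t => _ + 1 * _) = (fun t => lin_rhs a b c h phi dphi t + coll alpha (h t) phi)).
    rewrite (_ : (fun t => ind x y t * (_ + 1 * _)) = (fun t => ind x y t *
      (lin_rhs a b c h phi dphi t + coll alpha (h t) phi))).
      apply => //.
      + by move=> t; rewrite ler01 lexx.
      + by apply: aeW.
      + exact: (li_cst _ x0 xy).
      + move=> n t xt ty; have t0 : 0 <= t := le_trans x0 (ltW xt).
        have L2 := curve_L12 hcurve t0; rewrite mul1r.
        apply: (le_trans (norm_bil_le (measurable_Kcoll alpha (mc n))
          (Kcoll_bound2 alpha_gt0 alpha_lt1 (leqnn 1) (mc n) (bc n)) L2 L2)).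
        by rewrite ler_wpM2l ?mulr_ge0// ler_pM ?Nrm_ge0 ?hN.
      + move=> t xt ty; have t0 : 0 <= t := le_trans x0 (ltW xt).
        rewrite mul1r; apply: (@cvg_ext _ _ (fun n => coll alpha (h t) (cutf phi n))).
          by move=> n; rewrite mul1r.
        apply: (coll_cvg alpha_gt0 alpha_lt1 (curve_L12 hcurve t0) mc bc) => v.
        exact: cutf_cvg.
    by apply/funext => t; rewrite mul1r.
  by apply/funext => t; rewrite mul1r.
by split => x y x0 xy; have [] := H x y x0 xy.
Qed.

(** The dominating function is a multiple of the third moment, whose integrability on the interval
    is therefore a hypothesis. *)
Lemma evolves_quadratic phi dphi C x y : growth2 phi dphi C -> 0 <= x -> x <= y ->
  {ae mu, forall t, 0 < t -> fin3 h t = 1} ->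
  itg mu (fun t => ind x y t * (fin3 h t * Nrm 3 (h t))) ->
  itg mu (fun t => ind x y t * (lin_rhs a b c h phi dphi t + fin3 h t * coll alpha (h t) phi)) /\
  \int[leb]_v (h y v * phi v) - \int[leb]_v (h x v * phi v) =
  Int x y (fun t => lin_rhs a b c h phi dphi t + fin3 h t * coll alpha (h t) phi).
Proof.
move=> g2 x0 xy aeJ i3; have [hg b1 _ _] := g2; have mphi := has_grad_measurable hg.
have bc n v : `|cutf phi n v| <= C * japanese v ^+ 2 := le_trans (cutf_le _ _ _) (b1 v).
have mc n := has_grad_measurable (has_grad_cutf n hg).
have C0 : 0 <= C.
  have := le_trans (normr_ge0 _) (b1 0).
  by rewrite pmulr_lge0// exprn_gt0// japanese_gt0.
have [N [N0 hN]] := curve_Nrm2_bounded hcurve y.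
apply: (@evolves_extension R d alpha alpha_gt0 alpha_lt1 a b c h la lb lc hcurve phi dphi C
    (fin3 h) (fun t => (8 * C * N) * (fin3 h t * Nrm 3 (h t))) x y g2 x0 xy) => //.
- exact: (measurable_fin3 hcurve).
- by move=> t; exact: fin3_01.
- by under eq_fun do rewrite mulrCA; exact: itgZ.
- move=> n t xt ty; have t0 : 0 <= t := le_trans x0 (ltW xt).
  rewrite /fin3 max_l//; case: asboolP => h3; last by rewrite !mul0r normr0 mulr0.
  rewrite !mul1r; apply: (le_trans (coll_bound3 alpha_gt0 alpha_lt1 h3 (mc n) (bc n))).
  rewrite [leRHS](_ : _ = 8 * C * (Nrm 3 (h t) * N)); last by ring.
  rewrite ler_wpM2l ?mulr_ge0// ler_wpM2l ?Nrm_ge0//.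
  by apply: (le_trans _ (hN t t0 ty)); apply: Nrm_le => //; exact: (curve_L12 hcurve t0).
- move=> t xt ty; have t0 : 0 <= t := le_trans x0 (ltW xt).
  rewrite /fin3 max_l//; case: asboolP => h3 /=.
    by apply: cvgMr; apply: (coll_cvg alpha_gt0 alpha_lt1 h3 mc bc) => v; exact: cutf_cvg.
  rewrite mul0r; apply: (@cvg_ext _ _ (fun=> 0)); last exact: cvg_cst.
  by move=> n; rewrite mul0r.
Qed.

Lemma prim_density :
  prim (fun t => density (h t)) (fun t => a t * density (h t) - alpha * q0 (h t)).
Proof.
have b1 (v : V) : `|1 : R| <= 1 * japanese v ^+ 1 := cst1_bound 1 v.
apply: (prim_ext _ _ (evolves_linear (@growth2_cst R d) b1)) => t t0; first by rewrite densityE.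
rewrite /lin_rhs -densityE coll1; last exact: in_L1_le (curve_L12 hcurve (ltW t0)).
have -> : \int[leb]_v (h t v * euler (fun=> (fun=> 0)) v) = 0.
  rewrite -[RHS](Rint_zero leb); apply: eq_Rint => v.
  by rewrite /euler big1 ?mulr0// => i _; rewrite mulr0.
have -> : \int[leb]_v (h t v * 0) = 0.
  by rewrite -[RHS](Rint_zero leb); apply: eq_Rint => v; rewrite mulr0.
by rewrite mulr0 addr0 big1 ?subr0 ?mulNr// => i _; rewrite mulr0.
Qed.

Lemma prim_mom1 i : prim (fun t => mom1 i (h t))
  (fun t => (a t + b t) * mom1 i (h t) - c i t * density (h t) - alpha * q1 i (h t)).
Proof.
apply: (prim_ext _ _ (evolves_linear (@growth2_coord R d i) (coord_bound 0 i))) => // t t0.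
rewrite /lin_rhs (coll_coord alpha_gt0 alpha_lt1 i (curve_L12 hcurve (ltW t0))).
have -> : \int[leb]_v (h t v * euler (fun j : 'I_d => fun=> (j == i)%:R) v) = mom1 i (h t).
  apply: eq_Rint => v; rewrite /euler (bigD1 i)//= eqxx mulr1 big1 ?addr0// => j /negbTE ->.
  by rewrite mulr0.
rewrite (bigD1 i)//= eqxx -densityE big1 ?addr0 => [|j /negbTE ->]; last first.
  have -> : \int[leb]_v (h t v * false%:R) = 0 by rewrite -[RHS](Rint_zero leb); apply: eq_Rint => v; rewrite mulr0.
  by rewrite mulr0.
by rewrite /mom1; ring.
Qed.

(** Stated for one interval and not as a primitive: at this stage the third moment is known to be
    integrable away from time 0 only, and the energy balance is what will give integrability up to
    0. *)
Lemma mom2_increment x y : 0 <= x -> x <= y ->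
  {ae mu, forall t, 0 < t -> fin3 h t = 1} ->
  itg mu (fun t => ind x y t * (fin3 h t * Nrm 3 (h t))) ->
  let rhs t := (a t + 2 * b t) * mom2 (h t) - 2 * (\sum_i c i t * mom1 i (h t))
     - fin3 h t * (alpha * q2 (h t)) in
  itg mu (fun t => ind x y t * rhs t) /\ mom2 (h y) - mom2 (h x) = Int x y rhs.
Proof.
move=> x0 xy aeJ i3 rhs.
have [h1 h2] := evolves_quadratic (@growth2_energy R d) x0 xy aeJ i3.
have E t : 0 < t -> lin_rhs a b c h (fun v => enorm v ^+ 2) (fun i v => 2 * v 0 i) t +
    fin3 h t * coll alpha (h t) (fun v => enorm v ^+ 2) = rhs t.
  move=> t0; rewrite /lin_rhs /rhs; have L2 := curve_L12 hcurve (ltW t0).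
  have -> : \int[leb]_v (h t v * euler (fun i v => 2 * v 0 i) v) = 2 * mom2 (h t).
    rewrite /mom2 -RintZ; last exact: (in_L1_pairC L2 (@measurable_enorm_sqr R d) (@enorm_sqr_bound R d 0)).
    apply: eq_Rint => v; rewrite /euler enorm_sqr !mulr_sumr; apply: eq_bigr => i _; ring.
  have -> : \sum_i c i t * \int[leb]_v (h t v * (2 * v 0 i)) =
      2 * (\sum_i c i t * mom1 i (h t)).
    rewrite mulr_sumr; apply: eq_bigr => i _.
    rewrite [RHS]mulrCA; congr (_ * _); rewrite /mom1 -RintZ.
      by apply: eq_Rint => v; ring.
    exact: (in_L1_pairC L2 (measurable_coord i) (coord_bound 1 i)).
  rewrite /fin3 max_l ?(ltW t0)//; case: asboolP => h3; rewrite ?mul0r ?mul1r.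
    by rewrite (coll_enorm_sqr d_gt0 alpha_gt0 alpha_lt1 h3) /mom2; ring.
  by rewrite /mom2; ring.
split.
  rewrite (_ : (fun t => _) = (fun t => ind x y t * (lin_rhs a b c h (fun v => enorm v ^+ 2)
     (fun i v => 2 * v 0 i) t + fin3 h t * coll alpha (h t) (fun v => enorm v ^+ 2))))//.
  apply/funext => t; rewrite /ind; case: (boolP (x < t <= y)) => [/andP[xt _]|_]; rewrite ?mul0r//.
  by rewrite E// (le_lt_trans x0).
by rewrite [LHS]h2; apply: eq_Int => t xt _; rewrite E// (le_lt_trans x0).
Qed.

End evolution_moments.

(** * Solutions of the annihilation equation *)

Section interval_bridge.
Context {R : realType}.
Local Notation mu := (@lebesgue_measure R).

Lemma integrable_ind (f : R -> R) (x y : R) : x <= y ->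
  mu.-integrable `[x, y] (EFin \o f) <-> itg mu (fun s => ind x y s * f s).
Proof.
move=> xy; rewrite itg_ind_mkcond; split => [|h].
  by apply: integrableS => //; apply: subset_itvr; rewrite bnd_simp.
have E : `[x, y]%classic = [set x] `|` `]x, y].
  by rewrite setU1itv// bnd_simp.
have mf : measurable_fun `[x, y] (EFin \o f).
  rewrite E; apply/measurable_funU => //; split; last exact: measurable_int h.
  exact: measurable_fun_set1.
apply/integrableP; split => //.
rewrite -integral_itv_obnd_cbnd; first by case/integrableP : h.
by apply: measurableT_comp => //; exact: measurable_int h.
Qed.

Lemma Rintegral_ind (f : R -> R) (x y : R) : x <= y -> itg mu (fun s => ind x y s * f s) ->
  \int[mu]_(s in `[x, y]) f s = Int x y f.
Proof.
by move=> xy h; rewrite Int_mkcond Rintegral_itv_obnd_cbnd//; apply/itg_ind_mkcond.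
Qed.

Lemma li_ind0 (f : R -> R) : (forall t, 0 <= t -> itg mu (fun s => ind 0 t s * f s)) -> li f.
Proof.
move=> h x y x0 xy; have y0 := le_trans x0 xy.
rewrite (_ : (fun t => _) = (fun t => ind x y t * (ind 0 y t * f t))).
  have h' := h y y0; apply: (itg_dom _ _ (itg_norm h')).
    by apply: measurable_funM; [exact: measurable_ind|exact: (itg_meas h')].
  by move=> t; rewrite normrM (ger0_norm (ind_ge0 _ _ _)) ler_piMl// ind_le1.
apply/funext => t; rewrite mulrA; congr (_ * _).
rewrite /ind; case: (boolP (x < t <= y)) => [/andP[xt ->]|_]; rewrite ?mul0r//.
by rewrite (le_lt_trans x0 xt) mul1r.
Qed.

Lemma prim_intervals (F f : R -> R) (F0 : R) :
  (forall t, 0 <= t -> mu.-integrable `[0, t] (EFin \o f) /\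
     F t = F0 + \int[mu]_(s in `[0, t]) f s) <-> prim F f /\ F 0 = F0.
Proof.
split => [h|[[lf hF] <-] t t0]; last first.
  split; first by apply/integrable_ind => //; exact: lf.
  by rewrite Rintegral_ind//; [rewrite -hF// subrKC|exact: lf].
have lf : li f by apply: li_ind0 => t t0; apply/integrable_ind => //; exact: (h t t0).1.
have FE t : 0 <= t -> F t = F0 + Int 0 t f.
  by move=> t0; rewrite (h t t0).2 Rintegral_ind//; exact: lf.
split; last by rewrite FE// Intxx addr0.
split => // x y x0 xy; rewrite !FE ?(le_trans x0 xy)//.
by rewrite (Int_cat _ x0 xy lf)//; ring.
Qed.

End interval_bridge.

Section third_moment.
Context {R : realType} {d : nat}.
Local Notation V := 'rV[R]_d.
Local Notation mu := (@lebesgue_measure R).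

(** [Nrm3_le_q2] divided by a lower bound of the density, which is continuous and positive on
    [0, y]. *)
Lemma li_fin3_Nrm3 (h : R -> V -> R) : curve h -> (forall t, 0 <= t -> 0 < density (h t)) ->
  li (fun t => fin3 h t * q2 (h t)) -> li (fun t => fin3 h t * Nrm 3 (h t)).
Proof.
move=> hc n0 lq x y x0 xy.
have [c [c0 hcn]] := scont_lower y (scont_density hc) n0.
have [C [C0 hC]] := curve_Nrm2_bounded hc y.
pose G t := c^-1 * (4 * (ind x y t * (fin3 h t * q2 (h t))) + ind x y t * (8 * C ^+ 2)).
have iG : itg mu G.
  by apply: itgZ; apply: itgD; [apply: itgZ; exact: lq|exact: li_cst].
apply: (itg_dom _ _ iG) => [|t].
  under eq_fun do rewrite (ind_max (fun t => fin3 h t * Nrm 3 (h t)) _ _ x0).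
  apply: measurable_funM; first exact: measurable_ind.
  have E t : fin3 h (Num.max t 0) = fin3 h t.
    by rewrite /fin3 [Num.max (Num.max t 0) 0]max_l// le_max lexx orbT.
  under eq_fun do rewrite E.
  by apply: measurable_funM; [exact: measurable_fin3|exact: measurable_Nrm3].
rewrite /G /ind; case: (boolP (x < t <= y)) => [/andP[xt ty]|_]; last first.
  by rewrite !mul0r mulr0 addr0 mulr0 normr0.
have t0 : 0 <= t := le_trans x0 (ltW xt).
rewrite !mul1r /fin3 max_l//; case: asboolP => h3 /=; last first.
  by rewrite !mul0r mulr0 add0r normr0 mulr_ge0 ?invr_ge0 ?(ltW c0)// mulr_ge0 ?sqr_ge0.
rewrite !mul1r ger0_norm ?Nrm_ge0// mulrC ler_pdivlMr//.
have q := Nrm3_le_q2 h3 (curve_ge0 hc t0).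
have h2 : Nrm 2 (h t) ^+ 2 <= C ^+ 2 by rewrite lerXn2r ?nnegrE ?Nrm_ge0 ?hC.
have h1 : Nrm 3 (h t) * c <= Nrm 3 (h t) * density (h t) by rewrite ler_wpM2l ?Nrm_ge0 ?hcn.
by apply: (le_trans h1); apply: (le_trans q); rewrite lerD2l ler_wpM2l.
Qed.

End third_moment.

Section annihilation.
Context {R : realType} {d : nat}.
Hypothesis d_gt0 : (0 < d)%N.
Local Notation V := 'rV[R]_d.
Local Notation leb := (@lebesgue_rV R d).
Local Notation mu := (@lebesgue_measure R).
Variable alpha : R.
Hypotheses (alpha_gt0 : 0 < alpha) (alpha_lt1 : alpha < 1).

Local Notation zero := (fun=> 0).
Local Notation zeroI := (fun _ _ => 0).

Lemma lin_rhs0 (h : R -> V -> R) phi dphi t : lin_rhs zero zero zeroI h phi dphi t = 0.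
Proof. by rewrite /lin_rhs !mul0r add0r big1 ?subrr// => i _; rewrite mul0r. Qed.

(** The weak formulation fixes the initial value only through its pairings, so this relation stands
    for equality with the datum. *)
Definition same_tests (f g : V -> R) : Prop := forall phi, test_function phi ->
  \int[leb]_v (f v * phi v) = \int[leb]_v (g v * phi v).

(** Used in both directions: to exploit the given solution, and to submit a constructed solution to
    the uniqueness hypothesis. *)
Lemma annihilation_evolves (f0 : V -> R) (f : R -> V -> R) : annihilation_solution alpha f0 f <->
  [/\ solution_class f, forall t, 0 <= t -> in_L1 3 (f t),
      evolves alpha zero zero zeroI f & same_tests (f 0) f0].
Proof.
have E t phi dphi r (sf : solution_class f) : in_L1 3 (f t) -> 0 <= t -> has_grad phi dphi ->
    (forall v, r < enorm v -> phi v = 0) -> collision_rhs alpha f t phi =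
    lin_rhs zero zero zeroI f phi dphi t + coll alpha (f t) phi.
  move=> f3 t0 hg hr; have [C [[_ b _ _] _]] := test_growth2 hg hr.
  rewrite lin_rhs0 add0r; apply: (collision_rhsE d_gt0 alpha f3 _ (has_grad_measurable hg) b).
  exact: (sc_ge0 sf).
split => [[sf f3 w]|[sf f3 ev s0]]; split => //.
- move=> phi dphi r hg hr.
  have tphi : test_function phi by apply/test_functionP; exists dphi, r.
  have [p _] := (prim_intervals _ _ _).1 (w phi tphi).
  apply: (prim_ext _ _ p) => // t t0; apply: (E t phi dphi r sf) => //; [exact: f3 (ltW t0)|exact: ltW].
- move=> phi tphi; have [_] := (prim_intervals _ _ _).1 (w phi tphi); exact.
- move=> phi tphi; have [dphi [r [hg hr]]] := (test_functionP phi).1 tphi.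
  apply/prim_intervals; split; last exact: s0.
  apply: (prim_ext _ _ (ev phi dphi r hg hr)) => // t t0.
  by rewrite (E t phi dphi r sf)//; [exact: f3 (ltW t0)|exact: ltW].
Qed.

Section solution.
Variables (f0 : V -> R) (f : R -> V -> R).
Hypotheses (sf : solution_class f) (f3 : forall t, 0 <= t -> in_L1 3 (f t))
  (ev : evolves alpha zero zero zeroI f) (n0 : 0 < density (f 0)).

Let fc : curve f := solution_class_curve sf.
Let f_ge0 := curve_ge0 fc.
Let l0 : li (fun _ : R => 0 : R) := li_cst 0.

Let f1 t : 0 <= t -> in_L1 1 (f t).
Proof. by move=> t0; exact: (in_L1_le (isT : (1 <= 3)%N) (f3 t0)). Qed.

Lemma annihilation_density : prim (fun t => density (f t)) (fun t => - alpha * q0 (f t)).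
Proof.
apply: (prim_ext _ _ (prim_density alpha_gt0 alpha_lt1 l0 l0 (fun=> l0) fc ev)) => // t _.
by rewrite mul0r sub0r mulNr.
Qed.

Lemma annihilation_mom1 i : prim (fun t => mom1 i (f t)) (fun t => - alpha * q1 i (f t)).
Proof.
apply: (prim_ext _ _ (prim_mom1 alpha_gt0 alpha_lt1 l0 l0 (fun=> l0) fc ev i)) => // t _.
by rewrite addr0 !mul0r subrr sub0r mulNr.
Qed.

(** On [0, t] the loss rate is at most k = 2 alpha N times the density, where N bounds the L^1_2
    norm; so exp(k s) times the density cannot decrease. *)
Lemma annihilation_density_gt0 t : 0 <= t -> 0 < density (f t).
Proof.
move=> t0; have [N [N0 hN]] := curve_Nrm2_bounded fc t.
pose k := alpha * (2 * N).
have pe : prim (fun s : R => expR (k * s)) (fun s => expR (k * s) * (k * 1)).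
  apply: prim_exp; apply: primZ.
  split => [|x y x0 xy]; first exact: li_cst.
  by rewrite Int_cst// mul1r.
have p := primM pe annihilation_density.
have := prim_le (primN p) (li_cst 0) (lexx 0) t0 _.
rewrite /= Int_cst// mul0r addr0 lerN2 mulr0 expR0 mul1r => h.
have : density (f 0) <= expR (k * t) * density (f t).
  apply: h => s s0 st; rewrite oppr_le0 mulr1.
  have s0' := ltW s0; have := q0_le (f1 s0') (f_ge0 s0').
  have d0 : 0 <= density (f s) by apply: Rint_ge0 => v; exact: f_ge0.
  have : Nrm 1 (f s) <= N.
    by apply: (le_trans _ (hN s s0' st)); apply: Nrm_le => //; exact: (curve_L12 fc s0').
  move=> nN q; have h2 : q0 (f s) <= 2 * N * density (f s).
    by apply: (le_trans q); rewrite ler_wpM2r// ler_wpM2l.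
  have -> : expR (k * s) * k * density (f s) + expR (k * s) * (- alpha * q0 (f s)) =
    expR (k * s) * alpha * (2 * N * density (f s) - q0 (f s)) by rewrite /k; ring.
  by rewrite mulr_ge0 ?subr_ge0// mulr_ge0 ?expR_ge0// ltW.
by move=> /(lt_le_trans n0); rewrite pmulr_rgt0// expR_gt0.
Qed.

Let fin3E t : 0 <= t -> fin3 f t = 1.
Proof. by move=> t0; rewrite /fin3 max_l// asboolT//; exact: f3. Qed.

Let ae3 : {ae mu, forall t, 0 < t -> fin3 f t = 1}.
Proof. by apply: aeW => t t0; apply: fin3E; exact: ltW. Qed.

(** For x > 0 the energy balance makes alpha times the integral of [q2] over ]x, t] equal to an
    energy difference, bounded uniformly in x by continuity of the energy; then x tends to 0. *)
Lemma annihilation_li_q2 : li (fun t => q2 (f t)).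
Proof.
apply: li_ind0 => t t0.
have E x y s : 0 <= x -> ind x y s * q2 (f s) = ind x y s * q2 (f (Num.max s 0)).
  by move=> x0; exact: (ind_max (fun s => q2 (f s))).
under eq_fun do rewrite E//.
have step x : 0 < x -> x <= t -> itg mu (fun s => ind x t s * q2 (f s)) /\
    alpha * Int x t (fun s => q2 (f s)) = mom2 (f x) - mom2 (f t).
  move=> x0 xt; have i3 := solution_class_itg3 sf x0 xt.
  have [i e] := mom2_increment d_gt0 alpha_gt0 alpha_lt1 l0 l0 (fun=> l0) fc ev (ltW x0) xt ae3 i3.
  have E2 : forall s, ind x t s * ((0 + 2 * 0) * mom2 (f s) - 2 * (\sum_(i : 'I_d) 0 * mom1 i (f s))
     - fin3 f s * (alpha * q2 (f s))) = - alpha * (ind x t s * q2 (f s)).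
    move=> s; rewrite /ind; case: (boolP (x < s <= t)) => [/andP[xs _]|_]; rewrite ?mul0r ?mulr0//.
    rewrite fin3E; last by rewrite ltW// (lt_trans x0).
    by rewrite big1 => [|j _]; rewrite ?mul0r//; ring.
  have i' : itg mu (fun s => ind x t s * q2 (f s)).
    rewrite (_ : (fun s => _) = (fun s => - alpha^-1 * (- alpha * (ind x t s * q2 (f s))))).
      apply: itgZ; move: i; congr itg; apply/funext => s; exact: E2.
    by apply/funext => s; field; rewrite gt_eqF.
  split => //; apply: oppr_inj; rewrite -mulNr opprB e /Int -RintZ//.
  by apply: eq_Rint => s; rewrite -E2.
have [C [C0 hC]] := scont_bounded t (scont_mom2 fc).
have aV : 0 < alpha^-1 by rewrite invr_gt0.
apply: (@itg_ind_exhaust _ _ _ (alpha^-1 * C)) => [|s|n|n].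
- exact: (measurable_q2 fc).
- by apply: q2_ge0 => v; apply: f_ge0; rewrite le_max lexx orbT.
- have n0' : 0 < n.+1%:R^-1 :> R by rewrite invr_gt0 ltr0n.
  have [xt|tx] := leP n.+1%:R^-1 t.
    under eq_fun do rewrite -(ind_max (fun s => q2 (f s)) _ _ (ltW n0')).
    by have [] := step _ n0' xt.
  rewrite (_ : (fun s => _) = (fun=> 0)); first exact: itg0.
  apply/funext => s; rewrite /ind; case: (boolP (_ < s <= t)) => [/andP[h1 h2]|_]; last by rewrite mul0r.
  by have := lt_le_trans h1 h2; rewrite ltNge (ltW tx).
- have n0' : 0 < n.+1%:R^-1 :> R by rewrite invr_gt0 ltr0n.
  have [xt|tx] := leP n.+1%:R^-1 t.
    have [_ h] := step _ n0' xt.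
    have -> : Int n.+1%:R^-1 t (fun s => q2 (f (Num.max s 0))) = Int n.+1%:R^-1 t (fun s => q2 (f s)).
      by apply: eq_Int => s hs _; rewrite max_l// ltW// (lt_trans n0').
    rewrite -[leLHS](mulKf (lt0r_neq0 alpha_gt0)) ler_wpM2l ?(ltW aV)// h.
    have := hC _ (ltW n0') xt; have : 0 <= mom2 (f t).
      by apply: Rint_ge0 => v; rewrite mulr_ge0 ?sqr_ge0// f_ge0.
    have := ler_norm (mom2 (f n.+1%:R^-1)); lra.
  rewrite /Int (_ : \int[mu]_s _ = 0); first by rewrite mulr_ge0// ltW.
  rewrite -[RHS](Rint_zero mu); apply: eq_Rint => s.
  rewrite /ind; case: (boolP (_ < s <= t)) => [/andP[h1 h2]|_]; last by rewrite mul0r.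
  by have := lt_le_trans h1 h2; rewrite ltNge (ltW tx).
Qed.

Lemma annihilation_mom2 : prim (fun t => mom2 (f t)) (fun t => - alpha * q2 (f t)).
Proof.
split => [|x y x0 xy]; first exact/liZ/annihilation_li_q2.
have i3 : itg mu (fun t => ind x y t * (fin3 f t * Nrm 3 (f t))).
  apply: li_fin3_Nrm3 => //; first exact: annihilation_density_gt0.
  move=> x' y' x0' xy'; have := annihilation_li_q2 x0' xy'; congr itg; apply/funext => t.
  rewrite /ind; case: (boolP (x' < t <= y')) => [/andP[xt _]|_]; rewrite ?mul0r//.
  by rewrite fin3E ?mul1r// (le_trans x0')// ltW.
have [_ ->] := mom2_increment d_gt0 alpha_gt0 alpha_lt1 l0 l0 (fun=> l0) fc ev x0 xy ae3 i3.
apply: eq_Int => t xt _; rewrite fin3E; last by rewrite (le_trans x0)// ltW.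
by rewrite big1 => [|j _]; rewrite ?mul0r//; ring.
Qed.

End solution.
End annihilation.

Lemma Int_ge0 {R : realType} (x y : R) (f : R -> R) : (forall t, x < t -> t <= y -> 0 <= f t) ->
  0 <= Int x y f.
Proof.
move=> h; apply: Rint_ge0 => t; rewrite /ind.
by case: (boolP (x < t <= y)) => [/andP[xt ty]|_]; rewrite ?mul0r// mul1r h.
Qed.

(** * Temperature and pairs of close velocities *)

Section temperature_facts.
Context {R : realType} {d : nat}.
Hypothesis d_gt0 : (0 < d)%N.
Local Notation V := 'rV[R]_d.
Local Notation leb := (@lebesgue_rV R d).
Local Notation leb2 := (leb \x leb)%E.
Implicit Types (h k : V -> R) (u : V).

Lemma in_L1_itg1 q h : in_L1 q h -> itg leb h.
Proof.
move=> hq; have := in_L1_pairC (in_L1_le (leq0n q) hq) (measurable_cst (1 : R)) (cst1_bound 0).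
by congr itg; apply/funext => v; rewrite mulr1.
Qed.

Lemma ae_neq u : {ae leb, forall v, v != u}.
Proof.
exists [set u]; split.
- have := @measurable_rV_box R d (fun i => `[u 0 i, u 0 i]); congr measurable.
  apply/seteqP; split => v /=; last by move=> -> i; rewrite in_itv/= lexx.
  by move=> h; apply/rowP => i; apply/eqP; rewrite eq_le andbC; have := h i; rewrite in_itv.
- exact: lebesgue_rV_set1.
- by move=> v /= /negP; rewrite negbK => /eqP.
Qed.

Lemma measurable_distX u : measurable_fun setT (fun v : V => enorm (v - u) ^+ 2).
Proof. by apply: measurable_funX; apply: meas_enorm; apply: meas_vsub. Qed.

Lemma distX_bound u : exists C, forall v : V, `|enorm (v - u) ^+ 2| <= C * japanese v ^+ 2.
Proof.
exists (2 + 2 * enorm u ^+ 2) => v; rewrite ger0_norm ?sqr_ge0// japanese_sqr.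
have := enormB v u; have := enorm_ge0 (v - u); have := enorm_ge0 v; have := enorm_ge0 u.
move: (enorm (v - u)) (enorm v) (enorm u) => x y z z0 y0 x0 h.
have : x ^+ 2 <= (y + z) ^+ 2 by rewrite lerXn2r ?nnegrE// addr_ge0.
have := sqr_ge0 (y - z); have : 0 <= z ^+ 2 * y ^+ 2 by rewrite mulr_ge0 ?sqr_ge0.
nra.
Qed.

Lemma itg_distX u h : in_L1 2 h -> itg leb (fun v => h v * enorm (v - u) ^+ 2).
Proof.
by move=> h2; have [C hC] := distX_bound u; exact: (in_L1_pairC h2 (measurable_distX u) hC).
Qed.

Lemma temperature_spread h : 0 < density h ->
  \int[leb]_v (h v * enorm (v - bulk_velocity h) ^+ 2) = d%:R * density h * temperature h.
Proof.
by move=> n0; rewrite /temperature mulVKf// mulf_neq0 ?(lt0r_neq0 n0)// pnatr_eq0 -lt0n.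
Qed.

(** At zero temperature [h] would vanish almost everywhere off the point [u], which is
    Lebesgue-null, contradicting the positive density. *)
Lemma temperature_gt0 h : (forall v, 0 <= h v) -> in_L1 2 h -> 0 < density h ->
  0 < temperature h.
Proof.
move=> h0 h2 n0; set u := bulk_velocity h.
have dn : 0 < d%:R * density h by rewrite mulr_gt0 ?ltr0n.
have T0 : 0 <= temperature h.
  by rewrite mulr_ge0 ?invr_ge0 ?(ltW dn)//; apply: Rint_ge0 => v; rewrite mulr_ge0 ?sqr_ge0.
rewrite lt_neqAle T0 andbT eq_sym; apply/eqP => T00.
have := temperature_spread n0; rewrite T00 mulr0 => E.
have nn v : 0 <= h v * enorm (v - u) ^+ 2 by rewrite mulr_ge0 ?sqr_ge0.
have z := ge0_Rint_eq0 (itg_distX u h2) nn E.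
have : {ae leb, forall v, h v = 0}.
  apply: (filterS2 _ _ z (ae_neq u)) => v /eqP; rewrite mulf_eq0 expf_eq0/= => /orP[/eqP//|].
  by move=> /eqP /enorm_eq0 /eqP; rewrite subr_eq0 => ->.
move=> hz; have := ae_eq_Rint (in_L1_meas h2) (measurable_cst (0 : R)) hz.
by rewrite Rint_zero => n00; move: n0; rewrite /density n00 ltxx.
Qed.

Lemma temperatureE h : in_L1 2 h -> 0 < density h ->
  d%:R * density h * temperature h = mom2 h - (\sum_i mom1 i h ^+ 2) / density h.
Proof.
move=> h2 n0; rewrite -temperature_spread//; set n := density h; set u := bulk_velocity h.
have uE i : u 0 i = mom1 i h / n by rewrite /u /bulk_velocity !mxE mulrC.
have i1 i := in_L1_pairC h2 (measurable_coord i) (coord_bound 1 i).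
have i2 := in_L1_pairC h2 (@measurable_enorm_sqr R d) (@enorm_sqr_bound R d 0).
have ih := in_L1_itg1 h2.
have E v : h v * enorm (v - u) ^+ 2 = h v * enorm v ^+ 2 +
    \sum_i ((- (2 * u 0 i)) * (h v * v 0 i) + u 0 i ^+ 2 * h v).
  rewrite !enorm_sqr !mulr_sumr -big_split/=; apply: eq_bigr => i _; rewrite !mxE; ring.
have isum i : itg leb (fun v => (- (2 * u 0 i)) * (h v * v 0 i) + u 0 i ^+ 2 * h v).
  by apply: itgD; apply: itgZ => //; exact: i1.
rewrite (eq_Rint _ E) (RintD i2 (itg_sum_seq _ isum)) (Rint_sum_seq _ isum); congr (_ + _).
rewrite mulr_suml -sumrN; apply: eq_bigr => i _.
rewrite (RintD (itgZ _ (i1 i)) (itgZ _ ih)) (RintZ _ (i1 i)) (RintZ _ ih) uE.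
rewrite -/(mom1 i h) -/(density h) -/n; field; exact: lt0r_neq0.
Qed.

(** With |v - w|^2 <= 2 |v - u|^2 + 2 |w - u|^2, where u is the bulk velocity, a quadratic bound on
    the kernel becomes a bound by the temperature. *)
Lemma bil_le_spread (K : V * V -> R) A B h : (forall v, 0 <= h v) -> in_L1 2 h ->
  0 < density h -> measurable_fun setT K -> (forall p, 0 <= K p) -> 0 <= A -> 0 <= B ->
  (forall p, K p <= A + B * enorm (p.1 - p.2) ^+ 2) ->
  itg leb2 (fun p => K p * (h p.1 * h p.2)) /\
  bil K h h <= A * density h ^+ 2 + 4 * B * density h * (d%:R * density h * temperature h).
Proof.
move=> h0 h2 n0 mK K0 A0 B0 hK; set u := bulk_velocity h.
have ih := in_L1_itg1 h2; have id := itg_distX u h2.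
pose G p := A * (h p.1 * h p.2) + 2 * B * ((h p.1 * enorm (p.1 - u) ^+ 2) * h p.2) +
   2 * B * (h p.1 * (h p.2 * enorm (p.2 - u) ^+ 2)).
have iG : itg leb2 G.
  by apply: itgD; [apply: itgD|]; apply: itgZ; [exact: (itg_tensor ih ih)|exact: (itg_tensor id ih)|exact: (itg_tensor ih id)].
have KG p : K p * (h p.1 * h p.2) <= G p.
  have t : enorm (p.1 - p.2) <= enorm (p.1 - u) + enorm (p.2 - u).
    by have := enormB (p.1 - u) (p.2 - u); rewrite opprB addrA subrK.
  have e : enorm (p.1 - p.2) ^+ 2 <= 2 * enorm (p.1 - u) ^+ 2 + 2 * enorm (p.2 - u) ^+ 2.
    apply: (@le_trans _ _ ((enorm (p.1 - u) + enorm (p.2 - u)) ^+ 2)).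
      by rewrite lerXn2r ?nnegrE ?addr_ge0 ?enorm_ge0.
    by have := sqr_ge0 (enorm (p.1 - u) - enorm (p.2 - u)); nra.
  have k := ler_wpM2l B0 e.
  have hh : 0 <= h p.1 * h p.2 by rewrite mulr_ge0.
  apply: (@le_trans _ _ ((A + B * (2 * enorm (p.1 - u) ^+ 2 + 2 * enorm (p.2 - u) ^+ 2)) * (h p.1 * h p.2))).
    by rewrite ler_wpM2r// (le_trans (hK p))// lerD2l.
  by rewrite /G le_eqVlt; apply/orP; left; apply/eqP; ring.
have iK : itg leb2 (fun p => K p * (h p.1 * h p.2)).
  apply: (itg_dom _ _ iG).
    by apply: measurable_funM => //; apply: meas_tensor; exact: in_L1_meas h2.
  by move=> p; rewrite ger0_norm// !mulr_ge0.
split => //; apply: (le_trans (le_Rint iK iG KG)).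
have t1 := itg_tensor ih ih; have t2 := itg_tensor id ih; have t3 := itg_tensor ih id.
rewrite (RintD (itgD (itgZ A t1) (itgZ (2 * B) t2)) (itgZ (2 * B) t3)) (RintD (itgZ A t1) (itgZ (2 * B) t2)).
rewrite (RintZ A t1) (RintZ (2 * B) t2) (RintZ (2 * B) t3) (Rint_tensor ih ih) (Rint_tensor id ih) (Rint_tensor ih id) temperature_spread//.
by rewrite -/(density h) le_eqVlt; apply/orP; left; apply/eqP; ring.
Qed.

Lemma q0_le_temperature h : (forall v, 0 <= h v) -> in_L1 2 h -> 0 < density h ->
  q0 h <= (1 + 4 * d%:R) / 2 * (density h ^+ 2 * Num.sqrt (temperature h)).
Proof.
move=> h0 h2 n0; have T0 := temperature_gt0 h0 h2 n0.
set s := Num.sqrt (temperature h).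
have s0 : 0 < s by rewrite sqrtr_gt0.
have sT : temperature h = s ^+ 2 by rewrite sqr_sqrtr// ltW.
(* Coefficients of |v - w| <= s/2 + |v - w|^2 / (2 s). The choice s = sqrt T makes both
   contributions multiples of n^2 sqrt T. *)
have A0 : 0 <= s / 2 by rewrite divr_ge0// ltW.
have B0 : 0 <= (2 * s)^-1 by rewrite invr_ge0 mulr_ge0// ltW.
have K0 (p : V * V) : 0 <= enorm (p.1 - p.2) * (fun=> 1) p.1 by rewrite mulr1 enorm_ge0.
have hK (p : V * V) : enorm (p.1 - p.2) * (fun=> 1) p.1 <= s / 2 + (2 * s)^-1 * enorm (p.1 - p.2) ^+ 2.
  rewrite mulr1; move: (enorm (p.1 - p.2)) => x; rewrite -(ler_pM2r s0).
  rewrite (_ : (s / 2 + _) * s = 2^-1 * (s ^+ 2 + x ^+ 2)); last by field; exact: lt0r_neq0.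
  have := sqr_ge0 (s - x); nra.
have [_ H] := bil_le_spread h0 h2 n0 (measurable_dist_fst (measurable_cst (1 : R))) K0 A0 B0 hK.
apply: (le_trans H); rewrite sT le_eqVlt; apply/orP; left; apply/eqP.
by field; exact: lt0r_neq0.
Qed.

Lemma le_bil_r (K : V * V -> R) h k1 k2 L : (forall v, 0 <= h v) ->
  in_L1 0 h -> in_L1 0 k1 -> in_L1 0 k2 ->
  measurable_fun setT K -> (forall p, `|K p| <= 1) ->
  (forall v, \int[leb]_w (k1 w * K (v, w)) <= \int[leb]_w (k2 w * K (v, w)) + L) ->
  bil K h k1 <= bil K h k2 + L * density h.
Proof.
move=> h0 hL k1L k2L mK K1 H.
have KC p : `|K p| <= 1 * (japanese p.1 ^+ 0 * japanese p.2 ^+ 0) by rewrite !expr0 !mulr1.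
have i1 := Rint_fubini (itg_bil mK KC hL k1L).
have i2 := Rint_fubini (itg_bil mK KC hL k2L).
have ih := in_L1_itg1 hL.
rewrite /bil i1.2 i2.2 /density -(RintZ _ ih) -RintD; [|exact: i2.1|exact: itgZ].
apply: le_Rint; [exact: i1.1|by apply: itgD; [exact: i2.1|exact: itgZ]|move=> v /=].
have E k : in_L1 0 k -> \int[leb]_w (K (v, w) * (h v * k w)) = h v * \int[leb]_w (k w * K (v, w)).
  move=> kL; have mKv : measurable_fun setT (fun w => K (v, w)).
    exact: (measurableT_comp mK (measurable_pair1 v)).
  rewrite -RintZ; first by apply: eq_Rint => w; ring.
  by apply: (@in_L1_pairC _ _ 0 k _ 1 kL mKv) => w; rewrite expr0 mulr1.
by rewrite !E// (mulrC L) -mulrDr ler_wpM2l.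
Qed.

(** A smooth substitute for the indicator of pairs at distance at most [e]; its bilinear form
    measures how concentrated the distribution is. *)
Definition bump (e : R) (p : V * V) : R := chi e (p.1 - p.2).

Lemma measurable_bump e : measurable_fun setT (bump e).
Proof.
apply: (measurableT_comp (has_grad_measurable (@has_grad_chi R d e))).
exact: meas_vsub.
Qed.

Lemma bump_norm e p : `|bump e p| <= 1.
Proof. by rewrite ger0_norm ?chi_ge0 ?chi_le1. Qed.

Lemma bumpC e v w : bump e (v, w) = bump e (w, v).
Proof. by rewrite /bump/= /chi -(enormN (v - w)) opprB. Qed.

(** The kernels decrease to the indicator of the diagonal, which is null for the product measure:
    this is where it matters that the solution has a density. *)
Lemma bil_bump_cvg h : in_L1 0 h -> bil (bump n.+1%:R^-1) h h @[n --> \oo] --> (0 : R).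
Proof.
move=> hL; have ih := in_L1_itg1 hL; have mh := in_L1_meas hL.
pose F (p : V * V) : R := (p.1 == p.2)%:R * (h p.1 * h p.2).
have cv p : bump n.+1%:R^-1 p * (h p.1 * h p.2) @[n --> \oo] --> F p.
  apply: cvgMl; rewrite /bump; have [->|ne] := eqVneq p.1 p.2.
    rewrite subrr (_ : (fun n : nat => _) = (fun=> 1)); first exact: cvg_cst.
    apply/funext => n; apply/eqP; rewrite eq_le chi_le1/=.
    by apply: (le_trans _ (chi_ge _ _)); rewrite enorm0 expr0n/= mul0r mulr0 subr0.
  have z0 : 0 < enorm (p.1 - p.2).
    by rewrite lt_neqAle enorm_ge0 andbT eq_sym; apply: contra_neq ne => /enorm_eq0/eqP; rewrite subr_eq0 => /eqP.
  apply: cvg_near_cst; have := near_infty_natSinv_lt (PosNum z0).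
  by apply: filterS => n /= hn; rewrite chi_out// invr_gt0 ltr0n.
have m_ n : measurable_fun setT (fun p => bump n.+1%:R^-1 p * (h p.1 * h p.2)).
  by apply: measurable_funM; [exact: measurable_bump|exact: meas_tensor].
have mF : measurable_fun setT F by apply: (measurable_fun_cvg m_) => p _; exact: cv.
have b n p : `|bump n.+1%:R^-1 p * (h p.1 * h p.2)| <= `|h p.1 * h p.2|.
  by rewrite normrM ler_piMl// bump_norm.
have D := @Rint_dct _ _ R leb2 _ _ _ m_ cv (itg_norm (itg_tensor ih ih)) b.
suff E : \int[leb2]_p F p = 0 by rewrite -E.
have iF : itg leb2 F.
  apply: (itg_dom mF _ (itg_norm (itg_tensor ih ih))) => p.
  by rewrite normrM ler_piMl// normr_nat; case: eqP; rewrite ?ler01.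
rewrite (Rint_fubini iF).2 -[RHS](Rint_zero leb); apply: eq_Rint => v.
rewrite -[RHS](Rint_zero leb); apply: ae_eq_Rint => //.
  exact: (measurableT_comp mF (measurable_pair1 v)).
by apply: filterS (ae_neq v) => w /negbTE nw; rewrite /F/= eq_sym nw mul0r.
Qed.

(** Distant pairs are paid for by the temperature, since 1 - chi <= 2 |v - w|^2 / e^2. So a small
    temperature forces almost all pairs to be close. *)
Lemma sqr_density_le_bump e h : 0 < e -> (forall v, 0 <= h v) -> in_L1 2 h -> 0 < density h ->
  density h ^+ 2 <= bil (bump e) h h + 8 / e ^+ 2 * density h * (d%:R * density h * temperature h).
Proof.
move=> e0 h0 h2 n0; have ih := in_L1_itg1 h2.
have K0 (p : V * V) : 0 <= 1 - bump e p by rewrite subr_ge0 chi_le1.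
have B0 : 0 <= 2 / e ^+ 2 by rewrite divr_ge0 ?sqr_ge0.
have hK (p : V * V) : 1 - bump e p <= 0 + 2 / e ^+ 2 * enorm (p.1 - p.2) ^+ 2.
  have := chi_ge e (p.1 - p.2); rewrite /bump.
  rewrite (_ : 2 * (_ / _) = 2 / e ^+ 2 * enorm (p.1 - p.2) ^+ 2); last by ring.
  by lra.
have [i1 H] := bil_le_spread h0 h2 n0 (measurable_funB (measurable_cst (1 : R)) (measurable_bump e)) K0 (lexx 0) B0 hK.
have KC p : `|bump e p| <= 1 * (japanese p.1 ^+ 0 * japanese p.2 ^+ 0).
  by rewrite !expr0 !mulr1 bump_norm.
have hL := in_L1_le (isT : (0 <= 2)%N) h2.
have -> : density h ^+ 2 = bil (bump e) h h + bil (fun p => 1 - bump e p) h h.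
  rewrite /bil -RintD//; last exact: (itg_bil (measurable_bump e) KC hL hL).
  by rewrite expr2 -(Rint_tensor ih ih); apply: eq_Rint => p; ring.
rewrite lerD2l; apply: (le_trans H).
by rewrite mul0r add0r le_eqVlt; apply/orP; left; apply/eqP; ring.
Qed.

End temperature_facts.

(** * The rescaled time is unbounded *)

Section temperature_decay.
Context {R : realType} {d : nat}.
Hypothesis d_gt0 : (0 < d)%N.
Local Notation V := 'rV[R]_d.
Local Notation leb := (@lebesgue_rV R d).
Variable alpha : R.
Hypotheses (alpha_gt0 : 0 < alpha) (alpha_lt1 : alpha < 1).
Variables (f : R -> V -> R).
Hypotheses (sf : solution_class f) (f3 : forall t, 0 <= t -> in_L1 3 (f t))
  (ev : evolves alpha (fun=> 0) (fun=> 0) (fun _ _ => 0) f) (n0 : 0 < density (f 0)).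

Let fc : curve f := solution_class_curve sf.
Let f_ge0 := curve_ge0 fc.
Let f2 t : 0 <= t -> in_L1 2 (f t) := @curve_L12 _ _ _ fc t.
Let ngt0 t : 0 <= t -> 0 < density (f t).
Proof. exact: (annihilation_density_gt0 alpha_gt0 alpha_lt1 sf f3 ev n0). Qed.
Let pn := annihilation_density alpha_gt0 alpha_lt1 sf ev.

(** Whatever the region seen by [phi], it gains mass at most at the total collision rate, since (1 -
    alpha) avg phi - phi <= 1 when 0 <= phi <= 1. *)
Lemma coll_le_q0 (h phi : V -> R) C : in_L1 2 h -> (forall v, 0 <= h v) -> measurable_fun setT phi ->
  (forall v, 0 <= phi v <= 1) -> (forall v, `|phi v| <= C * japanese v ^+ 1) ->
  coll alpha h phi <= q0 h.
Proof.
move=> h2 h0 mphi p01 pC.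
have c1 (v : V) : `|1 : R| <= 1 * japanese v ^+ 1 := cst1_bound 1 v.
apply: (le_bil (measurable_Kcoll alpha mphi) (measurable_dist_fst (measurable_cst (1 : R)))
  (Kcoll_bound alpha_gt0 alpha_lt1 mphi pC) (dist_fst_bound c1) h2 h0) => p.
rewrite /Kcoll ler_wpM2l ?enorm_ge0//.
have a1 : avg phi p <= 2 / 2.
  by apply: (avg_le2 mphi pC) => s; rewrite -[2]/(1 + 1) lerD//; case/andP: (p01 (vpost p.1 p.2 (radial_proj s))) (p01 (vpost_star p.1 p.2 (radial_proj s))) => _ h1 /andP[_ h2'].
rewrite divff ?pnatr_eq0// in a1.
have a1' : (1 - alpha) * avg phi p <= 1 - alpha.
  by rewrite -[leRHS]mulr1 ler_wpM2l// subr_ge0 ltW.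
have /andP[p0 _] := p01 p.1; apply: (le_trans (lerB a1' p0)).
by rewrite subr0 gerBl ltW.
Qed.

Lemma density_loss x y : 0 <= x -> x <= y ->
  Int x y (fun t => q0 (f t)) = (density (f x) - density (f y)) / alpha.
Proof.
move=> x0 xy; have [_ /(_ x y x0 xy)] := pn.
rewrite (IntZ _ x0 xy (li_scont (scont_q0 fc))) => h.
rewrite -opprB h; field; exact: lt0r_neq0.
Qed.

(** Around any centre, the bump-weighted mass grows by at most the total number of collisions, which
    is the mass lost divided by alpha. The estimate is uniform in the centre, so it can be
    integrated against each of the two factors in turn. *)
Lemma bump_growth e x y : 0 < e -> 0 <= x -> x <= y ->
  bil (bump e) (f y) (f y) <= bil (bump e) (f x) (f x) +
    2 * density (f x) * ((density (f x) - density (f y)) / alpha).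
Proof.
move=> e0 x0 xy; have y0 := le_trans x0 xy; set L := (_ - _) / alpha.
have L0 : 0 <= L.
  rewrite /L -density_loss//; apply: Int_ge0 => t xt _.
  by apply: q0_ge0; apply: f_ge0; exact: le_trans x0 (ltW xt).
have nyx : density (f y) <= density (f x).
  by rewrite -subr_ge0 -(pmulr_lge0 _ (_ : 0 < alpha^-1)) ?invr_gt0.
have H w : \int[leb]_v (f y v * bump e (w, v)) <= \int[leb]_v (f x v * bump e (w, v)) + L.
  have hg := has_grad_affine 1 (- w) (@has_grad_chi R d e).
  have E (v : V) : chi e (1 *: v + - w) = bump e (w, v) by rewrite scale1r bumpC.
  have out (v : V) : e + enorm w < enorm v -> chi e (1 *: v + - w) = 0.
    rewrite scale1r => h; apply: chi_out => //.
    by have := enormD (v - w) w; rewrite subrK; move: h; lra.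
  have [li1 p] := ev hg out.
  have /eqP := p x y x0 xy; rewrite subr_eq => /eqP e1.
  have Et s : \int[leb]_v (f s v * bump e (w, v)) = \int[leb]_v (f s v * chi e (1 *: v + - w)).
    by apply: eq_Rint => v; rewrite E.
  rewrite !Et.
  rewrite e1 addrC lerD2l /L -density_loss//; apply: le_Int => //.
    exact: li_scont (scont_q0 fc).
  move=> t xt ty; have t0 : 0 <= t := le_trans x0 (ltW xt).
  rewrite lin_rhs0 add0r; apply: (@coll_le_q0 _ _ 1 (f2 t0) (f_ge0 t0) (has_grad_measurable hg)).
    by move=> v; rewrite chi_ge0 chi_le1.
  by move=> v; rewrite ger0_norm ?chi_ge0// mul1r (le_trans (chi_le1 _ _))// japanese_exp_ge1.
have fL t : 0 <= t -> in_L1 0 (f t) by move=> t0; exact: (in_L1_le (isT : (0 <= 2)%N) (f2 t0)).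
have mb := @measurable_bump R d e; have b1 := @bump_norm R d e.
have s1 := le_bil_r (f_ge0 y0) (fL y y0) (fL y y0) (fL x x0) mb b1 H.
have s2 := le_bil_r (f_ge0 x0) (fL x x0) (fL y y0) (fL x x0) mb b1 H.
have KC (p : V * V) : `|bump e p| <= 1 * (japanese p.1 ^+ 0 * japanese p.2 ^+ 0).
  by rewrite !expr0 !mulr1 b1.
have sw : bil (bump e) (f y) (f x) = bil (bump e) (f x) (f y).
  rewrite (bil_swap mb KC (fL y y0) (fL x x0)); apply: eq_bil => -[v w]; exact: bumpC.
have ny : L * density (f y) <= L * density (f x) by rewrite ler_wpM2l.
rewrite sw in s1; apply: (le_trans s1).
rewrite (_ : 2 * _ * L = L * density (f x) + L * density (f x)); last by ring.
by move: s2 ny; lra.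
Qed.

Definition clock_rate (t : R) : R := density (f t) * Num.sqrt (temperature (f t)).

Lemma scont_ext (F G : R -> R) : (forall t, 0 <= t -> F t = G t) -> scont F -> scont G.
Proof.
move=> FG sF t t0 u u0 ut; rewrite -FG//; apply: (@cvg_ext _ _ (fun n => F (u n))).
  by move=> n; rewrite FG.
exact: (sF t t0 u u0 ut).
Qed.

Lemma scont_temperature : scont (fun t => temperature (f t)).
Proof.
have dn t : 0 <= t -> d%:R * density (f t) != 0.
  by move=> t0; rewrite mulf_neq0 ?(lt0r_neq0 (ngt0 t0))// pnatr_eq0 -lt0n.
apply: (@scont_ext (fun t => (d%:R * density (f t))^-1 *
   (mom2 (f t) - (\sum_i mom1 i (f t) ^+ 2) / density (f t)))).
  by move=> t t0; rewrite -(temperatureE d_gt0 (f2 t0) (ngt0 t0)) mulKf// dn.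
have sn := scont_density fc.
apply: scontM; first by apply: scontV => //; apply: scontM => //; exact: scont_cst.
apply: scontB; first exact: scont_mom2.
apply: scontM; last by apply: scontV => // t t0; exact: lt0r_neq0 (ngt0 t0).
by apply: scont_sum => i; apply: scontM; exact: scont_mom1.
Qed.

Lemma scont_clock_rate : scont clock_rate.
Proof. by apply: scontM; [exact: scont_density|apply: scont_sqrt; exact: scont_temperature]. Qed.

Lemma clock_rate_gt0 t : 0 <= t -> 0 < clock_rate t.
Proof.
move=> t0; rewrite mulr_gt0 ?ngt0// sqrtr_gt0.
exact: (temperature_gt0 d_gt0 (f_ge0 t0) (f2 t0) (ngt0 t0)).
Qed.

Let pW : prim (fun t => Int 0 t clock_rate) clock_rate := prim_Int (li_scont scont_clock_rate).

Let density_mono x y : 0 <= x -> x <= y -> density (f y) <= density (f x).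
Proof.
move=> x0 xy; have := prim_le pn (li_cst 0) x0 xy; rewrite Int_cst// mul0r addr0; apply.
move=> t xt ty; rewrite mulNr oppr_le0 mulr_ge0 ?(ltW alpha_gt0)//.
by apply: q0_ge0; apply: f_ge0; exact: le_trans x0 (ltW xt).
Qed.

(** The collision rate is at most a constant times n^2 sqrt T, that is n times the clock rate: the
    density decays at most exponentially in the rescaled time. *)
Lemma density_ge t : 0 <= t ->
  density (f 0) <= expR (alpha * ((1 + 4 * d%:R) / 2) * Int 0 t clock_rate) * density (f t).
Proof.
move=> t0; set k := alpha * _.
have p := primM (prim_exp (primZ k pW)) pn.
have := prim_le (primN p) (li_cst 0) (lexx 0) t0 _.
rewrite /= Int_cst// mul0r addr0 lerN2 Intxx mulr0 expR0 mul1r; apply.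
move=> s s0 st; have s0' := ltW s0; rewrite oppr_le0.
have := q0_le_temperature d_gt0 (f_ge0 s0') (f2 s0') (ngt0 s0').
move: (expR_ge0 (k * Int 0 s clock_rate)); move: (expR _) => E E0.
rewrite [X in 0 <= X](_ : _ = E * alpha * ((1 + 4 * d%:R) / 2 *
  (density (f s) ^+ 2 * Num.sqrt (temperature (f s))) - q0 (f s))) => [q|].
  by rewrite mulr_ge0 ?subr_ge0// mulr_ge0// ltW.
by rewrite /k /clock_rate; ring.
Qed.

(* If the clock stopped at a finite time, the density would have a positive limit, so the
   total collision rate would be finite after some time [x]; the mass of the pairs of
   velocities at distance at most [e] could then hardly grow, which bounds the temperature
   from below and makes the clock run forever. *)
Lemma clock_unbounded K : exists2 t, 0 <= t & K <= Int 0 t clock_rate.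
Proof.
apply: contrapT => h.
have hK t : 0 <= t -> Int 0 t clock_rate <= K.
  by move=> t0; rewrite leNgt; apply/negP => /ltW k; apply: h; exists t.
pose S := [set density (f t) | t in [set t : R | 0 <= t]]; pose nu := inf S.
have k0 : 0 <= alpha * ((1 + 4 * d%:R) / 2).
  by rewrite mulr_ge0 ?(ltW alpha_gt0)// divr_ge0// addr_ge0// mulr_ge0.
pose m := density (f 0) / expR (alpha * ((1 + 4 * d%:R) / 2) * K).
have m0 : 0 < m by rewrite divr_gt0// expR_gt0.
have mS : lbound S m.
  move=> _ [t t0 <-]; rewrite ler_pdivrMr ?expR_gt0// mulrC.
  apply: (le_trans (density_ge t0)); rewrite ler_wpM2r ?(ltW (ngt0 t0))//.
  by rewrite ler_expR ler_wpM2l// hK.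
have S0 : S !=set0 by exists (density (f 0)), 0 => //=.
have nu0 : 0 < nu by apply: (lt_le_trans m0); exact: lb_le_inf.
have nuS t : 0 <= t -> nu <= density (f t) by move=> t0; apply: ge_inf; [exists m|exists t].
pose N := density (f 0).
(* Chosen so that 2 N de / alpha = nu^2 / 4. With the initial pair correlation below nu^2 / 4 as
   well, half of nu^2 must come from the temperature term, and [c] is the bound this gives. *)
pose de := alpha * nu ^+ 2 / (8 * N).
have de0 : 0 < de by rewrite divr_gt0 ?mulr_gt0 ?exprn_gt0.
have [_ [x x0 <-] hx] := inf_adherent de0 (conj S0 (ex_intro _ m mS)).
have [e [e0 he]] : exists e, 0 < e /\ bil (bump e) (f x) (f x) <= nu ^+ 2 / 4.
  have nu4 : 0 < nu ^+ 2 / 4 by rewrite divr_gt0// exprn_gt0.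
  have /cvgrPdist_le /(_ _ nu4) [n _ hn] := @bil_bump_cvg R d d_gt0 _ (in_L1_le (isT : (0 <= 2)%N) (f2 x0)).
  exists n.+1%:R^-1; split; first by rewrite invr_gt0 ltr0n.
  by have := hn n (leqnn n); rewrite /= sub0r normrN; exact: le_trans (ler_norm _).
have NN t : 0 <= t -> density (f t) <= N by move=> t0; exact: density_mono.
pose c := nu ^+ 2 * e ^+ 2 / (16 * d%:R * N ^+ 2).
have c0 : 0 < c by rewrite divr_gt0 ?mulr_gt0 ?exprn_gt0 ?ltr0n.
have Ty y : x <= y -> c <= temperature (f y).
  move=> xy; have y0 := le_trans x0 xy.
  have b1 := bump_growth e0 x0 xy.
  have b2 := sqr_density_le_bump d_gt0 e0 (f_ge0 y0) (f2 y0) (ngt0 y0).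
  have T0 := temperature_gt0 d_gt0 (f_ge0 y0) (f2 y0) (ngt0 y0).
  have b3 : nu ^+ 2 <= density (f y) ^+ 2 by rewrite lerXn2r ?nnegrE ?nuS ?(ltW nu0) ?(ltW (ngt0 y0)).
  have b4 : 2 * density (f x) * ((density (f x) - density (f y)) / alpha) <= nu ^+ 2 / 4.
    apply: (@le_trans _ _ (2 * N * (de / alpha))).
      apply: ler_pM; [by rewrite mulr_ge0// ltW// ngt0| |by rewrite ler_wpM2l// NN|].
        by rewrite divr_ge0 ?(ltW alpha_gt0)// subr_ge0 density_mono.
      by rewrite ler_pM2r ?invr_gt0//; have := nuS y y0; move: hx; rewrite -/nu; lra.
    rewrite le_eqVlt; apply/orP; left; apply/eqP; rewrite /de; field.
    by rewrite (lt0r_neq0 alpha_gt0) (lt0r_neq0 n0).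
  have b5 : 8 / e ^+ 2 * density (f y) * (d%:R * density (f y) * temperature (f y)) <=
      8 * d%:R / e ^+ 2 * N ^+ 2 * temperature (f y).
    rewrite (_ : _ * (_ * _) = 8 * d%:R / e ^+ 2 * density (f y) ^+ 2 * temperature (f y)); last by ring.
    rewrite ler_wpM2r ?(ltW T0)// ler_wpM2l//; first by rewrite mulr_ge0 ?mulr_ge0// invr_ge0 sqr_ge0.
    by rewrite lerXn2r ?nnegrE ?NN ?(ltW n0) ?(ltW (ngt0 y0)).
  have b6 : nu ^+ 2 / 2 <= 8 * d%:R / e ^+ 2 * N ^+ 2 * temperature (f y).
    by move: b1 b2 b3 b4 b5 he; lra.
  rewrite /c ler_pdivrMr ?mulr_gt0 ?exprn_gt0 ?ltr0n//.
  have e2 : 0 < e ^+ 2 by rewrite exprn_gt0.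
  have := ler_wpM2r (ltW e2) b6.
  rewrite (_ : 8 * d%:R / e ^+ 2 * _ * _ * _ = 8 * d%:R * N ^+ 2 * temperature (f y)); last first.
    by field; exact: lt0r_neq0.
  by move: (nu ^+ 2) (e ^+ 2) (N ^+ 2) => A B C; lra.
pose w := nu * Num.sqrt c.
have w0 : 0 < w by rewrite mulr_gt0 ?sqrtr_gt0.
have wle y : x <= y -> w <= clock_rate y.
  move=> xy; have y0 := le_trans x0 xy.
  by apply: ler_pM; [exact: ltW|exact: sqrtr_ge0|exact: nuS|rewrite ler_sqrt ?Ty// (le_trans (ltW c0) (Ty y xy))].
have Wx : 0 <= Int 0 x clock_rate.
  by apply: Int_ge0 => t t0 _; exact: ltW (clock_rate_gt0 (ltW t0)).
have K0 : 0 <= K := le_trans Wx (hK x x0).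
(* After [x] the clock runs at speed at least [w], so between [x] and [y] it advances by at least K
   + 1. *)
pose y := x + (K + 1) / w.
have xy : x <= y by rewrite lerDl divr_ge0 ?addr_ge0// ltW.
have := hK y (le_trans x0 xy); rewrite (Int_cat (lexx 0) x0 xy (li_scont scont_clock_rate)).
have := le_Int x0 xy (li_cst w) (li_scont scont_clock_rate) (fun t xt _ => wle t (ltW xt)).
rewrite Int_cst// /y addrAC subrr add0r mulrCA divff ?lt0r_neq0// mulr1.
by move: Wx; lra.
Qed.

End temperature_decay.

(** * Change of time *)

Section density_measure.
Local Open Scope ereal_scope.
Context d (T : measurableType d) (R : realType) (mu : {measure set T -> \bar R}).
Variables (w : T -> R) (mw : measurable_fun setT w) (w_ge0 : forall x, (0 <= w x)%R).

(** The measure w dmu. The proofs about [w] are arguments so that the measure structure can be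
    attached to the set function itself. *)
Definition density_measure (mw : measurable_fun setT w) (w_ge0 : forall x, (0 <= w x)%R)
  (A : set T) : \bar R := \int[mu]_(x in A) (w x)%:E.

Local Notation nu := (density_measure mw w_ge0).

Let nu0 : nu set0 = 0. Proof. by rewrite /density_measure integral_set0. Qed.

Let nu_ge0 A : 0 <= nu A.
Proof. by apply: integral_ge0 => x _; rewrite lee_fin. Qed.

Let nu_sigma_additive : semi_sigma_additive nu.
Proof.
apply: semi_sigma_additive_nng_induced; first exact/measurable_EFinP.
by move=> x; rewrite lee_fin.
Qed.

HB.instance Definition _ := isMeasure.Build _ _ _ nu nu0 nu_ge0 nu_sigma_additive.

Import HBNNSimple.

Let integral_density_indic (E : set T) : measurable E ->
  \int[nu]_x (\1_E x)%:E = \int[mu]_x (\1_E x * w x)%:E.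
Proof.
move=> mE; rewrite integral_indic// setIT.
transitivity (\int[mu]_(x in E) (w x)%:E); first by [].
rewrite integral_mkcond.
apply: eq_integral => x _; rewrite patchE indicE.
by case: ifPn => _; rewrite ?mul1r ?mul0r.
Qed.

Let mEf (g : {nnsfun T >-> R}) r : measurable_fun setT (fun x => (\1_(g @^-1` [set r]) x * w x)%:E).
Proof. by apply/measurable_EFinP; apply: measurable_funM. Qed.

Let integral_density_nnsfun (g : {nnsfun T >-> R}) :
  \int[nu]_x (g x)%:E = \int[mu]_x (g x * w x)%:E.
Proof.
under [LHS]eq_integral do rewrite fimfunE -fsumEFin//.
rewrite [LHS]ge0_integral_fsum//; last 2 first.
  - by move=> r; exact/measurable_EFinP/measurableT_comp.
  - by move=> n x _; rewrite EFinM nnfun_muleindic_ge0.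
under [RHS]eq_integral.
  move=> x xD; rewrite EFinM fimfunE -fsumEFin// ge0_mule_fsuml; last first.
    by move=> r; rewrite EFinM nnfun_muleindic_ge0.
  over.
rewrite [RHS]ge0_integral_fsum//; last 2 first.
  - move=> r; rewrite (_ : (fun x => _) = (fun x => r%:E * (\1_(g @^-1` [set r]) x * w x)%:E)).
      by apply: measurable_funeM; exact: mEf.
    by apply/funext => x; rewrite -!EFinM mulrA.
  - by move=> n x _; apply: mule_ge0; [rewrite EFinM nnfun_muleindic_ge0|rewrite lee_fin].
apply: eq_fsbigr => r _.
rewrite !integralZl_indic_nnsfun//= integral_density_indic//.
have [r0|r0] := leP 0%R r; last first.
  rewrite preimage_nnfun0//; rewrite indic0 /=.
  rewrite integral0_eq ?mule0; last by move=> x _; rewrite mul0r.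
  by rewrite integral0_eq// => x _; rewrite /= mulr0 mul0e.
rewrite -ge0_integralZl//.
- by apply: eq_integral => x _; rewrite -!EFinM mulrA.
- by move=> x _; rewrite lee_fin mulr_ge0.
Qed.

Lemma ge0_integral_density (F : T -> \bar R) : measurable_fun setT F -> (forall x, 0 <= F x) ->
  \int[nu]_x F x = \int[mu]_x (F x * (w x)%:E).
Proof.
move=> mF F0; pose f_ := nnsfun_approx measurableT mF.
transitivity (lim (\int[nu]_x (f_ n x)%:E @[n --> \oo])).
  rewrite -monotone_convergence//=.
  - apply: eq_integral => x _; apply/esym/cvg_lim => //=; exact: cvg_nnsfun_approx.
  - by move=> n; exact/measurable_EFinP/measurable_funTS.
  - by move=> n ? _; rewrite lee_fin.
  - by move=> ? _ ? ? mn; rewrite lee_fin; exact/lefP/nd_nnsfun_approx.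
transitivity (lim (\int[mu]_x (f_ n x * w x)%:E @[n --> \oo])).
  by apply: congr_lim; apply/funext => n; exact: integral_density_nnsfun.
rewrite -monotone_convergence//=.
- apply: eq_integral => x _; apply/cvg_lim => //=.
  rewrite (_ : (fun n => _) = (fun n => (f_ n x)%:E * (w x)%:E)); last by apply/funext => n.
  by apply: cvgeMr => //; exact: cvg_nnsfun_approx.
- by move=> n; apply/measurable_EFinP; apply: measurable_funM.
- by move=> n ? _; rewrite lee_fin mulr_ge0.
- move=> x _ m n mn; rewrite lee_fin ler_wpM2r//.
  exact/lefP/nd_nnsfun_approx.
Qed.

End density_measure.

Section monotone_substitution.
Context {R : realType}.
Local Notation mu := (@lebesgue_measure R).
Variables (Th S w : R -> R).
Hypotheses (mTh : measurable_fun setT Th) (mw : measurable_fun setT w)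
  (w_ge0 : forall r, 0 <= w r) (ThS : forall a r, (a < Th r) = (S a < r))
  (Th_S : forall a b, a < b -> (\int[mu]_(r in `]S a, S b]) (w r)%:E = (b - a)%:E)%E).

(** The image under [Th] of the measure w dr gives each interval ]a, b] its length, hence is
    Lebesgue measure. Only the order relation between [Th] and [S] is used, no differentiability. *)
Lemma ge0_integral_substitution (G : R -> \bar R) : measurable_fun setT G ->
  (forall s, (0 <= G s)%E) -> (\int[mu]_r (G (Th r) * (w r)%:E) = \int[mu]_s G s)%E.
Proof.
move=> mG G0; pose nu := density_measure mu mw w_ge0.
have mTh' : measurable_fun setT (Th : measurableTypeR R -> measurableTypeR R) by [].
pose m1 : {measure set (measurableTypeR R) -> \bar R} :=
  measure_function_pushforward__canonical__measure_function_Measure nu mTh'.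
have E A : measurable A -> mu A = m1 A.
  apply: lebesgue_measure_unique => //= X /ocitvP[->|[[a b] /= ab ->]].
    by rewrite !measure0.
  rewrite lebesgue_measure_itv/= lte_fin ab -EFinB -Th_S//.
  rewrite /pushforward /nu /density_measure; congr integral.
  by apply/seteqP; split => r /=; rewrite !in_itv/= ThS !leNgt ThS.
have -> : (\int[mu]_s G s = \int[m1]_s G s)%E.
  by apply: eq_measure_integral => A mA _ /=; exact: E.
by rewrite ge0_integral_pushforward//= ge0_integral_density//; exact: measurableT_comp.
Qed.

End monotone_substitution.

Section time_change.
Context {R : realType}.
Local Notation mu := (@lebesgue_measure R).
Variable kappa : R -> R.
Hypotheses (skappa : scont kappa) (kappa_gt0 : forall t, 0 <= t -> 0 < kappa t)
  (clock_oo : forall K, exists2 t, 0 <= t & K <= Int 0 t kappa).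

Let clock t : R := Int 0 t kappa.

Let pclock : prim clock kappa := prim_Int (li_scont skappa).

Let clock_incr x y : 0 <= x -> x < y -> clock x < clock y.
Proof.
move=> x0 xy; have [c [c0 hc]] := scont_lower y skappa kappa_gt0.
rewrite -subr_gt0 (pclock.2 _ _ x0 (ltW xy)).
apply: (@lt_le_trans _ _ (c * (y - x))); first by rewrite mulr_gt0// subr_gt0.
rewrite -(Int_cst c (ltW xy)); apply: (le_Int x0 (ltW xy) (li_cst c) (li_scont skappa)).
by move=> t xt ty; apply: hc => //; exact: le_trans x0 (ltW xt).
Qed.

Let clock_le x y : 0 <= x -> 0 <= y -> (clock x <= clock y) = (x <= y).
Proof.
move=> x0 y0; have [xy|yx] := leP x y; last by apply/negbTE; rewrite -ltNge clock_incr.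
by move: xy; rewrite le_eqVlt => /orP[/eqP ->|xy]; [exact: lexx|exact: ltW (clock_incr x0 xy)].
Qed.

Let clock0 : clock 0 = 0. Proof. exact: Intxx. Qed.

Let clock_ge0 t : 0 <= t -> 0 <= clock t.
Proof. by move=> t0; rewrite -clock0 clock_le. Qed.

Lemma clock_surj s : 0 <= s -> exists t, 0 <= t /\ Int 0 t kappa = s.
Proof.
move=> s0; have [T T0 hT] := clock_oo s.
have h : {within `[0, T], continuous fun t => clock (Num.max t 0)}.
  by apply: continuous_subspaceT => t; exact: (scont_max (prim_scont pclock)).
have [|t /itvP tT ts] := IVT (v := s) T0 h.
  rewrite maxxx clock0 max_l// ge_min s0/= le_max; apply/orP; right; exact: hT.
by exists t; rewrite tT; split => //; rewrite -ts max_l ?tT.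
Qed.

(** The inverse is chosen by its defining property; at negative arguments it takes the irrelevant
    default 0. *)
Definition inv_clock s : R := xget 0 [set t | 0 <= t /\ Int 0 t kappa = s].
Local Notation S := inv_clock.

Lemma inv_clockP s : 0 <= s -> 0 <= S s /\ Int 0 (S s) kappa = s.
Proof. by move=> /clock_surj[t ht]; rewrite /S; case: xgetP => [x _ //|/(_ t)]. Qed.

Lemma inv_clock_ge0 s : 0 <= s -> 0 <= S s. Proof. by move=> /inv_clockP[]. Qed.

Lemma inv_clockK s : 0 <= s -> Int 0 (S s) kappa = s. Proof. by move=> /inv_clockP[]. Qed.

Lemma clockK t : 0 <= t -> S (Int 0 t kappa) = t.
Proof.
move=> t0; have [s0 E] := inv_clockP (clock_ge0 t0).
by apply/eqP; rewrite eq_le -(clock_le s0 t0) -(clock_le t0 s0) /clock E lexx.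
Qed.

Lemma inv_clock_le x y : 0 <= x -> 0 <= y -> (S x <= S y) = (x <= y).
Proof.
move=> x0 y0; have [sx ex] := inv_clockP x0; have [sy ey] := inv_clockP y0.
by rewrite -(clock_le sx sy) /clock ex ey.
Qed.

Lemma inv_clock0 : S 0 = 0.
Proof. by rewrite -[X in S X]clock0 clockK. Qed.

Lemma scont_inv_clock : scont S.
Proof.
move=> s s0 u u0 us; pose T := S (s + 1).
have s1 : 0 <= s + 1 by rewrite addr_ge0.
have [c [c0 hc]] := scont_lower T skappa kappa_gt0.
have lip x y : 0 <= x -> x <= y -> y <= s + 1 -> `|S x - S y| <= `|x - y| / c.
  move=> x0 xy ys; have y0 := le_trans x0 xy.
  have Sxy : S x <= S y by rewrite inv_clock_le.
  rewrite distrC ger0_norm ?subr_ge0// distrC ger0_norm ?subr_ge0// ler_pdivlMr// mulrC.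
  rewrite -{2}(inv_clockK x0) -{2}(inv_clockK y0) (pclock.2 _ _ (inv_clock_ge0 x0) Sxy).
  rewrite -(Int_cst c Sxy); apply: (le_Int (inv_clock_ge0 x0) Sxy (li_cst c) (li_scont skappa)).
  move=> t xt ty; apply: hc; first exact: le_trans (inv_clock_ge0 x0) (ltW xt).
  by apply: (le_trans ty); rewrite inv_clock_le.
have z : `|u n - s| / c @[n --> \oo] --> 0.
  rewrite -(mul0r c^-1); apply: cvgMl; rewrite -(normr0 R) -(subrr s).
  by apply: cvg_norm; apply: cvgB => //; exact: cvg_cst.
have H : \forall n \near \oo, `|S (u n) - S s| <= `|u n - s| / c.
  have /cvgrPdist_lt /(_ 1 ltr01) := us; apply: filterS => n hn.
  have un : u n <= s + 1 by move: hn; rewrite ltr_norml => /andP[]; lra.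
  have [h|h] := leP (u n) s; first by apply: lip => //; rewrite lerDl.
  by rewrite distrC (distrC (u n)); apply: lip => //; exact: ltW.
apply/cvgrPdist_lt => e e0; have /cvgrPdist_lt /(_ e e0) := z.
apply: filterS2 H => n h1; rewrite sub0r normrN => h2.
by rewrite distrC (le_lt_trans h1)// (le_lt_trans (ler_norm _)).
Qed.

(* The clock and its rate are extended by the identity and by 1 to negative times, so that
   the substitution is by a bijection of the whole line. *)
Let clockx (r : R) := clock (Num.max r 0) + Num.min r 0.
Let ratex (r : R) := if r <= 0 then 1 else kappa (Num.max r 0).
Let invx (a : R) := S (Num.max a 0) + Num.min a 0.

Let ge0_max (r : R) : 0 <= Num.max r 0.
Proof. by rewrite le_max lexx orbT. Qed.

Let clockx_pos r : 0 < r -> clockx r = clock r.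
Proof. by move=> r0; rewrite /clockx max_l ?ltW// min_r ?ltW// addr0. Qed.

Let clockx_neg r : r <= 0 -> clockx r = r.
Proof. by move=> r0; rewrite /clockx max_r// min_l// clock0 add0r. Qed.

Let clockx_lt a r : (a < clockx r) = (invx a < r).
Proof.
have [r0|r0] := leP r 0.
  rewrite clockx_neg//; have [a0|a0] := leP a 0.
    by rewrite /invx max_r// inv_clock0 add0r min_l.
  rewrite /invx max_l ?ltW// min_r ?ltW// addr0.
  rewrite [LHS]ltNge (le_trans r0 (ltW a0)) [RHS]ltNge.
  by rewrite (le_trans r0 (inv_clock_ge0 (ltW a0))).
rewrite clockx_pos//; have [a0|a0] := leP a 0.
  rewrite /invx max_r// inv_clock0 add0r min_l// (le_lt_trans a0 r0).
  by rewrite (le_lt_trans a0)// -clock0 clock_incr.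
rewrite /invx max_l ?ltW// min_r ?ltW// addr0 !ltNge; congr (~~ _).
have := clock_le (ltW r0) (inv_clock_ge0 (ltW a0)).
by rewrite /clock (inv_clockK (ltW a0)).
Qed.

Let ratexE p q r : ind p q r * ratex r =
  ind (Num.min p 0) (Num.min q 0) r + ind (Num.max p 0) (Num.max q 0) r * kappa r.
Proof.
rewrite /ind /ratex gt_min le_min gt_max le_max; have [r0|r0] := leP r 0.
  by rewrite orbF !andbT andbF/= mul0r addr0 mulr1.
by rewrite orbT orbF !andbF !andbT add0r.
Qed.

Let ratex_int a b : a < b -> (\int[mu]_(r in `]invx a, invx b]) (ratex r)%:E = (b - a)%:E)%E.
Proof.
move=> ab; set p := invx a; set q := invx b.
have pq : p <= q.
  rewrite leNgt -clockx_lt -leNgt; have E c : clockx (invx c) = c.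
    have [c0|c0] := leP c 0.
      by rewrite /invx max_r// inv_clock0 add0r min_l// clockx_neg.
    rewrite /invx max_l ?ltW// min_r ?ltW// addr0 clockx_pos; first exact: inv_clockK (ltW c0).
    by rewrite -inv_clock0 ltNge inv_clock_le -?ltNge// ltW.
  by rewrite E ltW.
have l1 := itg_ind (Num.min p 0) (Num.min q 0).
have mm : Num.max p 0 <= Num.max q 0 by rewrite ge_max !le_max pq lexx orbT.
have l2 : itg mu (fun r => ind (Num.max p 0) (Num.max q 0) r * kappa r).
  exact: (li_scont skappa (ge0_max p) mm).
have i : itg mu (fun r => ind p q r * ratex r) by under eq_fun do rewrite ratexE; exact: itgD.
transitivity (\int[mu]_r (ind p q r * ratex r)%:E)%E.
  rewrite integral_mkcond; apply: eq_integral => r _; rewrite patchE /ind.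
  case: (boolP (p < r <= q)) => h; first by rewrite mem_set ?mul1r//= in_itv.
  by rewrite memNset ?mul0r//= in_itv; exact/negP.
rewrite -(EFin_Rintegral i); congr EFin.
transitivity (\int[mu]_r (ind (Num.min p 0) (Num.min q 0) r + ind (Num.max p 0) (Num.max q 0) r * kappa r)).
  by apply: eq_Rint => r; exact: ratexE.
rewrite (RintD l1 l2).
have mn : Num.min p 0 <= Num.min q 0 by rewrite le_min !ge_min pq lexx orbT.
have -> : \int[mu]_r ind (Num.min p 0) (Num.min q 0) r = Num.min q 0 - Num.min p 0.
  rewrite -[RHS]mul1r -Int_cst//; apply: eq_Rint => r; rewrite mulr1//.
rewrite -[\int[mu]_r _]/(Int (Num.max p 0) (Num.max q 0) kappa) -(pclock.2 _ _ (ge0_max p) mm).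
have E c : clock (Num.max (invx c) 0) + Num.min (invx c) 0 = c.
  rewrite /invx; have [c0|c0] := leP c 0.
    by rewrite inv_clock0 add0r (max_r c0) (min_l c0) clock0 add0r.
  rewrite addr0; have Sc := inv_clock_ge0 (ltW c0); rewrite (max_l Sc) (min_r Sc) addr0.
  exact: inv_clockK (ltW c0).
by rewrite -[in RHS](E a) -[in RHS](E b) -/p -/q; ring.
Qed.

Let mclockx : measurable_fun setT clockx.
Proof.
apply: measurable_funD; first exact: (scont_measurable (prim_scont pclock)).
exact: measurable_minr.
Qed.

Let mratex : measurable_fun setT ratex.
Proof.
apply: measurable_fun_ifT => //; last exact: scont_measurable.
exact: measurable_fun_ler.
Qed.

Let ratex_ge0 r : 0 <= ratex r.
Proof. by rewrite /ratex; have [r0|r0] := leP r 0; [exact: ler01|exact: (ltW (kappa_gt0 (ltW r0)))]. Qed.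

(** The substitution applies to nonnegative functions and yields integrability together with the
    value; the signed case follows by decomposition. *)
Let subst_ge0 f x y : 0 <= x -> x <= y -> li f -> (forall t, 0 <= f t) ->
  itg mu (fun s => ind x y s * (f (S s) / kappa (S s))) /\
  Int x y (fun s => f (S s) / kappa (S s)) = Int (S x) (S y) f.
Proof.
move=> x0 xy lf f0; have y0 := le_trans x0 xy.
have sx := inv_clock_ge0 x0; have sy := inv_clock_ge0 y0.
have sxy : S x <= S y by rewrite inv_clock_le.
have lfxy := lf _ _ sx sxy.
pose G s := ind x y s * (f (S s) / kappa (S s)).
have mS : measurable_fun setT (fun s : R => S (Num.max s 0)) by exact: (scont_measurable scont_inv_clock).
have indS s : 0 <= s -> ind (S x) (S y) (S s) = ind x y s.
  by move=> s0; rewrite /ind !ltNge !inv_clock_le.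
have GE : G = fun s => ind x y s * ((ind (S x) (S y) (S (Num.max s 0)) * f (S (Num.max s 0))) /
    kappa (Num.max (S (Num.max s 0)) 0)).
  apply/funext => s; rewrite /G /ind; case: (boolP (x < s <= y)) => [xs|_]; rewrite ?mul0r// !mul1r.
  have s0 : 0 <= s by case/andP: xs => xs _; rewrite ltW// (le_lt_trans x0).
  rewrite (max_l s0) -/(ind (S x) (S y) (S s)) indS// /ind xs mul1r.
  by rewrite max_l// inv_clock_ge0.
have mG : measurable_fun setT G.
  rewrite GE; apply: measurable_funM; first exact: measurable_ind.
  apply: measurable_funM.
    by apply: (measurableT_comp (itg_meas lfxy) mS).
  have mV : measurable_fun setT (fun r : R => (kappa (Num.max r 0))^-1).
    apply: (@scont_measurable _ (fun r => (kappa r)^-1)).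
    by apply: scontV => // t t0; exact: lt0r_neq0 (kappa_gt0 t0).
  exact: (measurableT_comp mV mS).
have G0 s : 0 <= G s.
  rewrite /G /ind; case: (boolP (x < s <= y)) => [/andP[xs _]|_]; rewrite ?mul0r// mul1r.
  have s0 : 0 <= s by rewrite ltW// (le_lt_trans x0).
  by rewrite divr_ge0// ltW// kappa_gt0// inv_clock_ge0.
have H : (\int[mu]_s (G s)%:E = \int[mu]_r (ind (S x) (S y) r * f r)%:E)%E.
  have mEG : measurable_fun setT (EFin \o G) by exact/measurable_EFinP.
  have EG0 s : (0 <= (EFin \o G) s)%E by rewrite lee_fin.
  rewrite -(ge0_integral_substitution mclockx mratex ratex_ge0 clockx_lt ratex_int mEG EG0).
  apply: eq_integral => r _; rewrite /= -EFinM; congr EFin.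
  have [r0|r0] := leP r 0.
    rewrite clockx_neg// /G /ind ltNge (le_trans r0 x0) ltNge (le_trans r0 sx)/=.
    by rewrite !mul0r.
  rewrite clockx_pos// /G /ratex leNgt r0/= max_l ?ltW// /clock clockK ?ltW//.
  rewrite -indS ?clock_ge0 ?ltW// clockK ?ltW//.
  by field; exact: lt0r_neq0 (kappa_gt0 (ltW r0)).
have iG : itg mu G.
  by apply: itg_ge0_fin => //; rewrite H -(EFin_Rintegral lfxy) ltry.
split => //; apply: EFin_inj.
by rewrite (EFin_Rintegral iG) (EFin_Rintegral lfxy).
Qed.

Lemma Int_time_change f x y : 0 <= x -> x <= y -> li f ->
  itg mu (fun s => ind x y s * (f (S s) / kappa (S s))) /\
  Int x y (fun s => f (S s) / kappa (S s)) = Int (S x) (S y) f.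
Proof.
move=> x0 xy lf; have sx := inv_clock_ge0 x0.
have sxy : S x <= S y by rewrite inv_clock_le// (le_trans x0 xy).
pose f1 t := 2^-1 * (`|f t| + f t); pose f2 t := 2^-1 * (`|f t| + (-1) * f t).
have l1 : li f1 by apply: liZ; apply: liD => //; exact: li_norm.
have l2 : li f2 by apply: liZ; apply: liD; [exact: li_norm|exact: liZ].
have p1 t : 0 <= f1 t by rewrite mulr_ge0//; have := ler_norm (- f t); rewrite normrN; lra.
have p2 t : 0 <= f2 t by rewrite mulr_ge0//; have := ler_norm (f t); lra.
have [i1 e1] := subst_ge0 x0 xy l1 p1; have [i2 e2] := subst_ge0 x0 xy l2 p2.
have fE t : f t = f1 t + (-1) * f2 t by rewrite /f1 /f2; field.
have E : (fun s => ind x y s * (f (S s) / kappa (S s))) = (fun s =>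
    ind x y s * (f1 (S s) / kappa (S s)) + (-1) * (ind x y s * (f2 (S s) / kappa (S s)))).
  by apply/funext => s; rewrite fE; ring.
rewrite /Int E; split; first by apply: itgD => //; exact: itgZ.
rewrite (RintD i1 (itgZ _ i2)) (RintZ _ i2) -!/(Int x y _) e1 e2.
rewrite -(IntZ (-1) sx sxy l2) -(IntD sx sxy l1 (liZ _ l2)).
by apply: eq_Int => t _ _; rewrite -fE.
Qed.

Lemma prim_time_change F f : prim F f ->
  prim (fun s => F (S s)) (fun s => f (S s) / kappa (S s)).
Proof.
move=> [lf hF]; split => x y x0 xy; have [i e] := Int_time_change x0 xy lf; first exact: i.
by rewrite e hF// ?inv_clock_ge0// inv_clock_le// (le_trans x0 xy).
Qed.

End time_change.

(** * Change of variables in the evolution equation *)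

Lemma cvg_sum_seq {R : realType} (I : Type) (s : seq I) (F_ : I -> nat -> R) (l : I -> R) :
  (forall i, F_ i n @[n --> \oo] --> l i) ->
  \sum_(i <- s) F_ i n @[n --> \oo] --> \sum_(i <- s) l i.
Proof.
move=> h; elim: s => [|i s IH].
  by rewrite big_nil; under eq_fun do rewrite big_nil; exact: cvg_cst.
by rewrite big_cons; under eq_fun do rewrite big_cons; exact: cvgD.
Qed.

Section mean_value.
Context {R : realType} {d : nat}.
Local Notation V := 'rV[R]_d.
Implicit Types (phi : V -> R).

Lemma mean_value_segment phi dphi (a v : V) : has_grad phi dphi ->
  exists2 l : R, 0 <= l <= 1 & phi (a + v) - phi a = \sum_i v 0 i * dphi i (a + l *: v).
Proof.
move=> [dp e c]; pose g (l : R) := phi (l *: v + a).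
have E l : (fun h : R => h^-1 *: (g (h *: 1 + l) - g l)) =
    (fun h : R => h^-1 *: (phi (h *: v + (l *: v + a)) - phi (l *: v + a))).
  by apply/funext => h; rewrite /g [h *: 1]mulr1 scalerDl addrA.
have ig l : is_derive l (1 : R) g (\sum_i v 0 i * dphi i (a + l *: v)).
  have dv : derivable phi (l *: v + a) v := diff_derivable (dp _).
  split; first by rewrite /derivable /= E.
  by rewrite /derive /= E -[LHS]/('D_v phi (l *: v + a)) e (addrC (l *: v)).
have cg : {within `[0 : R, 1], continuous g}.
  by apply: derivable_within_continuous => l _; have [] := ig l.
have [l] := @MVT R g _ 0 1 ltr01 (fun l _ => ig l) cg.
rewrite in_itv/= => /andP[l0 l1]; rewrite subr0 mulr1 /g scale1r scale0r add0r => h.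
by exists l; [rewrite (ltW l0) (ltW l1)|rewrite (addrC a v)].
Qed.

End mean_value.

(** * Differentiation against a test function moved by an affine map *)

Section moving_test_function.
Context {R : realType} {d : nat}.
Hypothesis d_gt0 : (0 < d)%N.
Local Notation V := 'rV[R]_d.
Local Notation leb := (@lebesgue_rV R d).
Local Notation mu := (@lebesgue_measure R).
Variable alpha : R.
Hypotheses (alpha_gt0 : 0 < alpha) (alpha_lt1 : alpha < 1).
Variables (a b : R -> R) (c : 'I_d -> R -> R) (h : R -> V -> R).
Hypotheses (la : li a) (lb : li b) (lc : forall i, li (c i)) (hc : curve h)
  (ev : evolves alpha a b c h).
Variables (sg dsg : R -> R) (p dp : 'I_d -> R -> R).
Hypotheses (psg : prim sg dsg) (pp : forall i, prim (p i) (dp i))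
  (sg_gt0 : forall t, 0 <= t -> 0 < sg t).
Variables (phi : V -> R) (dphi : 'I_d -> V -> R) (r : R).
Hypotheses (hg : has_grad phi dphi) (hr : forall v, r < enorm v -> phi v = 0).

Definition shiftv (t : R) : V := \row_i p i t.
Local Notation th t := (aff (sg t) (shiftv t)).
Let ph t (w : V) : R := phi (th t w).
Let dph t i (w : V) : R := sg t * dphi i (th t w).

Let hgt t : has_grad (ph t) (dph t) := has_grad_affine (sg t) (shiftv t) hg.

Let pout t : 0 <= t -> forall w, (r + enorm (shiftv t)) / sg t < enorm w -> ph t w = 0.
Proof.
move=> t0 w; rewrite ltr_pdivrMr ?sg_gt0// => H; apply: hr.
have := enormB (th t w) (shiftv t).
by rewrite /aff addrK enormZ gtr0_norm ?sg_gt0// mulrC; lra.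
Qed.

Let mdphi i t : measurable_fun setT (fun w => dphi i (th t w)).
Proof.
apply: (measurableT_comp _ (measurable_aff _ _)).
by apply: continuous_rV_measurable; have [_ _] := hg.
Qed.

Let fld (t : R) (w : V) : R := \sum_i w 0 i * dphi i (th t w).
Let mfld t : measurable_fun setT (fld t).
Proof. by apply: measurable_sum => i; apply: measurable_funM; [exact: measurable_coord|exact: mdphi]. Qed.

Let X (t : R) : R := \int[leb]_w (h t w * fld t w).
Let Y i (t : R) : R := \int[leb]_w (h t w * dphi i (th t w)).
Let inc (x y : R) : R := `|sg y - sg x| + \sum_i `|p i y - p i x|.
(** First-order remainder of the moved test function, divided by the displacement [inc] of the map.
    As [phi] is only continuously differentiable there is no quadratic remainder bound, just
    convergence of this quotient to 0. When the map does not move, 0^-1 = 0 makes it 0. *)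
Let rem x y (w : V) : R := (inc x y)^-1 * (ph y w - ph x w - (sg y - sg x) * fld x w -
  \sum_i (p i y - p i x) * dphi i (th x w)).
Let rho x y : R := \int[leb]_w (h x w * rem x y w).

Let mrem x y : measurable_fun setT (rem x y).
Proof.
apply: measurable_funM => //; apply: measurable_funB; last first.
  by apply: measurable_sum => i; apply: measurable_funM.
apply: measurable_funB; last by apply: measurable_funM.
by apply: measurable_funB; exact: (has_grad_measurable (hgt _)).
Qed.

Let inc_ge0 x y : 0 <= inc x y.
Proof. by rewrite addr_ge0// sumr_ge0. Qed.

Let rem_le x y (w : V) : exists2 l : R, 0 <= l <= 1 & `|rem x y w| <=
  \sum_i (`|w 0 i| + 1) * `|dphi i (th x w + l *: (th y w - th x w)) - dphi i (th x w)|.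
Proof.
have [l l01 E] := mean_value_segment (th x w) (th y w - th x w) hg; exists l => //.
have vE i : (th y w - th x w) 0 i = (sg y - sg x) * w 0 i + (p i y - p i x).
  by rewrite /aff !mxE; ring.
have -> : rem x y w = \sum_i ((inc x y)^-1 * ((sg y - sg x) * w 0 i + (p i y - p i x))) *
    (dphi i (th x w + l *: (th y w - th x w)) - dphi i (th x w)).
  rewrite (subrKC (th x w) (th y w)) in E.
  rewrite /rem /ph E /fld mulr_sumr -!sumrB mulr_sumr.
  by apply: eq_bigr => i _; rewrite vE; ring.
apply: (le_trans (ler_norm_sum _ _ _)); apply: ler_sum => i _.
rewrite normrM ler_wpM2r// normrM normfV (ger0_norm (inc_ge0 x y)).
have [->|n0] := eqVneq (inc x y) 0; first by rewrite invr0 mul0r addr_ge0.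
have i0 : 0 < inc x y by rewrite lt_neqAle eq_sym n0 inc_ge0.
rewrite mulrC ler_pdivrMr// (le_trans (ler_normD _ _))// normrM mulrDl mul1r.
have h1 : `|sg y - sg x| <= inc x y by rewrite lerDl sumr_ge0.
have h2 : `|p i y - p i x| <= inc x y.
  by rewrite /inc (bigD1 i)//= addrCA lerDl addr_ge0// sumr_ge0.
by rewrite lerD// mulrC ler_wpM2l.
Qed.

Let C := sval (cid (test_bounded hg hr)).
Let CP : [/\ 0 <= C, forall v, `|phi v| <= C, forall i v, `|dphi i v| <= C,
    forall v, `|euler dphi v| <= C & measurable_fun setT (euler dphi)].
Proof. exact: (svalP (cid (test_bounded hg hr))). Qed.
Let C0 : 0 <= C. Proof. by have [] := CP. Qed.
Let dC i v : `|dphi i v| <= C. Proof. by have [] := CP. Qed.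

Let j1 (w : V) (k : R) : 0 <= k -> k <= k * japanese w ^+ 2.
Proof. by move=> k0; rewrite ler_peMr// japanese_exp_ge1. Qed.

Let wj (w : V) i : `|w 0 i| <= japanese w ^+ 2.
Proof. by have := coord_bound 1 i w; rewrite mul1r. Qed.

Let fld_le t (w : V) : `|fld t w| <= (d%:R * C) * japanese w ^+ 2.
Proof.
apply: (le_trans (ler_norm_sum _ _ _)).
rewrite (_ : d%:R * C * _ = \sum_(i < d) japanese w ^+ 2 * C); last first.
  by rewrite sumr_const card_ord -mulr_natl; ring.
by apply: ler_sum => i _; rewrite normrM ler_pM.
Qed.

Let rem_bound x y (w : V) : `|rem x y w| <= (4 * (d%:R * C)) * japanese w ^+ 2.
Proof.
have [l _ H] := rem_le x y w; apply: (le_trans H).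
rewrite (_ : 4 * (d%:R * C) * _ = \sum_(i < d) (japanese w ^+ 2 + japanese w ^+ 2) * (C + C)); last first.
  by rewrite sumr_const card_ord -mulr_natl; ring.
apply: ler_sum => i _; rewrite ler_pM ?addr_ge0//.
  by rewrite lerD// japanese_exp_ge1.
by rewrite (le_trans (ler_normB _ _))// lerD.
Qed.

Let pairC t (k : V -> R) K : 0 <= t -> measurable_fun setT k -> (forall w, `|k w| <= K * japanese w ^+ 2) ->
  itg leb (fun w => h t w * k w) /\ `|\int[leb]_w (h t w * k w)| <= K * Nrm 2 (h t).
Proof. by move=> t0; apply: in_L1_pair; exact: curve_L12. Qed.

Let dphi_le i t (w : V) : `|dphi i (th t w)| <= C * japanese w ^+ 2.
Proof. by rewrite (le_trans (dC _ _))// j1. Qed.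

Let ph_le t (w : V) : `|ph t w| <= C * japanese w ^+ 2.
Proof. by have [_ h1 _ _ _] := CP; rewrite (le_trans (h1 _))// j1. Qed.

(** The solution changes against the test frozen at [y], then the test moves against the solution
    frozen at [x]. The remainder is a multiple of the absolute increments; writing |z| = sg(z) z
    turns it into multiples of the increments of [sg] and [p], which are integrals of [dsg] and
    [dp]. *)
Let H x y s : R := lin_rhs a b c h (ph y) (dph y) s + coll alpha (h s) (ph y) +
  dsg s * (X x + Num.sg (sg y - sg x) * rho x y) +
  \sum_i dp i s * (Y i x + Num.sg (p i y - p i x) * rho x y).

Definition moving_rhs (t : R) : R := lin_rhs a b c h (ph t) (dph t) t + coll alpha (h t) (ph t) + dsg t * X t +
  \sum_i dp i t * Y i t.

Let H_incr x y : 0 <= x -> x <= y -> itg mu (fun s => ind x y s * H x y s) /\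
  \int[leb]_w (h y w * ph y w) - \int[leb]_w (h x w * ph x w) = Int x y (H x y).
Proof.
move=> x0 xy; have y0 := le_trans x0 xy.
have [l1 e1] := ev (hgt y) (pout y0).
set f1 := (fun t => lin_rhs a b c h (ph y) (dph y) t + coll alpha (h t) (ph y)) in l1 e1.
pose k1 := X x + Num.sg (sg y - sg x) * rho x y.
pose k2 i := Y i x + Num.sg (p i y - p i x) * rho x y.
have l2 : li (fun s => k1 * dsg s) by apply: liZ; exact: psg.1.
have l3i i : li (fun s => k2 i * dp i s) by apply: liZ; exact: (pp i).1.
have l3 : li (fun s => \sum_i k2 i * dp i s) by exact: li_sum.
have E : H x y = (fun s => (f1 s + k1 * dsg s) + \sum_i k2 i * dp i s).
  apply/funext => s; rewrite /H /f1 /k1 (mulrC (dsg s)); congr (_ + _).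
  by apply: eq_bigr => i _; rewrite mulrC.
rewrite E; split; first exact: (liD (liD l1 l2) l3).
rewrite (IntD x0 xy (liD l1 l2) l3) (IntD x0 xy l1 l2) (IntZ _ x0 xy psg.1).
have -> : Int x y (fun s => \sum_i k2 i * dp i s) = \sum_i k2 i * (p i y - p i x).
  rewrite /Int; transitivity (\int[mu]_t (\sum_i k2 i * (ind x y t * dp i t))).
    by apply: eq_Rint => t; rewrite mulr_sumr; apply: eq_bigr => i _; ring.
  have il i : itg mu (fun t => ind x y t * dp i t) by exact: (pp i).1.
  rewrite Rint_sum_seq => [|i]; last exact: itgZ.
  by apply: eq_bigr => i _; rewrite (RintZ _ (il i)) -/(Int x y (dp i)) -(pp i).2.
rewrite -psg.2// -e1//.
have [ix _] := pairC x0 (has_grad_measurable (hgt x)) (ph_le x).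
have [iy _] := pairC x0 (has_grad_measurable (hgt y)) (ph_le y).
have [iX _] := pairC x0 (mfld x) (fld_le x).
have iY i := (pairC x0 (mdphi i x) (dphi_le i x)).1.
have [ir _] := pairC x0 (mrem x y) (rem_bound x y).
suff : \int[leb]_w (h x w * ph y w) - \int[leb]_w (h x w * ph x w) =
    k1 * (sg y - sg x) + \sum_i k2 i * (p i y - p i x) by lra.
have -> : k1 * (sg y - sg x) + \sum_i k2 i * (p i y - p i x) =
    (sg y - sg x) * X x + \sum_i (p i y - p i x) * Y i x + inc x y * rho x y.
  have E1 z : Num.sg z * rho x y * z = `|z| * rho x y by rewrite [`|z|]normrEsg; ring.
  rewrite /k1 mulrDl E1 /inc mulrDl.
  have -> : \sum_i k2 i * (p i y - p i x) = \sum_i (p i y - p i x) * Y i x +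
      (\sum_i `|p i y - p i x|) * rho x y.
    by rewrite mulr_suml -big_split/=; apply: eq_bigr => i _; rewrite /k2 mulrDl E1 mulrC.
  by ring.
rewrite -RintB// /X /rho -!RintZ//.
have is3 : itg leb (fun w => \sum_i (p i y - p i x) * (h x w * dphi i (th x w))).
  by apply: itg_sum_seq => i; exact: itgZ.
have -> : \sum_i (p i y - p i x) * Y i x =
    \int[leb]_w (\sum_i (p i y - p i x) * (h x w * dphi i (th x w))).
  rewrite Rint_sum_seq => [|i]; last exact: itgZ.
  by apply: eq_bigr => i _; rewrite -RintZ.
rewrite -RintD//; last exact: itgZ.
rewrite -RintD//; [|by apply: itgD => //; exact: itgZ|exact: itgZ].
apply: eq_Rint => w.
have -> : inc x y * (h x w * rem x y w) = h x w * (ph y w - ph x w - (sg y - sg x) * fld x w -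
    \sum_i (p i y - p i x) * dphi i (th x w)).
  have [i0|n0] := eqVneq (inc x y) 0; last by rewrite /rem; field.
  rewrite i0 mul0r; move: i0 => /eqP; rewrite /inc paddr_eq0 ?sumr_ge0// normr_eq0 subr_eq0.
  move=> /andP[/eqP es /eqP ep].
  have epi i : p i y = p i x.
    apply/eqP; rewrite -subr_eq0 -normr_eq0; apply/eqP.
    exact: (psumr_eq0P (fun i _ => normr_ge0 (p i y - p i x)) ep).
  have -> : ph y w = ph x w.
    by rewrite /ph es; congr (phi (aff _ _ w)); apply/rowP => i; rewrite !mxE epi.
  by rewrite es big1 => [|i _]; rewrite ?epi ?subrr ?mul0r// !subr0 mulr0.
rewrite (_ : \sum_i _ * (h x w * _) = h x w * \sum_i (p i y - p i x) * dphi i (th x w)); last first.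
  by rewrite mulr_sumr; apply: eq_bigr => i _; ring.
by ring.
Qed.

Let euler_dph t w : euler (dph t) w = sg t * fld t w.
Proof. by rewrite /euler /fld mulr_sumr; apply: eq_bigr => i _; rewrite /dph; ring. Qed.

Let H_bound T : 0 <= T -> exists q, itg mu q /\
  forall x y t, 0 <= x -> x < t -> t <= y -> y <= T -> `|H x y t| <= q t.
Proof.
move=> T0; have [N [N0 hN]] := curve_Nrm2_bounded hc T.
have [S [S0 hS]] := scont_bounded T (prim_scont psg).
have dC0 : 0 <= d%:R * C by rewrite mulr_ge0.
pose K := C + 5 * (d%:R * C) + d%:R * C * S + C * S.
have S1 : 0 <= d%:R * C * S by rewrite mulr_ge0.
have S2 : 0 <= C * S by rewrite mulr_ge0.
pose A := K * N; have K0 : 0 <= K by rewrite /K !addr_ge0// mulr_ge0.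
have pA t (k : V -> R) k0 : 0 <= t -> t <= T -> measurable_fun setT k ->
    (forall w, `|k w| <= k0 * japanese w ^+ 2) -> k0 <= K -> `|\int[leb]_w (h t w * k w)| <= A.
  move=> t0 tT mk hk kK; apply: (le_trans (pairC t0 mk hk).2).
  apply: (@le_trans _ _ (K * Nrm 2 (h t))); first by rewrite ler_wpM2r ?Nrm_ge0.
  by rewrite ler_wpM2l ?hN.
pose q t := ind 0 T t * ((`|a t| + `|b t| + \sum_i `|c i t|) * A + 4 * C * (N * N) +
  (`|dsg t| + \sum_i `|dp i t|) * (2 * A)).
exists q; split.
  have ls (g : 'I_d -> R -> R) : (forall i, li (g i)) -> li (fun t => \sum_i `|g i t|).
    by move=> lg; apply: (@li_sum _ _ _ (fun i t => `|g i t|)) => i; exact: li_norm.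
  have lM g k0 : li g -> li (fun t => g t * k0).
    by move=> lg x y x0 xy; under eq_fun do rewrite (mulrC _ k0); exact: liZ.
  apply: (_ : li _) (lexx 0) T0; apply: liD; [apply: liD; [|exact: li_cst]|]; apply: lM; apply: liD.
  - by apply: liD; exact: li_norm.
  - exact: ls.
  - exact: li_norm psg.1.
  - by apply: ls => i; exact: (pp i).1.
move=> x y t x0 xt ty yT; have t0 : 0 <= t := le_trans x0 (ltW xt).
have y0 : 0 <= y := le_trans t0 ty; have tT := le_trans ty yT.
have xT : x <= T := le_trans (ltW xt) tT.
rewrite /q /ind (le_lt_trans x0 xt) tT mul1r.
have Sy := hS y y0 yT.
have p1 : `|\int[leb]_w (h t w * ph y w)| <= A.
  by apply: (pA _ _ C t0 tT (has_grad_measurable (hgt y)) (ph_le y)); rewrite /K; lra.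
have p2 : `|\int[leb]_w (h t w * euler (dph y) w)| <= A.
  apply: (pA _ _ (S * (d%:R * C)) t0 tT (measurable_euler (hgt y))); last first.
    by rewrite /K mulrC; move: C0 dC0 S1 S2; move: (d%:R * C) => z; nra.
  by move=> w; rewrite euler_dph normrM -mulrA ler_pM// fld_le.
have p3 i : `|\int[leb]_w (h t w * dph y i w)| <= A.
  apply: (pA _ _ (S * C) t0 tT); last by rewrite /K (mulrC S); move: C0 dC0 S1 S2; lra.
    by apply: measurable_funM.
  by move=> w; rewrite normrM -mulrA ler_pM// dphi_le.
have p4 : `|coll alpha (h t) (ph y)| <= 4 * C * (N * N).
  have b1 v : `|ph y v| <= C * japanese v ^+ 1.
    by have [_ h1 _ _ _] := CP; rewrite (le_trans (h1 _))// ler_peMr// japanese_exp_ge1.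
  have mp := has_grad_measurable (hgt y).
  have L2 := curve_L12 hc t0.
  apply: (le_trans (norm_bil_le (measurable_Kcoll alpha mp) (Kcoll_bound alpha_gt0 alpha_lt1 mp b1) L2 L2)).
  by rewrite ler_wpM2l ?mulr_ge0// ler_pM ?Nrm_ge0 ?hN.
have p5 : `|X x| <= A by apply: (pA _ _ _ x0 xT (mfld x) (fld_le x)); rewrite /K; move: C0 dC0 S1 S2; move: (d%:R * C) => z; lra.
have p6 i : `|Y i x| <= A by apply: (pA _ _ _ x0 xT (mdphi i x) (dphi_le i x)); rewrite /K; move: C0 dC0 S1 S2; move: (d%:R * C) => z; lra.
have p7 : `|rho x y| <= A by apply: (pA _ _ _ x0 xT (mrem x y) (rem_bound x y)); rewrite /K; move: C0 dC0 S1 S2; move: (d%:R * C) => z; lra.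
have p8 z : `|Num.sg z * rho x y| <= A.
  rewrite normrM (le_trans _ p7)// ler_piMl// normr_sg; by case: (z != 0); rewrite ?ler01.
have tri (z1 z2 B1 B2 : R) : `|z1| <= B1 -> `|z2| <= B2 -> `|z1 + z2| <= B1 + B2.
  by move=> h1 h2; rewrite (le_trans (ler_normD _ _))// lerD.
have sumb (g : 'I_d -> R) (k : 'I_d -> R) B : (forall i, `|k i| <= B) ->
    `|\sum_i g i * k i| <= (\sum_i `|g i|) * B.
  move=> kB; rewrite (le_trans (ler_norm_sum _ _ _))// mulr_suml.
  by apply: ler_sum => i _; rewrite normrM ler_wpM2l.
rewrite /H -addrA mulrDl; apply: (tri _ _ (_ + _)); last first.
  rewrite (mulrDl `|dsg t|); apply: (@tri _ _ _ _); first by rewrite normrM ler_wpM2l// mulr_natl mulr2n tri.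
  by apply: sumb => i; rewrite mulr_natl mulr2n tri.
apply: (@tri _ _ _ _ _ p4); rewrite /lin_rhs !mulrDl; apply: (@tri _ _ _ _); last by rewrite normrN sumb.
by apply: (@tri _ _ _ _); rewrite normrM ler_wpM2l.
Qed.

Let th_cvg (t : R) (u : nat -> R) w : 0 <= t -> (forall n, 0 <= u n) -> u n @[n --> \oo] --> t ->
  th (u n) w @[n --> \oo] --> th t w.
Proof.
move=> t0 u0 ut; apply: (@aff_cvg R d (fun n => sg (u n)) (fun n => shiftv (u n))).
  exact: (prim_scont psg t0 u0 ut).
move=> i; rewrite mxE; apply: (@cvg_ext _ _ (fun n => p i (u n))) => [n|]; first by rewrite mxE.
exact: (prim_scont (pp i) t0 u0 ut).
Qed.

Let dphi_cvg i (z : nat -> V) (v : V) : z n @[n --> \oo] --> v -> dphi i (z n) @[n --> \oo] --> dphi i v.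
Proof. by have [_ _ cd] := hg => zv; exact: (cvg_comp z (dphi i) zv (cd i v)). Qed.

Let fld_cvg (t : R) (u : nat -> R) w : 0 <= t -> (forall n, 0 <= u n) -> u n @[n --> \oo] --> t ->
  fld (u n) w @[n --> \oo] --> fld t w.
Proof.
move=> t0 u0 ut; apply: (@cvg_sum_seq R _ _ (fun i n => w 0 i * dphi i (th (u n) w))) => i.
by apply: cvgMr; apply: dphi_cvg; exact: th_cvg.
Qed.

Let rem_cvg (t : R) (u v : nat -> R) w : 0 <= t -> (forall n, 0 <= u n) -> (forall n, 0 <= v n) ->
  u n @[n --> \oo] --> t -> v n @[n --> \oo] --> t -> rem (u n) (v n) w @[n --> \oo] --> (0 : R).
Proof.
move=> t0 u0 v0 ut vt.
have /choice[l hl] : forall n, exists l : R, 0 <= l <= 1 /\ `|rem (u n) (v n) w| <=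
    \sum_i (`|w 0 i| + 1) * `|dphi i (th (u n) w + l *: (th (v n) w - th (u n) w)) - dphi i (th (u n) w)|.
  by move=> n; have [l h1 h2] := rem_le (u n) (v n) w; exists l.
have cu : th (u n) w @[n --> \oo] --> th t w by exact: th_cvg.
have cv : th (v n) w @[n --> \oo] --> th t w by exact: th_cvg.
have cz : th (u n) w + l n *: (th (v n) w - th (u n) w) @[n --> \oo] --> th t w.
  apply: cvg_rV => i.
  have cui : th (u n) w 0 i @[n --> \oo] --> th t w 0 i.
    exact: (cvg_comp (fun n => th (u n) w) (fun x : V => x 0 i) cu (@coord_continuous _ _ _ 0 i _)).
  have cvi : th (v n) w 0 i @[n --> \oo] --> th t w 0 i.
    exact: (cvg_comp (fun n => th (v n) w) (fun x : V => x 0 i) cv (@coord_continuous _ _ _ 0 i _)).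
  apply: (@cvg_ext _ _ (fun n => th (u n) w 0 i + l n * (th (v n) w 0 i - th (u n) w 0 i))).
    by move=> n; rewrite !mxE.
  rewrite -[X in _ --> X]addr0; apply: cvgD => //.
  have z0 : `|th (v n) w 0 i - th (u n) w 0 i| @[n --> \oo] --> (0 : R).
    by rewrite -(normr0 R) -(subrr (th t w 0 i)); apply: cvg_norm; exact: cvgB.
  apply: norm_cvg0; apply: (squeeze_cvgr _ (cvg_cst 0) z0); apply: nearW => n.
  rewrite normr_ge0 normrM ler_piMl//; have [/andP[l0 l1] _] := hl n.
  by rewrite ger0_norm.
apply: norm_cvg0.
have z : \sum_i (`|w 0 i| + 1) * `|dphi i (th (u n) w + l n *: (th (v n) w - th (u n) w)) -
    dphi i (th (u n) w)| @[n --> \oo] --> \sum_(i < d) (0 : R).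
  apply: (@cvg_sum_seq R _ _ (fun i n => (`|w 0 i| + 1) *
     `|dphi i (th (u n) w + l n *: (th (v n) w - th (u n) w)) - dphi i (th (u n) w)|)) => i.
  rewrite -[X in _ --> X](mulr0 (`|w 0 i| + 1)); apply: cvgMr.
  rewrite -(normr0 R) -(subrr (dphi i (th t w))); apply: cvg_norm.
  by apply: cvgB; exact: dphi_cvg.
rewrite big1_eq in z; apply: (squeeze_cvgr _ (cvg_cst 0) z); apply: nearW => n.
by rewrite normr_ge0; have [_] := hl n.
Qed.

Let H_cvg (t : R) (u v : nat -> R) : 0 < t -> (forall n, 0 <= u n < t) -> (forall n, t <= v n) ->
  u n @[n --> \oo] --> t -> v n @[n --> \oo] --> t ->
  H (u n) (v n) t @[n --> \oo] --> moving_rhs t.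
Proof.
move=> tp hu hv ut vt; have [t0 u0 v0] := seq_ge0 tp hu hv.
have ct : (fun=> t) n @[n --> \oo] --> t by exact: cvg_cst.
have cph w : ph (v n) w @[n --> \oo] --> ph t w.
  have cth : th (v n) w @[n --> \oo] --> th t w by exact: th_cvg.
  apply: (cvg_comp (fun n => th (v n) w) phi cth).
  exact: (@has_grad_continuous R d phi dphi hg (th t w)).
have [S [S0 hS]] : exists S, 0 <= S /\ forall n, `|sg (v n)| <= S.
  have cs := prim_scont psg t0 v0 vt; have [S [_ hS]] := cvg_seq_bounded (cvgP _ cs).
  exists (`|S| + 1); split; first by rewrite addr_ge0.
  by move=> n; apply: hS => //; rewrite (le_lt_trans (ler_norm _))// ltrDl.
have cX : X (u n) @[n --> \oo] --> X t.
  apply: (curve_pair_seq hc t0 u0 ut (fun n => mfld (u n)) (fun n => fld_le (u n))) => w.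
  exact: fld_cvg.
have cY i : Y i (u n) @[n --> \oo] --> Y i t.
  apply: (curve_pair_seq hc t0 u0 ut (fun n => mdphi i (u n)) (fun n => dphi_le i (u n))) => w.
  by apply: dphi_cvg; exact: th_cvg.
have cr : rho (u n) (v n) @[n --> \oo] --> (0 : R).
  have -> : (0 : R) = \int[leb]_w (h t w * 0).
    by rewrite -[LHS](Rint_zero leb); apply: eq_Rint => w; rewrite mulr0.
  apply: (curve_pair_seq hc t0 u0 ut (fun n => mrem (u n) (v n)) (fun n => rem_bound (u n) (v n))) => w.
  exact: (@rem_cvg t u v w t0 u0 v0 ut vt).
have cs (z : nat -> R) : Num.sg (z n) * rho (u n) (v n) @[n --> \oo] --> (0 : R).
  apply: norm_cvg0; have cn : `|rho (u n) (v n)| @[n --> \oo] --> (0 : R).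
    by rewrite -(normr0 R); exact: cvg_norm.
  apply: (squeeze_cvgr _ (cvg_cst 0) cn); apply: nearW => n.
  rewrite normr_ge0 normrM ler_piMl// normr_sg; by case: (z n != 0); rewrite ?ler01.
have T0 := fun n : nat => t0.
rewrite /moving_rhs /H; apply: cvgD; [apply: cvgD; [apply: cvgD|]|].
- apply: cvgB; [apply: cvgD; apply: cvgMr|].
  + exact: (curve_pair_seq hc t0 T0 ct (fun n => has_grad_measurable (hgt (v n))) (fun n => ph_le (v n)) cph).
  + apply: (@curve_pair_seq _ _ h hc t (fun=> t) (fun n => euler (dph (v n))) (euler (dph t)) (S * (d%:R * C)) t0 T0 ct).
    * by move=> n; exact: measurable_euler (hgt (v n)).
    * by move=> n w; rewrite euler_dph normrM -mulrA ler_pM// fld_le.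
    * move=> w; rewrite euler_dph; apply: (@cvg_ext _ _ (fun n => sg (v n) * fld (v n) w)).
        by move=> n; rewrite euler_dph.
      by apply: cvgM; [exact: (prim_scont psg t0 v0 vt)|exact: fld_cvg].
  + apply: (@cvg_sum_seq R _ _ (fun i n => c i t * \int[leb]_w (h t w * dph (v n) i w))) => i.
    apply: cvgMr.
    apply: (@curve_pair_seq _ _ h hc t (fun=> t) (fun n => dph (v n) i) (dph t i) (S * C) t0 T0 ct).
    * by move=> n; apply: measurable_funM.
    * by move=> n w; rewrite normrM -mulrA ler_pM// dphi_le.
    * move=> w; apply: cvgM; first exact: (prim_scont psg t0 v0 vt).
      by apply: dphi_cvg; exact: th_cvg.
- apply: (@curve_coll_seq _ _ alpha alpha_gt0 alpha_lt1 h 1 C (fun n => ph (v n)) (ph t) t (fun=> t) hc (leqnn 1) t0 T0 ct).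
  + by move=> n; exact: has_grad_measurable (hgt (v n)).
  + move=> n w; have [_ h1 _ _ _] := CP.
    by rewrite (le_trans (h1 _))// ler_peMr// japanese_exp_ge1.
  + exact: cph.
- apply: cvgMr; rewrite -[X in _ --> X]addr0; exact: cvgD.
- apply: (@cvg_sum_seq R _ _ (fun i n => dp i t * (Y i (u n) +
     Num.sg (p i (v n) - p i (u n)) * rho (u n) (v n)))) => i.
  by apply: cvgMr; rewrite -[X in _ --> X]addr0; exact: cvgD.
Qed.

Lemma prim_moving_test : prim (fun t => \int[leb]_w (h t w * phi (th t w))) moving_rhs.
Proof. exact: (prim_of_increments H_incr H_bound H_cvg). Qed.

End moving_test_function.

Section affine_kinetic.
Context {R : realType} {d : nat}.
Local Notation V := 'rV[R]_d.
Local Notation leb := (@lebesgue_rV R d).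
Implicit Types (h k phi : V -> R) (u : V).

Lemma NrmD q h k : in_L1 q h -> in_L1 q k -> Nrm q (fun v => h v + k v) <= Nrm q h + Nrm q k.
Proof.
move=> hq kq; rewrite /Nrm -(RintD (in_L1_itg hq) (in_L1_itg kq)).
apply: le_Rint; [exact: in_L1_itg (in_L1D hq kq)|by apply: itgD; exact: in_L1_itg|move=> v].
by rewrite -mulrDl ler_wpM2r ?ler_normD// exprn_ge0// japanese_ge0.
Qed.

Lemma affVE (s : R) u : affV s u = aff s^-1 (- (s^-1 *: u)).
Proof. by apply/funext => y; rewrite /affV /aff scalerBr. Qed.

Lemma affVV (s : R) u : s != 0 -> affV s^-1 (- (s^-1 *: u)) = aff s u.
Proof. by move=> s0; apply/funext => w; rewrite /affV /aff invrK opprK scalerDr scalerA divff// scale1r. Qed.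

Lemma avg_aff phi s u (p : V * V) : 0 < s ->
  avg phi (aff s u p.1, aff s u p.2) = avg (phi \o aff s u) p.
Proof.
move=> s0; apply: eq_Rint => x /=; congr phi; rewrite /vpost /aff.
have -> : s *: p.1 + u - (s *: p.2 + u) = s *: (p.1 - p.2).
  by rewrite opprD addrACA subrr addr0 scalerBr.
move: (radial_proj x) => z; rewrite enormZ gtr0_norm//; by apply/rowP => i; rewrite !mxE; field.
Qed.

Lemma Kcoll_aff alpha phi s u (p : V * V) : 0 < s ->
  Kcoll alpha phi (aff s u p.1, aff s u p.2) = s * Kcoll alpha (phi \o aff s u) p.
Proof.
move=> s0; rewrite /Kcoll avg_aff//= mulrA; congr (_ * _).
by rewrite /aff opprD addrACA subrr addr0 -scalerBr enormZ gtr0_norm.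
Qed.

(** Density of the image of the measure m h dv under v -> s v + u: total mass is multiplied by m,
    and s^-d is the Jacobian. *)
Definition affpush (m s : R) u h (y : V) : R := m * s ^- d * h (affV s u y).

Lemma affpush_in_L1 q m s u h : 0 < s -> in_L1 q h -> in_L1 q (affpush m s u h).
Proof.
move=> s0 hq; apply: in_L1Z.
by have [] := aff_in_L1 (- (s^-1 *: u)) (_ : 0 < s^-1) hq; rewrite ?invr_gt0// -affVE.
Qed.

Lemma affpush_ge0 m s u h : 0 <= m -> 0 < s -> (forall v, 0 <= h v) ->
  forall y, 0 <= affpush m s u h y.
Proof. by move=> m0 s0 h0 y; rewrite !mulr_ge0// invr_ge0 exprn_ge0// ltW. Qed.

Lemma Rint_affpush m s u h k : 0 < s -> itg leb (fun w => h w * k (aff s u w)) ->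
  \int[leb]_y (affpush m s u h y * k y) = m * \int[leb]_w (h w * k (aff s u w)).
Proof.
move=> s0 i; have s1 : 0 < s^-1 by rewrite invr_gt0.
have [|i2 e] := @Rint_aff_mul _ _ s^-1 (- (s^-1 *: u)) h k s1.
  by rewrite affVV ?lt0r_neq0.
rewrite (affVV _ (lt0r_neq0 s0)) -affVE in i2 e.
transitivity (\int[leb]_y ((m * s ^- d) * (h (affV s u y) * k y))).
  by apply: eq_Rint => y; rewrite /affpush mulrA.
rewrite RintZ// e exprVn invrK; move: (expf_neq0 d (lt0r_neq0 s0)).
by move: (s ^+ d) => z z0; field.
Qed.

Lemma bil_affpush q C (K : V * V -> R) m s u h : 0 < s -> measurable_fun setT K ->
  (forall p, `|K p| <= C * (japanese p.1 ^+ q * japanese p.2 ^+ q)) -> in_L1 q h ->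
  bil K (affpush m s u h) (affpush m s u h) =
  m ^+ 2 * bil (fun p => K (aff s u p.1, aff s u p.2)) h h.
Proof.
move=> s0 mK KC hq; have s1 : 0 < s^-1 by rewrite invr_gt0.
have := bil_aff (- (s^-1 *: u)) s1 mK KC hq; rewrite (affVV _ (lt0r_neq0 s0)) -affVE => E.
have := aff_in_L1 (- (s^-1 *: u)) s1 hq; rewrite -affVE => -[hq' _].
have iK := itg_bil mK KC hq' hq'.
transitivity ((m * s ^- d) ^+ 2 * bil K (h \o affV s u) (h \o affV s u)).
  rewrite /bil -RintZ//; apply: eq_Rint => p; rewrite /affpush/=; ring.
rewrite E exprVn invrK exprD; move: (expf_neq0 d (lt0r_neq0 s0)).
by move: (s ^+ d) => z z0; field.
Qed.

(** Quadratic in [h], hence m^2, and homogeneous of degree 1 in the relative velocity, hence one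
    factor s; averages over collisions commute with affine maps. *)
Lemma coll_affpush alpha q C phi m s u h : 0 < alpha -> alpha < 1 -> 0 < s ->
  measurable_fun setT phi ->
  (forall v, `|phi v| <= C * japanese v ^+ q) -> in_L1 q.+1 h ->
  coll alpha (affpush m s u h) phi = m ^+ 2 * s * coll alpha h (phi \o aff s u).
Proof.
move=> a0 a1 s0 mphi pC hq.
have KC := Kcoll_bound a0 a1 mphi pC.
rewrite /coll (bil_affpush m u s0 (measurable_Kcoll alpha mphi) KC hq) -mulrA; congr (_ * _).
have s1 : 0 < s^-1 by rewrite invr_gt0.
rewrite (eq_bil _ _ (fun p => Kcoll_aff alpha phi u p s0)).
have mpa : measurable_fun setT (phi \o aff s u) by exact: (measurableT_comp mphi (measurable_aff s u)).
have C0 : 0 <= C.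
  have := le_trans (normr_ge0 _) (pC 0).
  by rewrite pmulr_lge0// exprn_gt0// japanese_gt0.
pose B := affC s^-1 (- (s^-1 *: u)).
have pa v : `|(phi \o aff s u) v| <= (C * B ^+ q) * japanese v ^+ q.
  apply: (le_trans (pC _)); rewrite -mulrA ler_wpM2l// -exprMn lerXn2r ?nnegrE ?japanese_ge0//.
    by rewrite mulr_ge0 ?japanese_ge0// (le_trans ler01)// affC_ge1.
  have := japanese_affV (- (s^-1 *: u)) v s1; rewrite affVV ?lt0r_neq0//.
exact: (bilZ_K s (measurable_Kcoll alpha mpa) (Kcoll_bound a0 a1 mpa pa) hq hq).
Qed.

Lemma affpush_cvg q (h_ : nat -> V -> R) h (m_ s_ : nat -> R) (u_ : nat -> V) (m s : R) u :
  (forall n, 0 < s_ n) -> 0 < s -> m_ n @[n --> \oo] --> m -> s_ n @[n --> \oo] --> s ->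
  (forall i, u_ n 0 i @[n --> \oo] --> u 0 i) ->
  (forall n, in_L1 q (h_ n)) -> in_L1 q h -> (forall v, 0 <= h v) ->
  Nrm q (h_ n \- h) @[n --> \oo] --> (0 : R) ->
  Nrm q (affpush (m_ n) (s_ n) (u_ n) (h_ n) \- affpush m s u h) @[n --> \oo] --> (0 : R).
Proof.
move=> s_0 s0 cm cs cu h_q hq h0 ch.
pose A_ n := (s_ n)^-1; pose U_ n := - (A_ n *: u_ n); pose U := - (s^-1 *: u).
have A_0 n : 0 < A_ n by rewrite invr_gt0.
have A0 : 0 < s^-1 by rewrite invr_gt0.
have cA : A_ n @[n --> \oo] --> s^-1 by apply: cvgV => //; exact: lt0r_neq0.
have cU i : U_ n 0 i @[n --> \oo] --> U 0 i.
  rewrite /U !mxE; apply: (@cvg_ext _ _ (fun n => - (A_ n * u_ n 0 i))) => [n|].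
    by rewrite /U_ !mxE.
  by apply: cvgN; exact: cvgM.
pose k_ n := m_ n * s_ n ^- d; pose k := m * s ^- d.
have ck : k_ n @[n --> \oo] --> k.
  apply: cvgM => //; apply: cvgV; first by rewrite expf_neq0// lt0r_neq0.
  exact: (cvg_comp s_ (fun x : R => x ^+ d) cs (@exprn_continuous _ d _)).
have [B [B0 hB]] := aff_Nrm_bounded q A_0 A0 cA cU.
have dn n := in_L1B (h_q n) hq.
have dnA n := (aff_in_L1 (U_ n) (A_0 n) (dn n)).1.
have hn n := (aff_in_L1 (U_ n) (A_0 n) hq).1; have hA := (aff_in_L1 U A0 hq).1.
have E n : affpush (m_ n) (s_ n) (u_ n) (h_ n) \- affpush m s u h =
  (fun v => (k_ n * ((h_ n \- h) \o aff (A_ n) (U_ n)) v +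
     k_ n * ((h \o aff (A_ n) (U_ n)) \- (h \o aff s^-1 U)) v) + (k_ n - k) * (h \o aff s^-1 U) v).
  by apply/funext => v; rewrite /affpush /= !affVE -/(A_ n) -/(U_ n) -/(k_ n) -/k -/U; ring.
have b n : Nrm q (affpush (m_ n) (s_ n) (u_ n) (h_ n) \- affpush m s u h) <=
    `|k_ n| * (B * Nrm q (h_ n \- h)) + `|k_ n| * Nrm q ((h \o aff (A_ n) (U_ n)) \- (h \o aff s^-1 U))
    + `|k_ n - k| * Nrm q (h \o aff s^-1 U).
  rewrite E; have z1 := in_L1Z (k_ n) (dnA n); have z2 := in_L1Z (k_ n) (in_L1B (hn n) hA).
  apply: (le_trans (NrmD (in_L1D z1 z2) (in_L1Z _ hA))).
  rewrite (NrmZ _ hA) lerD2r; apply: (le_trans (NrmD z1 z2)).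
  rewrite (NrmZ _ (dnA n)) (NrmZ _ (in_L1B (hn n) hA)) lerD2r ler_wpM2l//.
  by apply: (le_trans (aff_in_L1 (U_ n) (A_0 n) (dn n)).2); rewrite ler_wpM2r ?Nrm_ge0.
have z : `|k_ n| * (B * Nrm q (h_ n \- h)) + `|k_ n| * Nrm q ((h \o aff (A_ n) (U_ n)) \- (h \o aff s^-1 U))
    + `|k_ n - k| * Nrm q (h \o aff s^-1 U) @[n --> \oo] -->
    `|k| * (B * 0) + `|k| * 0 + 0 * Nrm q (h \o aff s^-1 U).
  have cnk : `|k_ n| @[n --> \oo] --> `|k| by exact: cvg_norm.
  apply: cvgD; [apply: cvgD; apply: cvgM => //|apply: cvgMl].
  - exact: cvgMr.
  - exact: (@aff_L1_cvg R d q A_ U_ s^-1 U A_0 A0 cA cU h h0 hq).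
  - rewrite -(normr0 R) -(subrr k); apply: cvg_norm; apply: cvgB => //; exact: cvg_cst.
rewrite !mulr0 mul0r !addr0 in z; apply: (squeeze_cvgr _ (cvg_cst 0) z).
by apply: nearW => n; rewrite Nrm_ge0 b.
Qed.

End affine_kinetic.

(** * Transformation of solutions by affine maps and change of time *)

Section transformation.
Context {R : realType} {d : nat}.
Hypothesis d_gt0 : (0 < d)%N.
Local Notation V := 'rV[R]_d.
Local Notation leb := (@lebesgue_rV R d).
Variable alpha : R.
Hypotheses (alpha_gt0 : 0 < alpha) (alpha_lt1 : alpha < 1).
Variables (a b : R -> R) (c : 'I_d -> R -> R) (h : R -> V -> R).
Hypotheses (la : li a) (lb : li b) (lc : forall i, li (c i)) (hc : curve h)
  (ev : evolves alpha a b c h).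
Variables (M dM sg dsg : R -> R) (p dp : 'I_d -> R -> R).
Hypotheses (pM : prim M dM) (psg : prim sg dsg) (pp : forall i, prim (p i) (dp i))
  (M_gt0 : forall t, 0 <= t -> 0 < M t) (sg_gt0 : forall t, 0 <= t -> 0 < sg t).

(** The time derivative of the transformed pairing contains M coll, while the collision term of the
    transformed function is M^2 sg coll. Dividing by this rate restores the coefficient 1. *)
Let kappa t : R := (M t * sg t)^-1.
Hypothesis clock_oo : forall K, exists2 t, 0 <= t & K <= Int 0 t kappa.

Let kappa_gt0 t : 0 <= t -> 0 < kappa t.
Proof. by move=> t0; rewrite invr_gt0 mulr_gt0 ?M_gt0 ?sg_gt0. Qed.

Let skappa : scont kappa.
Proof.
apply: scontV => [t t0|]; first by rewrite lt0r_neq0// mulr_gt0 ?M_gt0 ?sg_gt0.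
by apply: scontM; [exact: (prim_scont pM)|exact: (prim_scont psg)].
Qed.

Local Notation S := (inv_clock kappa).

Definition transformed (s : R) : V -> R :=
  affpush (M (S s)) (sg (S s)) (shiftv p (S s)) (h (S s)).

(** The new coefficients are read off by differentiating M(t) <h, phi(sg v + p)>: scaling adds its
    logarithmic derivative to [b], the factor M adds its own to [a], and [c] collects the motion of
    the centre, all per unit of the new time. *)
Let bt t := b t + dsg t / sg t.
Definition transformed_a (s : R) : R := (dM (S s) / M (S s) + a (S s)) / kappa (S s).
Definition transformed_b (s : R) : R := bt (S s) / kappa (S s).
Definition transformed_c (i : 'I_d) (s : R) : R :=
  (bt (S s) * p i (S s) + sg (S s) * c i (S s) - dp i (S s)) / kappa (S s).

Lemma transformed_in_L1 q s : 0 <= s -> in_L1 q (h (S s)) -> in_L1 q (transformed s).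
Proof. by move=> s0; apply: affpush_in_L1; apply: sg_gt0; exact: inv_clock_ge0. Qed.

Lemma transformed_curve : curve transformed.
Proof.
have S0 s : 0 <= s -> 0 <= S s by exact: inv_clock_ge0.
split=> [s s0|s s0|s s0 u u0 us].
- apply: affpush_ge0; [exact: ltW (M_gt0 (S0 s s0))|exact: sg_gt0 (S0 s s0)|].
  exact: (curve_ge0 hc (S0 s s0)).
- by apply: transformed_in_L1 => //; exact: (curve_L12 hc (S0 s s0)).
have cS := scont_inv_clock skappa kappa_gt0 clock_oo s0 u0 us.
have Su n := S0 _ (u0 n).
apply: affpush_cvg.
- by move=> n; exact: sg_gt0.
- by apply: sg_gt0; exact: S0.
- exact: (prim_scont pM (S0 s s0) Su cS).
- exact: (prim_scont psg (S0 s s0) Su cS).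
- move=> i; rewrite mxE; apply: (@cvg_ext _ _ (fun n => p i (S (u n)))) => [n|]; first by rewrite mxE.
  exact: (prim_scont (pp i) (S0 s s0) Su cS).
- by move=> n; exact: (curve_L12 hc (Su n)).
- exact: (curve_L12 hc (S0 s s0)).
- exact: (curve_ge0 hc (S0 s s0)).
- exact: (curve_cvg hc (S0 s s0) Su cS).
Qed.

Let li_ratio (f g : R -> R) : prim f g -> (forall t, 0 <= t -> 0 < f t) -> li (fun t => g t / f t).
Proof.
move=> pf f0; apply: (liM pf.1); apply: scontV; last exact: (prim_scont pf).
by move=> t t0; exact: lt0r_neq0 (f0 t t0).
Qed.

Let li_clock f : li f -> li (fun s => f (S s) / kappa (S s)).
Proof. by move=> lf x y x0 xy; exact: (Int_time_change skappa kappa_gt0 clock_oo x0 xy lf).1. Qed.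

Let li_bt : li bt. Proof. by apply: liD => //; exact: li_ratio. Qed.

Lemma transformed_li_b : li transformed_b.
Proof. exact: li_clock. Qed.

Lemma transformed_evolves :
  evolves alpha transformed_a transformed_b transformed_c transformed.
Proof.
move=> phi dphi r hg hr.
have [C [C0 pC dC eC me]] := test_bounded hg hr.
have mphi := has_grad_measurable hg.
have mdphi i : measurable_fun setT (dphi i).
  by apply: continuous_rV_measurable; have [_ _] := hg.
have p1 := prim_moving_test alpha_gt0 alpha_lt1 la lb lc hc ev psg pp sg_gt0 hg hr.
have p2 := prim_time_change skappa kappa_gt0 clock_oo (primM pM p1).
pose th t := aff (sg t) (shiftv p t).
have j2 (k : V -> R) K : (forall v, `|k v| <= K) -> forall v, `|k v| <= K * japanese v ^+ 2.
  move=> kK v; apply: (le_trans (kK v)); rewrite ler_peMr ?japanese_exp_ge1//.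
  exact: le_trans (normr_ge0 _) (kK v).
have ith t (k : V -> R) K : 0 <= t -> measurable_fun setT k -> (forall v, `|k v| <= K) ->
    itg leb (fun w => h t w * k (th t w)).
  move=> t0 mk kK; apply: (@in_L1_pairC _ _ 2 (h t) (k \o th t) K (curve_L12 hc t0)).
    exact: (measurableT_comp mk (measurable_aff _ _)).
  by apply: j2 => v; exact: kK.
apply: (prim_ext _ _ p2) => s s0.
  have t0 := inv_clock_ge0 skappa clock_oo s0.
  by rewrite Rint_affpush//; [exact: sg_gt0|exact: (ith _ _ C)].
set t := S s; have t0 : 0 <= t by apply: inv_clock_ge0 => //; exact: ltW.
have Mt := M_gt0 t0; have sgt := sg_gt0 t0.
pose J := \int[leb]_w (h t w * phi (th t w)).
pose Y i := \int[leb]_w (h t w * dphi i (th t w)).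
pose X := \int[leb]_w (h t w * \sum_i w 0 i * dphi i (th t w)).
have iY i : itg leb (fun w => h t w * dphi i (th t w)) by exact: (ith _ _ C).
have wj (w : V) i : `|w 0 i| <= japanese w ^+ 2 by have := coord_bound 1 i w; rewrite mul1r.
have iX : itg leb (fun w => h t w * \sum_i w 0 i * dphi i (th t w)).
  apply: (@in_L1_pairC _ _ 2 (h t) _ (\sum_(i < d) C) (curve_L12 hc t0)).
    apply: measurable_sum => i; apply: measurable_funM; first exact: measurable_coord.
    exact: (measurableT_comp (mdphi i) (measurable_aff _ _)).
  move=> w; apply: (le_trans (ler_norm_sum _ _ _)); rewrite mulr_suml.
  by apply: ler_sum => i _; rewrite normrM mulrC ler_pM.
pose cl := coll alpha (h t) (phi \o th t).
have Ef : \int[leb]_y (transformed s y * phi y) = M t * J.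
  by rewrite Rint_affpush//; exact: (ith _ _ C).
have Ed i : \int[leb]_y (transformed s y * dphi i y) = M t * Y i by rewrite Rint_affpush.
have Ee : \int[leb]_y (transformed s y * euler dphi y) = M t * (sg t * X + \sum_i p i t * Y i).
  rewrite Rint_affpush//; last exact: (ith _ _ C).
  congr (_ * _); rewrite /X -RintZ//.
  have -> : \sum_i p i t * Y i = \int[leb]_w (\sum_i p i t * (h t w * dphi i (th t w))).
    rewrite Rint_sum_seq => [|i]; last exact: itgZ.
    by apply: eq_bigr => i _; rewrite -RintZ.
  rewrite -RintD//; [|exact: itgZ|by apply: itg_sum_seq => i; exact: itgZ].
  apply: eq_Rint => w; rewrite /euler !mulr_sumr -big_split/=; apply: eq_bigr => i _.
  by rewrite -/t {1}/aff !mxE; ring.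
have Ec : coll alpha (transformed s) phi = M t ^+ 2 * sg t * cl.
  apply: (@coll_affpush _ _ alpha 1 C) => //; last exact: (curve_L12 hc t0).
  by move=> v; rewrite (le_trans (pC v))// ler_peMr// japanese_exp_ge1.
rewrite /lin_rhs Ef Ee Ec; under [X in _ = _ - X + _]eq_bigr do rewrite Ed.
rewrite /moving_rhs /lin_rhs -/(th t) -/J -/X -/cl.
have -> : \int[leb]_w (h t w * euler (fun i w => sg t * dphi i (th t w)) w) = sg t * X.
  rewrite /X -RintZ//; apply: eq_Rint => w; rewrite /euler !mulr_sumr.
  by apply: eq_bigr => i _; ring.
have -> : \sum_i c i t * \int[leb]_w (h t w * (sg t * dphi i (th t w))) = sg t * \sum_i c i t * Y i.
  rewrite mulr_sumr; apply: eq_bigr => i _; rewrite mulrCA; congr (_ * _).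
  by rewrite /Y -RintZ//; apply: eq_Rint => w; ring.
have -> : \sum_i transformed_c i s * (M t * Y i) = (bt t * (\sum_i p i t * Y i) +
    sg t * (\sum_i c i t * Y i) - \sum_i dp i t * Y i) * (M t / kappa t).
  rewrite !mulr_sumr -sumrN -!big_split/= mulr_suml; apply: eq_bigr => i _.
  by rewrite /transformed_c -/t; ring.
rewrite /transformed_a /transformed_b -/t /bt /kappa.
move: (\sum_i p i t * Y i) (\sum_i c i t * Y i) (\sum_i dp i t * Y i) => P1 P2 P3.
by field; rewrite !lt0r_neq0.
Qed.

End transformation.

(** * The rescaled solution *)

Section affpush_moments.
Context {R : realType} {d : nat}.
Local Notation V := 'rV[R]_d.
Local Notation leb := (@lebesgue_rV R d).
Implicit Types (h phi : V -> R) (u : V).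

Lemma li_ext (f g : R -> R) : (forall t, 0 < t -> f t = g t) -> li f -> li g.
Proof.
move=> fg lf x y x0 xy; have := lf x y x0 xy; congr itg; apply/funext => t; rewrite /ind.
by case: (boolP (x < t <= y)) => [/andP[xt _]|_]; rewrite ?mul0r// fg// (le_lt_trans x0).
Qed.

(** How constructed functions enter the solution class: the integrability of the third moment is
    deduced from that of the energy loss [q2]. *)
Lemma curve_solution3 (h : R -> V -> R) : curve h -> (forall t, 0 <= t -> in_L1 3 (h t)) ->
  (forall t, 0 <= t -> 0 < density (h t)) -> li (fun t => q2 (h t)) -> solution_class h.
Proof.
move=> hc h3 n0 lq; have f1 t : 0 <= t -> fin3 h t = 1.
  by move=> t0; rewrite /fin3 max_l// asboolT//; exact: h3.
have lN := li_fin3_Nrm3 hc n0 (li_ext (g := fun t => fin3 h t * q2 (h t))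
   (fun t t0 => esym (etrans (congr1 (fun z => z * _) (f1 t (ltW t0))) (mul1r _))) lq).
apply: curve_solution_class => // a b a0 ab.
have : lebesgue_measure.-integrable `[a, b] (EFin \o (fun t => fin3 h t * Nrm 3 (h t))).
  by apply/integrable_ind => //; apply: lN => //; exact: ltW.
apply: eq_integrable => //= t; rewrite inE/= in_itv/= => /andP[h1 _].
have t0 : 0 <= t by rewrite ltW// (lt_le_trans a0).
by rewrite f1// mul1r (L1normE (h3 t t0)).
Qed.

Lemma loss_weak q C phi h : in_L1 q.+1 h -> measurable_fun setT phi ->
  (forall v, `|phi v| <= C * japanese v ^+ q) ->
  itg leb (fun v => Qminus h h v * phi v) /\
  bil (fun p => enorm (p.1 - p.2) * phi p.1) h h = \int[leb]_v (Qminus h h v * phi v).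
Proof. by move=> h1 mp pC; have [i ->] := Qminus_weak h1 mp pC. Qed.

Section moments.
Variables (m s : R) (u : V) (h : V -> R).
Hypothesis s_gt0 : 0 < s.
Local Notation k := (affpush m s u h).

Lemma density_affpush : in_L1 0 h -> density k = m * density h.
Proof.
move=> h1; rewrite !densityE (@Rint_affpush R d m s u h (fun=> 1))//.
by under eq_fun do rewrite mulr1; exact: in_L1_itg1 h1.
Qed.

Lemma mom1_affpush i : in_L1 1 h -> mom1 i k = m * (s * mom1 i h + u 0 i * density h).
Proof.
move=> h1; have ih := in_L1_itg1 h1.
have i1 := in_L1_pairC h1 (measurable_coord i) (coord_bound 0 i).
have E w : h w * (aff s u w) 0 i = s * (h w * w 0 i) + u 0 i * h w by rewrite /aff !mxE; ring.
rewrite /mom1 (@Rint_affpush R d m s u h (fun v => v 0 i))//.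
  by congr (_ * _); rewrite (eq_Rint _ E) (RintD (itgZ s i1) (itgZ _ ih)) (RintZ s i1) (RintZ _ ih).
by under eq_fun do rewrite E; apply: itgD; exact: itgZ.
Qed.

Let sqE w : enorm (aff s u w) ^+ 2 = s ^+ 2 * enorm w ^+ 2 + (\sum_i (2 * s * u 0 i) * w 0 i + enorm u ^+ 2).
Proof.
rewrite !enorm_sqr mulr_sumr -!big_split/=; apply: eq_bigr => i _; rewrite /aff !mxE; ring.
Qed.

(** Stated for a general [F] because it is used for the energy of [h] and again for the energy of
    Q_-(h, h). *)
Let expand (F : V -> R) : itg leb F -> (forall i, itg leb (fun w => F w * w 0 i)) ->
  itg leb (fun w => F w * enorm w ^+ 2) ->
  itg leb (fun w => F w * enorm (aff s u w) ^+ 2) /\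
  \int[leb]_w (F w * enorm (aff s u w) ^+ 2) = s ^+ 2 * \int[leb]_w (F w * enorm w ^+ 2) +
    (2 * s * (\sum_i u 0 i * \int[leb]_w (F w * w 0 i)) + enorm u ^+ 2 * \int[leb]_w F w).
Proof.
move=> iF i1 i2.
have E w : F w * enorm (aff s u w) ^+ 2 = s ^+ 2 * (F w * enorm w ^+ 2) +
    (\sum_i (2 * s * u 0 i) * (F w * w 0 i) + enorm u ^+ 2 * F w).
  rewrite sqE !mulrDr mulrCA (mulrC (F w) (enorm u ^+ 2)); congr (_ + (_ + _)).
  by rewrite mulr_sumr; apply: eq_bigr => i _; ring.
have is1 : itg leb (fun w => \sum_i (2 * s * u 0 i) * (F w * w 0 i)).
  by apply: itg_sum_seq => i; exact: itgZ.
have is2 := itgD is1 (itgZ (enorm u ^+ 2) iF).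
split; first by under eq_fun do rewrite E; apply: itgD => //; exact: itgZ.
rewrite (eq_Rint _ E) (RintD (itgZ _ i2) is2) (RintD is1 (itgZ _ iF)) (RintZ _ i2) (RintZ _ iF).
rewrite Rint_sum_seq => [|i]; last exact: itgZ.
by congr (_ + (_ + _)); rewrite mulr_sumr; apply: eq_bigr => i _; rewrite RintZ//; ring.
Qed.

Lemma mom2_affpush : in_L1 2 h ->
  mom2 k = m * (s ^+ 2 * mom2 h + (2 * s * (\sum_i u 0 i * mom1 i h) + enorm u ^+ 2 * density h)).
Proof.
move=> h2; have [] := expand (in_L1_itg1 h2) (fun i => in_L1_pairC h2 (measurable_coord i) (coord_bound 1 i))
  (in_L1_pairC h2 (@measurable_enorm_sqr R d) (@enorm_sqr_bound R d 0)).
by move=> i e; rewrite /mom2 (@Rint_affpush R d m s u h (fun v => enorm v ^+ 2))// e.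
Qed.

Let loss_affpush q C phi : in_L1 q.+1 h -> measurable_fun setT phi ->
  (forall v, `|phi v| <= C * japanese v ^+ q) ->
  bil (fun p => enorm (p.1 - p.2) * phi p.1) k k =
  m ^+ 2 * s * bil (fun p => enorm (p.1 - p.2) * phi (aff s u p.1)) h h.
Proof.
move=> hq mp pC; rewrite (bil_affpush m u s_gt0 (measurable_dist_fst mp) (dist_fst_bound pC) hq) -mulrA.
congr (_ * _); have C0 : 0 <= C.
  have := le_trans (normr_ge0 _) (pC 0).
  by rewrite pmulr_lge0// exprn_gt0// japanese_gt0.
have s1 : 0 < s^-1 by rewrite invr_gt0.
pose B := affC s^-1 (- (s^-1 *: u)).
have mpa : measurable_fun setT (phi \o aff s u) by exact: (measurableT_comp mp (measurable_aff s u)).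
have pa v : `|(phi \o aff s u) v| <= (C * B ^+ q) * japanese v ^+ q.
  apply: (le_trans (pC _)); rewrite -mulrA ler_wpM2l// -exprMn lerXn2r ?nnegrE ?japanese_ge0//.
    by rewrite mulr_ge0 ?japanese_ge0// (le_trans ler01)// affC_ge1.
  have := japanese_affV (- (s^-1 *: u)) v s1; rewrite affVV ?lt0r_neq0//.
rewrite -(bilZ_K s (measurable_dist_fst mpa) (dist_fst_bound pa) hq hq); apply: eq_bil => p /=.
by rewrite mulrA; congr (_ * _); rewrite /aff opprD addrACA subrr addr0 -scalerBr enormZ gtr0_norm.
Qed.

Lemma q0_affpush : in_L1 1 h -> q0 k = m ^+ 2 * s * q0 h.
Proof. by move=> h1; rewrite /q0 (loss_affpush h1 (measurable_cst _) (cst1_bound 0)). Qed.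

Lemma q1_affpush i : in_L1 2 h -> q1 i k = m ^+ 2 * s * (s * q1 i h + u 0 i * q0 h).
Proof.
move=> h2; rewrite /q1 (loss_affpush h2 (measurable_coord i) (coord_bound 0 i)); congr (_ * _).
have [i1 e1] := loss_weak h2 (measurable_coord i) (coord_bound 0 i).
have [i0 e0] := loss_weak h2 (measurable_cst (1 : R)) (cst1_bound 1).
have mz : measurable_fun setT (fun v : V => (aff s u v) 0 i).
  exact: (measurableT_comp (measurable_coord i) (measurable_aff s u)).
rewrite e1 /q0 e0 -(RintZ s i1) -(RintZ _ i0) -RintD; [|exact: itgZ..].
have b v : `|(aff s u v) 0 i| <= (s + `|u 0 i|) * japanese v ^+ 1.
  rewrite /aff !mxE (le_trans (ler_normD _ _))// mulrDl lerD//.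
    by rewrite normrM gtr0_norm// ler_wpM2l ?(ltW s_gt0)//; have := coord_bound 0 i v; rewrite mul1r.
  by rewrite ler_peMr// japanese_exp_ge1.
have [_ ->] := loss_weak h2 mz b; apply: eq_Rint => v; rewrite /aff !mxE /cst; ring.
Qed.

Lemma q2_affpush : in_L1 3 h ->
  q2 k = m ^+ 2 * s * (s ^+ 2 * q2 h + (2 * s * (\sum_i u 0 i * q1 i h) + enorm u ^+ 2 * q0 h)).
Proof.
move=> h3.
rewrite /q2 (loss_affpush h3 (@measurable_enorm_sqr R d) (@enorm_sqr_bound R d 0)); congr (_ * _).
have [i2 e2] := loss_weak h3 (@measurable_enorm_sqr R d) (@enorm_sqr_bound R d 0).
have w1 i := loss_weak h3 (measurable_coord i) (coord_bound 1 i).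
have [i0 e0] := loss_weak h3 (measurable_cst (1 : R)) (cst1_bound 2).
have iQ : itg leb (fun v => Qminus h h v).
  by move: i0; congr itg; apply/funext => v; rewrite /cst mulr1.
have [_ ex] := expand iQ (fun i => (w1 i).1) i2.
have b v : `|enorm (aff s u v) ^+ 2| <= (2 * s ^+ 2 + 2 * enorm u ^+ 2) * japanese v ^+ 2.
  rewrite ger0_norm ?sqr_ge0// japanese_sqr.
  have : enorm (aff s u v) <= s * enorm v + enorm u.
    by rewrite (le_trans (enormD _ _))// enormZ gtr0_norm.
  have := enorm_ge0 (aff s u v); have := enorm_ge0 v; have := enorm_ge0 u; move: s_gt0.
  move: (enorm (aff s u v)) (enorm v) (enorm u) => x y z s0 z0 y0 x0 hx.
  have : x ^+ 2 <= (s * y + z) ^+ 2 by rewrite lerXn2r ?nnegrE ?addr_ge0 ?mulr_ge0 ?(ltW s0).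
  have := sqr_ge0 (s * y - z); have : 0 <= z ^+ 2 * y ^+ 2 by rewrite mulr_ge0 ?sqr_ge0.
  have := sqr_ge0 s; nra.
have mz : measurable_fun setT (fun v : V => enorm (aff s u v) ^+ 2).
  exact: (measurableT_comp (@measurable_enorm_sqr R d) (measurable_aff s u)).
have [_ ->] := loss_weak h3 mz b; rewrite ex e2; congr (_ + (_ + _ * _)).
  by congr (_ * _); apply: eq_bigr => i _; rewrite /q1 (w1 i).2.
by rewrite /q0 e0; apply: eq_Rint => v; rewrite /cst mulr1.
Qed.

End moments.

(** Moments are not pairings with admissible tests; they are limits of pairings with cut-off
    ones. *)
Lemma same_tests_growth (g g0 : V -> R) phi dphi C : in_L1 2 g -> in_L1 2 g0 -> same_tests g g0 ->
  growth2 phi dphi C -> \int[leb]_v (g v * phi v) = \int[leb]_v (g0 v * phi v).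
Proof.
move=> h2 k2 st [hg b _ _].
have lim (f : V -> R) : in_L1 2 f ->
    \int[leb]_v (f v * cutf phi n v) @[n --> \oo] --> \int[leb]_v (f v * phi v).
  move=> f2; have i := in_L1_pairC f2 (has_grad_measurable hg) b.
  apply: (Rint_dct _ _ (itg_norm i)) => [n|v|n v].
  - apply: measurable_funM; first exact: in_L1_meas f2.
    exact: has_grad_measurable (has_grad_cutf n hg).
  - by apply: cvgMr; exact: cutf_cvg.
  - by rewrite normrM [X in _ <= X]normrM ler_wpM2l// cutf_le.
have := lim _ k2; rewrite (_ : (fun n => _) = (fun n => \int[leb]_v (g v * cutf phi n v))).
  by move=> h1; exact: (etrans (esym (cvg_lim (@Rhausdorff R) (lim _ h2))) (cvg_lim (@Rhausdorff R) h1)).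
apply/funext => n; apply/esym/st/test_functionP.
by exists (dcut phi dphi n), n.+1%:R; split; [exact: has_grad_cutf|exact: cutf_out].
Qed.

Lemma same_tests_moments (g g0 : V -> R) : in_L1 2 g -> in_L1 2 g0 -> same_tests g g0 ->
  [/\ density g = density g0, forall i, mom1 i g = mom1 i g0 & mom2 g = mom2 g0].
Proof.
move=> h2 k2 st; split; first by rewrite !densityE; exact: (same_tests_growth h2 k2 st (@growth2_cst R d)).
  by move=> i; exact: (same_tests_growth h2 k2 st (@growth2_coord R d i)).
exact: (same_tests_growth h2 k2 st (@growth2_energy R d)).
Qed.

Lemma same_tests_affpush m s u (g g0 : V -> R) : 0 < s -> in_L1 0 g -> in_L1 0 g0 -> same_tests g g0 ->
  same_tests (affpush m s u g) (affpush m s u g0).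
Proof.
move=> s0 h0 k0 st phi /test_functionP[dphi [r [hg hr]]].
have [C [C0 pC _ _ _]] := test_bounded hg hr.
have hga := has_grad_affine s u hg.
have i (f : V -> R) : in_L1 0 f -> itg leb (fun w => f w * phi (aff s u w)).
  move=> f0; apply: (in_L1_pairC f0 (has_grad_measurable hga) (C := C)) => v.
  by rewrite expr0 mulr1 pC.
rewrite (@Rint_affpush R d m s u g phi s0 (i g h0)) (@Rint_affpush R d m s u g0 phi s0 (i g0 k0)).
congr (_ * _); apply: st; apply/test_functionP.
exists (fun i v => s * dphi i (aff s u v)), ((r + enorm u) / s); split => // v.
rewrite ltr_pdivrMr// => H; apply: hr; have := enormB (aff s u v) u.
by rewrite /aff addrK enormZ gtr0_norm// mulrC; lra.
Qed.

End affpush_moments.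

Section rescaled_equation.
Context {R : realType} {d : nat}.
Hypothesis d_gt0 : (0 < d)%N.
Local Notation V := 'rV[R]_d.
Local Notation leb := (@lebesgue_rV R d).
Variable alpha : R.

(** In terms of the rescaled equation, a = -(A - d B), b = B and c is the vector B v. The energy
    terms of A and d B cancel, so only [drift_b] involves [q2], and there [fin3] guards it. *)
Definition drift_a (h : R -> V -> R) t : R := alpha * q0 (h t).
Definition drift_b (h : R -> V -> R) t : R :=
  - (alpha / 2) * (q0 (h t) - 2 / d%:R * (fin3 h t * q2 (h t))).
Definition drift_c (h : R -> V -> R) (i : 'I_d) t : R := - alpha * q1 i (h t).

Lemma rescaled_rhsE (h : R -> V -> R) t phi dphi r : 0 <= t -> in_L1 3 (h t) ->
  (forall v, 0 <= h t v) -> has_grad phi dphi -> (forall v, r < enorm v -> phi v = 0) ->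
  rescaled_rhs alpha h t phi =
  lin_rhs (drift_a h) (drift_b h) (drift_c h) h phi dphi t + coll alpha (h t) phi.
Proof.
move=> t0 h3 h0 hg hr; have [C [[_ b _ _] _]] := test_growth2 hg hr.
have [C' [C0' pC' dC' eC' me]] := test_bounded hg hr.
have [i2 e2] := loss_weak h3 (@measurable_enorm_sqr R d) (@enorm_sqr_bound R d 0).
have [i0 e0] := loss_weak h3 (measurable_cst (1 : R)) (cst1_bound 2).
have w1 i := loss_weak h3 (measurable_coord i) (coord_bound 1 i).
rewrite -[bil _ _ _]/(q2 (h t)) in e2; rewrite -[bil _ _ _]/(q0 (h t)) in e0.
rewrite /rescaled_rhs (collision_rhsE d_gt0 alpha h3 h0 (has_grad_measurable hg) b); congr (_ + _).
have dn : d%:R != 0 :> R by rewrite pnatr_eq0 -lt0n.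
have BE : B_coef alpha h t = drift_b h t.
  rewrite /B_coef /drift_b /fin3 max_l// asboolT// mul1r e0 e2 -(RintZ _ i2) -RintB//; last exact: itgZ.
  by congr (_ * _); apply: eq_Rint => v; rewrite /cst; ring.
have AE : - (A_coef alpha h t - d%:R * B_coef alpha h t) = drift_a h t.
  have -> : A_coef alpha h t = - (alpha / 2) * ((d%:R + 2) * q0 (h t) - 2 * q2 (h t)).
    rewrite /A_coef e0 e2 -(RintZ 2 i2) -(RintZ (_ + 2) i0) -RintB; [|exact: itgZ..].
    by congr (_ * _); apply: eq_Rint => v; rewrite /cst; ring.
  rewrite BE /drift_b /drift_a /fin3 max_l// asboolT// mul1r; field; exact: dn.
have cE i : Bv_coef alpha h t 0 i = drift_c h i t.
  rewrite mxE /drift_c /q1 (w1 i).2; congr (_ * _); apply: eq_Rint => v; exact: mulrC.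
rewrite AE /lin_rhs -addrA; congr (_ + _); rewrite BE.
have i1 : itg leb (fun v => h t v * euler dphi v).
  apply: (in_L1_pairC (in_L1_le (isT : (0 <= 3)%N) h3) me (C := C')) => v.
  by rewrite expr0 mulr1.
have j1 i : itg leb (fun v => h t v * dphi i v).
  apply: (in_L1_pairC (in_L1_le (isT : (0 <= 3)%N) h3) _ (C := C')) => [|v].
    by apply: continuous_rV_measurable; have [_ _] := hg.
  by rewrite expr0 mulr1.
rewrite -(RintZ _ i1).
have -> : \sum_i drift_c h i t * \int[leb]_v (h t v * dphi i v) =
    \int[leb]_v (\sum_i drift_c h i t * (h t v * dphi i v)).
  by rewrite Rint_sum_seq => [|i]; [apply: eq_bigr => i _; rewrite RintZ|exact: itgZ].
rewrite -RintB; [|exact: itgZ|by apply: itg_sum_seq => i; exact: itgZ].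
apply: eq_Rint => v; have [_ e _] := hg; rewrite e /euler !mulr_sumr -sumrB.
by apply: eq_bigr => i _; rewrite -cE !mxE; ring.
Qed.

Lemma rescaled_solution_of_evolves (h : R -> V -> R) h0 : solution_class h ->
  (forall t, 0 <= t -> in_L1 3 (h t)) ->
  evolves alpha (drift_a h) (drift_b h) (drift_c h) h -> same_tests (h 0) h0 ->
  rescaled_solution alpha h0 h.
Proof.
move=> sh h3 ev s0; split => // phi tphi; have [dphi [r [hg hr]]] := (test_functionP phi).1 tphi.
apply/prim_intervals; split; last exact: s0.
apply: (prim_ext _ _ (ev phi dphi r hg hr)) => // t t0; have t0' := ltW t0.
by rewrite (rescaled_rhsE t0' (h3 t t0') (sc_ge0 sh t0') hg hr).
Qed.

End rescaled_equation.

Section rescaling.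
Context {R : realType} {d : nat}.
Hypothesis d_gt0 : (0 < d)%N.
Local Notation V := 'rV[R]_d.
Variable alpha : R.
Hypotheses (alpha_gt0 : 0 < alpha) (alpha_lt1 : alpha < 1).
Variables (f : R -> V -> R).
Hypotheses (sf : solution_class f) (f3 : forall t, 0 <= t -> in_L1 3 (f t))
  (ev : evolves alpha (fun=> 0) (fun=> 0) (fun _ _ => 0) f) (n0 : 0 < density (f 0)).

Let fc : curve f := solution_class_curve sf.
Let f_ge0 := curve_ge0 fc.
Let f2 t (t0 : 0 <= t) : in_L1 2 (f t) := curve_L12 fc t0.
Let n t : R := density (f t).
Let u i t : R := mom1 i (f t) / n t.
Let T2 t : R := 2 * temperature (f t).
Let sg t : R := (Num.sqrt (T2 t))^-1.
Let n_gt0 t : 0 <= t -> 0 < n t.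
Proof. exact: (annihilation_density_gt0 alpha_gt0 alpha_lt1 sf f3 ev n0). Qed.
Let T2_gt0 t : 0 <= t -> 0 < T2 t.
Proof. by move=> t0; rewrite mulr_gt0// (temperature_gt0 d_gt0 (f_ge0 t0) (f2 t0) (n_gt0 t0)). Qed.
Let dn : d%:R != 0 :> R. Proof. by rewrite pnatr_eq0 -lt0n. Qed.

Let dM t : R := - (n t) ^- 2 * (- alpha * q0 (f t)).
Let pM : prim (fun t => (n t)^-1) dM.
Proof. exact: (primV n_gt0 (annihilation_density alpha_gt0 alpha_lt1 sf ev)). Qed.

Let du i t : R := - alpha * q1 i (f t) * (n t)^-1 + mom1 i (f t) * dM t.
Let pu i : prim (u i) (du i).
Proof. exact: (primM (annihilation_mom1 alpha_gt0 alpha_lt1 sf ev i) pM). Qed.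

(** Twice the temperature written through the moments of [f], whose primitives are known, so that it
    can be differentiated. *)
Let W t : R := 2 / d%:R * (mom2 (f t) * (n t)^-1 - \sum_i u i t * u i t).
Let dW t : R := 2 / d%:R * (- alpha * q2 (f t) * (n t)^-1 + mom2 (f t) * dM t -
  \sum_i (du i t * u i t + u i t * du i t)).

Let WE t : 0 <= t -> T2 t = W t.
Proof.
move=> t0; have := temperatureE d_gt0 (f2 t0) (n_gt0 t0); rewrite -/(n t) => E.
have nn := lt0r_neq0 (n_gt0 t0).
have -> : T2 t = 2 / d%:R * ((d%:R * n t * temperature (f t)) * (n t)^-1).
  by rewrite /T2; field; rewrite nn dn.
rewrite E /W mulrBl; congr (_ * (_ - _)); rewrite !mulr_suml; apply: eq_bigr => i _.
by rewrite /u; field.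
Qed.

Let pW : prim T2 dW.
Proof.
have p2 := primM (annihilation_mom2 d_gt0 alpha_gt0 alpha_lt1 sf f3 ev n0) pM.
have ps := primN (@prim_sum R _ (index_enum 'I_d) _ _ (fun i => primM (pu i) (pu i))).
by apply: (prim_ext _ _ (primZ (2 / d%:R) (primD p2 ps))) => // t t0; exact: WE.
Qed.

Let dsg t : R := - (Num.sqrt (T2 t)) ^- 2 * ((2 * Num.sqrt (T2 t))^-1 * dW t).
Let psg : prim sg dsg.
Proof. by apply: primV; [move=> t t0; rewrite sqrtr_gt0 T2_gt0|exact: (prim_sqrt T2_gt0 pW)]. Qed.

Let sg_gt0 t : 0 <= t -> 0 < sg t.
Proof. by move=> t0; rewrite invr_gt0 sqrtr_gt0 T2_gt0. Qed.

Let p i t : R := - (u i t * sg t).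
Let dp i t : R := - (du i t * sg t + u i t * dsg t).
Let pp i : prim (p i) (dp i).
Proof. exact: (primN (primM (pu i) psg)). Qed.

Let M_gt0 t : 0 <= t -> 0 < (n t)^-1.
Proof. by move=> t0; rewrite invr_gt0 n_gt0. Qed.

Let kappa t : R := ((n t)^-1 * sg t)^-1.

(** The general clock 1/(M sg) becomes n sqrt(2 T), the rate of the rescaled time of the theorem. *)
Let kappaE t : kappa t = Num.sqrt 2 * clock_rate f t.
Proof.
rewrite /kappa invfM !invrK /sg /T2 /clock_rate sqrtrM// -/(n t).
by rewrite mulrCA.
Qed.

Let clockE t : 0 <= t -> Int 0 t kappa = rescaled_time f t.
Proof.
move=> t0; have sc := scont_clock_rate d_gt0 alpha_gt0 alpha_lt1 sf f3 ev n0.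
have lc := li_scont sc.
rewrite /rescaled_time (@Rintegral_ind _ (clock_rate f) 0 t t0 (lc _ _ (lexx 0) t0)).
by rewrite -(IntZ _ (lexx 0) t0 lc); apply: eq_Int => s _ _; exact: kappaE.
Qed.

Let clock_oo K : exists2 t, 0 <= t & K <= Int 0 t kappa.
Proof.
have s2 : 0 < Num.sqrt (2 : R) by rewrite sqrtr_gt0.
have sc := scont_clock_rate d_gt0 alpha_gt0 alpha_lt1 sf f3 ev n0.
have [t t0 h] := clock_unbounded d_gt0 alpha_gt0 alpha_lt1 sf f3 ev n0 (K / Num.sqrt 2).
exists t => //; have -> : Int 0 t kappa = Int 0 t (fun t => Num.sqrt 2 * clock_rate f t).
  by apply: eq_Int => s _ _; exact: kappaE.
by rewrite (IntZ _ (lexx 0) t0 (li_scont sc)) mulrC -ler_pdivrMr.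
Qed.

Let skappa : scont kappa.
Proof.
have sc := scont_clock_rate d_gt0 alpha_gt0 alpha_lt1 sf f3 ev n0.
by apply: (@scont_ext _ (fun t => Num.sqrt 2 * clock_rate f t)) => [t _|]; [rewrite kappaE|apply: scontM => //; exact: scont_cst].
Qed.

Let kappa_gt0 t : 0 <= t -> 0 < kappa t.
Proof. by move=> t0; rewrite invr_gt0 mulr_gt0 ?M_gt0 ?sg_gt0. Qed.

Definition rescaled : R -> V -> R := transformed f (fun t => (n t)^-1) sg p.
Local Notation psi := rescaled.
Local Notation S := (inv_clock kappa).

Let bulkE t i : bulk_velocity (f t) 0 i = u i t.
Proof. by rewrite /bulk_velocity !mxE mulrC. Qed.

Let affE t (v : V) : 0 <= t ->
  affV (sg t) (shiftv p t) ((Num.sqrt (T2 t))^-1 *: (v - bulk_velocity (f t))) = v.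
Proof.
move=> t0; have g0 := lt0r_neq0 (sg_gt0 t0); have := bulkE t; move: (bulk_velocity (f t)) => b bi.
by rewrite -/(sg t) /affV; apply/rowP => i; rewrite !mxE bi /p; field.
Qed.

Let powE t : 0 <= t -> T2 t `^ (- (d%:R / 2)) = sg t ^+ d.
Proof.
move=> t0; rewrite powRN /sg exprVn; congr (_^-1).
by rewrite -powR12_sqrt ?(ltW (T2_gt0 t0))// -powR_mulrn ?powR_ge0// -powRrM mulrC.
Qed.

Lemma rescaled_rescaling : rescaling_of f psi.
Proof.
move=> t t0 v; rewrite -clockE// /rescaled /transformed (clockK skappa kappa_gt0 clock_oo t0).
rewrite /affpush affE// powE// -/(n t); move: (expf_neq0 d (lt0r_neq0 (sg_gt0 t0))).
by move: (sg t ^+ d) => z z0; field; rewrite z0 (lt0r_neq0 (n_gt0 t0)).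
Qed.

(** The clock is unbounded, so every tau is reached, and at each time the affine change of velocity
    is onto: the rescaling identity determines every value at tau >= 0. *)
Lemma rescaling_unique (phi : R -> V -> R) : rescaling_of f phi ->
  forall tau, 0 <= tau -> phi tau = psi tau.
Proof.
move=> H tau tau0; apply/funext => xi.
set t := S tau; have t0 : 0 <= t by exact: inv_clock_ge0.
have ct : rescaled_time f t = tau by rewrite -clockE// inv_clockK.
pose v := Num.sqrt (T2 t) *: xi + bulk_velocity (f t).
have E : (Num.sqrt (T2 t))^-1 *: (v - bulk_velocity (f t)) = xi.
  by rewrite /v addrK scalerA mulVf ?scale1r// lt0r_neq0// sqrtr_gt0 T2_gt0.
have h1 := H t t0 v; have h2 := rescaled_rescaling t0 v.
rewrite -/(T2 t) E ct in h1 h2; rewrite h1 in h2; apply: (mulfI _ h2).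
rewrite mulf_neq0 ?(lt0r_neq0 (n_gt0 t0))// powE// expf_neq0//; exact: lt0r_neq0 (sg_gt0 t0).
Qed.

Lemma rescaled_curve : curve psi.
Proof. exact: (transformed_curve fc pM psg pp M_gt0 sg_gt0 clock_oo). Qed.

Lemma rescaled_in_L1 tau : 0 <= tau -> in_L1 3 (psi tau).
Proof.
move=> tau0; apply: (transformed_in_L1 p pM psg M_gt0 sg_gt0 clock_oo tau0).
by apply: f3; exact: inv_clock_ge0.
Qed.

Let S0 s : 0 <= s -> 0 <= S s. Proof. exact: inv_clock_ge0. Qed.

Let f01 t (t0 : 0 <= t) : in_L1 1 (f t) := in_L1_le (isT : (1 <= 2)%N) (f2 t0).

Let q0E s : 0 <= s -> q0 (psi s) = (n (S s))^-1 ^+ 2 * sg (S s) * q0 (f (S s)).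
Proof. by move=> s0; apply: q0_affpush; [apply: sg_gt0; exact: S0|exact: f01 (S0 s0)]. Qed.

Let q1E i s : 0 <= s -> q1 i (psi s) = (n (S s))^-1 ^+ 2 * sg (S s) *
  (sg (S s) * q1 i (f (S s)) + p i (S s) * q0 (f (S s))).
Proof.
move=> s0; rewrite /rescaled /transformed q1_affpush ?mxE//; first by apply: sg_gt0; exact: S0.
exact: f2 (S0 s0).
Qed.

Let q2E s : 0 <= s -> q2 (psi s) = (n (S s))^-1 ^+ 2 * sg (S s) * (sg (S s) ^+ 2 *
  (q2 (f (S s)) - 2 * (\sum_i u i (S s) * q1 i (f (S s))) + (\sum_i u i (S s) ^+ 2) * q0 (f (S s)))).
Proof.
move=> s0; rewrite /rescaled /transformed q2_affpush; [|by apply: sg_gt0; exact: S0|exact: f3 (S0 s0)].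
congr (_ * _); rewrite enorm_sqr mulrDr mulrBr addrA; congr (_ + _).
  rewrite -mulrN; congr (_ + _); rewrite !mulr_sumr -sumrN !mulr_sumr; apply: eq_bigr => i _.
  by rewrite mxE /p; ring.
rewrite mulrA mulr_sumr; congr (_ * _); apply: eq_bigr => i _; rewrite mxE /p; ring.
Qed.

Let aE s : 0 <= s -> transformed_a (fun=> 0) (fun t => (n t)^-1) dM sg s = drift_a alpha psi s.
Proof.
move=> s0; rewrite /transformed_a /drift_a q0E// /dM; have t0 := S0 s0.
by field; rewrite (lt0r_neq0 (n_gt0 t0)) (lt0r_neq0 (sg_gt0 t0)).
Qed.

Let cE i s : 0 <= s -> transformed_c (fun=> 0) (fun _ _ => 0) (fun t => (n t)^-1) sg dsg p dp i s =
  drift_c alpha psi i s.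
Proof.
move=> s0; rewrite /transformed_c /drift_c q1E// /dp /p /du /u /dM; have t0 := S0 s0.
move: (dsg (S s)) => D.
by field; rewrite (lt0r_neq0 (n_gt0 t0)) (lt0r_neq0 (sg_gt0 t0)).
Qed.

(** The derivative of 2 T is a combination of loss moments centred at the bulk velocity, and these
    are the loss moments of the rescaled solution up to powers of [sg]. *)
Let bE s : 0 <= s -> transformed_b (fun=> 0) (fun t => (n t)^-1) sg dsg s =
  - (alpha / 2) * (q0 (psi s) - 2 / d%:R * q2 (psi s)).
Proof.
move=> s0; rewrite /transformed_b q0E// q2E//; set t := S s; have t0 : 0 <= t := S0 s0.
have nn := lt0r_neq0 (n_gt0 t0); have gn := lt0r_neq0 (sg_gt0 t0).
have dWE : dW t = 2 * alpha / (d%:R * n t) * (d%:R / 2 * T2 t * q0 (f t) -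
    (q2 (f t) - 2 * (\sum_i u i t * q1 i (f t)) + (\sum_i u i t ^+ 2) * q0 (f t))).
  have -> : dW t = 2 / d%:R * (- alpha * q2 (f t) * (n t)^-1 + mom2 (f t) * dM t +
      2 * alpha / n t * ((\sum_i u i t * q1 i (f t)) - (\sum_i u i t ^+ 2) * q0 (f t))).
    rewrite /dW; congr (_ * (_ + _)); rewrite mulr_suml -sumrB -sumrN mulr_sumr.
    apply: eq_bigr => i _; rewrite /du /dM (_ : mom1 i (f t) = u i t * n t); last by rewrite /u divfK.
    by field.
  rewrite WE// /W /dM.
  have -> : \sum_i u i t * u i t = \sum_i u i t ^+ 2 by apply: eq_bigr => i _; rewrite expr2.
  move: (\sum_i u i t * q1 i (f t)) (\sum_i u i t ^+ 2) => x y.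
  by field; rewrite nn dn.
have sq : Num.sqrt (T2 t) = (sg t)^-1 by rewrite /sg invrK.
have TE : T2 t = (sg t) ^- 2 by rewrite -exprVn -sq sqr_sqrtr// ltW// T2_gt0.
rewrite /dsg dWE sq TE; move: (q2 (f t) - _ + _) => Q.
by field; rewrite nn gn dn.
Qed.

(** Solved for [q2] in the formula for the transformed coefficient, whose integrability comes with
    the change of time. *)
Lemma rescaled_li_q2 : li (fun s => q2 (psi s)).
Proof.
have lb := transformed_li_b (li_cst 0) pM psg M_gt0 sg_gt0 clock_oo.
have l0 := li_scont (scont_q0 rescaled_curve).
apply: (li_ext _ (liZ (d%:R / 2) (liD l0 (liZ (2 / alpha) lb)))) => s s0.
by rewrite (bE (ltW s0)); field; rewrite dn lt0r_neq0.
Qed.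

Lemma rescaled_density tau : 0 <= tau -> density (psi tau) = 1.
Proof.
move=> tau0; have t0 := S0 tau0; rewrite /rescaled /transformed density_affpush.
- by rewrite mulVf// (lt0r_neq0 (n_gt0 t0)).
- exact: sg_gt0.
- exact: in_L1_le (isT : (0 <= 2)%N) (f2 t0).
Qed.

Lemma rescaled_class : solution_class psi.
Proof.
apply: (curve_solution3 rescaled_curve rescaled_in_L1); last exact: rescaled_li_q2.
by move=> t t0; rewrite rescaled_density.
Qed.

Lemma rescaled_evolves :
  evolves alpha (drift_a alpha psi) (drift_b alpha psi) (drift_c alpha psi) psi.
Proof.
move=> phi dphi r hg hr.
have := transformed_evolves alpha_gt0 alpha_lt1 (li_cst 0) (li_cst 0) (fun=> li_cst 0) fc ev
  pM psg pp M_gt0 sg_gt0 clock_oo hg hr.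
apply: prim_ext => // s s0; have s0' := ltW s0; rewrite /lin_rhs aE// bE//; congr (_ + _ - _ + _).
  rewrite /drift_b /fin3 max_l// asboolT ?mul1r//; exact: rescaled_in_L1.
by apply: eq_bigr => i _; rewrite cE.
Qed.

(** [f 0] and [f0] agree only against test functions, but this fixes density, bulk velocity and
    temperature, so both are rescaled by the same affine map. *)
Lemma rescaled_initial f0 : in_L1 3 f0 -> same_tests (f 0) f0 ->
  same_tests (psi 0) (rescaled_datum f0).
Proof.
move=> f03 st; have f02 := in_L1_le (isT : (2 <= 3)%N) f03.
have t0 : (0 : R) <= 0 := lexx 0.
have [e0 e1 e2] := same_tests_moments (f2 t0) f02 st.
have eu : bulk_velocity f0 = bulk_velocity (f 0).
  by apply/rowP => i; rewrite !mxE -e0; congr (_ * _); rewrite -[LHS]/(mom1 i f0) -e1.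
have eT : temperature f0 = temperature (f 0).
  have h1 := temperatureE d_gt0 (f2 t0) (n_gt0 t0).
  have n00 : 0 < density f0 by rewrite -e0; exact: n_gt0.
  have h2 := temperatureE d_gt0 f02 n00; rewrite -e0 -e2 in h2.
  have dn0 : d%:R * density (f 0) != 0 by rewrite mulf_neq0// lt0r_neq0//; exact: n_gt0.
  have : d%:R * density (f 0) * temperature f0 = d%:R * density (f 0) * temperature (f 0).
    apply: (etrans h2); apply: (etrans _ (esym h1)); congr (_ - _ / _).
    by apply: eq_bigr => i _; rewrite e1.
  by move=> /(mulfI dn0).
have -> : rescaled_datum f0 = affpush (n 0)^-1 (sg 0) (shiftv p 0) f0.
  apply/funext => xi; rewrite /rescaled_datum /affpush eT eu -e0 -/(T2 0) -/(n 0).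
  have g0 := lt0r_neq0 (sg_gt0 t0).
  have -> : T2 0 `^ (d%:R / 2) = sg 0 ^- d by rewrite -[LHS]invrK -powRN powE.
  rewrite [X in X * _ = _]mulrC; congr (_ * f0 _).
  have := bulkE 0; move: (bulk_velocity (f 0)) => b bi; rewrite /affV; apply/rowP => i.
  by rewrite !mxE bi /p (_ : Num.sqrt (T2 0) = (sg 0)^-1); [field|rewrite /sg invrK].
have E : psi 0 = affpush (n 0)^-1 (sg 0) (shiftv p 0) (f 0).
  by rewrite /rescaled /transformed (inv_clock0 skappa kappa_gt0 clock_oo).
rewrite E; apply: same_tests_affpush (sg_gt0 t0) (in_L1_le (isT : (0 <= 2)%N) (f2 t0)) _ st.
exact: in_L1_le (isT : (0 <= 2)%N) f02.
Qed.

End rescaling.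

(** * A priori bounds for the rescaled equation *)

Section ae_primitive.
Context {R : realType}.
Local Notation mu := (@lebesgue_measure R).

(** Needed because the right-hand side of the rescaled equation and its form with [fin3] agree only
    at the times where the third moment is finite. *)
Lemma prim_ae (F f g : R -> R) : measurable_fun setT (fun t : R => g (Num.max t 0)) ->
  {ae mu, forall t, 0 < t -> f t = g t} -> prim F f -> prim F g.
Proof.
move=> mg fg [lf hF].
have m x y : 0 <= x -> measurable_fun setT (fun t : R => ind x y t * g t).
  move=> x0; under eq_fun do rewrite (ind_max g y _ x0).
  by apply: measurable_funM; [exact: measurable_ind|].
have e x y : 0 <= x -> {ae mu, forall t, ind x y t * f t = ind x y t * g t}.
  move=> x0; apply: (@filterS _ _ (ae_filter_ringOfSetsType mu) _ _ _ fg) => t h; rewrite /ind.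
  by case: (boolP (x < t <= y)) => [/andP[xt _]|_]; rewrite ?mul0r// h// (le_lt_trans x0).
split=> x y x0 xy; first by apply: (@ae_itg _ _ _ mu (fun t => ind x y t * f t)); [exact: m|exact: e|exact: lf].
rewrite hF//; apply: ae_eq_Rint; [exact: itg_meas (lf x y x0 xy)|exact: m|exact: e].
Qed.

End ae_primitive.

Section povzner.
Context {R : realType} {d : nat}.
Local Notation V := 'rV[R]_d.
Variables (alpha e : R).
Hypotheses (alpha_gt0 : 0 < alpha) (alpha_lt1 : alpha < 1) (e_gt0 : 0 < e).

Let continuous_comp_at (h : V -> R) (k : R -> R) : continuous h ->
  (forall v, {for h v, continuous k}) -> continuous (k \o h).
Proof. by move=> ch ck v; exact: (continuous_comp (ch v) (ck v)). Qed.

Let w (v : V) : R := (1 + e * japanese v)^-1.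

Let den (v : V) : 0 < 1 + e * japanese v.
Proof. by rewrite ltr_wpDr// mulr_ge0 ?japanese_ge0// ltW. Qed.

Let w_gt0 (v : V) : 0 < w v. Proof. by rewrite invr_gt0. Qed.

Let w_le1 (v : V) : w v <= 1.
Proof. by rewrite invf_le1// lerDl mulr_ge0 ?japanese_ge0// ltW. Qed.

(* <v>^3 truncated to quadratic growth *)
Definition cubic (v : V) : R := japanese v ^+ 2 * (e^-1 * (1 - w v)).

Lemma cubicE (v : V) : cubic v = japanese v ^+ 3 * w v.
Proof. by rewrite /cubic /w; field; rewrite (lt0r_neq0 (den v)) (lt0r_neq0 e_gt0). Qed.

(** Gradient of <v>^3 w with w = 1/(1 + e <v>), simplified by e <v> w = 1 - w into a sum of
    nonnegative radial slopes; this gives bounds by [cubic] that do not depend on e. *)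
Definition dcubic (i : 'I_d) (v : V) : R := (japanese v * w v ^+ 2 + 2 * (japanese v * w v)) * v 0 i.

Let grad_J : has_grad (@japanese R d) (fun i v => (japanese v)^-1 * v 0 i).
Proof.
have h := has_gradD (has_grad_cst (1 : R)) (@has_grad_enorm_sqr R d).
have p (v : V) : 0 < 1 + enorm v ^+ 2 :> R by rewrite ltr_wpDr// sqr_ge0.
have [|dd ed cd] := @has_grad_comp R d Num.sqrt (fun x => (2 * Num.sqrt x)^-1) _ _ h (fun v => is_derive1_sqrt (p v)).
  apply: continuous_comp_at => [v|v]; first exact: (@has_grad_continuous _ _ _ _ h v).
  apply: cvgV; first by rewrite lt0r_neq0// mulr_gt0// sqrtr_gt0.
  by apply: cvgMr; exact: sqrt_continuous.
have E i (v : V) : (2 * Num.sqrt (1 + enorm v ^+ 2))^-1 * (0 + 2 * v 0 i) = (japanese v)^-1 * v 0 i.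
  by rewrite -/(japanese v); field; exact: lt0r_neq0 (japanese_gt0 v).
split=> [v|v u|i]; first exact: dd.
- by rewrite ed; apply: eq_bigr => i _; rewrite E.
- by rewrite (_ : (fun v => _) = (fun v => (2 * Num.sqrt (1 + enorm v ^+ 2))^-1 * (0 + 2 * v 0 i)));
    [exact: cd|apply/funext => v; rewrite E].
Qed.

Let grad_w : has_grad w (fun i v => - w v ^+ 2 * (e * ((japanese v)^-1 * v 0 i))).
Proof.
have h := has_gradD (has_grad_cst (1 : R)) (has_gradM (has_grad_cst e) grad_J).
have D (v : V) : is_derive (1 + e * japanese v) (1 : R) (fun x : R => x^-1) (- (1 + e * japanese v) ^- 2).
  have := @is_deriveV R id (1 + e * japanese v) 1 1 (lt0r_neq0 (den v)) (is_derive_id _ _).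
  by rewrite [_ *: _]mulr1.
have [|dd ed cd] := @has_grad_comp R d (fun x => x^-1) (fun x => - x ^- 2) _ _ h D.
  apply: continuous_comp_at => [v|v]; first exact: (@has_grad_continuous _ _ _ _ h v).
  apply: cvgN; apply: cvgV; first by rewrite expf_neq0// lt0r_neq0.
  exact: exprn_continuous.
have E i (v : V) : - (1 + e * japanese v) ^- 2 * (0 + (e * ((japanese v)^-1 * v 0 i) + japanese v * 0)) =
    - w v ^+ 2 * (e * ((japanese v)^-1 * v 0 i)).
  by rewrite /w exprVn mulr0 addr0 add0r.
split=> [v|v u|i]; first exact: dd.
- by rewrite ed; apply: eq_bigr => i _; rewrite E.
- by under eq_fun do rewrite -E; exact: cd.
Qed.

Lemma has_grad_cubic : has_grad cubic dcubic.
Proof.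
have h1 := has_gradM grad_J grad_J.
have h2 := has_gradM (has_grad_cst e^-1) (has_gradD (has_grad_cst (1 : R)) (has_gradM (has_grad_cst (-1)) grad_w)).
have [dd ed cd] := has_gradM h1 h2.
have F (v : V) : japanese v * japanese v * (e^-1 * (1 + -1 * w v)) = cubic v by rewrite /cubic; ring.
have wE (v : V) : e * japanese v * w v = 1 - w v by rewrite /w; field; exact: lt0r_neq0 (den v).
have E i (v : V) : dcubic i v = japanese v * japanese v * (e^-1 * (0 + (-1 * (- w v ^+ 2 * (e * ((japanese v)^-1 * v 0 i))) + w v * 0)) + (1 + -1 * w v) * 0) +
   e^-1 * (1 + -1 * w v) * (japanese v * ((japanese v)^-1 * v 0 i) + japanese v * ((japanese v)^-1 * v 0 i)).
  have -> : 1 + -1 * w v = e * japanese v * w v by rewrite wE; ring.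
  by rewrite /dcubic; field; rewrite (lt0r_neq0 e_gt0) (lt0r_neq0 (japanese_gt0 v)).
have FE : cubic = (fun v => japanese v * japanese v * (e^-1 * (1 + -1 * w v))) by apply/funext => v.
rewrite FE; split=> [v|v u|i]; first exact: dd.
- by rewrite ed; apply: eq_bigr => i _; rewrite E.
- by rewrite (funext (E i) : dcubic i = _); exact: cd.
Qed.

Lemma cubic_ge0 (v : V) : 0 <= cubic v.
Proof. by rewrite cubicE mulr_ge0 ?exprn_ge0 ?japanese_ge0// ltW. Qed.

Lemma cubic_le (v : V) : cubic v <= japanese v ^+ 3.
Proof. by rewrite cubicE ler_piMr ?exprn_ge0 ?japanese_ge0. Qed.

Let cubic_le2 (v : V) : cubic v <= e^-1 * japanese v ^+ 2.
Proof.
rewrite /cubic mulrC ler_wpM2r ?sqr_ge0// ler_piMr ?invr_ge0 ?(ltW e_gt0)//.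
by rewrite gerBl ltW.
Qed.

Let slope (v : V) : 0 <= japanese v * w v ^+ 2 + 2 * (japanese v * w v) <= 3 * (japanese v * w v).
Proof.
have j0 := japanese_ge0 v; have w0 := ltW (w_gt0 v).
have h0 : 0 <= japanese v * w v by rewrite mulr_ge0.
have h1 : japanese v * w v ^+ 2 <= japanese v * w v by rewrite expr2 mulrA ler_piMr.
have h2 : 0 <= japanese v * w v ^+ 2 by rewrite mulr_ge0// sqr_ge0.
by apply/andP; split; lra.
Qed.

Lemma dcubic_le i (v : V) : `|dcubic i v| <= 3 * cubic v.
Proof.
have /andP[s0 s1] := slope v; rewrite /dcubic normrM (ger0_norm s0) cubicE.
rewrite (_ : 3 * _ = 3 * (japanese v * w v) * japanese v ^+ 2); last by ring.
rewrite ler_pM//; have := coord_bound 1 i v; rewrite mul1r; exact.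
Qed.

Lemma euler_dcubic_le (v : V) : `|euler dcubic v| <= 3 * cubic v.
Proof.
have /andP[s0 s1] := slope v.
have -> : euler dcubic v = (japanese v * w v ^+ 2 + 2 * (japanese v * w v)) * enorm v ^+ 2.
  by rewrite /euler enorm_sqr mulr_sumr; apply: eq_bigr => i _; rewrite /dcubic; ring.
rewrite normrM (ger0_norm s0) (ger0_norm (sqr_ge0 _)) cubicE.
rewrite (_ : 3 * _ = 3 * (japanese v * w v) * japanese v ^+ 2); last by ring.
by rewrite ler_pM ?sqr_ge0// japanese_sqr lerDr.
Qed.

Lemma growth2_cubic : growth2 cubic dcubic (3 * e^-1).
Proof.
have b (v : V) x : x <= 3 * cubic v -> x <= 3 * e^-1 * japanese v ^+ 2.
  by move=> /le_trans; apply; rewrite -mulrA ler_wpM2l.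
split; first exact: has_grad_cubic.
- by move=> v; apply: b; rewrite (ger0_norm (cubic_ge0 v)); have := cubic_ge0 v; lra.
- by move=> v; apply: b; exact: euler_dcubic_le.
- by move=> i v; apply: b; exact: dcubic_le.
Qed.

(* Povzner's inequality: the post-collisional weights are bounded by the weight at the total
   energy, and [(X + Y) (X^2 (L - X) + Y^2 (L - Y)) <= 4 X^2 Y^2] when [L^2 = X^2 + Y^2]. *)
Lemma coll_cubic_le (h : V -> R) : in_L1 3 h -> (forall v, 0 <= h v) -> coll alpha h cubic <= 2 * (Nrm 2 h * Nrm 2 h).
Proof.
move=> h3 h0; have [_ b _ _] := growth2_cubic.
have mc := has_grad_measurable has_grad_cubic.
have mK := measurable_Kcoll alpha mc; have KC := Kcoll_bound alpha_gt0 alpha_lt1 mc b.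
rewrite /coll (bil_symm mK KC h3) -(bil_weight 2 (in_L1_le (isT : (2 <= 3)%N) h3) h0).
have mK' : measurable_fun setT (fun p : V * V => Kcoll alpha cubic (p.2, p.1)).
  exact: (measurableT_comp mK (@measurable_swap _ _ _ _)).
have mj : measurable_fun setT (fun p : V * V => 2 * (japanese p.1 ^+ 2 * japanese p.2 ^+ 2)).
  apply: measurable_funM => //; apply: measurable_funM.
    exact: (measurableT_comp (measurable_japaneseX 2) measurable_fst).
  exact: (measurableT_comp (measurable_japaneseX 2) measurable_snd).
apply: (@le_bil R d 3 (4 * (3 * e^-1)) 2 _ _ h _ mj _ _ h3 h0) => [|p|p|p].
- by apply: measurable_funM => //; exact: measurable_funD.
- have := KC p; have := KC (p.2, p.1); rewrite /= (mulrC (japanese p.2 ^+ 3)) => k1 k2.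
  rewrite normrM gtr0_norm//; have := ler_normD (Kcoll alpha cubic p) (Kcoll alpha cubic (p.2, p.1)).
  by move: k1 k2; move: (_ * (_ * _)) => B; lra.
- rewrite ger0_norm; last by rewrite mulr_ge0// mulr_ge0 ?sqr_ge0.
  by rewrite ler_pM2l// ler_pM ?sqr_ge0//; exact: japanese_exp_le.
case: p => v u; rewrite /= /Kcoll/= -(enormN (u - v)) opprB (avgC _ u v).
set X := japanese v; set Y := japanese u; set A := avg cubic (v, u).
have X0 : 0 < X := japanese_gt0 v; have Y0 : 0 < Y := japanese_gt0 u.
pose L := Num.sqrt (X ^+ 2 + Y ^+ 2).
have L2 : L ^+ 2 = X ^+ 2 + Y ^+ 2 by rewrite sqr_sqrtr// addr_ge0// sqr_ge0.
have L0 : 0 <= L by exact: sqrtr_ge0.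
have XL : X <= L by rewrite -(ler_pXn2r (isT : (0 < 2)%N)) ?nnegrE ?(ltW X0)// L2 lerDl sqr_ge0.
have YL : Y <= L by rewrite -(ler_pXn2r (isT : (0 < 2)%N)) ?nnegrE ?(ltW Y0)// L2 lerDr sqr_ge0.
(* The truncated weight is x^2 th(x) at x = <v>. [th] is nondecreasing and 1-Lipschitz, so th L - th
   X <= L - X and the parameter e disappears from the estimate. *)
pose th (x : R) := x / (1 + e * x).
have th_mono x y : 0 <= x -> x <= y -> th x <= th y /\ th y - th x <= y - x.
  move=> x0 xy; have y0 := le_trans x0 xy.
  have dx : 0 < 1 + e * x by rewrite ltr_wpDr// mulr_ge0// ltW.
  have dy : 0 < 1 + e * y by rewrite ltr_wpDr// mulr_ge0// ltW.
  have E : th y - th x = (y - x) * ((1 + e * x)^-1 * (1 + e * y)^-1).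
    by rewrite /th; field; rewrite (lt0r_neq0 dx) (lt0r_neq0 dy).
  have yx : 0 <= y - x by rewrite subr_ge0.
  rewrite -(subr_ge0 (th x)) E mulr_ge0 ?mulr_ge0 ?invr_ge0 ?(ltW dx) ?(ltW dy)//; split => //.
  by rewrite ler_piMr//; apply: mulr_ile1; rewrite ?invr_ge0 ?(ltW dx) ?(ltW dy) ?invf_le1// lerDl mulr_ge0// ltW.
have cE (z : V) : cubic z = japanese z ^+ 2 * th (japanese z) by rewrite cubicE /th /w; ring.
have Ab : A <= (X ^+ 2 + Y ^+ 2) * th L / 2.
  apply: (avg_le2 mc b) => s /=.
  have E := japanese_vpostD v u s; rewrite -/X -/Y in E.
  set z1 := vpost v u _ in E *; set z2 := vpost_star v u _ in E *.
  have zL (z : V) : japanese z ^+ 2 <= X ^+ 2 + Y ^+ 2 -> cubic z <= japanese z ^+ 2 * th L.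
    move=> hz; rewrite cE ler_wpM2l ?sqr_ge0//; apply: (th_mono _ _ (japanese_ge0 z) _).1.
    by rewrite -(ler_pXn2r (isT : (0 < 2)%N)) ?nnegrE ?japanese_ge0// L2.
  have s1 := sqr_ge0 (japanese z1); have s2 := sqr_ge0 (japanese z2).
  have thL : 0 <= th L by rewrite divr_ge0// addr_ge0// mulr_ge0// ltW.
  apply: (le_trans (lerD (zL z1 _) (zL z2 _))); [by lra|by lra|].
  by rewrite -mulrDl ler_wpM2r.
have A0 : 0 <= A by apply: Rint_ge0 => s; exact: cubic_ge0.
have A1 : (1 - alpha) * A <= A by rewrite ler_piMl// gerBl ltW.
rewrite !cE -/X -/Y; have D0 := enorm_ge0 (v - u).
have D1 : enorm (v - u) <= X + Y.
  by apply: (le_trans (enormB _ _)); apply: lerD; exact: enorm_le_japanese.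
have [_ tX] := th_mono X L (ltW X0) XL; have [_ tY] := th_mono Y L (ltW Y0) YL.
have hX : X ^+ 2 * (th L - th X) <= X ^+ 2 * (L - X) by rewrite ler_wpM2l ?sqr_ge0.
have hY : Y ^+ 2 * (th L - th Y) <= Y ^+ 2 * (L - Y) by rewrite ler_wpM2l ?sqr_ge0.
move: Ab A1 hX hY D0 D1; move: (th L) (th X) (th Y) (enorm (v - u)) => tl tx ty D Ab A1 hX hY D0 D1.
have P0 : 0 <= X ^+ 2 * (L - X) + Y ^+ 2 * (L - Y) by rewrite addr_ge0// mulr_ge0 ?sqr_ge0// subr_ge0.
apply: (@le_trans _ _ (2^-1 * (D * (X ^+ 2 * (L - X) + Y ^+ 2 * (L - Y))))).
  by rewrite -mulrDr ler_pM2l// ler_wpM2l//; lra.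
apply: (@le_trans _ _ (2^-1 * ((X + Y) * (X ^+ 2 * (L - X) + Y ^+ 2 * (L - Y))))).
  by rewrite ler_pM2l// ler_wpM2r.
(* As X, Y <= L, the left side is at most 2 L (L - X) <= 2 (L + X)(L - X) = 2 Y^2. *)
have gX : (X + Y) * (L - X) <= 2 * Y ^+ 2.
  have h1 : (X + Y) * (L - X) <= 2 * L * (L - X) by rewrite ler_wpM2r ?subr_ge0//; lra.
  by have : 0 <= X * (L - X) by [rewrite mulr_ge0 ?(ltW X0) ?subr_ge0]; nra.
have gY : (X + Y) * (L - Y) <= 2 * X ^+ 2.
  have h1 : (X + Y) * (L - Y) <= 2 * L * (L - Y) by rewrite ler_wpM2r ?subr_ge0//; lra.
  by have : 0 <= Y * (L - Y) by [rewrite mulr_ge0 ?(ltW Y0) ?subr_ge0]; nra.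
have := ler_wpM2l (sqr_ge0 X) gX; have := ler_wpM2l (sqr_ge0 Y) gY.
by move: (X ^+ 2) (Y ^+ 2) => x2 y2; lra.
Qed.

End povzner.

Section rescaled_solution.
Context {R : realType} {d : nat}.
Hypothesis d_gt0 : (0 < d)%N.
Local Notation V := 'rV[R]_d.
Local Notation leb := (@lebesgue_rV R d).
Local Notation mu := (@lebesgue_measure R).
Variable alpha : R.
Hypotheses (alpha_gt0 : 0 < alpha) (alpha_lt1 : alpha < 1).
Variables (g : R -> V -> R) (psi0 : V -> R).
Hypotheses (gs : rescaled_solution alpha psi0 g) (psi0_ge0 : forall v, 0 <= psi0 v)
  (psi03 : in_L1 3 psi0) (psi0_density : density psi0 = 1)
  (psi0_mom1 : forall i, mom1 i psi0 = 0) (psi0_mom2 : mom2 psi0 = d%:R / 2).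

Let sg : solution_class g := gs.1.
Let gc : curve g := solution_class_curve sg.
Let g_ge0 := curve_ge0 gc.
Let g2 t (t0 : 0 <= t) : in_L1 2 (g t) := curve_L12 gc t0.
Let psi02 := in_L1_le (isT : (2 <= 3)%N) psi03.
Let dn : d%:R != 0 :> R. Proof. by rewrite pnatr_eq0 -lt0n. Qed.

Let a := drift_a alpha g.
Let b := drift_b alpha g.
Let c := drift_c alpha g.

Lemma rescaled_same_tests : same_tests (g 0) psi0.
Proof. by move=> phi tphi; have [_] := (prim_intervals _ _ _).1 (gs.2 phi tphi). Qed.

Let moments0 := same_tests_moments (g2 (lexx 0)) psi02 rescaled_same_tests.

Let sa : scont a. Proof. by apply: scontM; [exact: scont_cst|exact: scont_q0]. Qed.
Let sc i : scont (c i). Proof. by apply: scontM; [exact: scont_cst|exact: scont_q1]. Qed.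

Let fin3_max t : fin3 g (Num.max t 0) = fin3 g t.
Proof. by rewrite /fin3 [Num.max (Num.max t 0) 0]max_l// le_max lexx orbT. Qed.

Let mb : measurable_fun setT (fun t : R => b (Num.max t 0)).
Proof.
apply: measurable_funM => //; apply: measurable_funB; first exact: (scont_measurable (scont_q0 gc)).
apply: measurable_funM => //; under eq_fun do rewrite fin3_max.
by apply: measurable_funM; [exact: measurable_fin3|exact: measurable_q2].
Qed.

(** The two right-hand sides coincide at almost every time; measurability of the one with [fin3]
    lets the integrand be replaced. *)
Lemma rescaled_drift_evolves : evolves alpha a b c g.
Proof.
move=> phi dphi r hg hr; have tphi : test_function phi by apply/test_functionP; exists dphi, r.
have [p _] := (prim_intervals _ _ _).1 (gs.2 phi tphi).
have [C [[_ b1 b2 b3] b0]] := test_growth2 hg hr.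
apply: prim_ae p.
  apply: measurable_funD; last first.
    exact: (scont_measurable (curve_coll alpha_gt0 alpha_lt1 gc (leqnSn _) (has_grad_measurable hg) b0)).
  apply: measurable_funB; last first.
    apply: measurable_sum => i; apply: measurable_funM; first exact: (scont_measurable (@sc i)).
    exact: (scont_measurable (curve_pair gc (has_grad_measurable_d i hg) (b3 i))).
  apply: measurable_funD; apply: measurable_funM => //.
  - exact: scont_measurable sa.
  - exact: (scont_measurable (curve_pair gc (has_grad_measurable hg) b1)).
  - exact: (scont_measurable (curve_pair gc (measurable_euler hg) b2)).
apply: (@filterS _ _ (ae_filter_ringOfSetsType mu) _ _ _ (solution_class_fin3 sg)) => t h t0; have t0' := ltW t0.
have h3 : in_L1 3 (g t).
  have := h t0; rewrite /fin3 max_l//; case: asboolP => // _ /eqP.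
  by rewrite eq_sym oner_eq0.
exact: (rescaled_rhsE d_gt0 alpha t0' h3 (g_ge0 t0') hg hr).
Qed.
Let ev := rescaled_drift_evolves.

Let q2_le (h : V -> R) : in_L1 3 h -> q2 h <= alpha^-1 * (8 * 1 * (Nrm 3 h * Nrm 1 h)).
Proof.
move=> h3; have := coll_bound3 alpha_gt0 alpha_lt1 h3 (@measurable_enorm_sqr R d) (@enorm_sqr_bound R d 0).
rewrite (coll_enorm_sqr d_gt0 alpha_gt0 alpha_lt1 h3) normrM normrN (gtr0_norm alpha_gt0) => H.
rewrite ler_pdivlMl//; apply: (le_trans _ H); rewrite ler_pM2l//; exact: ler_norm.
Qed.

Let li_b_away e y : 0 < e -> e <= y -> itg mu (fun t => ind e y t * b t).
Proof.
move=> e0 ey; have [N [N0 hN]] := curve_Nrm2_bounded gc y.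
have i3 := solution_class_itg3 sg e0 ey.
have i0 := li_scont (scont_q0 gc) (ltW e0) ey.
pose q t := (alpha / 2) * (ind e y t * q0 (g t) + 2 / d%:R * (alpha^-1 * (8 * N) *
   (ind e y t * (fin3 g t * Nrm 3 (g t))))).
have iq : itg mu q by apply: itgZ; apply: itgD => //; apply: itgZ; exact: itgZ.
apply: (itg_dom _ _ iq) => [|t].
  under eq_fun do rewrite (ind_max b y _ (ltW e0)).
  by apply: measurable_funM; [exact: measurable_ind|].
rewrite /q /ind; case: (boolP (e < t <= y)) => [/andP[et ty]|_]; last by rewrite !mul0r !mulr0 addr0 mulr0 normr0.
have t0 : 0 <= t by rewrite ltW// (lt_trans e0).
have a2 : 0 <= alpha / 2 by rewrite divr_ge0// ltW.
rewrite !mul1r /b /drift_b normrM normrN (ger0_norm a2).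
rewrite ler_wpM2l//.
apply: (le_trans (ler_normB _ _)); rewrite (ger0_norm (q0_ge0 (g_ge0 t0))) lerD2l normrM ger0_norm//.
rewrite ler_wpM2l// /fin3 max_l//; case: asboolP => h3; last by rewrite !mul0r mulr0 normr0.
rewrite !mul1r ger0_norm; last exact: q2_ge0 (g_ge0 t0).
apply: (le_trans (q2_le h3)); rewrite -!mulrA ler_wpM2l ?invr_ge0 ?(ltW alpha_gt0)// ler_wpM2l// mul1r mulrC.
rewrite ler_wpM2r ?Nrm_ge0//; apply: (le_trans (Nrm_le (isT : (1 <= 2)%N) (g2 t0))); exact: hN.
Qed.

(* Near time 0 the integrability of [b] is read off the equation, tested against a bump whose
   radial derivative has a nonzero integral against the initial datum. *)
Lemma li_drift_b : li b.
Proof.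
have [n hn] : exists n, 0 < \int[leb]_v (g 0 v * cutf (fun v => enorm v ^+ 2) n v).
  have lim : \int[leb]_v (g 0 v * cutf (fun v => enorm v ^+ 2) n v) @[n --> \oo] --> mom2 (g 0).
    have i := in_L1_pairC (g2 (lexx 0)) (@measurable_enorm_sqr R d) (@enorm_sqr_bound R d 0).
    apply: (Rint_dct _ _ (itg_norm i)) => [n|v|n v].
    - apply: measurable_funM; first exact: in_L1_meas (g2 (lexx 0)).
      exact: has_grad_measurable (has_grad_cutf n (@has_grad_enorm_sqr R d)).
    - by apply: cvgMr; exact: cutf_cvg.
    - by rewrite normrM [X in _ <= X]normrM ler_wpM2l// cutf_le.
  have m0 : 0 < mom2 (g 0) by have [_ _ ->] := moments0; rewrite psi0_mom2 divr_gt0// ltr0n.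
  have /cvgrPdist_lt /(_ _ m0) [n _ /(_ n (leqnn n))] := lim.
  by rewrite /= ltr_norml => /andP[_ h]; exists n; move: h; lra.
pose r : R := n.+1%:R; have r0 : 0 < r by rewrite ltr0n.
have hg := @has_grad_chi R d r.
have out (v : V) : r < enorm v -> chi r v = 0 by exact: chi_out.
have r2 : 0 < r ^+ 2 by rewrite exprn_gt0.
have me := measurable_euler hg.
have be (v : V) : `|euler (dchi r) v| <= 4 * japanese v ^+ 2.
  by rewrite (le_trans (euler_dchi_le _ _))// ler_peMr// japanese_exp_ge1.
pose k t := \int[leb]_v (g t v * euler (dchi r) v).
have sk : scont k by exact: (curve_pair gc me be).
have k0 : k 0 < 0.
  apply: (@le_lt_trans _ _ (- (4 / r ^+ 2) * \int[leb]_v (g 0 v * cutf (fun v => enorm v ^+ 2) n v))); last first.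
    by rewrite mulNr oppr_lt0 mulr_gt0// divr_gt0.
  have ic : itg leb (fun v => g 0 v * cutf (fun v => enorm v ^+ 2) n v).
    apply: (in_L1_pairC (g2 (lexx 0)) _ (C := 1)).
      exact: has_grad_measurable (has_grad_cutf n (@has_grad_enorm_sqr R d)).
    by move=> v; apply: (le_trans (cutf_le _ _ _)); exact: (@enorm_sqr_bound R d 0).
  rewrite -RintZ//; apply: le_Rint; [exact: (in_L1_pairC (g2 (lexx 0)) me be)|exact: itgZ|move=> v].
  rewrite mulrCA ler_wpM2l ?g_ge0// euler_dchi /cutf -/r /chi /pospart2.
  rewrite (_ : - (4 / r ^+ 2) * _ = - 4 * (Num.max (1 - enorm v ^+ 2 / r ^+ 2) 0 ^+ 2 * (enorm v ^+ 2 / r ^+ 2))); last by ring.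
  rewrite !mulNr lerN2 ler_pM2l// ler_wpM2r ?divr_ge0 ?sqr_ge0//.
  have q0 : 0 <= enorm v ^+ 2 / r ^+ 2 by rewrite divr_ge0 ?sqr_ge0.
  have z0 : 0 <= Num.max (1 - enorm v ^+ 2 / r ^+ 2) 0 by rewrite le_max lexx orbT.
  have z1 : Num.max (1 - enorm v ^+ 2 / r ^+ 2) 0 <= 1 by rewrite ge_max ler01 andbT gerBl.
  by rewrite expr2 ler_piMl.
(* In the equation tested against the cut-off, b k is the only term not already known to be
   integrable up to time 0; so it is, as the difference of integrable ones. *)
have lbk : li (fun t => b t * k t).
  have [l _] := ev hg out; have [C [[_ b1 b2 b3] b0]] := test_growth2 hg out.
  have l1 := li_scont (scontM sa (curve_pair gc (has_grad_measurable hg) b1)).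
  have l3 : li (fun t => \sum_i c i t * \int[leb]_v (g t v * dchi r i v)).
    by apply: li_sum => i; apply: li_scont; apply: scontM => //; exact: (curve_pair gc (has_grad_measurable_d i hg) (b3 i)).
  have l4 := li_scont (curve_coll alpha_gt0 alpha_lt1 gc (leqnSn _) (has_grad_measurable hg) b0).
  have := liD (liD (liD l (liZ (-1) l1)) l3) (liZ (-1) l4).
  by congr li; apply/funext => t; rewrite /lin_rhs /k; ring.
(* [k] is continuous and nonzero at time 0, so near 0 the integrability of b k gives that of [b];
   after time [e] the solution class suffices. *)
have [e [e0 [de [de0 hde]]]] : exists e, 0 < e /\ exists de, 0 < de /\ forall t, 0 <= t -> t <= e -> de <= `|k t|.
  have h : 0 < - k 0 / 2 by rewrite divr_gt0// oppr_gt0.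
  have := @scont_max _ k sk (0 : R); rewrite /continuous_at maxxx => /cvgrPdist_lt /(_ _ h) [e /= e0 he].
  exists (e / 2); split; first by rewrite divr_gt0.
  exists (- k 0 / 2); split => // t t0 te; have := he t.
  rewrite /ball/= sub0r normrN ger0_norm// max_l// => /(_ (le_lt_trans te _)).
  have e2 : e / 2 < e by move: e0; lra.
  move=> /(_ e2); rewrite ltr_norml => /andP[h1 h2]; have := ler_norm (- k t); rewrite normrN.
  by move: h1 h2; lra.
move=> x y x0 xy; have y0 := le_trans x0 xy.
have ey : e <= Num.max y e by rewrite le_max lexx orbT.
have i1 := itg_norm (lbk 0 y (lexx 0) y0); have i2 := itg_norm (li_b_away e0 ey).
apply: (itg_dom _ _ (itgD (itgZ de^-1 i1) i2)) => [|t].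
  under eq_fun do rewrite (ind_max b y _ x0).
  by apply: measurable_funM; [exact: measurable_ind|].
rewrite {1}/ind; case: (boolP (x < t <= y)) => [/andP[xt ty]|_]; last first.
  by rewrite mul0r normr0 addr_ge0// mulr_ge0// invr_ge0 ltW.
rewrite mul1r; have t0 : 0 <= t := le_trans x0 (ltW xt).
have [te|et] := leP t e.
  rewrite ler_wpDr// [X in `|X * (_ * _)|](_ : _ = 1); last by rewrite /ind (le_lt_trans x0 xt) ty.
  have -> : de^-1 * `|1 * (b t * k t)| = `|b t| * (de^-1 * `|k t|) by rewrite mul1r normrM mulrCA.
  by rewrite ler_peMr// ler_pdivlMl// mulr1 hde.
rewrite ler_wpDl//; first by rewrite mulr_ge0// invr_ge0 ltW.
by rewrite /ind et le_max ty/= mul1r.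
Qed.

Let la : li a := li_scont sa.
Let lb := li_drift_b.
Let lc i : li (c i) := li_scont (@sc i).

(** As a = alpha q0, the rate a n - alpha q0 equals a (n - 1): the deviation from 1 solves a linear
    homogeneous equation and starts at 0. *)
Lemma rescaled_density1 t : 0 <= t -> density (g t) = 1.
Proof.
move=> t0; have p := prim_density alpha_gt0 alpha_lt1 la lb lc gc ev.
have c1 : prim (fun _ : R => -1 : R) (fun _ : R => 0 : R) by exact: prim_cst.
have H s : 0 < s -> a s * density (g s) - alpha * q0 (g s) + 0 = a s * (density (g s) + -1).
  by move=> _; rewrite /a /drift_a; ring.
have := linear_ode (primD p c1) la H t0; have [-> _ _] := moments0.
by rewrite psi0_density subrr mul0r => /eqP; rewrite subr_eq0 => /eqP.
Qed.

Lemma rescaled_mom10 i t : 0 <= t -> mom1 i (g t) = 0.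
Proof.
move=> t0; have p := prim_mom1 alpha_gt0 alpha_lt1 la lb lc gc ev i.
have H s : 0 < s -> (a s + b s) * mom1 i (g s) - c i s * density (g s) - alpha * q1 i (g s) =
    (a s + b s) * mom1 i (g s).
  by move=> s0; rewrite rescaled_density1 ?(ltW s0)// /c /drift_c; ring.
by rewrite (linear_ode p (liD la lb) H t0); have [_ -> _] := moments0; rewrite psi0_mom1 mul0r.
Qed.

Lemma rescaled_li_fin3_q2 : li (fun t => fin3 g t * q2 (g t)).
Proof.
have l0 := li_scont (scont_q0 gc).
have := liZ (d%:R / 2) (liD l0 (liZ (2 / alpha) lb)).
by congr li; apply/funext => t; rewrite /b /drift_b; field; rewrite dn lt0r_neq0.
Qed.

Lemma rescaled_li_fin3_Nrm3 : li (fun t => fin3 g t * Nrm 3 (g t)).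
Proof. by apply: (li_fin3_Nrm3 gc) rescaled_li_fin3_q2 => t t0; rewrite rescaled_density1. Qed.

(** With vanishing momentum and a + 2 b = (2 alpha / d) q2, the rate is (2 alpha / d) q2 times the
    deviation of the energy from d/2. *)
Lemma rescaled_mom2E t : 0 <= t -> mom2 (g t) = d%:R / 2.
Proof.
move=> t0; have lk := liZ (2 * alpha / d%:R) rescaled_li_fin3_q2.
pose rhs t := (a t + 2 * b t) * mom2 (g t) - 2 * (\sum_i c i t * mom1 i (g t)) - fin3 g t * (alpha * q2 (g t)).
have H x y : 0 <= x -> x <= y -> itg mu (fun t => ind x y t * rhs t) /\ mom2 (g y) - mom2 (g x) = Int x y rhs.
  move=> x0 xy; exact: (mom2_increment d_gt0 alpha_gt0 alpha_lt1 la lb lc gc ev x0 xy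
    (solution_class_fin3 sg) (rescaled_li_fin3_Nrm3 x0 xy)).
have p : prim (fun t => mom2 (g t)) rhs by split => x y x0 xy; have [] := H x y x0 xy.
have c1 : prim (fun _ : R => - (d%:R / 2) : R) (fun _ : R => 0 : R) by exact: prim_cst.
have E s : 0 < s -> rhs s + 0 = 2 * alpha / d%:R * (fin3 g s * q2 (g s)) * (mom2 (g s) + - (d%:R / 2)).
  move=> s0; rewrite /rhs big1 => [|i _]; last by rewrite rescaled_mom10 ?mulr0// ltW.
  by rewrite /a /b /drift_a /drift_b; field.
have := linear_ode (primD p c1) lk E t0; have [_ _ ->] := moments0.
by rewrite psi0_mom2 subrr mul0r => /eqP; rewrite subr_eq0 => /eqP.
Qed.

(** The truncated cubic moment obeys a Gronwall inequality with constants independent of the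
    truncation, Povzner's bound being used only at the times where the third moment is finite. The
    integrated bound holds at every time, and Fatou's lemma removes the truncation at T. *)
Lemma rescaled_third_moment T : 0 <= T -> in_L1 3 (g T).
Proof.
move=> T0; pose k t := `|a t| + 3 * `|b t| + 3 * \sum_i `|c i t|.
have lk : li k.
  apply: liD; first by apply: liD; [exact: li_norm|apply: liZ; exact: li_norm].
  by apply: liZ; apply: (@li_sum _ _ _ (fun i t => `|c i t|)) => i; exact: li_norm.
pose N : R := 1 + d%:R / 2.
have N2 t : 0 <= t -> Nrm 2 (g t) = N.
  move=> t0; rewrite /N -(rescaled_mom2E t0) -(rescaled_density1 t0) /density /mom2 -RintD.
  - by apply: eq_Rint => v; rewrite ger0_norm ?g_ge0// japanese_sqr; ring.
  - exact: in_L1_itg1 (g2 t0).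
  - exact: (in_L1_pairC (g2 t0) (@measurable_enorm_sqr R d) (@enorm_sqr_bound R d 0)).
pose B := expR (Int 0 T k) * (Nrm 3 psi0 + 2 * (N * N) * T).
have bound (e : R) : 0 < e -> \int[leb]_v (g T v * cubic e v) <= B.
  move=> e0; have gr := @growth2_cubic R d e e0; have [hg b1 b2 b3] := gr.
  pose rhs t := lin_rhs a b c g (cubic e) (dcubic e) t + fin3 g t * coll alpha (g t) (cubic e).
  have p : prim (fun t => \int[leb]_v (g t v * cubic e v)) rhs.
    by split=> x y x0 xy; have [] := evolves_quadratic alpha_gt0 alpha_lt1 la lb lc gc ev gr x0 xy
      (solution_class_fin3 sg) (rescaled_li_fin3_Nrm3 x0 xy).
  have k0 s : 0 <= k s by rewrite !addr_ge0 ?mulr_ge0// sumr_ge0.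
  have C0 : 0 <= 2 * (N * N) by rewrite mulr_ge0// -expr2 sqr_ge0.
  have H s : 0 < s -> rhs s <= k s * (\int[leb]_v (g s v * cubic e v)) + 2 * (N * N).
    move=> s0; have s0' := ltW s0.
    have iF := in_L1_pairC (g2 s0') (has_grad_measurable hg) b1.
    set F := \int[leb]_v (g s v * cubic e v).
    have F0 : 0 <= F by apply: Rint_ge0 => v; rewrite mulr_ge0 ?g_ge0 ?cubic_ge0.
    have le3 (z : V -> R) : measurable_fun setT z -> (forall v, `|z v| <= 3 * e^-1 * japanese v ^+ 2) ->
        (forall v, `|z v| <= 3 * cubic e v) -> `|\int[leb]_v (g s v * z v)| <= 3 * F.
      move=> mz z1 z3; rewrite -(RintZ 3 iF); apply: norm_Rint_le; [exact: (in_L1_pairC (g2 s0') mz z1)|exact: itgZ|move=> v].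
      by rewrite normrM (ger0_norm (g_ge0 s0' v)) mulrCA ler_wpM2l ?g_ge0.
    have eu := le3 _ (measurable_euler hg) b2 (euler_dcubic_le e0).
    have ed i := le3 _ (has_grad_measurable_d i hg) (b3 i) (dcubic_le e0 i).
    have cl : fin3 g s * coll alpha (g s) (cubic e) <= 2 * (N * N).
      rewrite /fin3 max_l//; case: asboolP => h3; rewrite ?mul0r// mul1r -(N2 s s0').
      exact: (coll_cubic_le alpha_gt0 alpha_lt1 e0 h3 (g_ge0 s0')).
    have li : lin_rhs a b c g (cubic e) (dcubic e) s <= k s * F.
      have -> : k s * F = `|a s| * F + `|b s| * (3 * F) + (\sum_i `|c i s|) * (3 * F) by rewrite /k; ring.
      rewrite /lin_rhs -/F lerD//; first rewrite lerD//.
      - by rewrite ler_wpM2r// ler_norm.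
      - apply: (le_trans (ler_norm _)); by rewrite normrM ler_wpM2l.
      - apply: (le_trans (ler_norm _)); rewrite normrN; apply: (le_trans (ler_norm_sum _ _ _)).
        by rewrite mulr_suml; apply: ler_sum => i _; rewrite normrM ler_wpM2l.
    by rewrite /rhs lerD.
  apply: (le_trans (gronwall p lk C0 T0 k0 H)); rewrite /B ler_wpM2l ?expR_ge0// lerD2r.
  rewrite (same_tests_growth (g2 (lexx 0)) psi02 rescaled_same_tests gr); apply: le_Rint => [||v].
  - exact: (in_L1_pairC psi02 (has_grad_measurable hg) b1).
  - exact: in_L1_itg.
  - by rewrite ger0_norm// ler_wpM2l// cubic_le.
have gm := in_L1_meas (g2 T0).
apply/in_L1P; split => //; pose phi n v := g T v * cubic n.+1%:R^-1 v.
have en (n : nat) : 0 < n.+1%:R^-1 :> R by rewrite invr_gt0 ltr0n.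
have gr n := @growth2_cubic R d n.+1%:R^-1 (en n).
have iphi n : itg leb (phi n) by have [hg b1 _ _] := gr n; exact: (in_L1_pairC (g2 T0) (has_grad_measurable hg) b1).
have cv v : (phi n v)%:E @[n --> \oo] --> (`|g T v| * japanese v ^+ 3)%:E.
  apply: cvg_EFin; first exact: nearW.
  rewrite ger0_norm ?g_ge0//; apply: cvgMr.
  apply: (@cvg_ext _ _ (fun n : nat => japanese v ^+ 3 * (1 + n.+1%:R^-1 * japanese v)^-1)) => [n|]; first by rewrite cubicE.
  rewrite -[X in _ --> X]mulr1; apply: cvgMr; rewrite -[X in _ --> X]invr1; apply: cvgV; first exact: oner_neq0.
  rewrite -[X in _ --> X]addr0; apply: cvgD; first exact: cvg_cst.
  by rewrite -(mul0r (japanese v)); apply: cvgMl; exact: cvg_harmonic.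
apply: itg_ge0_fin => [|v|].
- by apply: measurable_funM; [exact: measurableT_comp|exact: measurable_japaneseX].
- by rewrite mulr_ge0// exprn_ge0// japanese_ge0.
apply: (@le_lt_trans _ _ B%:E); last exact: ltry.
rewrite (_ : (\int[leb]_v _)%E = (\int[leb]_v limn_einf (fun n => (phi n v)%:E))%E); last first.
  apply: eq_integral => v _; apply/esym; rewrite is_cvg_limn_einfE; last by apply/cvg_ex; eexists; exact: cv.
  by apply/cvg_lim => //; exact: cv.
apply: (le_trans (fatou _ _ _ _)) => //.
- by move=> n; apply/measurable_EFinP; exact: itg_meas (iphi n).
- by move=> n v _; rewrite lee_fin mulr_ge0 ?g_ge0 ?cubic_ge0.
rewrite limn_einf_lim; apply: lime_le; first exact: is_cvg_einfs.
apply: nearW => n; apply: (@le_trans _ _ (\int[leb]_v (phi n v)%:E)%E); first by apply: ge_ereal_inf; exists (\int[leb]_v (phi n v)%:E)%E => //; exists n => /=.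
by rewrite -(EFin_Rintegral (iphi n)) lee_fin bound.
Qed.

End rescaled_solution.

(** * Uniqueness for the rescaled equation *)

Section rescaled_datum.
Context {R : realType} {d : nat}.
Hypothesis d_gt0 : (0 < d)%N.
Local Notation V := 'rV[R]_d.
Variable f0 : V -> R.
Hypotheses (f0_ge0 : forall v, 0 <= f0 v) (f03 : in_L1 3 f0) (n_gt0 : 0 < density f0).

Let n := density f0.
Let u := bulk_velocity f0.
Let s := Num.sqrt (2 * temperature f0).
Let T_gt0 : 0 < temperature f0.
Proof. exact: (temperature_gt0 d_gt0 f0_ge0 (in_L1_le (isT : (2 <= 3)%N) f03) n_gt0). Qed.
Let T2_gt0 : 0 < 2 * temperature f0. Proof. by rewrite mulr_gt0. Qed.
Let s_gt0 : 0 < s. Proof. by rewrite sqrtr_gt0. Qed.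
Let sV_gt0 : 0 < s^-1. Proof. by rewrite invr_gt0. Qed.
Let s2 : s ^+ 2 = 2 * temperature f0. Proof. by rewrite sqr_sqrtr// ltW. Qed.
Let w : V := - (s^-1 *: u).

Lemma rescaled_datumE : rescaled_datum f0 = affpush n^-1 s^-1 w f0.
Proof.
apply/funext => xi; rewrite /rescaled_datum /affpush -/s -/u -/n (affVV _ (lt0r_neq0 s_gt0)) mulrC (mulrC (n^-1)).
rewrite mulrC exprVn invrK; congr (_ * _ * _).
by rewrite /s -powR12_sqrt ?(ltW T2_gt0)// -powR_mulrn ?powR_ge0// -powRrM [2^-1 * _]mulrC.
Qed.

Lemma affpush_rescaled_datum : affpush n s u (rescaled_datum f0) = f0.
Proof.
apply/funext => v; rewrite rescaled_datumE /affpush (affVV _ (lt0r_neq0 s_gt0)) affVK ?lt0r_neq0//.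
rewrite exprVn invrK; move: (expf_neq0 d (lt0r_neq0 s_gt0)).
by move: (s ^+ d) => z z0; field; rewrite z0 (lt0r_neq0 n_gt0).
Qed.

Lemma rescaled_datum_ge0 xi : 0 <= rescaled_datum f0 xi.
Proof. by rewrite rescaled_datumE affpush_ge0// invr_ge0 ltW. Qed.

Lemma rescaled_datum_L1 : in_L1 3 (rescaled_datum f0).
Proof. by rewrite rescaled_datumE; exact: affpush_in_L1. Qed.

Lemma density_rescaled_datum : density (rescaled_datum f0) = 1.
Proof.
rewrite rescaled_datumE (density_affpush _ _ sV_gt0 (in_L1_le (isT : (0 <= 3)%N) f03)) mulVf//.
exact: lt0r_neq0 n_gt0.
Qed.

Let uE i : u 0 i = n^-1 * mom1 i f0. Proof. by rewrite /u /bulk_velocity !mxE. Qed.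
Let wE i : w 0 i = - (s^-1 * (n^-1 * mom1 i f0)).
Proof. by rewrite -uE mxE [(s^-1 *: u) 0 i]mxE. Qed.

Lemma mom1_rescaled_datum i : mom1 i (rescaled_datum f0) = 0.
Proof.
rewrite rescaled_datumE (mom1_affpush _ _ sV_gt0 i (in_L1_le (isT : (1 <= 3)%N) f03)) -/n.
by rewrite wE; field; rewrite (lt0r_neq0 s_gt0) (lt0r_neq0 n_gt0).
Qed.

Lemma mom2_rescaled_datum : mom2 (rescaled_datum f0) = d%:R / 2.
Proof.
have h2 := in_L1_le (isT : (2 <= 3)%N) f03.
have nn : n != 0 := lt0r_neq0 n_gt0; have sn := lt0r_neq0 s_gt0; have Tn := lt0r_neq0 T_gt0.
have E := temperatureE d_gt0 h2 n_gt0; rewrite -/n in E.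
rewrite rescaled_datumE (mom2_affpush _ _ sV_gt0 h2) -/n.
pose P := \sum_i mom1 i f0 ^+ 2.
have -> : \sum_i w 0 i * mom1 i f0 = - (s^-1 * n^-1 * P).
  by rewrite mulr_sumr -sumrN; apply: eq_bigr => i _; rewrite wE; ring.
have -> : enorm w ^+ 2 = s^-1 ^+ 2 * n^-1 ^+ 2 * P.
  by rewrite enorm_sqr mulr_sumr; apply: eq_bigr => i _; rewrite wE; ring.
have -> : n^-1 * (s^-1 ^+ 2 * mom2 f0 + (2 * s^-1 * - (s^-1 * n^-1 * P) + s^-1 ^+ 2 * n^-1 ^+ 2 * P * n)) =
    n^-1 * s^-1 ^+ 2 * (mom2 f0 - P / n) by field; rewrite nn sn.
rewrite -E exprVn s2; field; by rewrite nn Tn.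
Qed.

End rescaled_datum.

Section almost_everywhere.
Context {R : realType} {d : nat}.
Local Notation V := 'rV[R]_d.
Local Notation leb := (@lebesgue_rV R d).

Lemma ae_eq_velocity_moments (h k : V -> R) : measurable_fun setT h -> measurable_fun setT k ->
  {ae leb, forall v, h v = k v} ->
  [/\ density h = density k, bulk_velocity h = bulk_velocity k & temperature h = temperature k].
Proof.
move=> mh mk hk.
have E (phi : V -> R) : measurable_fun setT phi -> \int[leb]_v (h v * phi v) = \int[leb]_v (k v * phi v).
  move=> mphi; apply: ae_eq_Rint; [exact: measurable_funM|exact: measurable_funM|].
  by apply: filterS hk => v ->.
have D : density h = density k by rewrite !densityE; exact: E.
have B : bulk_velocity h = bulk_velocity k.
  rewrite /bulk_velocity D; congr (_ *: _); apply/rowP => i; rewrite !mxE.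
  exact: (E _ (measurable_coord i)).
split; [exact: D|exact: B|].
by rewrite /temperature D B; congr (_ * _); exact: (E _ (measurable_distX _)).
Qed.

Lemma ae_eq_rescaled_time (h k : R -> V -> R) t :
  (forall s, 0 <= s -> measurable_fun setT (h s)) -> (forall s, 0 <= s -> measurable_fun setT (k s)) ->
  (forall s, 0 <= s -> {ae leb, forall v, h s v = k s v}) -> rescaled_time h t = rescaled_time k t.
Proof.
move=> mh mk hk; rewrite /rescaled_time.
have cM (x y z : R) : y = z -> x * y = x * z by move=> ->.
apply: cM; apply: eq_Rintegral => s; rewrite inE/= in_itv/= => /andP[s0 _].
by have [-> _ ->] := ae_eq_velocity_moments (mh s s0) (mk s s0) (hk s s0).
Qed.

(** Invertible affine maps do not create null sets: the integral of |g - k| is, up to the factor m,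
    that of its transport, which vanishes. *)
Lemma affpush_ae m s u (g k : V -> R) : m != 0 -> 0 < s -> in_L1 0 g -> in_L1 0 k ->
  {ae leb, forall v, affpush m s u g v = affpush m s u k v} -> {ae leb, forall v, g v = k v}.
Proof.
move=> m0 s0 g0 k0 H; pose r v : R := `|(g \- k) v|.
have r1 : in_L1 0 r.
  have [mk fk] := in_L1B g0 k0; split; first exact: (measurableT_comp (@normr_measurable R setT) mk).
  by rewrite /L1norm; under eq_integral do rewrite normr_id.
have ir : itg leb (fun w => r w * 1) by under eq_fun do rewrite mulr1; exact: in_L1_itg1 r1.
have mF : measurable_fun setT (fun y => affpush m s u r y * 1).
  by under eq_fun do rewrite mulr1; exact: in_L1_meas (affpush_in_L1 m u s0 r1).
have z0 : m * s ^- d != 0 by rewrite mulf_neq0 ?invr_eq0 ?expf_neq0// lt0r_neq0.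
have F0 : {ae leb, forall v, affpush m s u r v * 1 = 0}.
  apply: filterS H => v /(mulfI z0) E; rewrite /affpush /r mulr1.
  have e : (g \- k) (affV s u v) = 0 by apply/eqP; rewrite subr_eq0; apply/eqP; exact: E.
  by rewrite e normr0 mulr0.
have Z : \int[leb]_v (r v * 1) = 0.
  have := Rint_affpush m (u := u) (k := fun=> 1) s0 ir.
  rewrite (ae_eq_Rint mF (measurable_cst (0 : R)) F0) (Rint_zero leb).
  by move/esym/eqP; rewrite mulf_eq0 (negbTE m0) => /eqP.
have r_ge0 w : 0 <= r w * 1 by rewrite mulr1 normr_ge0.
apply: filterS (ge0_Rint_eq0 ir r_ge0 Z) => v; rewrite mulr1 /r => /eqP.
by rewrite normr_eq0 subr_eq0 => /eqP.
Qed.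

(** The parameters of the rescaling are integrals, hence the same for [f t] and [h]; so both are
    images of [psi] and [g] under the same affine map, which can be undone almost everywhere. *)
Lemma rescaling_ae (f psi : R -> V -> R) (h g : V -> R) t (m s : R) (u : V) : rescaling_of f psi -> 0 <= t ->
  measurable_fun setT (f t) -> measurable_fun setT h -> {ae leb, forall v, f t v = h v} ->
  m != 0 -> 0 < s -> density h = m -> 2 * temperature h = s ^+ 2 -> bulk_velocity h = u ->
  h = affpush m s u g -> in_L1 0 g -> in_L1 0 (psi (rescaled_time f t)) ->
  {ae leb, forall v, g v = psi (rescaled_time f t) v}.
Proof.
move=> rf t0 mf mh fh m0 s0 hm hs hu hE g0 psi0; have s_neq0 := lt0r_neq0 s0.
have [Ed Eb Et] := ae_eq_velocity_moments mf mh fh.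
have pE : (s ^+ 2) `^ (- (d%:R / 2)) = s ^- d.
  rewrite -(powR_mulrn d (ltW s0)) -powRN -(powR_mulrn 2 (ltW s0)) -powRrM.
  have e : 2%:R * - (d%:R / 2) = - d%:R :> R by field.
  by rewrite e.
have fE : f t = affpush m s u (psi (rescaled_time f t)).
  apply/funext => v; rewrite (rf t t0 v) Ed Eb Et hm hs hu sqrtr_sqr (gtr0_norm s0) pE; exact: erefl.
apply: (affpush_ae m0 s0 g0 psi0); apply: filterS fh => v e.
exact: (etrans (esym (congr1 (fun F => F v) hE)) (etrans (esym e) (congr1 (fun F => F v) fE))).
Qed.

End almost_everywhere.

Section uniqueness.
Context {R : realType} {d : nat}.
Hypothesis d_gt0 : (0 < d)%N.
Local Notation V := 'rV[R]_d.
Local Notation leb := (@lebesgue_rV R d).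
Variable alpha : R.
Hypotheses (alpha_gt0 : 0 < alpha) (alpha_lt1 : alpha < 1).
Variables (f0 : V -> R) (g : R -> V -> R).
Hypotheses (f0_ge0 : forall v, 0 <= f0 v) (f03 : in_L1 3 f0) (n_gt0 : 0 < density f0)
  (gs : rescaled_solution alpha (rescaled_datum f0) g).

Let psi0_ge0 := rescaled_datum_ge0 d_gt0 f0_ge0 f03 n_gt0.
Let psi03 := rescaled_datum_L1 d_gt0 f0_ge0 f03 n_gt0.
Let psi0_density := density_rescaled_datum d_gt0 f0_ge0 f03 n_gt0.
Let psi0_mom1 := mom1_rescaled_datum d_gt0 f0_ge0 f03 n_gt0.
Let psi0_mom2 := mom2_rescaled_datum d_gt0 f0_ge0 f03 n_gt0.

Let gc : curve g := solution_class_curve gs.1.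
Let g_ge0 := curve_ge0 gc.
Let g3 (t : R) (t0 : 0 <= t) : in_L1 3 (g t) :=
  rescaled_third_moment d_gt0 alpha_gt0 alpha_lt1 gs psi0_ge0 psi03 psi0_density psi0_mom1 psi0_mom2 t0.
Let g2 (t : R) (t0 : 0 <= t) : in_L1 2 (g t) := curve_L12 gc t0.
Let g_density (t : R) (t0 : 0 <= t) : density (g t) = 1 :=
  rescaled_density1 d_gt0 alpha_gt0 alpha_lt1 gs psi03 psi0_density psi0_mom2 t0.
Let g_mom1 i (t : R) (t0 : 0 <= t) : mom1 i (g t) = 0 :=
  rescaled_mom10 d_gt0 alpha_gt0 alpha_lt1 gs psi03 psi0_density psi0_mom1 psi0_mom2 i t0.
Let g_mom2 (t : R) (t0 : 0 <= t) : mom2 (g t) = d%:R / 2 :=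
  rescaled_mom2E d_gt0 alpha_gt0 alpha_lt1 gs psi03 psi0_density psi0_mom1 psi0_mom2 t0.

Let a := drift_a alpha g.
Let b := drift_b alpha g.
Let c := drift_c alpha g.
Let ev : evolves alpha a b c g := rescaled_drift_evolves d_gt0 alpha_gt0 alpha_lt1 gs.
Let la : li a. Proof. by apply: liZ; apply: li_scont; exact: scont_q0. Qed.
Let lb : li b := li_drift_b d_gt0 alpha_gt0 alpha_lt1 gs psi03 psi0_mom2.
Let lc i : li (c i). Proof. by apply: liZ; apply: li_scont; exact: scont_q1. Qed.

Let lq2 : li (fun t => q2 (g t)).
Proof.
apply: li_ext (rescaled_li_fin3_q2 d_gt0 alpha_gt0 alpha_lt1 gs psi03 psi0_mom2) => t t0.
by rewrite /fin3 max_l ?(ltW t0)// asboolT ?mul1r//; exact: g3 (ltW t0).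
Qed.

Let n0 := density f0.
Let T0 := temperature f0.
Let s0 := Num.sqrt (2 * T0).
Let u0 := bulk_velocity f0.
Let T0_gt0 : 0 < T0.
Proof. exact: (temperature_gt0 d_gt0 f0_ge0 (in_L1_le (isT : (2 <= 3)%N) f03) n_gt0). Qed.
Let s0_gt0 : 0 < s0. Proof. by rewrite sqrtr_gt0 mulr_gt0. Qed.

(** Chosen so that all transformed drift coefficients vanish: the logarithmic derivatives of M and
    sg are -a and -b, and p moves at speed c sg. The initial values undo the rescaling of [f0]. *)
Let M t : R := n0 * expR (Int 0 t (fun t => -1 * a t)).
Let dM t : R := n0 * (expR (Int 0 t (fun t => -1 * a t)) * (-1 * a t)).
Let sg t : R := s0 * expR (Int 0 t (fun t => -1 * b t)).
Let dsg t : R := s0 * (expR (Int 0 t (fun t => -1 * b t)) * (-1 * b t)).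
Let p i t : R := u0 0 i + Int 0 t (fun t => c i t * sg t).
Let dp i t : R := 0 + c i t * sg t.

Let pM : prim M dM. Proof. exact: (primZ n0 (prim_exp (prim_Int (liZ (-1) la)))). Qed.
Let psg : prim sg dsg. Proof. exact: (primZ s0 (prim_exp (prim_Int (liZ (-1) lb)))). Qed.
Let pp i : prim (p i) (dp i).
Proof. exact: (primD (prim_cst (u0 0 i)) (prim_Int (liM (lc i) (prim_scont psg)))). Qed.
Let M_gt0 t : 0 <= t -> 0 < M t. Proof. by move=> _; rewrite mulr_gt0 ?expR_gt0. Qed.
Let sg_gt0 t : 0 <= t -> 0 < sg t. Proof. by move=> _; rewrite mulr_gt0 ?expR_gt0. Qed.

Let kappa t : R := (M t * sg t)^-1.
Local Notation S := (inv_clock kappa).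

(* [M sg^2] is, up to a constant, the thermal energy of the transformed solution: it decreases. *)
Let M_sg_le t : 0 <= t -> M t * sg t <= n0 * s0.
Proof.
move=> t0; have lx := lexx (0 : R).
have q0_ge (s : R) : 0 < s -> 0 <= q0 (g s) by move=> h; apply: q0_ge0; exact: g_ge0 (ltW h).
(* The exponent of M sg is -(A + B), with A and B the integrals of a and b; A + B is half the sum of
   A and A + 2 B, both nonnegative. *)
have A : 0 <= Int 0 t a by apply: Int_ge0 => s h _; rewrite mulr_ge0 ?(ltW alpha_gt0) ?q0_ge.
have B : 0 <= Int 0 t a + 2 * Int 0 t b.
  rewrite -(IntZ 2 lx t0 lb) -(IntD lx t0 la (liZ 2 lb)); apply: Int_ge0 => s h _.
  rewrite /a /b /drift_a /drift_b (_ : _ + _ = alpha * (2 / d%:R * (fin3 g s * q2 (g s)))); last by field; rewrite pnatr_eq0 -lt0n.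
  have /andP[f1 _] := fin3_01 g s; have q := q2_ge0 (g_ge0 (ltW h)).
  by apply: mulr_ge0; [exact: ltW|apply: mulr_ge0; [exact: divr_ge0|exact: mulr_ge0]].
rewrite /M /sg (IntZ (-1) lx t0 la) (IntZ (-1) lx t0 lb) mulrACA -expRD ler_piMr ?mulr_ge0 ?(ltW n_gt0) ?(ltW s0_gt0)//.
by rewrite -[X in _ <= X](expR0 R) ler_expR; lra.
Qed.

Let kappa_gt0 t : 0 <= t -> 0 < kappa t.
Proof. by move=> t0; rewrite invr_gt0 mulr_gt0 ?M_gt0 ?sg_gt0. Qed.

Let skappa : scont kappa.
Proof.
apply: scontV => [t t0|]; first by rewrite lt0r_neq0// mulr_gt0 ?M_gt0 ?sg_gt0.
by apply: scontM; [exact: (prim_scont pM)|exact: (prim_scont psg)].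
Qed.

Let clock_oo K : exists2 t, 0 <= t & K <= Int 0 t kappa.
Proof.
have c0 : 0 < n0 * s0 by rewrite mulr_gt0.
exists (Num.max K 0 * (n0 * s0)); first by rewrite mulr_ge0 ?(ltW c0)// le_max lexx orbT.
set t := _ * (n0 * s0); have t0 : 0 <= t by rewrite mulr_ge0 ?(ltW c0)// le_max lexx orbT.
have : Int 0 t (fun _ : R => (n0 * s0)^-1 : R) <= Int 0 t kappa.
  apply: le_Int => //; [by apply: li_scont; exact: scont_cst|exact: li_scont|move=> s /ltW h _].
  by rewrite lef_pV2 ?posrE ?M_sg_le// mulr_gt0 ?M_gt0 ?sg_gt0.
apply: le_trans; rewrite Int_cst// subr0 /t mulrC mulfK ?lt0r_neq0//.
by rewrite le_max lexx.
Qed.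

Let h : R -> V -> R := transformed g M sg p.
Let S0 s : 0 <= s -> 0 <= S s. Proof. exact: inv_clock_ge0. Qed.

Let h_curve : curve h.
Proof. exact: (transformed_curve gc pM psg pp M_gt0 sg_gt0 clock_oo). Qed.

Let h_L13 s : 0 <= s -> in_L1 3 (h s).
Proof.
by move=> s_ge0; apply: (transformed_in_L1 p pM psg M_gt0 sg_gt0 clock_oo s_ge0); apply: g3; exact: S0.
Qed.

Let M_neq0 t : M t != 0. Proof. by rewrite lt0r_neq0// mulr_gt0 ?expR_gt0. Qed.
Let sg_neq0 t : sg t != 0. Proof. by rewrite lt0r_neq0// mulr_gt0 ?expR_gt0. Qed.

Let h_evolves : evolves alpha (fun=> 0) (fun=> 0) (fun _ _ => 0) h.
Proof.
have E := transformed_evolves alpha_gt0 alpha_lt1 la lb lc gc ev pM psg pp M_gt0 sg_gt0 clock_oo.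
have RM t : dM t / M t = - a t.
  by rewrite /dM mulrA -/(M t) mulN1r mulrN mulNr mulrC mulKf.
have Rs t : dsg t / sg t = - b t.
  by rewrite /dsg mulrA -/(sg t) mulN1r mulrN mulNr mulrC mulKf.
have Ea : transformed_a a M dM sg = (fun=> 0).
  by apply/funext => s; rewrite /transformed_a RM addNr mul0r.
have Eb : transformed_b b M sg dsg = (fun=> 0).
  by apply/funext => s; rewrite /transformed_b Rs subrr mul0r.
have Ec : transformed_c b c M sg dsg p dp = (fun _ _ => 0).
  apply/funext => i; apply/funext => s; rewrite /transformed_c Rs subrr mul0r add0r /dp add0r.
  by rewrite (mulrC (sg _)) subrr mul0r.
by rewrite Ea Eb Ec in E.
Qed.

Let h_density s : 0 <= s -> density (h s) = M (S s).
Proof.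
move=> s_ge0; rewrite (density_affpush _ _ (sg_gt0 (S0 s_ge0)) (in_L1_le (isT : (0 <= 2)%N) (g2 (S0 s_ge0)))).
by rewrite g_density ?mulr1//; exact: S0.
Qed.

Let h_mom1 i s : 0 <= s -> mom1 i (h s) = M (S s) * p i (S s).
Proof.
move=> s_ge0; have t0 := S0 s_ge0.
rewrite (mom1_affpush _ _ (sg_gt0 t0) i (in_L1_le (isT : (1 <= 2)%N) (g2 t0))).
by rewrite g_density// g_mom1// mulr0 add0r mulr1 mxE.
Qed.

Let h_mom2 s : 0 <= s -> mom2 (h s) = M (S s) * (sg (S s) ^+ 2 * (d%:R / 2) + \sum_i p i (S s) ^+ 2).
Proof.
move=> s_ge0; have t0 := S0 s_ge0.
rewrite (mom2_affpush _ _ (sg_gt0 t0) (g2 t0)) g_density// g_mom2// mulr1 enorm_sqr.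
rewrite big1 => [|i _]; last by rewrite g_mom1// mulr0.
by rewrite mulr0 add0r; under eq_bigr do rewrite mxE.
Qed.

Let h_li_q2 : li (fun s => q2 (h s)).
Proof.
pose F t : R := M t * (q2 (g t) * (sg t ^+ 2) +
  (2 * (\sum_i p i t * q1 i (g t)) * sg t + (\sum_i p i t ^+ 2) * q0 (g t))).
have sM := prim_scont pM; have ss := prim_scont psg; have sp i := prim_scont (pp i).
have s2 : scont (fun t => sg t ^+ 2) by exact: (scontM ss ss).
have s1 : scont (fun t => \sum_i p i t * q1 i (g t)).
  by apply: (@scont_sum R _ _ (fun i t => p i t * q1 i (g t))) => i; apply: scontM => //; exact: scont_q1.
have s3 : scont (fun t => \sum_i p i t ^+ 2).
  by apply: (@scont_sum R _ _ (fun i t => p i t ^+ 2)) => i; exact: (scontM (@sp i) (@sp i)).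
have lF : li (fun t => (q2 (g t) * (sg t ^+ 2) +
  (2 * (\sum_i p i t * q1 i (g t)) * sg t + (\sum_i p i t ^+ 2) * q0 (g t))) * M t).
  apply: liM => //; apply: liD; first exact: liM.
  apply: li_scont; apply: scontD; first by apply: scontM => //; apply: scontM => //; exact: scont_cst.
  by apply: scontM => //; exact: scont_q0.
have lS := fun x y x0 xy => (@Int_time_change R kappa skappa kappa_gt0 clock_oo _ x y x0 xy lF).1.
apply: li_ext lS => s /ltW s_ge0.
have t0 := S0 s_ge0; rewrite (q2_affpush _ _ (sg_gt0 t0) (g3 t0)) enorm_sqr /kappa invrK.
under [X in _ = _ * (_ + (_ * X + _))]eq_bigr do rewrite mxE.
under [X in _ = _ * (_ + (_ + X * _))]eq_bigr do rewrite mxE.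
ring.
Qed.

Let h_initial : same_tests (h 0) f0.
Proof.
have E : shiftv p 0 = u0 by apply/rowP => i; rewrite mxE /p Intxx addr0.
have -> : h 0 = affpush n0 s0 u0 (g 0).
  by rewrite /h /transformed (inv_clock0 skappa kappa_gt0 clock_oo) E /M /sg !Intxx !expR0 !mulr1.
have st := same_tests_affpush n0 u0 s0_gt0 (in_L1_le (isT : (0 <= 2)%N) (g2 (lexx 0)))
  (in_L1_le (isT : (0 <= 3)%N) psi03) (rescaled_same_tests gs).
by move=> phi tphi; rewrite (st phi tphi) (affpush_rescaled_datum d_gt0 f0_ge0 f03 n_gt0).
Qed.

Lemma transformed_annihilation : annihilation_solution alpha f0 (transformed g M sg p).
Proof.
apply/(annihilation_evolves d_gt0); split.
- apply: (curve_solution3 h_curve h_L13 _ h_li_q2) => t t0; rewrite h_density//; apply: M_gt0; exact: S0.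
- exact: h_L13.
- exact: h_evolves.
- exact: h_initial.
Qed.

Let h_temperature s : 0 <= s -> 2 * temperature (h s) = sg (S s) ^+ 2.
Proof.
move=> s_ge0; have h2 := in_L1_le (isT : (2 <= 3)%N) (h_L13 s_ge0).
have D : 0 < density (h s) by rewrite h_density// M_gt0// S0.
have E := temperatureE d_gt0 h2 D; rewrite h_density// h_mom2// in E.
have F : (\sum_i mom1 i (h s) ^+ 2) / M (S s) = M (S s) * \sum_i p i (S s) ^+ 2.
  rewrite mulr_sumr mulr_suml; apply: eq_bigr => i _; rewrite h_mom1//; field; exact: M_neq0.
rewrite F mulrDr addrK in E.
have dn : d%:R != 0 :> R by rewrite pnatr_eq0 -lt0n.
have : d%:R * M (S s) * (2 * temperature (h s)) = d%:R * M (S s) * sg (S s) ^+ 2 by rewrite mulrCA E; field.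
by apply: mulfI; rewrite mulf_neq0// M_neq0.
Qed.

Let h_bulk s : 0 <= s -> bulk_velocity (h s) = shiftv p (S s).
Proof.
move=> s_ge0; apply/rowP => i; rewrite /bulk_velocity !mxE h_density// -[X in _ * X]/(mom1 i (h s)) h_mom1//.
by rewrite mulKf// M_neq0.
Qed.

(** The rate of the rescaled time of [h] is n sqrt(2 T) = M sg = 1/kappa evaluated at S, so the
    rescaled time of [h] is exactly the inverse clock S. *)
Let h_time s : 0 <= s -> rescaled_time h s = S s.
Proof.
move=> s_ge0.
have l1 : li (fun _ : R => 1 : R) by apply: li_scont; exact: scont_cst.
have [i1 E] := Int_time_change skappa kappa_gt0 clock_oo (lexx 0) s_ge0 l1.
have rE (t : R) : 0 <= t -> 1 / kappa (S t) = Num.sqrt 2 * clock_rate h t.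
  move=> t0; rewrite /clock_rate mulrCA -sqrtrM// h_temperature// h_density// sqrtr_sqr.
  by rewrite ger0_norm ?(ltW (sg_gt0 (S0 t0)))// /kappa invrK mul1r.
have lc' : li (clock_rate h).
  have l2 := liZ (Num.sqrt 2)^-1 (fun x y x0 xy => (Int_time_change skappa kappa_gt0 clock_oo x0 xy l1).1).
  apply: li_ext l2 => t /ltW t0; rewrite rE// mulKf// lt0r_neq0// sqrtr_gt0//.
rewrite /rescaled_time (@Rintegral_ind _ (clock_rate h) 0 s s_ge0 (lc' _ _ (lexx 0) s_ge0)).
rewrite -(IntZ _ (lexx 0) s_ge0 lc'); transitivity (Int 0 s (fun t => 1 / kappa (S t))).
  by apply: eq_Int => t /ltW t0 _; rewrite rE.
by rewrite E (inv_clock0 skappa kappa_gt0 clock_oo) Int_cst ?S0// subr0 mul1r.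
Qed.

(** By uniqueness for the annihilation equation, [f] agrees almost everywhere with the inverse
    transform of [g] at each time. For given tau, the time t = Int 0 tau kappa satisfies S t = tau,
    so comparing the rescalings at t identifies g(tau) with psi(tau). *)
Lemma rescaled_solution_unique (f psi : R -> V -> R) :
  unique_solution (annihilation_solution alpha f0) f -> rescaling_of f psi ->
  (forall tau, 0 <= tau -> in_L1 0 (psi tau)) ->
  forall tau, 0 <= tau -> {ae leb, forall v, g tau v = psi tau v}.
Proof.
move=> [[sf f3 _] uf] rf psi1 tau tau0.
have hf t (t0 : 0 <= t) : {ae leb, forall v, f t v = h t v}.
  by apply: filterS (uf _ transformed_annihilation t t0) => v /esym.
have [t t0 St] : exists2 t, 0 <= t & S t = tau.
  exists (Int 0 tau kappa); last exact: (clockK skappa kappa_gt0 clock_oo tau0).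
  by apply: Int_ge0 => s /ltW s_ge0 _; exact: ltW (kappa_gt0 s_ge0).
have f1 s (s_ge0 : 0 <= s) : measurable_fun setT (f s) := in_L1_meas (f3 s s_ge0).
have h1 s (s_ge0 : 0 <= s) : measurable_fun setT (h s) := in_L1_meas (h_L13 s_ge0).
have time : rescaled_time f t = tau.
  exact: (etrans (ae_eq_rescaled_time t f1 h1 hf) (etrans (h_time t0) St)).
rewrite -time in tau0 *.
apply: (rescaling_ae rf t0 (f1 t t0) (h1 t t0) (hf t t0) (M_neq0 (S t)) (sg_gt0 (S0 t0))
  (h_density t0) (h_temperature t0) (h_bulk t0) _ _ (psi1 _ tau0)).
- by rewrite time -St.
- exact: (in_L1_le (isT : (0 <= 2)%N) (g2 tau0)).
Qed.

End uniqueness.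

Section extensionality.
Context {R : realType} {d : nat}.
Local Notation V := 'rV[R]_d.

Lemma rescaled_solution_ext (alpha : R) (psi0 : V -> R) (f g : R -> V -> R) :
  (forall t, 0 <= t -> f t = g t) -> rescaled_solution alpha psi0 g -> rescaled_solution alpha psi0 f.
Proof.
move=> fg [[g0 g2 gc g3] w]; split; first split=> [t t0|t t0|t t0|a b a0 ab].
- by rewrite fg//; exact: g0.
- by rewrite fg//; exact: g2.
- rewrite fg//; apply: cvg_trans (gc t t0); apply: near_eq_cvg.
  rewrite near_withinE; apply: nearW => s s0; by rewrite fg.
- apply: eq_integrable (g3 a b a0 ab) => // s; rewrite inE/= in_itv/= => /andP[/(le_trans (ltW a0)) s0 _].
  by rewrite fg.
move=> phi tphi t t0; have [i e] := w phi tphi t t0.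
have E s : 0 <= s -> rescaled_rhs alpha f s phi = rescaled_rhs alpha g s phi.
  by move=> s0; rewrite /rescaled_rhs /A_coef /B_coef /Bv_coef /collision_rhs fg.
split; first apply: eq_integrable i => // s; first by rewrite inE/= in_itv/= => /andP[s0 _]; rewrite E.
rewrite (fg t t0); apply: (etrans e); have cD (x y z : R) : y = z -> x + y = x + z by move=> ->.
by apply: cD; apply: eq_Rintegral => s; rewrite inE/= in_itv/= => /andP[s0 _]; rewrite (E s s0).
Qed.

End extensionality.

Unset Implicit Arguments.

Theorem proposition1p2 (R : realType) (d : nat) (alpha : R)
    (f0 : 'rV[R]_d -> R) (f : R -> 'rV[R]_d -> R)
    (d_ge2 : (2 <= d)%N) (alpha_gt0 : 0 < alpha) (alpha_lt1 : alpha < 1)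
    (f0_ge0 : forall v, 0 <= f0 v) (f0_L13 : in_L1 3 f0)
    (density_f0 : 0 < density f0) (temperature_f0 : 0 < temperature f0)
    (f_solution : unique_solution (annihilation_solution alpha f0) f) :
  (forall t : R, 0 <= t -> 0 < Num.min (density (f t)) (temperature (f t))) /\
  (exists psi, rescaling_of f psi) /\
  (forall psi, rescaling_of f psi ->
     (forall tau : R, 0 <= tau -> in_L1 3 (psi tau)) /\
     unique_solution (rescaled_solution alpha (rescaled_datum f0)) psi).
Proof.
have d_gt0 : (0 < d)%N := ltnW d_ge2.
have [[sf f3 _] _] := f_solution.
have [_ _ ev s0] := (annihilation_evolves d_gt0 alpha f0 f).1 f_solution.1.
have fc := solution_class_curve sf.
have f02 := in_L1_le (isT : (2 <= 3)%N) f0_L13.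
have n0 : 0 < density (f 0).
  by have [-> _ _] := same_tests_moments (curve_L12 fc (lexx 0)) f02 s0.
split.
  move=> t t0; have n_gt0 := annihilation_density_gt0 alpha_gt0 alpha_lt1 sf f3 ev n0 t0.
  by rewrite lt_min n_gt0/=; exact: (temperature_gt0 d_gt0 (curve_ge0 fc t0) (curve_L12 fc t0) n_gt0).
split.
  by exists (rescaled f); exact: (rescaled_rescaling d_gt0 alpha_gt0 alpha_lt1 sf f3 ev n0).
move=> psi rf.
(* A function satisfying the rescaling identity is free at negative tau only; for tau >= 0 it equals
   the constructed one at every point. *)
have E := rescaling_unique d_gt0 alpha_gt0 alpha_lt1 sf f3 ev n0 rf.
have psi3 tau : 0 <= tau -> in_L1 3 (psi tau).
  by move=> tau0; rewrite (E tau tau0); exact: (rescaled_in_L1 d_gt0 alpha_gt0 alpha_lt1 sf f3 ev n0).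
have rs : rescaled_solution alpha (rescaled_datum f0) (rescaled f).
  apply: (rescaled_solution_of_evolves d_gt0 (rescaled_class d_gt0 alpha_gt0 alpha_lt1 sf f3 ev n0)).
  - exact: (rescaled_in_L1 d_gt0 alpha_gt0 alpha_lt1 sf f3 ev n0).
  - exact: (rescaled_evolves d_gt0 alpha_gt0 alpha_lt1 sf f3 ev n0).
  - exact: (rescaled_initial d_gt0 alpha_gt0 alpha_lt1 sf f3 ev n0 f0_L13 s0).
split; first exact: psi3.
split; first exact: (rescaled_solution_ext E rs).
move=> g gs tau tau0.
apply: (rescaled_solution_unique d_gt0 alpha_gt0 alpha_lt1 f0_ge0 f0_L13 density_f0 gs f_solution rf _ tau0).
by move=> s hs; exact: in_L1_le (isT : (0 <= 3)%N) (psi3 s hs).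
Qed.
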